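(* Let $I$ be a set and $1 \leq p < \infty$. The space $\mathfrak{R}_{p,cb}^I$ equipped with the Schur product is a commutative completely contractive Banach algebra.
   Context: For $1\le p<\infty$, $S_p^I$ is the Schatten class of compact operators $A$ on $\ell_2^I$ with $\|A\|_{S_p^I}=(\mathrm{Tr}\,(A^*A)^{p/2})^{1/p}<\infty$; $S_\infty^I$ is the space of compact operators on $\ell_2^I$ with the operator norm. Elements are regarded as $I\times I$ matrices. $p^*$ is the conjugate exponent. Operator space structures: $S_\infty^I$ has its $C^*$-algebra structure, $S_1^I$ is the dual of $S_\infty^I$ via the pairing $\langle A,B\rangle=\mathrm{Tr}(AB^T)$ ($B^T$ the matrix transpose), and $S_p^I=(S_\infty^I,S_1^I)_{1/p}$ by complex interpolation, with $M_n(E_\theta)=(M_n(E_0),M_n(E_1))_\theta$. $*$ is the Schur (entrywise) product $[a_{ij}]*[b_{ij}]=[a_{ij}b_{ij}]$. $\widehat{\otimes}$ is the operator space projective tensor product. $\psi_p^I: S_p^I\widehat{\otimes}S_{p^*}^I\to S_1^I$ is the completely contractive linear map with $\psi_p^I(A\otimes B)=A*B$. $\mathfrak{R}_{p,cb}^I$ is $\mathrm{Im}\,\psi_p^I\subset S_1^I$ with the operator space structure of $(S_p^I\widehat{\otimes}S_{p^*}^I)/\mathrm{Ker}\,\psi_p^I$. A Banach algebra $\mathcal{A}$ with an operator space structure is completely contractive if its product is a jointly completely contractive bilinear map $\mathcal{A}\times\mathcal{A}\to\mathcal{A}$, i.e. induces a complete contraction $\mathcal{A}\widehat{\otimes}\mathcal{A}\to\mathcal{A}$.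 *)

(* Defs.v *)
From HB Require Import structures.
From mathcomp Require Import all_boot all_order all_algebra.
From mathcomp Require Import finmap complex mxtens.
From mathcomp Require Import all_classical all_reals all_analysis.

Set Implicit Arguments.
Unset Strict Implicit.
Unset Printing Implicit Defensive.
Import Order.TTheory GRing.Theory Num.Theory.
Import numFieldNormedType.Exports.
Local Open Scope classical_set_scope.
Local Open Scope ring_scope.

(* C^X; [R[i]^o] makes it a left module over [R[i]] *)
Notation cfun R X := (X -> (complex R)^o).

Definition cabs {R : realType} (z : R[i]) : R := ComplexField.Normc.normc z.

Definition has_sum {R : realType} {T : choiceType} (f : T -> R[i]) (s : R[i]) :=
  forall e : R, 0 < e -> exists A : {fset T}, forall B : {fset T},
    (A `<=` B)%fset -> cabs (\sum_(t <- B) f t - s) < e.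

(* the value is 0 when the family is not summable *)
Definition csum {R : realType} {T : choiceType} (f : T -> R[i]) : R[i] :=
  xget 0 [set s | has_sum f s].

Definition l2norm {R : realType} {T : choiceType} (x : cfun R T) : \bar R :=
  ((\esum_(t in [set: T]) (cabs (x t) ^+ 2)%:E) `^ (2^-1))%E.

Definition mulv {R : realType} {S T : choiceType} (A : cfun R (S * T)%type)
    (x : cfun R T) : cfun R S :=
  fun s => csum (fun t => A (s, t) * x t).

Definition bounded_op {R : realType} {S T : choiceType}
    (A : cfun R (S * T)%type) :=
  exists c : R, forall x : cfun R T, (l2norm x < +oo)%E ->
    (forall s, exists y, has_sum (fun t => A (s, t) * x t) y) /\
    (l2norm (mulv A x) <= c%:E * l2norm x)%E.

Definition opnorm {R : realType} {S T : choiceType}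
    (A : cfun R (S * T)%type) : \bar R :=
  ereal_sup [set l2norm (mulv A x) | x in [set x | (l2norm x <= 1)%E]].

Definition mxopnorm {R : realType} {m n : nat} (a : 'M[R[i]]_(m, n)) : \bar R :=
  opnorm (fun ij => a ij.1 ij.2).

Definition compact_op {R : realType} {T : choiceType}
    (A : cfun R (T * T)%type) :=
  bounded_op A /\
  forall x : nat -> cfun R T, (forall k, l2norm (x k) <= 1)%E ->
    exists (phi : nat -> nat) (y : cfun R T),
      [/\ {homo phi : j k / (j < k)%N}, (l2norm y < +oo)%E &
          l2norm (mulv A (x (phi k)) - y) @[k --> \oo] --> (0 : \bar R)].

Definition mmul {R : realType} {T : choiceType} (A B : cfun R (T * T)%type) :
    cfun R (T * T)%type :=
  fun ij => csum (fun k => A (ij.1, k) * B (k, ij.2)).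

Definition mtr {R : realType} {T : choiceType} (A : cfun R (T * T)%type) :
    cfun R (T * T)%type :=
  fun ij => A (ij.2, ij.1).

Definition madj {R : realType} {T : choiceType} (A : cfun R (T * T)%type) :
    cfun R (T * T)%type :=
  fun ij => conjc (A (ij.2, ij.1)).

Definition mtrace {R : realType} {T : choiceType} (A : cfun R (T * T)%type) :
    R[i] :=
  csum (fun i => A (i, i)).

(* B = A ^ r for a positive compact A, through a spectral decomposition
   A = \sum_k lam_k <., e_k> e_k; the e_k with lam_k = 0 are irrelevant,
   which covers operators of finite rank. *)
Definition positive_power {R : realType} {T : choiceType}
    (A : cfun R (T * T)%type) (r : R) (B : cfun R (T * T)%type) :=
  exists (lam : nat -> R) (e : nat -> cfun R T),
    [/\ forall k, 0 <= lam k,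
        forall k l, lam k != 0 -> lam l != 0 ->
          has_sum (fun i => e k i * conjc (e l i)) (k == l)%:R,
        forall i j, has_sum
          (fun k => real_complex R (lam k) * e k i * conjc (e k j)) (A (i, j)) &
        forall i j, has_sum
          (fun k => real_complex R (lam k `^ r) * e k i * conjc (e k j))
          (B (i, j))].

(* Tr (A^* A)^(p/2) < +oo *)
Definition schatten_class {R : realType} {T : choiceType} (p : R)
    (A : cfun R (T * T)%type) :=
  compact_op A /\
  exists B, positive_power (mmul (madj A) A) (p / 2) B /\
    (\esum_(i in [set: T]) (complex.Re (B (i, i)))%:E < +oo)%E.

(* Operator spaces, as subspaces of C^X with a norm on each M_n.  The norms
    are only meaningful on matrices with entries in the carrier. *)

Record opspace (R : realType) (X : Type) := OpSpace {
  os_car : set (cfun R X);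
  os_norm : forall n, 'M[cfun R X]_n -> \bar R
}.

Definition os_mx {R : realType} {X : Type} (E : opspace R X) (n : nat) :
    set 'M[cfun R X]_n :=
  [set x | forall i j, os_car E (x i j)].

Definition amx {R : realType} {X : Type} {m n n' m' : nat}
    (a : 'M[R[i]]_(m, n)) (x : 'M[cfun R X]_(n, n')) (b : 'M[R[i]]_(n', m')) :
    'M[cfun R X]_(m, m') :=
  \matrix_(i, j) \sum_k \sum_l (a i k * b l j) *: x k l.

Definition smx {R : realType} {X : Type} {n : nat} (c : R[i])
    (x : 'M[cfun R X]_n) : 'M[cfun R X]_n :=
  \matrix_(i, j) (c *: x i j).

Definition amplify {V W U : Type} (f : V -> W -> U) {k l : nat}
    (v : 'M[V]_k) (w : 'M[W]_l) : 'M[U]_(k * l) :=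
  \matrix_(i, j) f (v (mxtens_unindex i).1 (mxtens_unindex j).1)
                   (w (mxtens_unindex i).2 (mxtens_unindex j).2).

Definition os_cauchy {R : realType} {X : Type} (E : opspace R X) (n : nat)
    (u : nat -> 'M[cfun R X]_n) :=
  forall e : R, 0 < e -> exists N, forall j k, (N <= j)%N -> (N <= k)%N ->
    (os_norm E (u j - u k) < e%:E)%E.

Definition os_cvg {R : realType} {X : Type} (E : opspace R X) (n : nat)
    (u : nat -> 'M[cfun R X]_n) (x : 'M[cfun R X]_n) :=
  os_mx E x /\ os_norm E (u k - x) @[k --> \oo] --> (0 : \bar R).

Record is_operator_space {R : realType} {X : Type} (E : opspace R X) : Prop :=
  IsOperatorSpace {
    os_car0 : os_car E 0;
    os_carD : forall a b, os_car E a -> os_car E b -> os_car E (a + b);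
    os_carZ : forall (c : R[i]) a, os_car E a -> os_car E (c *: a);
    os_norm_ge0 : forall n (x : 'M[_]_n), os_mx E x -> (0 <= os_norm E x)%E;
    os_norm_fin : forall n (x : 'M[_]_n), os_mx E x -> (os_norm E x < +oo)%E;
    os_norm_eq0 : forall n (x : 'M[_]_n), os_mx E x -> os_norm E x = 0%E -> x = 0;
    os_normZ : forall n (c : R[i]) (x : 'M[_]_n), os_mx E x ->
      os_norm E (smx c x) = ((cabs c)%:E * os_norm E x)%E;
    os_normD : forall n (x y : 'M[_]_n), os_mx E x -> os_mx E y ->
      (os_norm E (x + y) <= os_norm E x + os_norm E y)%E;
    os_ruan_sum : forall m n (x : 'M[_]_m) (y : 'M[_]_n), os_mx E x -> os_mx E y ->
      os_norm E (block_mx x 0 0 y) = maxe (os_norm E x) (os_norm E y);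
    os_ruan_mul : forall m n (a : 'M[R[i]]_(m, n)) (x : 'M[_]_n)
        (b : 'M[R[i]]_(n, m)), os_mx E x ->
      (os_norm E (amx a x b) <= mxopnorm a * os_norm E x * mxopnorm b)%E;
    os_complete : forall u : nat -> cfun R X,
      (forall k, os_car E (u k)) ->
      os_cauchy E (fun k => const_mx (u k) : 'M[_]_1) ->
      exists x, os_cvg E (fun k => const_mx (u k) : 'M[_]_1) (const_mx x)
  }.

Definition strip {R : realType} (z : R[i]) := 0 <= complex.Re z <= 1.
Definition open_strip {R : realType} (z : R[i]) := 0 < complex.Re z < 1.

Section Interpolation.
Context {R : realType} {X : Type} (E0 E1 : opspace R X) (n : nat).
Local Notation M := 'M[cfun R X]_n.

Definition sum_car : set M :=
  [set x | exists x0 x1, [/\ os_mx E0 x0, os_mx E1 x1 & x = x0 + x1]].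

Definition sum_norm (x : M) : \bar R :=
  ereal_inf [set r | exists x0 x1,
    [/\ os_mx E0 x0, os_mx E1 x1, x = x0 + x1 &
        r = (os_norm E0 x0 + os_norm E1 x1)%E]].

Definition bounded_continuous_on {D : set R[i]} (car : set M)
    (N : M -> \bar R) (F : R[i] -> M) :=
  [/\ forall z, D z -> car (F z),
      exists c : R, forall z, D z -> (N (F z) <= c%:E)%E &
      forall z, D z -> forall e : R, 0 < e -> exists2 d : R, 0 < d &
        forall w, D w -> cabs (w - z) < d -> (N (F w - F z)%R < e%:E)%E].

Definition analytic_on_open_strip (F : R[i] -> M) :=
  forall z0, open_strip z0 -> exists (a : nat -> M) (r : R),
    [/\ 0 < r, forall k, sum_car (a k) &
        forall z, cabs (z - z0) < r ->
          sum_norm (F z - \sum_(k < N) smx ((z - z0) ^+ k) (a k))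
            @[N --> \oo] --> (0 : \bar R)].

Definition admissible (F : R[i] -> M) :=
  [/\ bounded_continuous_on (D := [set z | strip z]) sum_car sum_norm F,
      analytic_on_open_strip F,
      bounded_continuous_on (D := [set z | complex.Re z = 0])
        (@os_mx _ _ E0 n) (@os_norm _ _ E0 n) F &
      bounded_continuous_on (D := [set z | complex.Re z = 1])
        (@os_mx _ _ E1 n) (@os_norm _ _ E1 n) F].

(* the norm of (M_n(E0), M_n(E1))_theta *)
Definition interp_norm (theta : R) (x : M) : \bar R :=
  ereal_inf [set r | exists F, [/\ admissible F, F (real_complex R theta) = x &
    r = maxe (ereal_sup [set os_norm E0 (F z) | z in [set z | complex.Re z = 0]])
             (ereal_sup [set os_norm E1 (F z) | z in [set z | complex.Re z = 1]])]].

End Interpolation.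

Section Schatten.
Context {R : realType} (I : choiceType).
Local Notation mat := (cfun R (I * I)%type).

(* M_n(B(l_2^I)) = B(l_2^({1..n} x I)) *)
Definition flat {n : nat} (x : 'M[mat]_n) :
    cfun R (('I_n * I) * ('I_n * I))%type :=
  fun rs => x rs.1.1 rs.2.1 (rs.1.2, rs.2.2).

Definition S_infty : opspace R (I * I)%type :=
  OpSpace [set A | compact_op A] (fun n x => opnorm (flat x)).

Definition trace_pairing (A B : mat) : R[i] := mtrace (mmul A (mtr B)).

(* M_n(S_1) is normed as a subspace of CB(S_infty, M_n) *)
Definition S_one : opspace R (I * I)%type :=
  OpSpace [set A | schatten_class 1 A]
    (fun n x => ereal_sup [set r | exists m (b : 'M[mat]_m),
      [/\ os_mx S_infty b, (os_norm S_infty b <= 1)%E &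
          r = mxopnorm (amplify trace_pairing x b)]]).

(* M_n(S_p) = (M_n(S_infty), M_n(S_1))_{1/p} for 1 < p < +oo *)
Definition S_ (p : \bar R) : opspace R (I * I)%type :=
  match p with
  | EFin r => if r == 1 then S_one else
      OpSpace [set A | schatten_class r A]
        (fun n x => interp_norm S_infty S_one r^-1 x)
  | _ => S_infty
  end.

End Schatten.

(* The elementary tensor, in the realization of C^X (x) C^Y inside
   C^(X x Y): the canonical map is injective. *)
Definition tens {R : realType} {X Y : Type} (a : cfun R X) (b : cfun R Y) :
    cfun R (X * Y)%type :=
  fun t => a t.1 * b t.2.

(* the algebraic tensor product with the matrix norms of E (x)^ F, not yet
   completed *)
Definition proj_tensor {R : realType} {X Y : Type}
    (E : opspace R X) (F : opspace R Y) : opspace R (X * Y)%type :=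
  OpSpace
    [set u | exists n (a : 'I_n -> cfun R X) (b : 'I_n -> cfun R Y),
      [/\ forall i, os_car E (a i), forall i, os_car F (b i) &
          u = \sum_i tens (a i) (b i)]]
    (fun n u => ereal_inf [set r | exists k l
        (al : 'M[R[i]]_(n, k * l)) (v : 'M[cfun R X]_k) (w : 'M[cfun R Y]_l)
        (be : 'M[R[i]]_(k * l, n)),
      [/\ os_mx E v, os_mx F w, u = amx al (amplify tens v w) be &
          r = (mxopnorm al * os_norm E v * os_norm F w * mxopnorm be)%E]]).

(* Quotient structure on the image of the extension of a map to a completion.
    Elements of the completion of M_n(E) are represented by Cauchy sequences u
    in M_n(E), with norm lim ||u_k||; the extension of f maps u to
    lim f(u_k). *)

Definition completed_map {R : realType} {X Y : Type}
    (E : opspace R X) (F : opspace R Y) (f : cfun R X -> cfun R Y) (n : nat)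
    (u : nat -> 'M[cfun R X]_n) (x : 'M[cfun R Y]_n) :=
  [/\ forall k, os_mx E (u k), os_cauchy E u &
      os_cvg F (fun k => map_mx f (u k)) x].

Definition completed_image {R : realType} {X Y : Type}
    (E : opspace R X) (F : opspace R Y) (f : cfun R X -> cfun R Y) :
    opspace R Y :=
  OpSpace
    [set x | exists u, completed_map E F f u (const_mx x : 'M[_]_1)]
    (fun n x => ereal_inf [set limn (fun k => os_norm E (u k)) |
                            u in [set u | completed_map E F f u x]]).

Definition schur {R : realType} {I : Type} (A B : cfun R (I * I)%type) :
    cfun R (I * I)%type :=
  fun ij => A ij * B ij.

(* The linear extension of A (x) B |-> A * B to the tensors realized as in
   [tens]; see [psi_tens]. *)
Definition psi {R : realType} {I : Type}
    (u : cfun R ((I * I) * (I * I))%type) : cfun R (I * I)%type :=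
  fun ij => u (ij, ij).

Lemma psi_tens {R : realType} {I : Type} (A B : cfun R (I * I)%type) :
  psi (tens A B) = schur A B.
Proof. by []. Qed.

Lemma psi_linear {R : realType} {I : Type} (c : R[i])
    (u v : cfun R ((I * I) * (I * I))%type) :
  psi (c *: u + v) = c *: psi u + psi v.
Proof. by []. Qed.

Definition R_pcb {R : realType} (I : choiceType) (p : R) :
    opspace R (I * I)%type :=
  completed_image
    (proj_tensor (S_ I p%:E) (S_ I (hoelder_conjugate p%:E)))
    (S_one I) psi.

Record is_cc_banach_algebra {R : realType} {X : Type} (E : opspace R X)
    (mul : cfun R X -> cfun R X -> cfun R X) : Prop := IsCCBanachAlgebra {
  cc_operator_space : is_operator_space E;
  cc_closed : forall a b, os_car E a -> os_car E b -> os_car E (mul a b);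
  cc_assoc : forall a b c, os_car E a -> os_car E b -> os_car E c ->
    mul a (mul b c) = mul (mul a b) c;
  cc_linl : forall (t : R[i]) a a' b, os_car E a -> os_car E a' ->
    os_car E b -> mul (t *: a + a') b = t *: mul a b + mul a' b;
  cc_linr : forall (t : R[i]) a b b', os_car E a -> os_car E b ->
    os_car E b' -> mul a (t *: b + b') = t *: mul a b + mul a b';
  cc_submult : forall a b, os_car E a -> os_car E b ->
    (os_norm E (const_mx (mul a b) : 'M[_]_1) <=
     os_norm E (const_mx a : 'M[_]_1) * os_norm E (const_mx b : 'M[_]_1))%E;
  cc_jointly_contractive : forall m n (a : 'M[_]_m) (b : 'M[_]_n),
    os_mx E a -> os_mx E b ->
    (os_norm E (amplify mul a b) <= os_norm E a * os_norm E b)%E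
}.

Definition is_commutative_cc_banach_algebra {R : realType} {X : Type}
    (E : opspace R X) (mul : cfun R X -> cfun R X -> cfun R X) :=
  is_cc_banach_algebra E mul /\
  forall a b, os_car E a -> os_car E b -> mul a b = mul b a.

(* Main.v *)
(* A tensor realized as a function on (I * I) * (I * I) is mapped by psi to its restriction to
   the diagonal, so psi intertwines the pointwise product of tensors with the Schur product.  By
   the definition of the projective norms, this pointwise product is jointly completely contractive
   on S_p (x) S_p* as soon as the Schur product is so on each of S_p and S_p*, and joint complete
   contractivity passes to the completion and then to the quotient by the kernel of psi.

   On S_infty the Schur product of two matrices is a compression of their tensor product.  On S_1
   it is dual to this: writing A * B as A paired with compressions of B reduces the estimate to the
   fact that functionals on the compacts are completely bounded with the same bound.  S_p follows by
   multiplying two admissible functions of z, and the complete contractivity of psi by pairing an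
   admissible F z with an admissible G (1 - z) and applying the three lines lemma.

   The Schatten class defined by singular values has to be identified with the interpolation space:
   in one direction the singular values s_k are replaced by analytic families a_k b_k^z, in the
   other F is paired with an analytic family of finite rank built from the singular vectors of the
   given operator. *)

From HB Require Import structures.
Require Import Defs.
From mathcomp Require Import all_boot all_order all_algebra.
From mathcomp Require Import finmap complex mxtens.
From mathcomp Require Import all_classical all_reals all_analysis.
From mathcomp Require Import zify ring lra.

Set Implicit Arguments.
Unset Strict Implicit.
Unset Printing Implicit Defensive.
Import Order.TTheory GRing.Theory Num.Theory.
Import numFieldNormedType.Exports.
Local Open Scope classical_set_scope.
Local Open Scope ring_scope.

(** * Finite sections of matrices *)

(** The definitions are awkward to compute with: [csum] returns 0 on a family that is not summable,
    the norms are suprema and infima in [\bar R], and [I] may be uncountable. Norms are therefore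
    traded for real bounds on finite sections ([opb], [tcb], [sib], [s1b]), where the algebra is
    mostly that of finite sums; the infinite objects reappear only in the lemmas that translate one
    form into the other. Analyticity is likewise reduced to what the maximum principle needs, a
    second-order Taylor expansion ([taylor2]), so no contour integral occurs. Neither separation nor
    completeness of the interpolation spaces or of the tensor product is proved: the quotient is
    separated because its norm dominates that of [S_one], and it is complete by successive
    approximation, where only [S_one] has to be complete. This is why the intermediate spaces are
    only shown to satisfy [preop]. The case [p = 1] stands apart, its conjugate space being
    [S_infty] and not an interpolation space. *)

Section ComplexModulus.
Context {R : realType}.
Implicit Types z w : R[i].

Lemma cabs0 : cabs (0 : R[i]) = 0.
Proof. exact: ComplexField.Normc.normc0. Qed.

Lemma cabs1 : cabs (1 : R[i]) = 1.
Proof. exact: ComplexField.Normc.normc1. Qed.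

Lemma cabsM z w : cabs (z * w) = cabs z * cabs w.
Proof. exact: ComplexField.Normc.normcM. Qed.

Lemma cabsD z w : cabs (z + w) <= cabs z + cabs w.
Proof. exact: le_normcD. Qed.

Lemma cabsN z : cabs (- z) = cabs z.
Proof. exact: normcN. Qed.

Lemma cabs_ge0 z : 0 <= cabs z.
Proof. by case: z => a b; exact: sqrtr_ge0. Qed.

Lemma cabs_eq0 z : cabs z = 0 -> z = 0.
Proof. exact: ComplexField.Normc.eq0_normc. Qed.

Lemma cabs_gt0 z : z != 0 -> 0 < cabs z.
Proof.
by move=> z0; rewrite lt_neqAle cabs_ge0 andbT eq_sym; apply: contra z0 => /eqP/cabs_eq0 ->.
Qed.

Lemma cabsBC z w : cabs (z - w) = cabs (w - z).
Proof. by rewrite -cabsN opprB. Qed.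

Lemma cabs_conj z : cabs (conjc z) = cabs z.
Proof. by case: z => a b; rewrite /cabs /= sqrrN. Qed.

Lemma cabs_real (a : R) : cabs (real_complex R a) = `|a|.
Proof. by rewrite /cabs /= expr0n /= addr0 sqrtr_sqr. Qed.

Lemma cabsX z n : cabs (z ^+ n) = cabs z ^+ n.
Proof.
by elim: n => [|n IH]; rewrite ?expr0 ?cabs1 // !exprS cabsM IH.
Qed.

Lemma cabs_sqr z : cabs z ^+ 2 = complex.Re z ^+ 2 + complex.Im z ^+ 2.
Proof. by case: z => a b; rewrite /cabs /= sqr_sqrtr // addr_ge0 ?sqr_ge0. Qed.

Lemma mul_conjc z : z * conjc z = real_complex R (cabs z ^+ 2).
Proof.
rewrite cabs_sqr; case: z => a b /=; simpc.
by congr (_ +i* _)%C; ring.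
Qed.

Lemma le_Re_cabs z : `|complex.Re z| <= cabs z.
Proof.
rewrite -[leLHS]sqrtr_sqr; case: z => a b; rewrite /cabs /= ler_sqrt.
  by rewrite lerDl sqr_ge0.
by rewrite addr_ge0 ?sqr_ge0.
Qed.

Lemma le_Im_cabs z : `|complex.Im z| <= cabs z.
Proof.
rewrite -[leLHS]sqrtr_sqr; case: z => a b; rewrite /cabs /= ler_sqrt.
  by rewrite lerDr sqr_ge0.
by rewrite addr_ge0 ?sqr_ge0.
Qed.

Lemma cabs_le_ReIm z : cabs z <= `|complex.Re z| + `|complex.Im z|.
Proof.
case: z => a b; have -> : (a +i* b)%C = real_complex R a + (0 +i* b)%C.
  by simpc.
apply: (le_trans (cabsD _ _)); rewrite cabs_real.
by rewrite {1}/cabs /= expr0n /= !add0r addr0 sqrtr_sqr.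
Qed.

Lemma cabs_sum (T : Type) (r : seq T) (P : pred T) (f : T -> R[i]) :
  cabs (\sum_(i <- r | P i) f i) <= \sum_(i <- r | P i) cabs (f i).
Proof.
elim/big_rec2: _ => [|i a b _ H]; first by rewrite cabs0.
by apply: (le_trans (cabsD _ _)); rewrite lerD2l.
Qed.

Lemma Re_sum (T : Type) (r : seq T) (P : pred T) (f : T -> R[i]) :
  complex.Re (\sum_(i <- r | P i) f i) = \sum_(i <- r | P i) complex.Re (f i).
Proof.
elim/big_rec2: _ => [//|i a b _ <-]; by case: (f i) b => ? ? [].
Qed.

Lemma cabs_le_dist z w : cabs z <= cabs w + cabs (z - w).
Proof. by have := cabsD w (z - w); rewrite addrC subrK. Qed.

Lemma real_complex_sum (T : Type) (r : seq T) (P : pred T) (f : T -> R) :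
  real_complex R (\sum_(i <- r | P i) f i) = \sum_(i <- r | P i) real_complex R (f i).
Proof. exact: rmorph_sum. Qed.

End ComplexModulus.

Section FiniteSums.
Context {R : realType}.

(** An epsilon argument whose error carries a fixed factor; dividing by [k + 1] instead of [k]
    covers [k = 0]. *)
Lemma ler_addgt0_mul (x y k : R) : 0 <= k -> (forall e, 0 < e -> x <= y + k * e) -> x <= y.
Proof.
move=> k0 H; apply/ler_addgt0Pr => e e0.
have k1 : 0 < k + 1 by rewrite ltr_pwDr.
apply: (le_trans (H (e / (k + 1)) _)); first by rewrite divr_gt0.
rewrite lerD2l mulrCA -[leRHS]mulr1 ler_pM2l // ler_pdivrMr // mul1r lerDl.
exact: ler01.
Qed.

(** Cauchy-Schwarz by induction on the list: if [a ^+ 2 <= b * c], adding a term [x * y] to [a]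
    creates the cross term [2 a x y], and this is at most [x^2 c + b y^2] by the
    arithmetic-geometric mean inequality. *)
Lemma sum_CS (T : Type) (r : seq T) (f g : T -> R) :
  (\sum_(i <- r) f i * g i) ^+ 2 <= (\sum_(i <- r) f i ^+ 2) * (\sum_(i <- r) g i ^+ 2).
Proof.
suff H a b c (x y : R) : 0 <= b -> 0 <= c -> a ^+ 2 <= b * c ->
    (x * y + a) ^+ 2 <= (x ^+ 2 + b) * (y ^+ 2 + c).
  elim: r => [|i r IH]; first by rewrite !big_nil expr0n mul0r.
  by rewrite !big_cons; apply: H => //; apply: sumr_ge0 => ? _; rewrite sqr_ge0.
move=> b0 c0 abc.
have -> : (x * y + a) ^+ 2 = x ^+ 2 * y ^+ 2 + a ^+ 2 + a * (x * y) *+ 2 by ring.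
have -> : (x ^+ 2 + b) * (y ^+ 2 + c) = x ^+ 2 * y ^+ 2 + b * c + (x ^+ 2 * c + b * y ^+ 2).
  by ring.
apply: lerD; first by rewrite lerD2l.
have P0 : 0 <= x ^+ 2 * c by rewrite mulr_ge0 ?sqr_ge0.
have Q0 : 0 <= b * y ^+ 2 by rewrite mulr_ge0 ?sqr_ge0.
apply: (@le_trans _ _ `|a * (x * y) *+ 2|); first exact: ler_norm.
rewrite -(@ler_pXn2r _ 2) // ?nnegrE // ?addr_ge0 //.
rewrite real_normK ?num_real // -mulr_natr !exprMn.
have h : a ^+ 2 * (x ^+ 2 * y ^+ 2) <= (b * c) * (x ^+ 2 * y ^+ 2).
  by rewrite ler_wpM2r // mulr_ge0 ?sqr_ge0.
have h2 : 0 <= (x ^+ 2 * c - b * y ^+ 2) ^+ 2 by rewrite sqr_ge0.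
nra.
Qed.

Definition sqn (T : Type) (J : seq T) (x : T -> R[i]) : R := \sum_(t <- J) cabs (x t) ^+ 2.

Lemma sqn_ge0 (T : Type) (J : seq T) (x : T -> R[i]) : 0 <= sqn J x.
Proof. by apply: sumr_ge0 => ? _; rewrite sqr_ge0. Qed.

Lemma sum_cabs_CS (T : Type) (J : seq T) (x y : T -> R[i]) :
  (\sum_(t <- J) cabs (x t) * cabs (y t)) ^+ 2 <= sqn J x * sqn J y.
Proof. exact: sum_CS. Qed.

Lemma cabs_sum_CS (T : Type) (J : seq T) (x y : T -> R[i]) :
  cabs (\sum_(t <- J) x t * y t) ^+ 2 <= sqn J x * sqn J y.
Proof.
apply: le_trans (sum_cabs_CS J x y); rewrite ler_pXn2r ?nnegrE ?cabs_ge0 //; last first.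
  by apply: sumr_ge0 => t _; rewrite mulr_ge0 ?cabs_ge0.
apply: (le_trans (cabs_sum _ _ _)); by under eq_bigr do rewrite cabsM.
Qed.

Lemma sqn_subset (T : eqType) (J K : seq T) (x : T -> R[i]) :
  uniq J -> {subset J <= K} -> sqn J x <= sqn K x.
Proof.
move=> uJ JK; rewrite /sqn.
have [s [s1 s2]] : exists s, perm_eq (J ++ s) (undup K) /\ true.
  exists [seq x <- undup K | x \notin J]; split=> //.
  apply: uniq_perm; rewrite ?undup_uniq //.
    rewrite cat_uniq uJ filter_uniq ?undup_uniq // andbT.
    by apply/hasPn => y; rewrite mem_filter => /andP[].
  move=> y; rewrite mem_cat mem_filter mem_undup.
  by case: (boolP (y \in J)) => //= yJ; rewrite JK.
apply: (@le_trans _ _ (\sum_(t <- undup K) cabs (x t) ^+ 2)).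
  rewrite -(perm_big _ s1) /= big_cat /= lerDl; exact: sqn_ge0.
elim: K {s1 JK} => [|k K IH] //=; case: ifP => kK; rewrite !big_cons.
  by apply: (le_trans IH); rewrite lerDr sqr_ge0.
by rewrite lerD2l.
Qed.

Lemma big_subset_supp (T : eqType) (V : nmodType) (J K : seq T) (f : T -> V) :
  uniq J -> uniq K -> {subset J <= K} -> (forall t, t \in K -> t \notin J -> f t = 0) ->
  \sum_(t <- K) f t = \sum_(t <- J) f t.
Proof.
move=> uJ uK JK f0.
rewrite (bigID (mem J)) /= [X in _ + X]big1_seq ?addr0; last first.
  by move=> t /andP[tJ tK]; rewrite f0.
rewrite -big_filter; apply: perm_big; apply: uniq_perm; rewrite ?filter_uniq //.
by move=> t; rewrite mem_filter; apply/andP/idP => [[]//|tJ]; rewrite JK.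
Qed.

End FiniteSums.

Section OperatorBound.
Context {R : realType}.

(* every finite section of [A] has operator norm at most [c] *)
Definition opb (S T : eqType) (A : S -> T -> R[i]) (c : R) : Prop :=
  0 <= c /\ forall (J : seq S) (K : seq T) (x : T -> R[i]), uniq J -> uniq K ->
    sqn J (fun s => \sum_(t <- K) A s t * x t) <= c ^+ 2 * sqn K x.

Variables S T : eqType.
Implicit Types A B : S -> T -> R[i].

Lemma opb_ge0 A c : opb A c -> 0 <= c. Proof. by case. Qed.

Lemma opb_bil A c J K x y : opb A c -> uniq J -> uniq K ->
  cabs (\sum_(s <- J) \sum_(t <- K) A s t * x t * y s) ^+ 2
  <= c ^+ 2 * sqn K x * sqn J y.
Proof.
move=> [c0 H] uJ uK; under eq_bigr do rewrite -mulr_suml.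
apply: (le_trans (cabs_sum_CS _ _ _)); rewrite ler_wpM2r ?sqn_ge0 //; exact: H.
Qed.

(** Testing against the conjugate of the image vector [z] turns the bilinear form into [sqn J z];
    one factor [sqn J z] then cancels. *)
Lemma opb_bil_conv A c : 0 <= c ->
  (forall J K x y, uniq J -> uniq K ->
    cabs (\sum_(s <- J) \sum_(t <- K) A s t * x t * y s) ^+ 2
    <= c ^+ 2 * sqn K x * sqn J y) -> opb A c.
Proof.
move=> c0 H; split=> // J K x uJ uK.
set z := fun s => \sum_(t <- K) A s t * x t.
have := H J K x (fun s => conjc (z s)) uJ uK.
under eq_bigr do rewrite -mulr_suml -/(z _) mul_conjc.
rewrite -real_complex_sum cabs_real -/(sqn J z) ger0_norm ?sqn_ge0 //.
have -> : sqn J (fun s => conjc (z s)) = sqn J z.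
  by apply: eq_bigr => s _; rewrite cabs_conj.
have := sqn_ge0 J z; rewrite le_eqVlt => /orP[/eqP <- _|z0].
  by rewrite mulr_ge0 ?sqn_ge0 ?sqr_ge0.
by rewrite expr2 ler_pM2r.
Qed.

(** A bound needs checking only on conveniently enlarged lists, such as products, because a vector
    on [K] extends by 0 to [K']. *)
Lemma opb_subset A c : 0 <= c ->
  (forall J K, uniq J -> uniq K -> exists J' K',
    [/\ uniq J', uniq K', {subset J <= J'}, {subset K <= K'} &
      forall x, sqn J' (fun s => \sum_(t <- K') A s t * x t) <= c ^+ 2 * sqn K' x]) ->
  opb A c.
Proof.
move=> c0 H; split=> // J K x uJ uK.
have [J' [K' [uJ' uK' JJ KK {}H]]] := H J K uJ uK.
set x' := fun t => if t \in K then x t else 0.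
have -> : sqn J (fun s => \sum_(t <- K) A s t * x t) =
    sqn J (fun s => \sum_(t <- K') A s t * x' t).
  apply: eq_bigr => s _; congr (cabs _ ^+ 2).
  rewrite (big_subset_supp uK uK' KK); last first.
    by move=> t _ tK; rewrite /x' (negbTE tK) mulr0.
  by apply: eq_big_seq => t tK; rewrite /x' tK.
apply: (le_trans (sqn_subset _ uJ JJ)); apply: (le_trans (H _)).
rewrite le_eqVlt; apply/orP; left; apply/eqP; congr (_ * _).
rewrite /sqn (big_subset_supp uK uK' KK); last first.
  by move=> t _ tK; rewrite /x' (negbTE tK) cabs0 expr0n.
by apply: eq_big_seq => t tK; rewrite /x' tK.
Qed.

Lemma eq_opb A B c : (forall s t, A s t = B s t) -> opb A c -> opb B c.
Proof.
move=> AB [c0 H]; split=> // J K x uJ uK.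
suff <- : sqn J (fun s => \sum_(t <- K) A s t * x t) =
    sqn J (fun s => \sum_(t <- K) B s t * x t) by exact: H.
by apply: eq_bigr => s _; under eq_bigr do rewrite AB.
Qed.

Lemma opb_le A c d : c <= d -> opb A c -> opb A d.
Proof.
move=> cd [c0 H]; split=> [|J K x uJ uK]; first exact: le_trans cd.
apply: (le_trans (H J K x uJ uK)); rewrite ler_wpM2r ?sqn_ge0 //.
by rewrite ler_pXn2r ?nnegrE // (le_trans c0).
Qed.

Lemma opb_entry A c s t : opb A c -> cabs (A s t) <= c.
Proof.
move=> [c0 H]; have := H [:: s] [:: t] (fun=> 1) isT isT.
by rewrite /sqn !big_seq1 mulr1 cabs1 expr1n mulr1 ler_pXn2r ?nnegrE ?cabs_ge0.
Qed.

Lemma opb_scale A c z : opb A c -> opb (fun s t => z * A s t) (cabs z * c).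
Proof.
move=> [c0 H]; split=> [|J K x uJ uK]; first by rewrite mulr_ge0 ?cabs_ge0.
have -> : sqn J (fun s => \sum_(t <- K) z * A s t * x t) =
    cabs z ^+ 2 * sqn J (fun s => \sum_(t <- K) A s t * x t).
  rewrite /sqn mulr_sumr; apply: eq_bigr => s _; rewrite -exprMn -cabsM mulr_sumr.
  by under eq_bigr do rewrite -mulrA.
rewrite [X in _ <= X * _]exprMn -[leRHS]mulrA ler_wpM2l ?sqr_ge0 //; exact: H.
Qed.

Lemma opb_opp A c : opb A c -> opb (fun s t => - A s t) c.
Proof.
move=> /(opb_scale (-1)); rewrite cabsN cabs1 mul1r; apply: eq_opb => s t.
by rewrite mulN1r.
Qed.

Lemma sqnD (J : seq S) (x y : S -> R[i]) (a b : R) : 0 <= a -> 0 <= b ->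
  sqn J x <= a ^+ 2 -> sqn J y <= b ^+ 2 -> sqn J (fun s => x s + y s) <= (a + b) ^+ 2.
Proof.
move=> a0 b0 xa yb.
have xy : \sum_(s <- J) cabs (x s) * cabs (y s) <= a * b.
  rewrite -(@ler_pXn2r _ 2) ?nnegrE ?mulr_ge0 //; last first.
    by apply: sumr_ge0 => s _; rewrite mulr_ge0 ?cabs_ge0.
  apply: (le_trans (sum_cabs_CS _ _ _)); rewrite exprMn.
  by rewrite ler_pM ?sqn_ge0.
apply: (@le_trans _ _ (sqn J x + sqn J y + (\sum_(s <- J) cabs (x s) * cabs (y s)) *+ 2)).
  rewrite /sqn -sumrMnl -!big_split /=; apply: ler_sum => s _.
  rewrite -addrA [cabs (y s) ^+ 2 + _]addrC addrA -sqrrD.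
  by rewrite ler_pXn2r ?nnegrE ?addr_ge0 ?cabs_ge0 ?cabsD.
have -> : (a + b) ^+ 2 = a ^+ 2 + b ^+ 2 + (a * b) *+ 2 by ring.
by rewrite lerD ?lerD // lerMn2r.
Qed.

Lemma opb_add A B c d : opb A c -> opb B d -> opb (fun s t => A s t + B s t) (c + d).
Proof.
move=> [c0 HA] [d0 HB]; split=> [|J K x uJ uK]; first exact: addr_ge0.
have -> : sqn J (fun s => \sum_(t <- K) (A s t + B s t) * x t) =
    sqn J (fun s => (\sum_(t <- K) A s t * x t) + (\sum_(t <- K) B s t * x t)).
  apply: eq_bigr => s _; rewrite -big_split /=.
  by under eq_bigr do rewrite mulrDl.
have n0 := sqn_ge0 K x.
rewrite -(sqr_sqrtr n0) -exprMn mulrDl; apply: sqnD.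
- by rewrite mulr_ge0 ?sqrtr_ge0.
- by rewrite mulr_ge0 ?sqrtr_ge0.
- by rewrite exprMn sqr_sqrtr //; exact: HA.
- by rewrite exprMn sqr_sqrtr //; exact: HB.
Qed.

Lemma opb_sub A B c d : opb A c -> opb B d -> opb (fun s t => A s t - B s t) (c + d).
Proof. by move=> HA HB; apply: opb_add => //; exact: opb_opp. Qed.

Lemma opb_cst0 c : 0 <= c -> opb (fun (s : S) (t : T) => 0) c.
Proof.
move=> c0; split=> // J K x _ _; rewrite [leLHS]big1 ?mulr_ge0 ?sqn_ge0 ?sqr_ge0 //.
by move=> s _; rewrite big1 ?cabs0 ?expr0n // => t _; rewrite mul0r.
Qed.

Lemma opb_sum (I : Type) (r : seq I) (A : I -> S -> T -> R[i]) (c : I -> R) :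
  (forall i, opb (A i) (c i)) ->
  opb (fun s t => \sum_(i <- r) A i s t) (\sum_(i <- r) c i).
Proof.
move=> H; elim: r => [|i r IH].
  rewrite big_nil; apply: (eq_opb _ (opb_cst0 (lexx 0))) => s t; by rewrite big_nil.
rewrite big_cons; apply: (eq_opb _ (opb_add (H i) IH)) => s t; by rewrite big_cons.
Qed.

Lemma opb_eps A c : 0 <= c -> (forall e, 0 < e -> opb A (c + e)) -> opb A c.
Proof.
move=> c0 H; split=> // J K x uJ uK; have n0 := sqn_ge0 K x; set a := leLHS.
have a0 : 0 <= a by exact: sqn_ge0.
suff: Num.sqrt a <= c * Num.sqrt (sqn K x).
  move=> h; rewrite -(sqr_sqrtr a0) -(sqr_sqrtr n0) -exprMn.
  by rewrite ler_pXn2r ?nnegrE ?mulr_ge0 ?sqrtr_ge0.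
apply: (@ler_addgt0_mul _ _ _ (Num.sqrt (sqn K x))); first exact: sqrtr_ge0.
move=> e e0; rewrite [_ * e]mulrC -mulrDl.
have [ce h] := H e e0.
rewrite -(@ler_pXn2r _ 2) ?nnegrE ?mulr_ge0 ?sqrtr_ge0 //.
by rewrite exprMn !sqr_sqrtr //; exact: h.
Qed.

(** Only the entries of one section have to be close to those of [B], and [B] may change with the
    section and with [e]. This makes the bound stable under entrywise limits. *)
Lemma opb_lim A c : 0 <= c ->
  (forall (J : seq S) (K : seq T) e, 0 < e -> exists2 B, opb B c &
     forall s t, s \in J -> t \in K -> cabs (A s t - B s t) <= e) ->
  opb A c.
Proof.
move=> c0 H; split=> // J K x uJ uK; have n0 := sqn_ge0 K x; set a := leLHS.
have a0 : 0 <= a by exact: sqn_ge0.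
(* [m * e ^+ 2] is a crude bound for the squared norm of [(A - B) x] on [J]; it depends on the
   section, which is fixed while [e] tends to 0. *)
pose m := (size J)%:R * (1 + \sum_(t <- K) cabs (x t)) ^+ 2 : R.
have m0 : 0 <= m by rewrite mulr_ge0 // sqr_ge0.
suff: Num.sqrt a <= c * Num.sqrt (sqn K x).
  move=> h; rewrite -(sqr_sqrtr a0) -(sqr_sqrtr n0) -exprMn.
  by rewrite ler_pXn2r ?nnegrE ?mulr_ge0 ?sqrtr_ge0.
apply: (@ler_addgt0_mul _ _ _ (Num.sqrt m)); first exact: sqrtr_ge0.
move=> e e0; have [B [_ HB] AB] := H J K e e0.
rewrite -(@ler_pXn2r _ 2) ?nnegrE ?addr_ge0 ?mulr_ge0 ?sqrtr_ge0 ?(ltW e0) //.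
rewrite sqr_sqrtr //.
have -> : a = sqn J (fun s => (\sum_(t <- K) B s t * x t) +
    (\sum_(t <- K) (A s t - B s t) * x t)).
  apply: eq_bigr => s _; rewrite -big_split /=; congr (cabs _ ^+ 2).
  by apply: eq_bigr => t _; rewrite -mulrDl addrC subrK.
apply: sqnD; rewrite ?mulr_ge0 ?sqrtr_ge0 ?(ltW e0) //.
  by rewrite exprMn sqr_sqrtr //; exact: HB.
rewrite exprMn sqr_sqrtr // /m /sqn.
have -> : (size J)%:R * (1 + \sum_(t <- K) cabs (x t)) ^+ 2 * e ^+ 2 =
   \sum_(s <- J) ((1 + \sum_(t <- K) cabs (x t)) * e) ^+ 2.
  by rewrite big_const_seq count_predT iter_addr addr0 -[RHS]mulr_natl [X in _ = _ * X]exprMn [RHS]mulrA.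
rewrite [leLHS]big_seq [leRHS]big_seq; apply: ler_sum => s sJ.
have x0 : 0 <= \sum_(t <- K) cabs (x t) by apply: sumr_ge0 => t _; exact: cabs_ge0.
rewrite ler_pXn2r ?nnegrE ?cabs_ge0 ?mulr_ge0 ?addr_ge0 ?(ltW e0) //.
apply: (le_trans (cabs_sum _ _ _)); rewrite mulrDl mul1r.
apply: ler_wpDl; first exact: ltW.
rewrite mulr_suml !big_seq; apply: ler_sum => t tK; rewrite cabsM mulrC.
by rewrite ler_wpM2l ?cabs_ge0 // AB.
Qed.

End OperatorBound.

Section OperatorBoundConstructions.
Context {R : realType}.

Lemma opb_tr (S T : eqType) (A : S -> T -> R[i]) c :
  opb A c -> opb (fun t s => A s t) c.
Proof.
move=> H; apply: opb_bil_conv => [|J K x y uJ uK]; first exact: opb_ge0 H.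
rewrite exchange_big /= mulrAC.
under eq_bigr do under eq_bigr do rewrite mulrAC.
exact: opb_bil.
Qed.

Lemma opb_conj (S T : eqType) (A : S -> T -> R[i]) c :
  opb A c -> opb (fun s t => conjc (A s t)) c.
Proof.
move=> [c0 H]; split=> // J K x uJ uK.
have := H J K (fun t => conjc (x t)) uJ uK.
have -> : sqn K (fun t => conjc (x t)) = sqn K x.
  by apply: eq_bigr => t _; rewrite cabs_conj.
congr (_ <= _); apply: eq_bigr => s _; rewrite -[in RHS]cabs_conj rmorph_sum /=.
by congr (cabs _ ^+ 2); apply: eq_bigr => t _; rewrite rmorphM /= conjcK.
Qed.

Lemma big_dep_fiber (S D : eqType) (V : nmodType) (J : seq S) (f : S -> D)
    (E : seq D) (F : S -> V) : uniq E -> {subset map f J <= E} ->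
  \sum_(s <- J) F s = \sum_(d <- E) \sum_(s <- J | f s == d) F s.
Proof.
move=> uE JE; rewrite (exchange_big_dep predT) //=.
rewrite !big_seq; apply: eq_bigr => s sJ; rewrite -big_filter.
have -> : [seq d <- E | f s == d] = [:: f s].
  rewrite (_ : [seq d <- E | f s == d] = [seq d <- E | pred1 (f s) d]); last first.
    by apply: eq_filter => d; rewrite /= eq_sym.
  by apply: filter_pred1_uniq; rewrite ?JE // map_f.
by rewrite big_seq1.
Qed.

(** Block diagonal matrices: [f] and [g] give the block of a row and of a column. Squared norms add
    up over the blocks, so the constant does not grow with their number. *)
Lemma opb_dsum (S T D : eqType) (f : S -> D) (g : T -> D) (A : S -> T -> R[i]) c :
  0 <= c -> (forall s t, f s != g t -> A s t = 0) ->
  (forall d, opb (fun s t => if (f s == d) && (g t == d) then A s t else 0) c) ->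
  opb A c.
Proof.
move=> c0 A0 H; split=> // J K x uJ uK.
pose E := undup (map f J ++ map g K).
have uE : uniq E by exact: undup_uniq.
have fE : {subset map f J <= E} by move=> d dJ; rewrite mem_undup mem_cat dJ.
have gE : {subset map g K <= E} by move=> d dJ; rewrite mem_undup mem_cat dJ orbT.
rewrite /sqn (big_dep_fiber _ uE fE) (big_dep_fiber _ uE gE) mulr_sumr.
apply: ler_sum => d _.
have [_ h] := H d; have := h [seq s <- J | f s == d] [seq t <- K | g t == d] x.
rewrite !filter_uniq // => /(_ isT isT); rewrite /sqn !big_filter.
congr (_ <= _); apply: eq_bigr => s /eqP sd; congr (cabs _ ^+ 2).
rewrite big_filter [RHS](bigID (fun t => g t == d)) /= [X in _ + X]big1 ?addr0.
  by apply: eq_bigr => t td; rewrite sd eqxx td.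
by move=> t td; rewrite A0 ?mul0r // sd eq_sym.
Qed.

(* [None] marks a zero row or column *)
Lemma opb_pinj (S T S' T' : eqType) (f : S' -> option S) (g : T' -> option T)
    (A : S -> T -> R[i]) c :
  (forall s1 s2, f s1 != None -> f s1 = f s2 -> s1 = s2) ->
  (forall t1 t2, g t1 != None -> g t1 = g t2 -> t1 = t2) ->
  opb A c ->
  opb (fun s t => if f s is Some a then if g t is Some b then A a b else 0 else 0) c.
Proof.
move=> fi gi [c0 H]; split=> // J K x uJ uK.
have um (U U' : eqType) (h : U' -> option U) L : uniq L ->
    (forall s1 s2, h s1 != None -> h s1 = h s2 -> s1 = s2) -> uniq (pmap h L).
  move=> uL hi; elim: L uL => //= u L IH /andP[uL /IH {}IH].
  case E : (h u) => [a|//=]; rewrite /= IH andbT.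
  apply/negP; rewrite mem_pmap => /mapP[v vL av].
  by move: uL; rewrite (hi u v) ?vL // E.
have pb (U U' : eqType) (V : nmodType) (h : U' -> option U) L (F : U -> V) :
    \sum_(a <- pmap h L) F a = \sum_(u <- L) (if h u is Some a then F a else 0).
  elim: L => [|u L IH]; first by rewrite !big_nil.
  by rewrite /= big_cons; case: (h u) => [a|] /=; rewrite ?big_cons IH ?add0r.
pose x' b := \sum_(t <- K | g t == Some b) x t.
have x'E t b : t \in K -> g t = Some b -> x' b = x t.
  move=> tK gt; rewrite /x' -big_filter.
  have -> : [seq t0 <- K | g t0 == Some b] = [:: t].
    rewrite -(filter_pred1_uniq uK tK); apply: eq_filter => t0 /=.
    apply/eqP/eqP => [h|->//]; apply: gi; by rewrite h ?gt.
  by rewrite big_seq1.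
have := H (pmap f J) (pmap g K) x' (um _ _ _ _ uJ fi) (um _ _ _ _ uK gi).
rewrite /sqn !pb => h; apply: (le_trans (le_trans _ h)).
  apply: ler_sum => s _; case: (f s) => [a|]; last first.
    by rewrite big1 ?cabs0 ?expr0n // => t _; rewrite mul0r.
  rewrite pb; rewrite le_eqVlt; apply/orP; left; apply/eqP; congr (cabs _ ^+ 2).
  apply: eq_big_seq => t tK; case E : (g t) => [b|]; last by rewrite mul0r.
  by rewrite (x'E t).
rewrite ler_wpM2l ?sqr_ge0 // !big_seq; apply: ler_sum => t tK.
by case E : (g t) => [b|]; rewrite ?sqr_ge0 // (x'E t).
Qed.

Lemma opb_inj (S T S' T' : eqType) (f : S' -> S) (g : T' -> T)
    (A : S -> T -> R[i]) c : injective f -> injective g -> opb A c ->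
  opb (fun s t => A (f s) (g t)) c.
Proof.
move=> fi gi H; apply: (@opb_pinj _ _ _ _ (Some \o f) (Some \o g)) H => //=.
  by move=> s1 s2 _ [] /fi.
by move=> s1 s2 _ [] /gi.
Qed.

Lemma opb_restrict (S T : eqType) (P : pred S) (Q : pred T) (A : S -> T -> R[i]) c :
  opb A c -> opb (fun s t => if P s && Q t then A s t else 0) c.
Proof.
move=> H; have := @opb_pinj _ _ _ _ (fun s => if P s then Some s else None)
  (fun s => if Q s then Some s else None) _ _ _ _ H.
have K (U : eqType) (P' : pred U) s1 s2 : (if P' s1 then Some s1 else None) != None ->
    (if P' s1 then Some s1 else None) = (if P' s2 then Some s2 else None) -> s1 = s2.
  by case: (P' s1) => //; case: (P' s2) => // _ [].
move=> /(_ (@K _ P) (@K _ Q)); apply: eq_opb => s t.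
by case: (P s) => //=; case: (Q t).
Qed.

(** On a product of lists the tensor product is [1 (x) B] followed by [A (x) 1], and each factor
    acts in one coordinate with the other one frozen. Arbitrary lists of pairs are contained in such
    products. *)
Lemma opb_tens (S T S' T' : eqType) (A : S -> T -> R[i]) (B : S' -> T' -> R[i]) c d :
  opb A c -> opb B d -> opb (fun p q => A p.1 q.1 * B p.2 q.2) (c * d).
Proof.
move=> [c0 HA] [d0 HB]; apply: opb_subset => [|J K uJ uK]; first exact: mulr_ge0.
have prodP (U V : eqType) (L : seq (U * V)) :
    {subset L <= allpairs pair (undup (map fst L)) (undup (map snd L))}.
  move=> p pL; apply/allpairsP; exists p; rewrite !mem_undup !map_f //.
  by rewrite -surjective_pairing.
set J1 := undup (map fst J); set J2 := undup (map snd J).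
set K1 := undup (map fst K); set K2 := undup (map snd K).
have up (U V : eqType) (L1 : seq U) (L2 : seq V) : uniq L1 -> uniq L2 ->
    uniq (allpairs pair L1 L2).
  by move=> u1 u2; apply: allpairs_uniq => // -[? ?] [].
exists (allpairs pair J1 J2), (allpairs pair K1 K2); split.
- by apply: up; exact: undup_uniq.
- by apply: up; exact: undup_uniq.
- exact: prodP.
- exact: prodP.
move=> x; rewrite /sqn !big_allpairs_dep /=.
pose z s' t := \sum_(t' <- K2) B t t' * x (s', t').
apply: (@le_trans _ _ (\sum_(t <- J2) c ^+ 2 * sqn K1 (z ^~ t))).
  rewrite exchange_big /=; apply: ler_sum => t _.
  have := HA J1 K1 (z ^~ t) (undup_uniq _) (undup_uniq _).
  congr (_ <= _); apply: eq_bigr => s _; congr (cabs _ ^+ 2).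
  rewrite big_allpairs_dep /=; apply: eq_bigr => s' _; rewrite mulr_sumr.
  by apply: eq_bigr => t' _; rewrite mulrA.
rewrite -mulr_sumr exprMn -[leRHS]mulrA ler_wpM2l ?sqr_ge0 // /sqn exchange_big /= mulr_sumr.
apply: ler_sum => s _; exact: (HB J2 K2 (fun t' => x (s, t')) (undup_uniq _) (undup_uniq _)).
Qed.

(** Left multiplication by the ampliation of a scalar matrix [a]. Together with [opb_rmul] it gives
    the inequality for [amx] in the matrix norms. *)
Lemma opb_lmul (N M : finType) (S T : eqType) (a : N -> M -> R[i])
    (X : M * S -> T -> R[i]) c d :
  opb a c -> opb X d ->
  opb (fun p t => \sum_m a p.1 m * X (m, p.2) t) (c * d).
Proof.
move=> [c0 Ha] [d0 HX]; apply: opb_subset => [|J K uJ uK]; first exact: mulr_ge0.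
set J2 := undup (map snd J).
exists (allpairs pair (enum N) J2), K; split=> //.
- by apply: allpairs_uniq; rewrite ?enum_uniq ?undup_uniq // => -[? ?] [].
- move=> p pJ; apply/allpairsP; exists p; rewrite mem_undup map_f // mem_enum.
  by rewrite -surjective_pairing.
move=> x; rewrite /sqn big_allpairs_dep exchange_big /=.
pose z m s := \sum_(t <- K) X (m, s) t * x t.
apply: (@le_trans _ _ (\sum_(s <- J2) c ^+ 2 * sqn (enum M) (z ^~ s))).
  apply: ler_sum => s _.
  have := Ha (enum N) (enum M) (z ^~ s) (enum_uniq _) (enum_uniq _).
  congr (_ <= _); apply: eq_bigr => n _; congr (cabs _ ^+ 2).
  rewrite [RHS](eq_bigr (fun t => \sum_(m <- enum M) a n m * X (m, s) t * x t)); last first.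
    by move=> t _; rewrite mulr_suml big_enum.
  rewrite exchange_big /=; apply: eq_bigr => m _; rewrite mulr_sumr.
  by apply: eq_bigr => t _; rewrite mulrA.
rewrite -mulr_sumr exprMn -[leRHS]mulrA ler_wpM2l ?sqr_ge0 // /sqn exchange_big /=.
have := HX (allpairs pair (enum M) J2) K x _ uK.
rewrite /sqn big_allpairs_dep /=; apply.
by apply: allpairs_uniq; rewrite ?enum_uniq ?undup_uniq // => -[? ?] [].
Qed.

Lemma opb_rmul (N M : finType) (S T : eqType) (a : M -> N -> R[i])
    (X : T -> M * S -> R[i]) c d :
  opb a c -> opb X d ->
  opb (fun t p => \sum_m X t (m, p.2) * a m p.1) (d * c).
Proof.
move=> Ha HX; have := opb_tr (opb_lmul (opb_tr Ha) (opb_tr HX)).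
by rewrite mulrC; apply: eq_opb => s t; apply: eq_bigr => m _; rewrite mulrC.
Qed.

Lemma opb_mul (S T U : eqType) (A : S -> T -> R[i]) (B : T -> U -> R[i]) (L : seq T) c d :
  uniq L -> opb A c -> opb B d -> opb (fun s u => \sum_(t <- L) A s t * B t u) (c * d).
Proof.
move=> uL [c0 HA] [d0 HB]; split=> [|J K x uJ uK]; first exact: mulr_ge0.
have := HA J L (fun t => \sum_(u <- K) B t u * x u) uJ uL.
have := HB L K x uL uK; rewrite exprMn -[X in _ -> _ -> _ <= X]mulrA => h1 h2.
apply: le_trans (_ : c ^+ 2 * _ <= _); last by apply: (ler_wpM2l _ h1); rewrite sqr_ge0.
apply: le_trans h2; rewrite le_eqVlt; apply/orP; left; apply/eqP.
apply: eq_bigr => s _; congr (cabs _ ^+ 2).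
under eq_bigr do rewrite mulr_suml.
rewrite exchange_big /=; apply: eq_bigr => t _; rewrite mulr_sumr.
by apply: eq_bigr => u _; rewrite mulrA.
Qed.

Lemma opb_col1 (S : eqType) (x : S -> R[i]) c : 0 <= c ->
  (forall J, uniq J -> sqn J x <= c ^+ 2) -> opb (fun s (_ : unit) => x s) c.
Proof.
move=> c0 H; split=> // J K y uJ uK.
have -> : sqn J (fun s => \sum_(t <- K) x s * y t) =
    sqn J x * cabs (\sum_(t <- K) y t) ^+ 2.
  by rewrite /sqn mulr_suml; apply: eq_bigr => s _; rewrite -mulr_sumr cabsM exprMn.
rewrite ler_pM ?sqn_ge0 ?sqr_ge0 ?H //.
case: K uK => [|[] [|[] K]] //= _; rewrite /sqn; first by rewrite !big_nil cabs0 expr0n.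
by rewrite !big_seq1.
Qed.

Lemma opb_HS (S T : eqType) (A : S -> T -> R[i]) c : 0 <= c ->
  (forall J K, uniq J -> uniq K -> \sum_(s <- J) sqn K (A s) <= c ^+ 2) -> opb A c.
Proof.
move=> c0 H; split=> // J K x uJ uK.
apply: (@le_trans _ _ (\sum_(s <- J) sqn K (A s) * sqn K x)).
  by apply: ler_sum => s _; exact: cabs_sum_CS.
by rewrite -mulr_suml ler_wpM2r ?sqn_ge0 ?H.
Qed.

End OperatorBoundConstructions.

(** * Operators on square-summable families *)

Section UnconditionalSums.
Context {R : realType}.

(** Duplicate-free lists instead of finite sets, to match the lists of [opb] and [sqn]. *)
Lemma has_sumP (T : choiceType) (f : T -> R[i]) (s : R[i]) :
  has_sum f s <-> forall e : R, 0 < e -> exists2 A : seq T, uniq A &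
    forall B, uniq B -> {subset A <= B} -> cabs (\sum_(t <- B) f t - s) < e.
Proof.
split=> H e /H.
  case=> A HA; exists (enum_fset A) => [|B uB AB]; first exact: fset_uniq.
  have mB : [fset x in B]%fset =i B by move=> x; rewrite inE.
  have -> : \sum_(t <- B) f t = \sum_(t <- [fset x in B]%fset) f t.
    by apply: perm_big; apply: uniq_perm => [//||x]; rewrite ?fset_uniq ?mB.
  by apply: HA; apply/fsubsetP => x xA; rewrite mB AB.
case=> A uA HA; exists [fset x in A]%fset => B AB; apply: HA; first exact: fset_uniq.
by move=> x xA; apply: (fsubsetP AB); rewrite inE.
Qed.

Lemma uniq_undup_cat (T : eqType) (A B : seq T) :
  [/\ uniq (undup (A ++ B)), {subset A <= undup (A ++ B)} &
      {subset B <= undup (A ++ B)}].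
Proof.
by split=> [|x xA|x xB]; rewrite ?undup_uniq // mem_undup mem_cat ?xA ?xB ?orbT.
Qed.

Lemma has_sum_uniq (T : choiceType) (f : T -> R[i]) (s s' : R[i]) :
  has_sum f s -> has_sum f s' -> s = s'.
Proof.
move=> /has_sumP H /has_sumP H'; apply/eqP; rewrite -subr_eq0; apply/eqP/cabs_eq0.
apply/eqP; rewrite eq_le cabs_ge0 andbT; apply: (@ler_addgt0_mul _ _ _ 2) => // e e0.
have [A uA HA] := H e e0; have [B uB HB] := H' e e0.
have [uC AC BC] := uniq_undup_cat A B.
have h1 := HA _ uC AC; have h2 := HB _ uC BC.
set x := \sum_(t <- _) _ in h1 h2.
have -> : s - s' = (x - s') - (x - s) by ring.
apply: (le_trans (cabsD _ _)); rewrite cabsN; lra.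
Qed.

Lemma csumE (T : choiceType) (f : T -> R[i]) (s : R[i]) : has_sum f s -> csum f = s.
Proof.
by move=> H; rewrite /csum; case: xgetP => [x _ /(has_sum_uniq H) //|/(_ s)].
Qed.

Lemma eq_has_sum (T : choiceType) (f g : T -> R[i]) (s : R[i]) :
  (forall t, f t = g t) -> has_sum f s -> has_sum g s.
Proof. by move=> /funext ->. Qed.

Lemma has_sum_fin (T : choiceType) (J : seq T) (f : T -> R[i]) : uniq J ->
  (forall t, t \notin J -> f t = 0) -> has_sum f (\sum_(t <- J) f t).
Proof.
move=> uJ f0; apply/has_sumP => e e0; exists J => // B uB JB.
rewrite (big_subset_supp uJ uB JB) ?subrr ?cabs0 // => t _; exact: f0.
Qed.

Lemma has_sum_eq0 (T : choiceType) (f : T -> R[i]) : (forall t, f t = 0) -> has_sum f 0.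
Proof. by move=> f0; have := @has_sum_fin T [::] f isT; rewrite big_nil; apply. Qed.

Lemma csum_eq0 (T : choiceType) (f : T -> R[i]) : (forall t, f t = 0) -> csum f = 0.
Proof. by move=> /has_sum_eq0/csumE. Qed.

Lemma big_iota (V : nmodType) N (F : nat -> V) : \sum_(k <- iota 0 N) F k = \sum_(k < N) F k.
Proof. by rewrite -(big_mkord predT F) /index_iota subn0. Qed.

Lemma has_sum1 (T : choiceType) (t0 : T) (f : T -> R[i]) :
  (forall t, t != t0 -> f t = 0) -> has_sum f (f t0).
Proof.
move=> f0; have := @has_sum_fin _ [:: t0] f isT; rewrite big_seq1; apply => t.
by rewrite inE; exact: f0.
Qed.

Lemma has_sumD (T : choiceType) (f g : T -> R[i]) (s s' : R[i]) :
  has_sum f s -> has_sum g s' -> has_sum (fun t => f t + g t) (s + s').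
Proof.
move=> /has_sumP H /has_sumP H'; apply/has_sumP => e e0.
have e2 : 0 < e / 2 by rewrite divr_gt0.
have [A uA HA] := H _ e2; have [B uB HB] := H' _ e2.
have [uC AC BC] := uniq_undup_cat A B; exists (undup (A ++ B)) => // C uC' CC.
have h1 := HA C uC' (fun x xA => CC x (AC x xA)).
have h2 := HB C uC' (fun x xA => CC x (BC x xA)).
rewrite big_split /= (_ : _ - _ = (\sum_(t <- C) f t - s) + (\sum_(t <- C) g t - s')).
  by apply: (le_lt_trans (cabsD _ _)); lra.
by ring.
Qed.

Lemma has_sumZ (T : choiceType) (c : R[i]) (f : T -> R[i]) (s : R[i]) :
  has_sum f s -> has_sum (fun t => c * f t) (c * s).
Proof.
move=> /has_sumP H; apply/has_sumP => e e0.
have c1 : 0 < cabs c + 1 by rewrite ltr_wpDl ?cabs_ge0.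
have [A uA HA] := H _ (divr_gt0 e0 c1); exists A => // B uB AB.
rewrite -mulr_sumr -mulrBr cabsM.
have := HA B uB AB; rewrite ltr_pdivlMr // => h.
apply: le_lt_trans h; rewrite mulrC mulrDr mulr1 lerDl; exact: cabs_ge0.
Qed.

Lemma has_sumN (T : choiceType) (f : T -> R[i]) (s : R[i]) :
  has_sum f s -> has_sum (fun t => - f t) (- s).
Proof.
by move=> /(has_sumZ (-1)); rewrite mulN1r; apply: eq_has_sum => t; rewrite mulN1r.
Qed.

Lemma has_sum_conj (T : choiceType) (f : T -> R[i]) (s : R[i]) :
  has_sum f s -> has_sum (fun t => conjc (f t)) (conjc s).
Proof.
move=> /has_sumP H; apply/has_sumP => e /H [A uA HA]; exists A => // B uB AB.
by rewrite -(rmorph_sum conjc) -rmorphB /= cabs_conj; exact: HA.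
Qed.

Lemma has_sum_sum (T : choiceType) (I : Type) (r : seq I) (f : I -> T -> R[i])
    (s : I -> R[i]) : (forall i, has_sum (f i) (s i)) ->
  has_sum (fun t => \sum_(i <- r) f i t) (\sum_(i <- r) s i).
Proof.
move=> H; elim: r => [|i r IH].
  rewrite big_nil; apply: (@eq_has_sum _ (fun=> 0)) => [t|]; first by rewrite big_nil.
  have := @has_sum_fin T [::] (fun=> 0) isT (fun _ _ => erefl).
  by rewrite big_nil.
rewrite big_cons; apply: eq_has_sum (has_sumD (H i) IH) => t; by rewrite big_cons.
Qed.

Lemma has_sum_le (T : choiceType) (f : T -> R[i]) (s : R[i]) (c : R) :
  has_sum f s -> (forall J, uniq J -> cabs (\sum_(t <- J) f t) <= c) -> cabs s <= c.
Proof.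
move=> /has_sumP H fc; apply: (@ler_addgt0_mul _ _ _ 1) => // e /H [A uA HA].
have h1 := HA A uA (fun x h => h); have h2 := fc A uA.
have := cabs_le_dist s (\sum_(t <- A) f t); rewrite cabsBC; lra.
Qed.

Lemma has_sum_Re_le (T : choiceType) (f : T -> R[i]) (s : R[i]) (J : seq T) :
  (forall t, 0 <= complex.Re (f t)) -> has_sum f s -> uniq J ->
  \sum_(t <- J) complex.Re (f t) <= complex.Re s.
Proof.
move=> f0 /has_sumP H uJ; apply: (@ler_addgt0_mul _ _ _ 1) => // e /H [A uA HA].
have [uC AC BC] := uniq_undup_cat A J; have h1 := HA _ uC AC.
have h : \sum_(t <- J) complex.Re (f t) <= \sum_(t <- undup (A ++ J)) complex.Re (f t).
  rewrite [leRHS](bigID (mem J)) /= -[leLHS]addr0; apply: lerD; last exact: sumr_ge0.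
  rewrite -[X in _ <= X]big_filter le_eqVlt; apply/orP; left; apply/eqP.
  apply: perm_big; apply: uniq_perm; rewrite ?filter_uniq //.
  by move=> x; rewrite mem_filter; apply/idP/andP => [xJ|[]//]; split=> //; exact: BC.
apply: (le_trans h); rewrite -Re_sum.
have := le_trans (le_Re_cabs _) (ltW h1).
case: (\sum_(t <- _) f t) => a b; case: s {H HA h1} => c d /=.
by rewrite ler_norml => /andP[]; lra.
Qed.

Lemma has_sum_nonneg (T : choiceType) (f : T -> R) (c : R) : (forall t, 0 <= f t) ->
  (forall J, uniq J -> \sum_(t <- J) f t <= c) ->
  exists s, has_sum (fun t => real_complex R (f t)) (real_complex R s).
Proof.
move=> f0 fc; pose E := [set x | exists2 J, uniq J & x = \sum_(t <- J) f t].
have hE : has_sup E.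
  split; first by exists 0, [::]; rewrite ?big_nil.
  by exists c => x [J uJ ->]; exact: fc.
exists (sup E); apply/has_sumP => e e0.
have [x [A uA ->] hA] := sup_adherent e0 hE.
exists A => // B uB AB; rewrite -real_complex_sum -(rmorphB (real_complex R)) cabs_real.
have h1 : \sum_(t <- B) f t <= sup E by apply: sup_upper_bound => //; exists B.
have h2 : \sum_(t <- A) f t <= \sum_(t <- B) f t.
  rewrite [leRHS](bigID (mem A)) /= -[leLHS]addr0; apply: lerD; last exact: sumr_ge0.
  rewrite -[X in _ <= X]big_filter le_eqVlt; apply/orP; left; apply/eqP.
  apply: perm_big; apply: uniq_perm; rewrite ?filter_uniq //.
  by move=> y; rewrite mem_filter; apply/idP/andP => [xJ|[]//]; split=> //; exact: AB.
by rewrite ler0_norm ?subr_le0 // opprB; lra.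
Qed.

(** The real and imaginary parts [g] are written as [(|g| + g) - |g|], a difference of nonnegative
    families with bounded partial sums. *)
Lemma has_sum_abs (T : choiceType) (f : T -> R[i]) (c : R) :
  (forall J, uniq J -> \sum_(t <- J) cabs (f t) <= c) ->
  exists2 s, has_sum f s & cabs s <= c.
Proof.
move=> fc.
have aux (g : T -> R) : (forall t, `|g t| <= cabs (f t)) ->
    exists s, has_sum (fun t => real_complex R (g t)) (real_complex R s).
  move=> gf.
  have [s1 h1] : exists s, has_sum (fun t => real_complex R (`|g t| + g t)) (real_complex R s).
    apply: (@has_sum_nonneg _ _ (c + c)) => [t|J uJ].
      by have := ler_norm (- g t); rewrite normrN; lra.
    rewrite big_split; apply: lerD; apply: le_trans (fc J uJ); apply: ler_sum => t _ //.
    by apply: le_trans (gf t); exact: ler_norm.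
  have [s2 h2] : exists s, has_sum (fun t => real_complex R (`|g t|)) (real_complex R s).
    apply: (@has_sum_nonneg _ _ c) => [//|J uJ].
    by apply: le_trans (fc J uJ); apply: ler_sum => t _.
  exists (s1 - s2); rewrite rmorphB /=; apply: eq_has_sum (has_sumD h1 (has_sumN h2)) => t.
  by rewrite /= rmorphD /= addrAC subrr add0r.
have [a ha] := aux (fun t => complex.Re (f t)) (fun t => le_Re_cabs _).
have [b hb] := aux (fun t => complex.Im (f t)) (fun t => le_Im_cabs _).
have H : has_sum f (real_complex R a + 'i%C * real_complex R b).
  apply: eq_has_sum (has_sumD ha (has_sumZ 'i%C hb)) => t /=.
  by rewrite -complexE.
exists (real_complex R a + 'i%C * real_complex R b) => //; apply: (has_sum_le H) => J uJ.
exact: le_trans (cabs_sum _ _ _) (fc J uJ).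
Qed.

Lemma sum_nat_le (f : nat -> R) (c : R) (J : seq nat) : (forall k, 0 <= f k) ->
  (forall N, \sum_(k < N) f k <= c) -> uniq J -> \sum_(k <- J) f k <= c.
Proof.
move=> f0 fc uJ; apply: le_trans (fc (\max_(j <- J) j).+1).
rewrite -(big_mkord predT f) /= [leRHS](bigID (mem J)) /= -[leLHS]addr0.
apply: lerD; last exact: sumr_ge0.
rewrite -[X in _ <= X]big_filter le_eqVlt; apply/orP; left; apply/eqP.
apply: perm_big; apply: uniq_perm; rewrite ?filter_uniq ?iota_uniq //.
move=> y; rewrite mem_filter; apply/idP/andP => [xJ|[]//]; split=> //.
by rewrite mem_index_iota ltnS leq_bigmax_seq.
Qed.

(** Absolute boundedness yields some unconditional sum; the convergence of the partial sums in their
    natural order identifies it. *)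
Lemma has_sum_nat (f : nat -> R[i]) (s : R[i]) (c : R) :
  (forall N, \sum_(k < N) cabs (f k) <= c) ->
  (forall e, 0 < e -> exists N0, forall N, (N0 <= N)%N ->
     cabs (\sum_(k < N) f k - s) <= e) ->
  has_sum f s.
Proof.
move=> fc fs.
have [s' Hs' _] : exists2 s', has_sum f s' & cabs s' <= c.
  by apply: has_sum_abs => J uJ; apply: sum_nat_le => // k; exact: cabs_ge0.
suff -> : s = s' by [].
apply/eqP; rewrite -subr_eq0; apply/eqP/cabs_eq0; apply/eqP; rewrite eq_le cabs_ge0 andbT.
apply: (@ler_addgt0_mul _ _ _ 2) => // e e0.
have [N0 HN] := fs e e0; have /has_sumP/(_ e e0)[A uA HA] := Hs'.
pose N := maxn N0 (\max_(j <- A) j).+1.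
have h1 := HN N (leq_maxl _ _).
have := HA (iota 0 N) (iota_uniq _ _).
rewrite big_iota => h2.
have {}h2 : cabs (\sum_(i < N) f i - s') < e.
  apply: h2 => k kA; rewrite mem_iota /= add0n /N leq_max ltnS.
  by rewrite leq_bigmax_seq ?orbT.
have -> : s - s' = (\sum_(i < N) f i - s') - (\sum_(i < N) f i - s) by ring.
apply: (le_trans (cabsD _ _)); rewrite cabsN; lra.
Qed.

End UnconditionalSums.

Section SquareSummable.
Context {R : realType} {T : choiceType}.
Implicit Types (x y : T -> R[i]).

Lemma esum_leP (f : T -> R) (d : R) :
  (\esum_(t in [set: T]) (f t)%:E <= d%:E)%E <->
  forall J, uniq J -> \sum_(t <- J) f t <= d.
Proof.
split=> [H J uJ|H].
  rewrite -lee_fin; apply: le_trans H; apply: esum_ge; exists [set` J].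
    by split=> //; exact: finite_seq.
  by rewrite -sumEFin -fsbig_seq.
apply: ge_ereal_sup => _ [A [/finite_seqP[s ->] _] <-].
have -> : [set` s] = [set` undup s].
  by apply/seteqP; split=> z /=; rewrite mem_undup.
by rewrite -fsbig_seq ?undup_uniq // sumEFin lee_fin; exact/H/undup_uniq.
Qed.

Definition l2b x (c : R) := 0 <= c /\ forall J, uniq J -> sqn J x <= c ^+ 2.

Lemma l2normP x (c : R) : (l2norm (x : cfun R T) <= c%:E)%E <-> l2b x c.
Proof.
have e0 : (0 <= \esum_(t in [set: T]) (cabs (x t) ^+ 2)%:E)%E.
  by apply: esum_ge0 => t _; rewrite lee_fin sqr_ge0.
have eP d := esum_leP (fun t => cabs (x t) ^+ 2) d.
rewrite /l2norm poweR12_sqrt //; split.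
  move=> H.
  have c0 : 0 <= c by rewrite -lee_fin; apply: le_trans H; exact: sqrte_ge0.
  split=> //; apply/eP; rewrite -[leLHS]sqr_sqrte // EFin_expe.
  by rewrite lee_sqr ?lee_fin ?sqrte_ge0.
case=> c0 /eP H; rewrite -[leRHS](_ : sqrte (c ^+ 2)%:E = _).
  by rewrite lee_sqrt // lee_fin sqr_ge0.
by rewrite /= sqrtr_sqr ger0_norm.
Qed.

Lemma l2norm_ge0 x : (0 <= l2norm (x : cfun R T))%E.
Proof. exact: poweR_ge0. Qed.

Lemma l2norm_fin x : (l2norm (x : cfun R T) < +oo)%E <-> exists c, l2b x c.
Proof.
split=> [H|[c /l2normP H]]; last by rewrite (le_lt_trans H) ?ltry.
exists (fine (l2norm (x : cfun R T))); apply/l2normP.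
by rewrite fineK // ge0_fin_numE ?l2norm_ge0.
Qed.

End SquareSummable.

Lemma cvge0P {R : realType} (u : nat -> \bar R) : (forall n, (0 <= u n)%E) ->
  u n @[n --> \oo] --> (0 : \bar R) <->
  forall e : R, 0 < e -> exists N, forall n, (N <= n)%N -> (u n < e%:E)%E.
Proof.
move=> u0; split=> [H e e0|H].
  have : nbhs (0%:E : \bar R) [set y | (y < e%:E)%E].
    exact: (@nbhs_open_ereal_lt _ _ (fun=> e)).
  by move=> /H [N _ HN]; exists N => n Nn; exact: HN.
apply/fine_cvgP; split.
  have [N HN] := H 1 ltr01; exists N => // n /= Nn.
  by rewrite ge0_fin_numE // (lt_trans (HN _ Nn)) ?ltry.
apply/cvgrPdist_lt => e e0; have [N HN] := H e e0; exists N => // n /= Nn.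
have h := HN _ Nn; rewrite sub0r normrN ger0_norm ?fine_ge0 //.
by rewrite -lte_fin fineK // ge0_fin_numE // (lt_trans h) ?ltry.
Qed.

Section L2.
Context {R : realType} {T : choiceType}.
Implicit Types (x y z : T -> R[i]) (c d : R).

Definition l2 x := exists c, l2b x c.

(** Since [fine] sends [+oo] to 0, this is a norm only on vectors satisfying [l2]. *)
Definition nrm x : R := fine (l2norm (x : cfun R T)).

Lemma nrm_ge0 x : 0 <= nrm x.
Proof. by rewrite fine_ge0 ?l2norm_ge0. Qed.

Lemma l2normE x : l2 x -> l2norm (x : cfun R T) = (nrm x)%:E.
Proof. by move=> /l2norm_fin H; rewrite fineK // ge0_fin_numE ?l2norm_ge0. Qed.

Lemma l2b_nrm x : l2 x -> l2b x (nrm x).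
Proof. by move=> Hx; apply/l2normP; rewrite l2normE. Qed.

Lemma nrm_le x c : l2b x c -> nrm x <= c.
Proof.
by move=> Hx; rewrite -lee_fin -l2normE; [apply/l2normP|exists c].
Qed.

Lemma sqn_nrm x J : l2 x -> uniq J -> sqn J x <= nrm x ^+ 2.
Proof. by move=> /l2b_nrm [_ H] /H. Qed.

Lemma l2bD x y c d : l2b x c -> l2b y d -> l2b (fun t => x t + y t) (c + d).
Proof.
by move=> [c0 Hx] [d0 Hy]; split=> [|J uJ]; [exact: addr_ge0|apply: sqnD; auto].
Qed.

Lemma l2bZ a x c : l2b x c -> l2b (fun t => a * x t) (cabs a * c).
Proof.
move=> [c0 Hx]; split=> [|J uJ]; first by rewrite mulr_ge0 ?cabs_ge0.
rewrite exprMn; apply: (@le_trans _ _ (cabs a ^+ 2 * sqn J x)).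
  by rewrite /sqn mulr_sumr; apply: ler_sum => t _; rewrite cabsM exprMn.
by rewrite ler_wpM2l ?sqr_ge0 ?Hx.
Qed.

Lemma l2b_ext x y c : (forall t, x t = y t) -> l2b x c -> l2b y c.
Proof. by move=> /funext ->. Qed.

Lemma l2D x y : l2 x -> l2 y -> l2 (fun t => x t + y t).
Proof. by move=> [c Hx] [d Hy]; exists (c + d); exact: l2bD. Qed.

Lemma l2Z a x : l2 x -> l2 (fun t => a * x t).
Proof. by move=> [c Hx]; exists (cabs a * c); exact: l2bZ. Qed.

Lemma l2B x y : l2 x -> l2 y -> l2 (fun t => x t - y t).
Proof.
move=> Hx Hy; have := l2D Hx (l2Z (-1) Hy); congr l2; apply/funext => t.
by rewrite mulN1r.
Qed.

Lemma nrmD x y : l2 x -> l2 y -> nrm (fun t => x t + y t) <= nrm x + nrm y.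
Proof. by move=> Hx Hy; apply/nrm_le/l2bD; exact: l2b_nrm. Qed.

Lemma nrmZ_le a x : l2 x -> nrm (fun t => a * x t) <= cabs a * nrm x.
Proof. by move=> Hx; apply/nrm_le/l2bZ; exact: l2b_nrm. Qed.

Lemma nrmZ a x : l2 x -> nrm (fun t => a * x t) = cabs a * nrm x.
Proof.
move=> Hx; apply/eqP; rewrite eq_le nrmZ_le //=.
have [->|a0] := eqVneq a 0; first by rewrite cabs0 mul0r nrm_ge0.
have h := nrmZ_le a^-1 (l2Z a Hx).
have E : (fun t => a^-1 * (a * x t)) = x.
  by apply/funext => t; rewrite mulrA mulVf // mul1r.
rewrite E in h; apply: (le_trans (ler_wpM2l (cabs_ge0 _) h)).
by rewrite mulrA -cabsM divff // cabs1 mul1r.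
Qed.

Lemma nrmBC x y : nrm (fun t => x t - y t) = nrm (fun t => y t - x t).
Proof.
rewrite /nrm /l2norm; congr fine; congr (poweR _ _); apply: eq_esum => t _.
by rewrite cabsBC.
Qed.

Lemma nrm_entry x t : l2 x -> cabs (x t) <= nrm x.
Proof.
move=> Hx; have := sqn_nrm Hx (J := [:: t]) isT; rewrite /sqn big_seq1.
by rewrite ler_pXn2r ?nnegrE ?cabs_ge0 ?nrm_ge0.
Qed.

Lemma nrm_eq0 x : l2 x -> nrm x = 0 -> forall t, x t = 0.
Proof.
move=> Hx x0 t; apply/cabs_eq0/eqP; rewrite eq_le cabs_ge0 andbT -x0.
exact: nrm_entry.
Qed.

Lemma l2b0 : l2b (fun _ : T => 0 : R[i]) 0.
Proof.
by split=> // J _; rewrite /sqn big1 ?expr0n // => t _; rewrite cabs0 expr0n.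
Qed.

Definition cutoff (J : seq T) x t := if t \in J then x t else 0.

Lemma l2b_cutoff J x c : l2b x c -> l2b (cutoff J x) c.
Proof.
move=> [c0 H]; split=> // K uK; apply: le_trans (H K uK); apply: ler_sum => t _.
by rewrite /cutoff; case: ifP => // _; rewrite cabs0 expr0n sqr_ge0.
Qed.

Lemma l2b_cutoff_fin J x : uniq J -> l2b (cutoff J x) (Num.sqrt (sqn J x)).
Proof.
move=> uJ; split=> [|K uK]; rewrite ?sqrtr_ge0 // sqr_sqrtr ?sqn_ge0 //.
have [uC KC JC] := uniq_undup_cat K J.
apply: (le_trans (sqn_subset _ uK KC)); rewrite /sqn (big_subset_supp uJ uC JC).
  by rewrite le_eqVlt; apply/orP; left; apply/eqP/eq_big_seq => t tJ; rewrite /cutoff tJ.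
by move=> t _ tJ; rewrite /cutoff (negbTE tJ) cabs0 expr0n.
Qed.

Lemma l2_cutoff J x : uniq J -> l2 (cutoff J x).
Proof. by move=> uJ; exists (Num.sqrt (sqn J x)); exact: l2b_cutoff_fin. Qed.

(** Once [J] carries more than [s - e ^+ 2] of the total mass [s], a finite set disjoint from [J]
    carries at most [e ^+ 2]. *)
Lemma l2_tail x (e : R) : l2 x -> 0 < e -> exists2 J0, uniq J0 &
  forall J, uniq J -> {subset J0 <= J} -> nrm (fun t => x t - cutoff J x t) <= e.
Proof.
move=> Hx e0; have [c0 Hb] := l2b_nrm Hx.
have [s Hs] := has_sum_nonneg (fun t => sqr_ge0 (cabs (x t))) Hb.
have /has_sumP/(_ (e ^+ 2)) := Hs.
case=> [|J0 uJ0 HJ0]; first by rewrite exprn_gt0.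
exists J0 => // J uJ J0J; apply: nrm_le; split=> [|K uK]; first exact: ltW.
have [uC KC JC] := uniq_undup_cat K J.
apply: (le_trans (sqn_subset _ uK KC)).
pose L := [seq t <- undup (K ++ J) | t \notin J].
have -> : sqn (undup (K ++ J)) (fun t => x t - cutoff J x t) = sqn L x.
  rewrite /sqn /L big_filter [LHS](bigID (mem J)) /= big1 ?add0r => [|t tJ].
    by apply: eq_bigr => t tJ; rewrite /cutoff (negbTE tJ) subr0.
  by rewrite /cutoff tJ subrr cabs0 expr0n.
have uJL : uniq (J ++ L).
  rewrite cat_uniq uJ filter_uniq // andbT; apply/hasPn => t.
  by rewrite mem_filter => /andP[].
suff ss M : uniq M -> {subset J0 <= M} -> `|sqn M x - s| < e ^+ 2 /\ sqn M x <= s.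
  have [h1 h2] := ss _ uJ J0J.
  have [h3 h4] := ss _ uJL (fun t tJ => mem_subseq (prefix_subseq _ _) (J0J _ tJ)).
  move: h4 h1; rewrite /sqn big_cat /= -!/(sqn _ _) => h4.
  by rewrite ltr_norml => /andP[]; lra.
move=> uM JM; have := HJ0 M uM JM.
rewrite -real_complex_sum -(rmorphB (real_complex R)) cabs_real; split=> //.
by apply: has_sum_Re_le Hs uM => t /=; exact: sqr_ge0.
Qed.

End L2.

Section InnerProduct.
Context {R : realType} {T : choiceType}.
Implicit Types (x y z : T -> R[i]).

Definition ip x y : R[i] := csum (fun t => x t * conjc (y t)).

Lemma sqrt_mul_le (a b c d : R) : 0 <= c -> 0 <= d -> 0 <= a ->
  a ^+ 2 <= c ^+ 2 * d ^+ 2 -> a <= c * d.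
Proof.
by move=> c0 d0 a0; rewrite -exprMn ler_pXn2r ?nnegrE ?mulr_ge0.
Qed.

Lemma sum_mul_le x y (c d : R) J : l2b x c -> l2b y d -> uniq J ->
  \sum_(t <- J) cabs (x t) * cabs (y t) <= c * d.
Proof.
move=> [c0 Hx] [d0 Hy] uJ; apply: sqrt_mul_le => //.
  by apply: sumr_ge0 => t _; rewrite mulr_ge0 ?cabs_ge0.
apply: (le_trans (sum_cabs_CS _ _ _)).
by rewrite ler_pM ?sqn_ge0 ?Hx ?Hy.
Qed.

Lemma has_sum_mul x y (c d : R) : l2b x c -> l2b y d ->
  exists2 s, has_sum (fun t => x t * y t) s & cabs s <= c * d.
Proof.
move=> Hx Hy; apply: has_sum_abs => J uJ; under eq_bigr do rewrite cabsM.
exact: sum_mul_le.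
Qed.

Lemma l2b_conj y (c : R) : l2b y c -> l2b (fun t => conjc (y t)) c.
Proof.
move=> [c0 H]; split=> // J /H; congr (_ <= _).
by apply: eq_bigr => t _; rewrite cabs_conj.
Qed.

Lemma ip_has_sum x y : l2 x -> l2 y ->
  has_sum (fun t => x t * conjc (y t)) (ip x y).
Proof.
move=> [c Hx] [d Hy]; have [s Hs _] := has_sum_mul Hx (l2b_conj Hy).
by rewrite /ip (csumE Hs).
Qed.

Lemma ip_le x y : l2 x -> l2 y -> cabs (ip x y) <= nrm x * nrm y.
Proof.
move=> Hx Hy; have [s Hs h] := has_sum_mul (l2b_nrm Hx) (l2b_conj (l2b_nrm Hy)).
by rewrite /ip (csumE Hs).
Qed.

Lemma ipDl x y z : l2 x -> l2 y -> l2 z -> ip (fun t => x t + y t) z = ip x z + ip y z.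
Proof.
move=> Hx Hy Hz; apply: csumE.
apply: eq_has_sum (has_sumD (ip_has_sum Hx Hz) (ip_has_sum Hy Hz)) => t.
by rewrite mulrDl.
Qed.

Lemma ipZl a x z : l2 x -> l2 z -> ip (fun t => a * x t) z = a * ip x z.
Proof.
move=> Hx Hz; apply: csumE.
by apply: eq_has_sum (has_sumZ a (ip_has_sum Hx Hz)) => t; rewrite mulrA.
Qed.

Lemma ipC x y : l2 x -> l2 y -> ip y x = conjc (ip x y).
Proof.
move=> Hx Hy; apply: csumE; apply: eq_has_sum (has_sum_conj (ip_has_sum Hx Hy)) => t.
by rewrite rmorphM /= conjcK mulrC.
Qed.

Lemma ipBl x y z : l2 x -> l2 y -> l2 z -> ip (fun t => x t - y t) z = ip x z - ip y z.
Proof.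
move=> Hx Hy Hz; apply: csumE.
apply: eq_has_sum (has_sumD (ip_has_sum Hx Hz) (has_sumN (ip_has_sum Hy Hz))) => t.
by rewrite mulrBl.
Qed.

Lemma ipDr x y z : l2 x -> l2 y -> l2 z -> ip z (fun t => x t + y t) = ip z x + ip z y.
Proof.
move=> Hx Hy Hz; rewrite ipC //; last exact: l2D.
by rewrite ipDl // rmorphD /= -!ipC.
Qed.

Lemma ipBr x y z : l2 x -> l2 y -> l2 z -> ip z (fun t => x t - y t) = ip z x - ip z y.
Proof.
move=> Hx Hy Hz; rewrite ipC //; last exact: l2B.
by rewrite ipBl // rmorphB /= -!ipC.
Qed.

Lemma ipZr a x z : l2 x -> l2 z -> ip z (fun t => a * x t) = conjc a * ip z x.
Proof.
move=> Hx Hz; rewrite ipC //; last exact: l2Z.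
by rewrite ipZl // rmorphM /= -ipC.
Qed.

Lemma ip_nrm x : l2 x -> ip x x = real_complex R (nrm x ^+ 2).
Proof.
move=> Hx; have [_ Hb] := l2b_nrm Hx.
have [s Hs] := has_sum_nonneg (fun t => sqr_ge0 (cabs (x t))) Hb.
have -> : ip x x = real_complex R s.
  by apply: csumE; apply: eq_has_sum Hs => t; rewrite mul_conjc.
congr (real_complex R _).
have le_s J : uniq J -> sqn J x <= s.
  by move=> uJ; apply: has_sum_Re_le Hs uJ => t /=; exact: sqr_ge0.
have s0 : 0 <= s by have := le_s [::] isT; rewrite /sqn big_nil.
apply/eqP; rewrite eq_le; apply/andP; split.
  have := has_sum_le Hs (c := nrm x ^+ 2); rewrite cabs_real ger0_norm //; apply => J uJ.
  by rewrite -real_complex_sum cabs_real ger0_norm ?sqn_nrm ?sqn_ge0.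
rewrite -(sqr_sqrtr s0) ler_pXn2r ?nnegrE ?nrm_ge0 ?sqrtr_ge0 //; apply: nrm_le.
by split=> [|J uJ]; rewrite ?sqrtr_ge0 // sqr_sqrtr // le_s.
Qed.

Lemma nrm_sqrB x y : l2 x -> l2 y ->
  nrm (fun t => x t - y t) ^+ 2 =
  nrm x ^+ 2 + nrm y ^+ 2 - complex.Re (ip x y) *+ 2.
Proof.
move=> Hx Hy.
have := ip_nrm (l2B Hx Hy); rewrite ipBl ?ipBr //; [|exact: l2B].
rewrite !ip_nrm // (ipC Hx Hy).
move=> /(congr1 (@complex.Re R)).
have ReB (z w : R[i]) : complex.Re (z - w) = complex.Re z - complex.Re w.
  by case: z w => ? ? [].
have -> : complex.Re (real_complex R (nrm (fun t => x t - y t) ^+ 2)) =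
  nrm (fun t => x t - y t) ^+ 2 by [].
move=> <-; rewrite !ReB; case: (ip x y) => a b /=; ring.
Qed.

Definition delta (t : T) : T -> R[i] := fun s => (s == t)%:R.

Lemma l2b_delta t : l2b (delta t) 1.
Proof.
split=> // J uJ; have [uC JC tC] := uniq_undup_cat J [:: t].
apply: (le_trans (sqn_subset _ uJ JC)); rewrite /sqn (big_subset_supp _ uC tC) //.
  by rewrite big_seq1 /delta eqxx cabs1.
by move=> s _; rewrite inE /delta => /negbTE ->; rewrite cabs0 expr0n.
Qed.

Lemma l2_delta t : l2 (delta t).
Proof. by exists 1; exact: l2b_delta. Qed.

Lemma ip_delta x t : ip x (delta t) = x t.
Proof.
apply: csumE; rewrite -[X in has_sum _ X](_ : x t * conjc (delta t t) = _).
  by apply: has_sum1 => s; rewrite /delta => /negbTE ->; rewrite conjc0 mulr0.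
by rewrite /delta eqxx conjc1 mulr1.
Qed.

End InnerProduct.

Section Application.
Context {R : realType} {S T : choiceType}.
Implicit Types (A : S -> T -> R[i]) (x y : T -> R[i]) (c : R).

Definition ap A x : S -> R[i] := fun s => csum (fun t => A s t * x t).

Lemma opb_row A c s : opb A c -> l2b (A s) c.
Proof.
move=> H; split=> [|J uJ]; first exact: opb_ge0 H.
have [_ /(_ J [:: s] (fun=> 1) uJ isT)] := opb_tr H.
rewrite /sqn big_seq1 cabs1 expr1n mulr1; congr (_ <= _).
by apply: eq_bigr => t _; rewrite big_seq1 mulr1.
Qed.

Lemma ap_has_sum A c x s : opb A c -> l2 x -> has_sum (fun t => A s t * x t) (ap A x s).
Proof.
move=> HA [d Hx]; have [y Hy _] := has_sum_mul (opb_row s HA) Hx.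
by rewrite /ap (csumE Hy).
Qed.

Lemma ap_cutoff A J x s : uniq J -> ap A (cutoff J x) s = \sum_(t <- J) A s t * x t.
Proof.
move=> uJ; apply: csumE.
rewrite (_ : \sum_(t <- J) _ = \sum_(t <- J) A s t * cutoff J x t); last first.
  by apply: eq_big_seq => t tJ; rewrite /cutoff tJ.
by apply: has_sum_fin => // t tJ; rewrite /cutoff (negbTE tJ) mulr0.
Qed.

Lemma ap_delta A t s : ap A (delta t) s = A s t.
Proof.
apply: csumE; rewrite -[X in has_sum _ X](_ : A s t * delta t t = _).
  by apply: has_sum1 => s'; rewrite /delta => /negbTE ->; rewrite mulr0.
by rewrite /delta eqxx mulr1.
Qed.

Lemma apD A c x y : opb A c -> l2 x -> l2 y ->
  ap A (fun t => x t + y t) = (fun s => ap A x s + ap A y s).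
Proof.
move=> HA Hx Hy; apply/funext => s; apply: csumE.
apply: eq_has_sum (has_sumD (ap_has_sum s HA Hx) (ap_has_sum s HA Hy)) => t.
by rewrite mulrDr.
Qed.

Lemma apZ A c a x : opb A c -> l2 x ->
  ap A (fun t => a * x t) = (fun s => a * ap A x s).
Proof.
move=> HA Hx; apply/funext => s; apply: csumE.
by apply: eq_has_sum (has_sumZ a (ap_has_sum s HA Hx)) => t; rewrite mulrCA.
Qed.

Lemma apB A c x y : opb A c -> l2 x -> l2 y ->
  ap A (fun t => x t - y t) = (fun s => ap A x s - ap A y s).
Proof.
move=> HA Hx Hy; apply/funext => s; apply: csumE.
apply: eq_has_sum (has_sumD (ap_has_sum s HA Hx) (has_sumN (ap_has_sum s HA Hy))) => t.
by rewrite mulrBr.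
Qed.

(** The vector is split into a finite cutoff, to which [opb] applies, and a tail of norm at most
    [e]. On the finitely many rows of [J] the tail contributes at most [m * e], by Cauchy-Schwarz in
    each row. *)
Lemma l2b_ap A c x d : opb A c -> l2b x d -> l2b (ap A x) (c * d).
Proof.
move=> HA Hx; have [c0 HA'] := HA; have [d0 Hd] := Hx.
have l2x : l2 x by exists d.
split=> [|J uJ]; first exact: mulr_ge0.
set m := Num.sqrt (size J)%:R * c.
have m0 : 0 <= m by rewrite mulr_ge0 ?sqrtr_ge0.
suff h : Num.sqrt (sqn J (ap A x)) <= c * d.
  by rewrite -(sqr_sqrtr (sqn_ge0 J _)) ler_pXn2r ?nnegrE ?sqrtr_ge0 ?mulr_ge0.
apply: (ler_addgt0_mul m0) => e e0.
have [L uL /(_ L uL (fun _ h => h)) HL] := l2_tail l2x e0.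
have l2t : l2 (fun t => x t - cutoff L x t) by apply: l2B => //; exact: l2_cutoff.
have E s : ap A x s = ap A (cutoff L x) s + ap A (fun t => x t - cutoff L x t) s.
  by rewrite (apB HA) //; [rewrite addrC subrK|exact: l2_cutoff].
rewrite -(@ler_pXn2r _ 2) ?nnegrE ?sqrtr_ge0 ?addr_ge0 ?mulr_ge0 ?(ltW e0) //.
rewrite sqr_sqrtr ?sqn_ge0 //.
have -> : sqn J (ap A x) =
    sqn J (fun s => ap A (cutoff L x) s + ap A (fun t => x t - cutoff L x t) s).
  by apply: eq_bigr => s _; rewrite E.
apply: sqnD; rewrite ?mulr_ge0 ?(ltW e0) //.
  apply: (@le_trans _ _ (c ^+ 2 * sqn L x)).
    apply: le_trans (HA' J L x uJ uL); rewrite le_eqVlt; apply/orP; left; apply/eqP.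
    by apply: eq_bigr => s _; rewrite ap_cutoff.
  by rewrite exprMn ler_wpM2l ?sqr_ge0 // Hd.
apply: (@le_trans _ _ (\sum_(s <- J) (c * e) ^+ 2)).
  apply: ler_sum => s _; rewrite ler_pXn2r ?nnegrE ?cabs_ge0 ?mulr_ge0 ?(ltW e0) //.
  have [y Hy hy] := has_sum_mul (opb_row s HA) (l2b_nrm l2t).
  by rewrite /ap (csumE Hy); apply: le_trans hy _; rewrite ler_wpM2l.
rewrite big_const_seq count_predT iter_addr addr0 /m -[X in _ <= X ^+ 2]mulrA.
by rewrite [leRHS]exprMn sqr_sqrtr // mulr_natl.
Qed.

Lemma l2_ap A c x : opb A c -> l2 x -> l2 (ap A x).
Proof. by move=> HA [d Hx]; exists (c * d); exact: l2b_ap. Qed.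

Lemma nrm_ap A c x : opb A c -> l2 x -> nrm (ap A x) <= c * nrm x.
Proof. by move=> HA Hx; apply/nrm_le/l2b_ap => //; exact: l2b_nrm. Qed.

(* The two bounds below only concern finitely supported vectors, for which
   [csum] is never used on a non-summable family. *)
Lemma opb_of_l2 A c : 0 <= c ->
  (forall x, (exists J, uniq J /\ (forall t, t \notin J -> x t = 0)) ->
     l2b x 1 -> l2b (ap A x) c) -> opb A c.
Proof.
move=> c0 H; split=> // J K x uJ uK.
have [x0|x0] := eqVneq (sqn K x) 0.
  rewrite x0 mulr0 [leLHS]big1 // => s _.
  rewrite big1_seq ?cabs0 ?expr0n // => t /= tK.
  have : cabs (x t) ^+ 2 <= 0.
    rewrite -x0; apply: (le_trans _ (@sqn_subset _ _ [:: t] K x isT _)).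
      by rewrite /sqn big_seq1.
    by move=> u; rewrite inE => /eqP ->.
  move=> h; have /eqP : cabs (x t) ^+ 2 = 0 by apply/eqP; rewrite eq_le h sqr_ge0.
  by rewrite sqrf_eq0 => /eqP/cabs_eq0 ->; rewrite mulr0.
have p0 : 0 < sqn K x by rewrite lt_neqAle eq_sym x0 sqn_ge0.
set n := Num.sqrt (sqn K x); have n0 : 0 < n by rewrite sqrtr_gt0.
pose y t := real_complex R n^-1 * cutoff K x t.
have Hy : l2b y 1.
  have := l2bZ (real_complex R n^-1) (l2b_cutoff_fin x uK).
  by rewrite cabs_real ger0_norm ?invr_ge0 ?(ltW n0) // mulVf ?gt_eqF.
have yK t : t \notin K -> y t = 0 by rewrite /y /cutoff => /negbTE ->; rewrite mulr0.
have [_ /(_ J uJ)] := H y (ex_intro _ K (conj uK yK)) Hy.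
have -> : sqn J (ap A y) = n^-1 ^+ 2 * sqn J (fun s => \sum_(t <- K) A s t * x t).
  rewrite /sqn mulr_sumr; apply: eq_bigr => s _.
  rewrite -[n^-1](@ger0_norm) ?invr_ge0 ?(ltW n0) // -cabs_real -exprMn -cabsM.
  congr (cabs _ ^+ 2); apply: csumE; rewrite mulr_sumr.
  rewrite (_ : \sum_(t <- K) _ = \sum_(t <- K) A s t * y t); last first.
    by apply: eq_big_seq => t tK; rewrite /y /cutoff tK mulrCA.
  by apply: has_sum_fin => // t tK; rewrite yK ?mulr0.
rewrite exprVn sqr_sqrtr ?sqn_ge0 // => h.
by rewrite -ler_pdivrMr // mulrC.
Qed.

(** The bridge between the operator norm of the definitions and finite sections. From left to right
    it tests on normalized finitely supported vectors, from right to left it uses [l2b_ap]. *)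
Lemma opnormP (A : cfun R (S * T)%type) c :
  (opnorm A <= c%:E)%E <-> opb (fun s t => A (s, t)) c.
Proof.
split=> H.
  have H1 x : l2b x 1 -> l2b (ap (fun s t => A (s, t)) x) c.
    move=> Hx; apply/(l2normP (ap _ _)); apply: le_trans H; apply: ereal_sup_ubound.
    by exists x => //; apply/l2normP.
  apply: opb_of_l2 => [|x _]; last exact: H1.
  have /H1 [//] : l2b (fun _ : T => 0 : R[i]) 1.
  split=> // J uJ; have [_ /(_ J uJ)] := @l2b0 R T; rewrite expr0n => /le_trans; apply.
  by rewrite expr1n.
apply: ge_ereal_sup => _ [x /= /l2normP Hx <-].
by apply/(l2normP (ap (fun s t => A (s, t)) x)); rewrite -[c]mulr1; exact: l2b_ap.
Qed.

Lemma opnorm_ge0 (A : cfun R (S * T)%type) : (0 <= opnorm A)%E.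
Proof.
apply: (@le_trans _ _ (l2norm (mulv A (fun=> 0)))); first exact: l2norm_ge0.
apply: ereal_sup_ubound; exists (fun=> 0) => //=.
apply/l2normP; split=> // J uJ; have [_ /(_ J uJ)] := @l2b0 R T.
by rewrite expr0n => /le_trans; apply; rewrite expr1n.
Qed.

Lemma bounded_opP (A : cfun R (S * T)%type) :
  bounded_op A <-> exists c, opb (fun s t => A (s, t)) c.
Proof.
split=> [[c H]|[c H]].
  exists `|c|; apply: opb_of_l2 => // x _ Hx; apply/(l2normP (ap _ _)).
  have [|_ h] := H x; first by apply/l2norm_fin; exists 1.
  apply: (le_trans h); apply: (@le_trans _ _ (`|c|%:E * l2norm (x : cfun R T))%E).
    by rewrite lee_wpmul2r ?l2norm_ge0 // lee_fin ler_norm.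
  rewrite -[leRHS]mule1; apply: lee_wpmul2l; first by rewrite lee_fin.
  exact/l2normP.
exists c => x /l2norm_fin l2x; split=> [s|]; first by eexists; exact: (ap_has_sum s H l2x).
by rewrite (l2normE (x := x)) // -EFinM; apply/(l2normP (ap (fun s t => A (s, t)) x))/l2b_ap/l2b_nrm.
Qed.

End Application.

Section Adjoint.
Context {R : realType}.

Definition adj (S T : Type) (A : S -> T -> R[i]) : T -> S -> R[i] :=
  fun t s => conjc (A s t).

Lemma opb_adj (S T : eqType) (A : S -> T -> R[i]) c : opb A c -> opb (adj A) c.
Proof. by move=> H; exact: opb_conj (opb_tr H). Qed.

Lemma cutoffE (T : choiceType) (J : seq T) (x : T -> R[i]) : uniq J ->
  cutoff J x = (fun t => \sum_(s <- J) x s * delta s t).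
Proof.
move=> uJ; apply/funext => t; rewrite /cutoff; case: ifPn => tJ.
  rewrite (bigD1_seq t) //= /delta eqxx mulr1 big1 ?addr0 // => s.
  by rewrite eq_sym => /negbTE ->; rewrite mulr0.
rewrite big1_seq // => s /= sJ; rewrite /delta; case: eqVneq tJ => [->|_ _].
  by rewrite sJ.
by rewrite mulr0.
Qed.

Definition idm (T : eqType) (s t : T) : R[i] := (s == t)%:R.

Lemma opb_idm (T : eqType) : opb (@idm T) 1.
Proof.
split=> // J K x uJ uK; rewrite expr1n mul1r.
apply: (@le_trans _ _ (sqn J (fun s => if s \in K then x s else 0))).
  rewrite le_eqVlt; apply/orP; left; apply/eqP/eq_bigr => s _; congr (cabs _ ^+ 2).
  case: ifPn => sK.
    rewrite (bigD1_seq s) //= /idm eqxx mul1r big1 ?addr0 // => t.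
    by rewrite eq_sym => /negbTE ->; rewrite mul0r.
  rewrite big1_seq // => t /= tK; rewrite /idm; case: eqVneq => [st|_]; rewrite ?mul0r //.
  by rewrite st tK in sK.
have [uC JC KC] := uniq_undup_cat J K.
apply: (le_trans (sqn_subset _ uJ JC)); rewrite /sqn (big_subset_supp uK uC KC).
  by rewrite le_eqVlt; apply/orP; left; apply/eqP/eq_big_seq => s ->.
by move=> s _ /negbTE ->; rewrite cabs0 expr0n.
Qed.

Lemma ap_idm (T : choiceType) (x : T -> R[i]) : ap (@idm T) x = x.
Proof.
apply/funext => s; apply: csumE; rewrite -[X in has_sum _ X](_ : idm s s * x s = _).
  by apply: has_sum1 => t; rewrite eq_sym /idm => /negbTE ->; rewrite mul0r.
by rewrite /idm eqxx mul1r.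
Qed.

Lemma ap_sum (S T : choiceType) (I : Type) (r : seq I) (A : S -> T -> R[i]) c
    (f : I -> T -> R[i]) : opb A c -> (forall i, l2 (f i)) ->
  ap A (fun t => \sum_(i <- r) f i t) = (fun s => \sum_(i <- r) ap A (f i) s).
Proof.
move=> HA Hf; apply/funext => s; apply: csumE.
apply: eq_has_sum (has_sum_sum r (fun i => ap_has_sum s HA (Hf i))) => t.
by rewrite mulr_sumr.
Qed.

Lemma l2_sum (T : choiceType) (I : Type) (r : seq I) (f : I -> T -> R[i]) :
  (forall i, l2 (f i)) -> l2 (fun t => \sum_(i <- r) f i t).
Proof.
move=> Hf; elim: r => [|i r IH].
  by have := ex_intro _ _ (@l2b0 R T); congr l2; apply/funext => t; rewrite big_nil.
by have := l2D (Hf i) IH; congr l2; apply/funext => t; rewrite big_cons.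
Qed.

Lemma ip_suml (T : choiceType) (I : Type) (r : seq I) (f : I -> T -> R[i]) y :
  (forall i, l2 (f i)) -> l2 y ->
  ip (fun t => \sum_(i <- r) f i t) y = \sum_(i <- r) ip (f i) y.
Proof.
move=> Hf Hy; apply: csumE.
apply: eq_has_sum (has_sum_sum r (fun i => ip_has_sum (Hf i) Hy)) => t.
by rewrite mulr_suml.
Qed.

Lemma ip_sumr (T : choiceType) (I : Type) (r : seq I) (f : I -> T -> R[i]) y :
  (forall i, l2 (f i)) -> l2 y ->
  ip y (fun t => \sum_(i <- r) f i t) = \sum_(i <- r) ip y (f i).
Proof.
move=> Hf Hy; rewrite ipC //; last exact: l2_sum.
by rewrite ip_suml // rmorph_sum /=; apply: eq_bigr => i _; rewrite -ipC.
Qed.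

(** Two bounded sesquilinear forms that agree on basis vectors agree on finitely supported vectors,
    hence everywhere by cutting off tails. This yields both the adjoint relation and, later, the
    spectral form of the product of an operator with its adjoint. *)
Lemma ip_ap_ext (U U' S T : choiceType) (A : U -> T -> R[i]) (B : U -> S -> R[i])
    (A' : U' -> T -> R[i]) (B' : U' -> S -> R[i]) (c : R) :
  opb A c -> opb B c -> opb A' c -> opb B' c ->
  (forall t s, ip (ap A (delta t)) (ap B (delta s)) =
     ip (ap A' (delta t)) (ap B' (delta s))) ->
  forall x y, l2 x -> l2 y -> ip (ap A x) (ap B y) = ip (ap A' x) (ap B' y).
Proof.
move=> HA HB HA' HB' Hd x y Hx Hy; have c0 := opb_ge0 HA.
apply/eqP; rewrite -subr_eq0; apply/eqP/cabs_eq0/eqP.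
rewrite eq_le cabs_ge0 andbT.
have k0 : 0 <= 2 * (c * c) * (nrm x + nrm y) by rewrite !mulr_ge0 ?addr_ge0 ?nrm_ge0.
apply: (ler_addgt0_mul k0) => e e0.
have [J uJ /(_ J uJ (fun _ h => h)) HJ] := l2_tail Hx e0.
have [K uK /(_ K uK (fun _ h => h)) HK] := l2_tail Hy e0.
have l2xc := l2_cutoff x uJ; have l2yc := l2_cutoff y uK.
have l2xt := l2B Hx l2xc; have l2yt := l2B Hy l2yc.
have l2d (V : choiceType) (z : V -> R[i]) (t : V) : l2 (fun t' => z t * delta t t').
  exact/l2Z/l2_delta.
have ec (V : choiceType) (C : V -> T -> R[i]) (D : V -> S -> R[i]) : opb C c -> opb D c ->
   ip (ap C (cutoff J x)) (ap D (cutoff K y)) = \sum_(t <- J) \sum_(s <- K)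
     x t * (conjc (y s) * ip (ap C (delta t)) (ap D (delta s))).
  move=> HC HD; rewrite !cutoffE // (ap_sum _ HC) // (ap_sum _ HD) //.
  have lC t : l2 (ap C (fun t' => x t * delta t t')) by exact: l2_ap HC (l2d _ _ _).
  have lD s : l2 (ap D (fun t' => y s * delta s t')) by exact: l2_ap HD (l2d _ _ _).
  rewrite ip_suml //; last exact: l2_sum.
  apply: eq_bigr => t _; rewrite ip_sumr //; apply: eq_bigr => s _.
  have lt := l2_ap HC (l2_delta t); have ls := l2_ap HD (l2_delta s).
  rewrite (apZ _ HC) ?(apZ _ HD); try exact: l2_delta.
  by rewrite ipZl ?ipZr //; exact: l2Z.
have cutb : ip (ap A (cutoff J x)) (ap B (cutoff K y)) =
    ip (ap A' (cutoff J x)) (ap B' (cutoff K y)).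
  by rewrite !ec //; apply: eq_bigr => t _; apply: eq_bigr => s _; rewrite Hd.
have dec (V : choiceType) (C : V -> T -> R[i]) (D : V -> S -> R[i]) : opb C c -> opb D c ->
    cabs (ip (ap C x) (ap D y) - ip (ap C (cutoff J x)) (ap D (cutoff K y))) <=
    (c * c) * (nrm x + nrm y) * e.
  move=> HC HD.
  have Ex : ap C x = fun t => ap C (cutoff J x) t + ap C (fun t => x t - cutoff J x t) t.
    by rewrite -(apD HC) //; congr (ap C _); apply/funext => t; rewrite addrC subrK.
  have Ey : ap D y = fun t => ap D (cutoff K y) t + ap D (fun t => y t - cutoff K y t) t.
    by rewrite -(apD HD) //; congr (ap D _); apply/funext => t; rewrite addrC subrK.
  have lxc := l2_ap HC l2xc; have lyc := l2_ap HD l2yc; have ly := l2_ap HD Hy.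
  have lxt := l2_ap HC l2xt; have lyt := l2_ap HD l2yt.
  rewrite {1}Ex ipDl // {1}Ey ipDr //.
  rewrite addrAC [X in cabs X](_ : _ =
    ip (ap C (cutoff J x)) (ap D (fun t => y t - cutoff K y t)) +
    ip (ap C (fun t => x t - cutoff J x t)) (ap D y)); last by ring.
  apply: (le_trans (cabsD _ _)).
  have ncut : nrm (cutoff J x) <= nrm x by apply: nrm_le; apply: l2b_cutoff; exact: l2b_nrm.
  have h1 := ler_pM (nrm_ge0 _) (nrm_ge0 _) (nrm_ap HC l2xc) (nrm_ap HD l2yt).
  have h2 := ler_pM (nrm_ge0 _) (nrm_ge0 _) (nrm_ap HC l2xt) (nrm_ap HD Hy).
  have h3 : c * nrm (cutoff J x) * (c * nrm (fun t => y t - cutoff K y t)) <=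
     c * nrm x * (c * e).
    by apply: ler_pM; rewrite ?mulr_ge0 ?nrm_ge0 ?ler_wpM2l.
  have h4 : c * nrm (fun t => x t - cutoff J x t) * (c * nrm y) <= c * e * (c * nrm y).
    by rewrite ler_wpM2r ?mulr_ge0 ?nrm_ge0 // ler_wpM2l.
  have := ip_le lxc lyt; have := ip_le lxt ly; nra.
have h1 := dec _ _ _ HA HB; have h2 := dec _ _ _ HA' HB'.
rewrite cutb in h1.
set z := ip (ap A' (cutoff J x)) _ in h1 h2.
have -> : ip (ap A x) (ap B y) - ip (ap A' x) (ap B' y) =
  (ip (ap A x) (ap B y) - z) - (ip (ap A' x) (ap B' y) - z) by ring.
apply: (le_trans (cabsD _ _)); rewrite cabsN; lra.
Qed.

Lemma ip_ap_adj (S T : choiceType) (A : S -> T -> R[i]) c x y : opb A c ->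
  l2 x -> l2 y -> ip (ap A x) y = ip x (ap (adj A) y).
Proof.
move=> HA Hx Hy.
(* [ip_ap_ext] is used with identity matrices in the two free places, so the common bound must also
   dominate 1. *)
have m1 : c <= Num.max c 1 by rewrite le_max lexx.
have m2 : 1 <= Num.max c 1 by rewrite le_max lexx orbT.
have := ip_ap_ext (opb_le m1 HA) (opb_le m2 (opb_idm S)) (opb_le m2 (opb_idm T))
  (opb_le m1 (opb_adj HA)).
rewrite -[y in LHS]ap_idm -[x in RHS]ap_idm; apply => // t s.
rewrite !ap_idm ip_delta ap_delta -[RHS]conjcK -ipC.
- by rewrite ip_delta ap_delta /adj conjcK.
- exact: l2_delta.
- exact: l2_ap (opb_adj HA) (l2_delta _).
Qed.

Lemma ip_cutoff_r (T : choiceType) (K : seq T) (x y : T -> R[i]) : uniq K ->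
  ip x (cutoff K y) = \sum_(t <- K) x t * conjc (y t).
Proof.
move=> uK; apply: csumE.
rewrite (_ : \sum_(t <- K) _ = \sum_(t <- K) x t * conjc (cutoff K y t)).
  by apply: has_sum_fin => // t tK; rewrite /cutoff (negbTE tK) conjc0 mulr0.
by apply: eq_big_seq => t tK; rewrite /cutoff tK.
Qed.

Lemma ip_ap_trunc (T : choiceType) (A : T -> T -> R[i]) c x y (e : R) : opb A c ->
  l2 x -> l2 y -> 0 < e -> exists2 J0, uniq J0 & forall J, uniq J -> {subset J0 <= J} ->
  cabs (\sum_(s <- J) \sum_(t <- J) A s t * x t * conjc (y s) - ip (ap A x) y) <= e.
Proof.
move=> HA Hx Hy e0; have c0 := opb_ge0 HA.
pose k := c * (nrm x + nrm y); have k0 : 0 <= k by rewrite mulr_ge0 ?addr_ge0 ?nrm_ge0.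
have k1 : 0 < k + 1 by rewrite ltr_wpDl.
have d0 : 0 < e / (k + 1) by rewrite divr_gt0.
have [J1 uJ1 HJ1] := l2_tail Hx d0; have [J2 uJ2 HJ2] := l2_tail Hy d0.
have [uC C1 C2] := uniq_undup_cat J1 J2; exists (undup (J1 ++ J2)) => // J uJ JJ.
have {}HJ1 := HJ1 J uJ (fun t h => JJ t (C1 t h)).
have {}HJ2 := HJ2 J uJ (fun t h => JJ t (C2 t h)).
have l2xc := l2_cutoff x uJ; have l2yc := l2_cutoff y uJ.
have l2xt := l2B Hx l2xc; have l2yt := l2B Hy l2yc.
have -> : \sum_(s <- J) \sum_(t <- J) A s t * x t * conjc (y s) =
    ip (ap A (cutoff J x)) (cutoff J y).
  rewrite ip_cutoff_r //; apply: eq_bigr => s _; by rewrite ap_cutoff // mulr_suml.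
have Ex : ip (ap A x) y = ip (ap A (cutoff J x)) y + ip (ap A (fun t => x t - cutoff J x t)) y.
  rewrite -ipDl //; try exact: l2_ap HA _.
  rewrite -(apD HA) //; congr (ip (ap A _) y); apply/funext => t; by rewrite addrC subrK.
have Ey : ip (ap A (cutoff J x)) y = ip (ap A (cutoff J x)) (cutoff J y) +
    ip (ap A (cutoff J x)) (fun t => y t - cutoff J y t).
  rewrite -ipDr //; last exact: l2_ap HA _.
  congr (ip _ _); apply/funext => t; by rewrite addrC subrK.
rewrite Ex Ey cabsBC [X in cabs X](_ : _ = ip (ap A (cutoff J x)) (fun t => y t - cutoff J y t) +
     ip (ap A (fun t => x t - cutoff J x t)) y); last by ring.
apply: (le_trans (cabsD _ _)).
apply: (@le_trans _ _ (k * (e / (k + 1)))); last first.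
  rewrite mulrCA -[leRHS]mulr1 ler_pM2l // ler_pdivrMr // mul1r; lra.
rewrite [X in _ <= X * _](_ : k = c * nrm x + c * nrm y) ?mulrDl; last by rewrite /k mulrDr.
apply: lerD.
  apply: (le_trans (ip_le (l2_ap HA l2xc) l2yt)); apply: ler_pM => //; try exact: nrm_ge0.
  apply: (le_trans (nrm_ap HA l2xc)); rewrite ler_wpM2l //.
  by apply: nrm_le; apply: l2b_cutoff; exact: l2b_nrm.
apply: (le_trans (ip_le (l2_ap HA l2xt) Hy)).
rewrite -mulrA [nrm y * _]mulrC mulrA ler_wpM2r ?nrm_ge0 //.
by apply: (le_trans (nrm_ap HA l2xt)); rewrite ler_wpM2l.
Qed.

End Adjoint.

(** * Compact operators and singular values *)

Section Compact.
Context {R : realType} {T : choiceType}.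
Implicit Types (A : T -> T -> R[i]) (x y : T -> R[i]).

Definition seqcompact A := (exists c, opb A c) /\
  forall x : nat -> T -> R[i], (forall k, l2b (x k) 1) ->
    exists (phi : nat -> nat) (y : T -> R[i]),
      [/\ {homo phi : j k / (j < k)%N}, l2 y & forall e : R, 0 < e -> exists N,
          forall k, (N <= k)%N -> l2b (fun s => ap A (x (phi k)) s - y s) e].

Definition sub_section A (J : seq T) s t := if (s \in J) && (t \in J) then A s t else 0.

(** Compactness as norm approximation by finite square sections. In contrast to the sequential form,
    it passes readily to sums, norm limits and Schur products. *)
Definition approximable A := (exists c, opb A c) /\ forall e : R, 0 < e ->
  exists J : seq T, opb (fun s t => A s t - sub_section A J s t) e.

Lemma compact_opP (A : cfun R (T * T)%type) :
  compact_op A <-> seqcompact (fun s t => A (s, t)).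
Proof.
have P (x : nat -> T -> R[i]) y :
    (l2norm (mulv A (x k) - y) @[k --> \oo] --> (0 : \bar R)) <->
    forall e : R, 0 < e -> exists N, forall k, (N <= k)%N ->
      l2b (fun s => ap (fun s t => A (s, t)) (x k) s - y s) e.
  rewrite cvge0P; last by move=> n; exact: l2norm_ge0.
  split=> H e e0.
    by have [N HN] := H e e0; exists N => k /HN /ltW /l2normP.
  have [N HN] := H (e / 2) (divr_gt0 e0 (ltr0Sn _ 1)); exists N => k /HN /l2normP h.
  by rewrite (le_lt_trans h) // lte_fin; lra.
split=> -[bA H]; split; try exact/bounded_opP; move=> x Hx.
  have [k|phi [y [h1 /l2norm_fin h2 h3]]] := H x; first exact/l2normP.
  by exists phi, y; split=> //; apply/(P (x \o phi)).
have [k|phi [y [h1 h2 h3]]] := H x; first exact/l2normP.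
exists phi, y; split=> //; first exact/l2norm_fin.
exact/(P (x \o phi)).
Qed.

Lemma subset_cutoff_tail (J K : seq T) x : {subset J <= K} -> l2 x ->
  nrm (fun t => x t - cutoff K x t) <= nrm (fun t => x t - cutoff J x t).
Proof.
move=> JK Hx; have l2c (L : seq T) : l2 (cutoff L x).
  by exists (nrm x); apply: l2b_cutoff; exact: l2b_nrm.
have [c0 H] := l2b_nrm (l2B Hx (l2c J)).
apply: nrm_le; split=> // L uL; apply: le_trans (H L uL); apply: ler_sum => t _.
rewrite /cutoff; case: ifP => [tK|]; first by rewrite subrr cabs0 expr0n sqr_ge0.
by case: ifP => // /JK ->.
Qed.

(** Otherwise there are growing finite sets [Js n] and vectors [x n] in the unit ball such that
    [A (x n)] has norm more than [e] outside [Js n] and at most [e / 2] outside [Js n.+1]. The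
    images are then pairwise more than [e / 2] apart, and no subsequence converges. *)
Lemma compact_rows A (e : R) : seqcompact A -> 0 < e ->
  exists J : seq T, opb (fun s t => if s \in J then 0 else A s t) e.
Proof.
move=> [[c HA] Hc] e0; apply: contrapT => /forallNP H.
have l2A x : l2b x 1 -> l2 (ap A x) by move=> Hx; apply: (l2_ap HA); exists 1.
have step (J : seq T) : exists p : (T -> R[i]) * seq T, [/\ {subset J <= p.2},
    l2b p.1 1, ~ (nrm (fun s => ap A p.1 s - cutoff J (ap A p.1) s) <= e) &
    nrm (fun s => ap A p.1 s - cutoff p.2 (ap A p.1) s) <= e / 2].
  have [x Hx nx] : exists2 x, l2b x 1 &
      ~ (nrm (fun s => ap A x s - cutoff J (ap A x) s) <= e).
    apply: contrapT => /forall2NP h; apply: (H J); apply: opb_of_l2 => [|x _ Hx].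
      exact: ltW.
    have {h} : nrm (fun s => ap A x s - cutoff J (ap A x) s) <= e.
      by apply: contrapT; have [] := h x.
    have l2c : l2 (fun s => ap A x s - cutoff J (ap A x) s).
      apply: l2B; first exact: l2A.
      by exists (nrm (ap A x)); apply/l2b_cutoff/l2b_nrm/l2A.
    move=> h; have [c0 h'] := l2b_nrm l2c.
    split=> [|K uK]; first exact: ltW.
    apply: le_trans (_ : nrm (fun s => ap A x s - cutoff J (ap A x) s) ^+ 2 <= _); last first.
      by rewrite ler_pXn2r ?nnegrE ?nrm_ge0 ?(ltW e0).
    apply: le_trans (h' K uK); apply: ler_sum => s _; rewrite /cutoff /ap.
    case: ifP => sJ; last by rewrite subr0.
    rewrite subrr (_ : csum _ = 0) ?cabs0 ?expr0n //.
    by apply: csum_eq0 => t0; rewrite mul0r.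
  have [L uL /(_ (undup (L ++ J)))] := l2_tail (l2A x Hx) (divr_gt0 e0 (ltr0Sn _ 1)).
  have [uC LC JC] := uniq_undup_cat L J.
  by move=> /(_ uC LC) h; exists (x, undup (L ++ J)).
have [f Hf] := choice step.
pose Js := fix F n := if n is n'.+1 then (f (F n')).2 else [::].
pose x n := (f (Js n)).1.
have Jmono m n : (m <= n)%N -> {subset Js m <= Js n}.
  move=> /subnK <-; elim: (n - m)%N => // k IH t /IH.
  by rewrite addSn /=; have [h _ _ _] := Hf (Js (k + m)%N); exact: h.
have Hx n : l2b (x n) 1 by have [] := Hf (Js n).
have sep m n : (m < n)%N -> e / 2 < nrm (fun s => ap A (x n) s - ap A (x m) s).
  move=> mn; have [_ _ /negP h1 _] := Hf (Js n); have [_ _ _ h2] := Hf (Js m).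
  rewrite -ltNge -/(x n) in h1; rewrite -/(x m) in h2.
  have ln := l2A _ (Hx n); have lm := l2A _ (Hx m).
  have cl (J : seq T) (z : T -> R[i]) : l2 z -> l2 (cutoff J z).
    by move=> Hz; exists (nrm z); apply: l2b_cutoff; exact: l2b_nrm.
  have h3 := le_trans (subset_cutoff_tail (Jmono _ _ mn) lm) h2.
  have := nrmD (l2B (l2B ln lm) (cl (Js n) _ (l2B ln lm))) (l2B lm (cl (Js n) _ lm)).
  have -> : (fun t => ap A (x n) t - ap A (x m) t -
      cutoff (Js n) (fun t0 => ap A (x n) t0 - ap A (x m) t0) t +
      (ap A (x m) t - cutoff (Js n) (ap A (x m)) t)) =
      (fun s => ap A (x n) s - cutoff (Js n) (ap A (x n)) s).
    by apply/funext => t; rewrite /cutoff; case: ifP => _; ring.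
  have h4 : nrm (fun t => ap A (x n) t - ap A (x m) t -
      cutoff (Js n) (fun t0 => ap A (x n) t0 - ap A (x m) t0) t) <=
      nrm (fun t => ap A (x n) t - ap A (x m) t).
    have [b0 hb] := l2b_nrm (l2B ln lm); apply: nrm_le; split=> // K uK.
    apply: le_trans (hb K uK); apply: ler_sum => t _; rewrite /cutoff.
    by case: ifP => _; rewrite ?subr0 // subrr cabs0 expr0n sqr_ge0.
  move=> h5; lra.
have [phi [y [hphi l2y hy]]] := Hc x Hx.
have e8 : 0 < e / 8 by rewrite divr_gt0.
have [N HN] := hy _ e8.
have := sep _ _ (hphi N N.+1 (ltnSn N)).
have h := l2bD (HN N.+1 (leqnSn N)) (l2bZ (-1) (HN N (leqnn N))).
rewrite cabsN cabs1 mul1r in h.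
have {}h : nrm (fun s => ap A (x (phi N.+1)) s - ap A (x (phi N)) s) <= e / 8 + e / 8.
  apply: nrm_le; apply: l2b_ext h => t; ring.
lra.
Qed.

Lemma rows_tail A (c d : R) (J : seq T) : opb A c -> 0 < d ->
  exists K : seq T, forall s, s \in J -> nrm (fun t => A s t - cutoff K (A s) t) <= d.
Proof.
move=> HA d0; elim: J => [|s J [K IH]]; first by exists [::].
have l2r s' : l2 (A s') by exists c; exact: opb_row.
have [L uL /(_ L uL (fun _ h => h)) HL] := l2_tail (l2r s) d0.
exists (K ++ L) => s'; rewrite inE => /orP[/eqP ->|s'J].
  apply: le_trans HL; apply: subset_cutoff_tail => // t tL; by rewrite mem_cat tL orbT.
apply: le_trans (IH s' s'J); apply: subset_cutoff_tail => // t tL; by rewrite mem_cat tL.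
Qed.

(** All rows outside a finite set [J] are negligible by compactness. The rows in [J] are
    square-summable, so cutting them to finitely many columns leaves a small Hilbert-Schmidt error.
    Passing from the rectangle [J x K] to the square on [J ++ K] doubles the error [e / 2]. *)
Lemma seqcompact_approximable A : seqcompact A -> approximable A.
Proof.
move=> HA; have [[c bA] _] := HA; split; first by exists c.
move=> e e0; have e4 : 0 < e / 4 by rewrite divr_gt0.
have [J HJ] := compact_rows HA e4.
pose n : R := (size J)%:R + 1; have n0 : 0 < n by rewrite ltr_wpDl.
have d0 : 0 < e / 4 / n by rewrite divr_gt0.
have [K HK] := rows_tail J bA d0.
have H2 : opb (fun s t => if (s \in J) && (t \notin K) then A s t else 0) (e / 4).
  apply: opb_HS => [|J' K' uJ' uK']; first exact: ltW.
  apply: (@le_trans _ _ (\sum_(s <- undup J) (e / 4 / n) ^+ 2)).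
    have [uC JC J'C] := uniq_undup_cat (undup J) J'.
    apply: (@le_trans _ _ (\sum_(s <- undup (undup J ++ J')) sqn K'
      (fun t => if (s \in J) && (t \notin K) then A s t else 0))).
      have ge0 s : 0 <= sqn K' (fun t => if (s \in J) && (t \notin K) then A s t else 0).
        exact: sqn_ge0.
      have := @sqn_subset R T J' (undup (undup J ++ J')) (fun s => real_complex R (Num.sqrt
        (sqn K' (fun t => if (s \in J) && (t \notin K) then A s t else 0)))) uJ' J'C.
      congr (_ <= _); apply: eq_bigr => s _;
        by rewrite cabs_real ger0_norm ?sqrtr_ge0 // sqr_sqrtr.
    rewrite (big_subset_supp _ uC JC) ?undup_uniq //; last first.
      move=> s _; rewrite mem_undup => /negbTE ->; apply: big1 => t _.
      by rewrite cabs0 expr0n.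
    rewrite !big_seq; apply: ler_sum => s; rewrite mem_undup => sJ.
    have l2r : l2 (A s) by exists c; exact: opb_row.
    have l2c : l2 (cutoff K (A s)) by exists (nrm (A s)); apply/l2b_cutoff/l2b_nrm.
    have [_ /(_ K' uK') h] := l2b_nrm (l2B l2r l2c).
    apply: (@le_trans _ _ (nrm (fun t => A s t - cutoff K (A s) t) ^+ 2)).
      apply: le_trans h; apply: ler_sum => t _; rewrite sJ /= /cutoff.
      by case: (t \in K); rewrite /= ?subr0 // subrr.
    by rewrite ler_pXn2r ?nnegrE ?nrm_ge0 ?(ltW d0) // HK.
  rewrite big_const_seq count_predT iter_addr addr0 -[leLHS]mulr_natl expr_div_n.
  rewrite mulrA ler_pdivrMr ?exprn_gt0 // mulrC ler_wpM2l ?sqr_ge0 //.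
  have : ((size (undup J))%:R : R) <= (size J)%:R by rewrite ler_nat size_undup.
  have m0 : 0 <= (size J)%:R :> R by [].
  rewrite /n => h; nra.
pose X s t := A s t - if (s \in J) && (t \in K) then A s t else 0.
have HX : opb X (e / 2).
  have -> : e / 2 = e / 4 + e / 4 by field.
  apply: (eq_opb _ (opb_add HJ H2)) => s t; rewrite /X.
  by case: (s \in J); case: (t \in K); rewrite /= ?subrr ?subr0 ?addr0 ?add0r.
exists (J ++ K).
have -> : e = e / 2 + e / 2 by field.
apply: (eq_opb _ (opb_sub HX (opb_restrict (mem (J ++ K)) (mem (J ++ K)) HX))) => s t.
rewrite /X /sub_section /= !mem_cat.
by case: (s \in J); case: (t \in K); case: (s \in K); case: (t \in J);
  rewrite /= ?subrr ?subr0.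
Qed.

(** The index set may be uncountable, so no diagonal subsequence can be extracted. Tychonoff's
    theorem, applied to the real and imaginary parts, provides a pointwise cluster point instead. *)
Lemma cluster_seq (z : nat -> T -> R[i]) (c : R) : (forall k s, cabs (z k s) <= c) ->
  exists y : T -> R[i], forall (J : seq T) (N : nat) (d : R), 0 < d ->
    exists2 k, (N <= k)%N & forall s, s \in J -> cabs (z k s - y s) <= d.
Proof.
move=> zc.
pose w k (p : T * bool) : R := if p.2 then complex.Re (z k p.1) else complex.Im (z k p.1).
have wc k p : `[- c, c]%classic (w k p).
  rewrite /= in_itv /= -ler_norml /w; case: p => s [] /=; apply: le_trans (zc k s).
    exact: le_Re_cabs.
  exact: le_Im_cabs.
pose TT := fun _ : T * bool => R^o.
have cpt := @tychonoff (T * bool)%type TT (fun=> `[- c, c]%classic)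
  (fun=> @segment_compact R (- c) c).
have [|g [_ Hg]] := cpt (fmap w \oo) _; first by exists 0%N => // k _ /= p; exact: wc.
exists (fun s => (g (s, true) +i* g (s, false))%C) => J N d d0.
have nb (L : seq (T * bool)) : nbhs g [set f | forall p, p \in L -> `|f p - g p| < d / 2].
  elim: L => [|p L IH]; first by apply: filterE.
  have h : nbhs g [set f | `|f p - g p| < d / 2].
    have /cvgrPdist_lt/(_ _ (divr_gt0 d0 (ltr0Sn _ 1))) :
      proj p f @[f --> g] --> (g p : R^o) by exact: (@proj_continuous _ TT p g).
    by apply: filterS => f; rewrite /proj distrC.
  apply: filterS (filterI h IH) => f [h1 h2] q.
  by rewrite inE => /orP[/eqP ->|/h2].
have Fw : (fmap w \oo) (w @` [set k | (N <= k)%N]) by exists N => // k Nk /=; exists k.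
have [_ [[k Nk <-] Hk]] := Hg _ _ Fw (nb [seq (s, b) | s <- J, b <- [:: true; false]]).
exists k => // s sJ; apply: (le_trans (cabs_le_ReIm _)).
have h1 : `|w k (s, true) - g (s, true)| < d / 2.
  by apply: Hk; apply: allpairs_f => //; rewrite !inE.
have h2 : `|w k (s, false) - g (s, false)| < d / 2.
  by apply: Hk; apply: allpairs_f => //; rewrite !inE.
move: h1 h2; rewrite /w /=; case: (z k s) => a b /= h1 h2.
by apply: ltW; have := ltrD h1 h2; lra.
Qed.

Lemma homo_iter (h : nat -> nat -> nat) : (forall N j, (N <= h N j)%N) ->
  exists phi : nat -> nat, {homo phi : j k / (j < k)%N} /\ forall j, exists N, phi j = h N j.
Proof.
move=> hN; pose phi := fix F n := if n is n'.+1 then h (F n').+1 n'.+1 else h 0%N 0%N.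
exists phi; split=> [|[|j]]; last 2 first.
- by exists 0%N.
- by exists (phi j).+1.
by apply: (homo_ltn ltn_trans) => n; exact: hN.
Qed.

Lemma sqn_cat (J K : seq T) x : sqn (J ++ K) x = sqn J x + sqn K x.
Proof. by rewrite /sqn big_cat. Qed.

(** Outside one finite set all the images, and therefore also their cluster point [y], have small
    norm; on that set pointwise closeness is enough. Hence [y] is a norm cluster point, from which
    [homo_iter] extracts a subsequence. *)
Lemma approximable_seqcompact A : approximable A -> seqcompact A.
Proof.
move=> [[c HA] Hap]; split; first by exists c.
move=> x Hx; have c0 := opb_ge0 HA.
have lz k : l2b (ap A (x k)) c by rewrite -[c]mulr1; exact: l2b_ap.
have [y Hy] : exists y : T -> R[i], forall (J : seq T) (N : nat) (d : R), 0 < d ->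
    exists2 k, (N <= k)%N & forall s, s \in J -> cabs (ap A (x k) s - y s) <= d.
  apply: (@cluster_seq _ c) => k s.
  have lk : l2 (ap A (x k)) by exists c.
  exact: le_trans (nrm_entry s lk) (nrm_le (lz k)).
have key N (e : R) : 0 < e -> exists2 k, (N <= k)%N & l2b (fun s => ap A (x k) s - y s) e.
  move=> e0; have e4 : 0 < e / 4 by rewrite divr_gt0.
  have [J0 HJ0] := Hap _ e4; pose J := undup J0; have uJ : uniq J by exact: undup_uniq.
  have zout k K : uniq K -> (forall s, s \in K -> s \notin J) ->
      sqn K (ap A (x k)) <= (e / 4) ^+ 2.
    move=> uK KJ; have := l2b_ap HJ0 (Hx k); rewrite mulr1 => -[_ /(_ K uK)].
    congr (_ <= _); apply: eq_big_seq => s /KJ; rewrite mem_undup => sJ.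
    rewrite /ap; congr (cabs (csum _) ^+ 2); apply/funext => t.
    by rewrite /sub_section (negbTE sJ) subr0.
  have small K (d : R) (N' : nat) : 0 < d -> exists2 k, (N' <= k)%N &
      sqn K (fun s => ap A (x k) s - y s) <= d ^+ 2.
    move=> d0; pose n : R := (size K)%:R + 1; have n0 : 0 < n by rewrite ltr_wpDl.
    have [k Nk Hk] := Hy K N' _ (divr_gt0 d0 n0); exists k => //.
    apply: (@le_trans _ _ (\sum_(s <- K) (d / n) ^+ 2)).
      rewrite /sqn !big_seq; apply: ler_sum => s sK.
      by rewrite ler_pXn2r ?nnegrE ?cabs_ge0 ?(ltW (divr_gt0 d0 n0)) // Hk.
    rewrite big_const_seq count_predT iter_addr addr0 -[leLHS]mulr_natl expr_div_n.
    rewrite mulrA ler_pdivrMr ?exprn_gt0 // mulrC ler_wpM2l ?sqr_ge0 //.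
    have m0 : 0 <= (size K)%:R :> R by [].
    rewrite /n; nra.
  have yout K : uniq K -> (forall s, s \in K -> s \notin J) -> sqn K y <= (e / 2) ^+ 2.
    move=> uK KJ; have [k _ h] := small K _ 0%N e4.
    have -> : e / 2 = e / 4 + e / 4 by field.
    have -> : sqn K y = sqn K (fun s => ap A (x k) s + - (ap A (x k) s - y s)).
      by apply: eq_bigr => s _; congr (cabs _ ^+ 2); ring.
    apply: sqnD; rewrite ?(ltW e4) ?zout //.
    by move: h; congr (_ <= _); apply: eq_bigr => s _; rewrite cabsN.
  have [k Nk h] := small J _ N e4; exists k => //; split=> [|K uK]; first exact: ltW.
  have [uC KC JC] := uniq_undup_cat K J.
  apply: (le_trans (sqn_subset _ uK KC)).
  pose L := [seq s <- undup (K ++ J) | s \notin J].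
  have uL : uniq L by exact: filter_uniq.
  have LJ s : s \in L -> s \notin J by rewrite mem_filter => /andP[].
  have -> : sqn (undup (K ++ J)) (fun s => ap A (x k) s - y s) =
      sqn J (fun s => ap A (x k) s - y s) + sqn L (fun s => ap A (x k) s - y s).
    rewrite -sqn_cat; apply: perm_big; apply: uniq_perm => //.
      rewrite cat_uniq uJ uL andbT; apply/hasPn => s /LJ //.
    move=> s; rewrite mem_cat mem_filter; case: (boolP (s \in J)) => //= sJ.
    exact: JC.
  have h2 : sqn L (fun s => ap A (x k) s - y s) <= (e / 4 + e / 2) ^+ 2.
    apply: sqnD; rewrite ?(ltW e4) ?zout //; first by rewrite divr_ge0 // ltW.
    have := yout L uL LJ; congr (_ <= _); apply: eq_bigr => s _; by rewrite cabsN.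
  apply: le_trans (lerD h h2) _.
  have -> : (e / 4) ^+ 2 + (e / 4 + e / 2) ^+ 2 = (10 / 16) * e ^+ 2 by field.
  have e2 := sqr_ge0 e; lra.
have inv_gt0 j : 0 < j.+1%:R^-1 :> R by rewrite invr_gt0.
pose h N j := projT1 (cid2 (key N _ (inv_gt0 j))).
have hN N j : (N <= h N j)%N by rewrite /h; case: cid2.
have hl N j : l2b (fun s => ap A (x (h N j)) s - y s) j.+1%:R^-1 by rewrite /h; case: cid2.
have [phi [hphi phiE]] := homo_iter hN.
exists phi, y; split=> //.
  have := l2B (ex_intro _ _ (lz (h 0%N 0%N))) (ex_intro _ _ (hl 0%N 0%N)).
  by congr l2; apply/funext => s; ring.
move=> e e0; exists (Num.truncn e^-1) => k Nk.
have [N ->] := phiE k; have [_ hb] := hl N k; split=> [|K uK]; first exact: ltW.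
apply: (le_trans (hb K uK)); rewrite ler_pXn2r ?nnegrE ?(ltW e0) ?(ltW (inv_gt0 k)) //.
rewrite invf_ple ?posrE //; apply: ltW; apply: (lt_le_trans (truncnS_gt _)).
by rewrite ler_nat.
Qed.

Lemma compact_opE (A : cfun R (T * T)%type) :
  compact_op A <-> approximable (fun s t => A (s, t)).
Proof.
rewrite compact_opP; split; [exact: seqcompact_approximable|exact: approximable_seqcompact].
Qed.

Definition capprox (A : T * T -> R[i]) := approximable (fun s t => A (s, t)).

Lemma capprox_bounded (A : T * T -> R[i]) : capprox A -> exists c, opb (fun s t => A (s, t)) c.
Proof. by case. Qed.

Lemma opb_sub_section A (J : seq T) c : opb A c -> opb (sub_section A J) c.
Proof. by move=> H; exact: (opb_restrict (mem J) (mem J) H). Qed.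

(** The error for [K] is the error for [J] minus its own section on [K], hence the factor 2. *)
Lemma opb_co_section A (J K : seq T) c : {subset J <= K} ->
  opb (fun s t => A s t - sub_section A J s t) c ->
  opb (fun s t => A s t - sub_section A K s t) (c + c).
Proof.
move=> JK H; apply: (eq_opb _ (opb_sub H (opb_restrict (mem K) (mem K) H))) => s t /=.
rewrite /sub_section; case: (boolP (s \in J)) => sJ; case: (boolP (t \in J)) => tJ /=.
- by rewrite (JK _ sJ) (JK _ tJ) /= !subrr.
- by rewrite (JK _ sJ) /=; case: (t \in K); rewrite !subr0 ?subrr.
- by rewrite (JK _ tJ) andbT; case: (s \in K); rewrite !subr0 ?subrr.
- by case: ifP; rewrite !subr0 ?subrr.
Qed.

Lemma capprox_lim (A : T * T -> R[i]) : (forall e : R, 0 < e -> exists2 B, capprox B &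
   opb (fun s t => A (s, t) - B (s, t)) e) -> capprox A.
Proof.
move=> H; split.
  have [B [[c HB] _] HAB] := H 1 ltr01; exists (c + 1).
  by apply: (eq_opb _ (opb_add HB HAB)) => s t; rewrite addrC subrK.
move=> e e0; have e3 : 0 < e / 3 by rewrite divr_gt0.
have [B [_ HB] HAB] := H _ e3; have [J HJ] := HB _ e3; exists J.
have -> : e = e / 3 + e / 3 + e / 3 by field.
apply: (eq_opb _ (opb_sub (opb_add HAB HJ) (opb_sub_section J HAB))) => s t.
by rewrite /sub_section; case: ifP => _; ring.
Qed.

Lemma capprox_fin (A : T * T -> R[i]) (J : seq T) c : opb (fun s t => A (s, t)) c ->
  (forall s t, ~~ ((s \in J) && (t \in J)) -> A (s, t) = 0) -> capprox A.
Proof.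
move=> HA A0; split; first by exists c.
move=> e e0; exists J; apply: (eq_opb _ (opb_cst0 T T (ltW e0))) => s t.
rewrite /sub_section; case: ifPn => st; by rewrite ?subrr // A0 ?subr0.
Qed.

Lemma capproxD (A B : T * T -> R[i]) : capprox A -> capprox B -> capprox (fun p => A p + B p).
Proof.
move=> [[c HA] cA] [[d HB] cB]; split; first by exists (c + d); exact: opb_add.
move=> e e0; have e4 : 0 < e / 4 by rewrite divr_gt0.
have [J HJ] := cA _ e4; have [K HK] := cB _ e4; exists (J ++ K).
have J' : {subset J <= J ++ K} by move=> t tJ; rewrite mem_cat tJ.
have K' : {subset K <= J ++ K} by move=> t tJ; rewrite mem_cat tJ orbT.
have -> : e = (e / 4 + e / 4) + (e / 4 + e / 4) by field.
apply: (eq_opb _ (opb_add (opb_co_section J' HJ) (opb_co_section K' HK))) => s t.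
by rewrite /sub_section; case: ifP => _; ring.
Qed.

Lemma capproxZ z (A : T * T -> R[i]) : capprox A -> capprox (fun p => z * A p).
Proof.
move=> [[c HA] cA]; split; first by exists (cabs z * c); exact: opb_scale.
move=> e e0; have z1 : 0 < cabs z + 1 by rewrite ltr_wpDl ?cabs_ge0.
have [J HJ] := cA _ (divr_gt0 e0 z1); exists J.
apply: (opb_le _ (eq_opb _ (opb_scale z HJ))) => [|s t]; last first.
  by rewrite /sub_section; case: ifP => _; ring.
rewrite mulrCA -[leRHS]mulr1 ler_pM2l // ler_pdivrMr // mul1r lerDl; exact: ler01.
Qed.

Lemma capprox0 : capprox (fun _ => 0).
Proof. exact: (@capprox_fin _ [::] 0 (opb_cst0 T T (lexx 0))). Qed.

Lemma capprox_sum (I : Type) (r : seq I) (A : I -> T * T -> R[i]) :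
  (forall i, capprox (A i)) -> capprox (fun p => \sum_(i <- r) A i p).
Proof.
move=> H; elim: r => [|i r IH].
  by have -> : (fun p => \sum_(i <- [::]) A i p) = (fun _ => 0 : R[i]);
    [apply/funext => p; rewrite big_nil|exact: capprox0].
have -> : (fun p => \sum_(j <- i :: r) A j p) = (fun p => A i p + \sum_(j <- r) A j p).
  by apply/funext => p; rewrite big_cons.
exact: capproxD.
Qed.

Lemma opb_schur A B c d : opb A c -> opb B d -> opb (fun s t => A s t * B s t) (c * d).
Proof.
move=> HA HB; have dinj : injective (fun s : T => (s, s)) by move=> ? ? [].
exact: (opb_inj dinj dinj (opb_tens HA HB)).
Qed.

Lemma capprox_schur (A B : T * T -> R[i]) d : capprox A -> opb (fun s t => B (s, t)) d ->
  capprox (fun p => A p * B p).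
Proof.
move=> [[c HA] cA] HB; split; first by exists (c * d); exact: (opb_schur HA HB).
move=> e e0; have d0 := opb_ge0 HB; have d1 : 0 < d + 1 by rewrite ltr_wpDl.
have [J HJ] := cA _ (divr_gt0 e0 d1); exists J.
apply: (opb_le _ (eq_opb _ (opb_schur HJ HB))) => [|s t]; last first.
  by rewrite /sub_section; case: ifP => _; ring.
rewrite mulrAC ler_pdivrMr // ler_wpM2l ?(ltW e0) // lerDl; exact: ler01.
Qed.

Lemma capprox_HS (A : T * T -> R[i]) (c : R) :
  (forall J, uniq J -> \sum_(s <- J) sqn J (fun t => A (s, t)) <= c) -> capprox A.
Proof.
move=> H; have c0 : 0 <= c by have := H [::] isT; rewrite big_nil.
have l2A : l2 A.
  exists (Num.sqrt c); split=> [|K uK]; rewrite ?sqrtr_ge0 // sqr_sqrtr //.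
  pose J := undup (map fst K ++ map snd K).
  apply: le_trans (H J (undup_uniq _)).
  have -> : \sum_(s <- J) sqn J (fun t => A (s, t)) = sqn (allpairs pair J J) A.
    by rewrite /sqn big_allpairs_dep.
  apply: sqn_subset => // -[s t] stK; apply/allpairsP; exists (s, t).
  by rewrite !mem_undup !mem_cat (map_f fst stK) (map_f snd stK) orbT.
have tail (e : R) : 0 < e -> exists2 P, uniq P & opb (fun s t => A (s, t) - cutoff P A (s, t)) e.
  move=> e0; have [P uP /(_ P uP (fun _ h => h)) HP] := l2_tail l2A e0; exists P => //.
  have [_ h] := l2b_nrm (l2B l2A (l2_cutoff A uP)).
  apply: opb_HS => [|J K uJ uK]; first exact: ltW.
  apply: (@le_trans _ _ (nrm (fun t => A t - cutoff P A t) ^+ 2)); last first.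
    by rewrite ler_pXn2r ?nnegrE ?nrm_ge0 ?(ltW e0).
  have := h (allpairs pair J K); rewrite /sqn big_allpairs_dep; apply.
  by apply: allpairs_uniq => // -[? ?] [].
apply: capprox_lim => e e0; have [P uP HP] := tail e e0.
exists (cutoff P A) => //.
apply: (@capprox_fin _ (map fst P ++ map snd P) (nrm A)).
  apply: opb_HS => [|J K uJ uK]; first exact: nrm_ge0.
  have [_ h] := l2b_cutoff P (l2b_nrm l2A).
  have := h (allpairs pair J K); rewrite /sqn big_allpairs_dep; apply.
  by apply: allpairs_uniq => // -[? ?] [].
move=> s t; rewrite /cutoff; case: ifP => // stP.
by rewrite !mem_cat (map_f fst stP) (map_f snd stP) orbT.
Qed.

End Compact.

Section OrthonormalFamilies.
Context {R : realType} {T : choiceType}.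

(** [P] marks the indices that carry unit vectors; at the others the vector is 0. Operators of
    finite rank can thus be indexed by all of [nat]. *)
Definition orthofam (P : pred nat) (v : nat -> T -> R[i]) :=
  (forall k, l2 (v k)) /\ forall k l, ip (v k) (v l) = ((k == l) && P k)%:R.

(** By orthogonality the synthesis map, sending [x] to the combination of the [v k] with
    coefficients [x k], is contractive. Bessel's inequality is the transposed bound. *)
Lemma orthofam_bessel P v : orthofam P v -> opb (fun t k => v k t) 1.
Proof.
move=> [l2v Hv]; split=> // J K x uJ uK; rewrite expr1n mul1r.
pose w t := \sum_(k <- K) x k * v k t.
have l2w : l2 w by apply: l2_sum => k; exact: l2Z.
apply: (@le_trans _ _ (nrm w ^+ 2)).
  apply: le_trans (sqn_nrm l2w uJ); rewrite le_eqVlt; apply/orP; left; apply/eqP.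
  by apply: eq_bigr => t _; under eq_bigr do rewrite mulrC.
rewrite -lecR -(ip_nrm l2w) /w ip_suml //; last by move=> k; exact: l2Z.
rewrite real_complex_sum.
have -> : \sum_(k <- K) ip (fun t => x k * v k t) (fun t => \sum_(l <- K) x l * v l t) =
    \sum_(k <- K) real_complex R (cabs (x k) ^+ 2 * (P k)%:R).
  apply: eq_big_seq => k kK; rewrite ip_sumr; last 2 first.
  - by move=> l; exact: l2Z.
  - exact: l2Z.
  rewrite (bigD1_seq k) //= big1 ?addr0 => [|l lk].
    rewrite ipZl ?ipZr //; last exact: l2Z.
    rewrite Hv eqxx /= mulrA mul_conjc.
    by case: (P k); rewrite ?mulr1 ?mulr0 ?rmorph0.
  rewrite ipZl ?ipZr //; last exact: l2Z.
  by rewrite Hv eq_sym (negbTE lk) !mulr0.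
rewrite -!real_complex_sum lecR; apply: ler_sum => k _.
by case: (P k); rewrite ?mulr1 // mulr0 sqr_ge0.
Qed.

End OrthonormalFamilies.

Section SingularValues.
Context {R : realType} {T : choiceType}.
Implicit Types (A : T -> T -> R[i]).

Definition opn A : R := fine (opnorm (fun p : T * T => A p.1 p.2)).

Lemma opnE A c : opb A c -> opnorm (fun p : T * T => A p.1 p.2) = (opn A)%:E.
Proof.
move=> H; rewrite fineK // ge0_fin_numE ?opnorm_ge0 //.
by rewrite (@le_lt_trans _ _ c%:E) ?ltry //; apply/opnormP.
Qed.

Lemma opb_opn A c : opb A c -> opb A (opn A).
Proof. by move=> H; apply/(opnormP (fun p => A p.1 p.2)); rewrite (opnE H). Qed.

Lemma opn_le A c : opb A c -> opn A <= c.
Proof. by move=> H; rewrite -lee_fin -(opnE H); apply/opnormP. Qed.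

Lemma opn_ge0 A : 0 <= opn A.
Proof. by rewrite fine_ge0 ?opnorm_ge0. Qed.

Lemma opn_witness A c d : opb A c -> 0 <= d -> d < opn A ->
  exists2 x, l2b x 1 & d < nrm (ap A x).
Proof.
move=> HA d0 dA; apply: contrapT => /forall2NP H.
suff /opn_le : opb A d by rewrite leNgt dA.
apply: opb_of_l2 => // x _ Hx.
have l2x : l2 (ap A x) by apply: (l2_ap HA); exists 1.
have [//|/negP] := H x; rewrite -leNgt => h.
have [_ hb] := l2b_nrm l2x; split=> // J uJ; apply: (le_trans (hb J uJ)).
by rewrite ler_pXn2r ?nnegrE ?nrm_ge0.
Qed.

(* A maximising sequence [x] satisfies [A^* A x - s^2 x --> 0], so the
   compactness of [A] makes a subsequence converge in norm. *)
Lemma opn_attained A : seqcompact A -> 0 < opn A ->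
  exists v, [/\ l2 v, nrm v = 1 & nrm (ap A v) = opn A].
Proof.
move=> [[c HA0] Hc] s0; set s := opn A in s0 *; have HA : opb A s by exact: opb_opn HA0.
have HB := opb_adj HA.
have wit (n : nat) : exists x, l2b x 1 /\ s - s / n.+1%:R < nrm (ap A x).
  have h1 : 0 <= s - s / n.+1%:R.
    by rewrite subr_ge0 ler_pdivrMr // ler_peMr ?(ltW s0) // ler1n.
  have h2 : s - s / n.+1%:R < s by rewrite ltrBlDr ltrDl divr_gt0.
  by have [x Hx hx] := opn_witness HA0 h1 h2; exists x.
have [x Hx] := choice wit.
have [phi [y [hphi l2y Hy]]] := Hc x (fun n => (Hx n).1).
have l2x n : l2 (x n) by exists 1; exact: (Hx n).1.
have nx n : nrm (x n) <= 1 by apply: nrm_le; exact: (Hx n).1.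
(* The only candidate for the limit: [A x] tends to [y] along [phi] and the adjoint of [A] sends
   [A x] nearly to [s^2 x]. *)
pose w t := real_complex R (s ^- 2) * ap (adj A) y t.
have l2w : l2 w by apply: l2Z; exact: l2_ap HB l2y.
have phin n : (n <= phi n)%N.
  by elim: n => // n IH; apply: (leq_ltn_trans IH); exact: hphi.
(* Expanding the square, the first term is at most [s^2 |A x|^2] and the second at most [s^4], while
   the cross term equals [-2 s^2 |A x|^2]. *)
have key n : nrm (fun t => ap (adj A) (ap A (x n)) t - real_complex R (s ^+ 2) * x n t) ^+ 2
    <= s ^+ 2 * (s ^+ 2 - nrm (ap A (x n)) ^+ 2).
  have lA := l2_ap HA (l2x n); have lB := l2_ap HB lA.
  rewrite nrm_sqrB //; last exact: l2Z.
  rewrite nrmZ // cabs_real ger0_norm ?sqr_ge0 // ipZr // conjc_real.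
  have -> : ip (ap (adj A) (ap A (x n))) (x n) = real_complex R (nrm (ap A (x n)) ^+ 2).
    by rewrite ipC // -(ip_ap_adj HA) // ip_nrm // conjc_real.
  rewrite -rmorphM /=.
  have h1 : nrm (ap (adj A) (ap A (x n))) ^+ 2 <= s ^+ 2 * nrm (ap A (x n)) ^+ 2.
    by rewrite -exprMn ler_pXn2r ?nnegrE ?mulr_ge0 ?nrm_ge0 ?(ltW s0) // (nrm_ap HB).
  have h2 : (s ^+ 2 * nrm (x n)) ^+ 2 <= s ^+ 2 * s ^+ 2.
    rewrite -expr2 ler_pXn2r ?nnegrE ?mulr_ge0 ?nrm_ge0 ?(ltW s0) //.
    by rewrite -[leRHS]mulr1 ler_wpM2l ?sqr_ge0.
  set a := nrm _ ^+ 2 in h1 *; set b := nrm (ap A _) ^+ 2 in h1 *.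
  move: h1 h2; set d := s ^+ 2; set f := (_ * nrm (x n)) ^+ 2 => h1 h2.
  have -> : d * b *+ 2 = d * b + d * b by rewrite mulr2n.
  rewrite mulrBr; lra.
have key2 n : nrm (fun t => ap (adj A) (ap A (x n)) t - real_complex R (s ^+ 2) * x n t) ^+ 2
    <= s ^+ 4 * 2 / n.+1%:R.
  apply: (le_trans (key n)); have [_ h] := Hx n.
  have n1 : (1 : R) <= n.+1%:R by rewrite ler1n.
  have n0 : (0 : R) < n.+1%:R by rewrite ltr0n.
  set q : R := n.+1%:R^-1; have q0 : 0 < q by rewrite invr_gt0.
  have q1 : q <= 1 by rewrite invf_le1.
  rewrite -/q in h *; set b := nrm _ in h *.
  have h3 : (s - s * q) ^+ 2 <= b ^+ 2.
    rewrite ler_pXn2r ?nnegrE ?nrm_ge0 ?(ltW h) // subr_ge0 ler_piMr ?(ltW s0) //.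
  have -> : s ^+ 4 * 2 * q = s ^+ 2 * (s ^+ 2 * 2 * q) by ring.
  rewrite ler_wpM2l ?sqr_ge0 //.
  have : (s - s * q) ^+ 2 = s ^+ 2 - s ^+ 2 * 2 * q + s ^+ 2 * q ^+ 2 by ring.
  have : 0 <= s ^+ 2 * q ^+ 2 by rewrite mulr_ge0 ?sqr_ge0.
  lra.
have s2 : s ^+ 2 != 0 by rewrite expf_neq0 // gt_eqF.
have conv (e : R) : 0 < e -> exists2 k, nrm (fun t => x k t - w t) <= e &
    s - e < nrm (ap A (x k)).
  move=> e0.
  have d0 : 0 < e * s / 2 by rewrite !(mulr_gt0, divr_gt0).
  have [N HN] := Hy _ d0.
  pose m := (e * s ^+ 2 / 2) ^+ 2 / (s ^+ 4 * 2).
  have q0 : 0 < e * s ^+ 2 / 2 by apply: divr_gt0 => //; apply: mulr_gt0 => //; exact: exprn_gt0.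
  have m0 : 0 < m.
    by apply: divr_gt0; [exact: exprn_gt0|apply: mulr_gt0 => //; exact: exprn_gt0].
  pose k := maxn N (maxn (Num.truncn m^-1) (Num.truncn (e / s)^-1)).
  have kN : (N <= k)%N by rewrite leq_maxl.
  have inv_small (a : R) : 0 < a -> (Num.truncn a^-1 <= k)%N -> (phi k).+1%:R^-1 < a.
    move=> a0 ak; rewrite invf_plt ?posrE //; apply: (lt_le_trans (truncnS_gt _)).
    by rewrite ler_nat ltnS (leq_trans ak).
  have h1 : nrm (fun t => ap (adj A) (ap A (x (phi k))) t - real_complex R (s ^+ 2) * x (phi k) t)
      <= e * s ^+ 2 / 2.
    rewrite -(@ler_pXn2r _ 2) ?nnegrE ?nrm_ge0 ?(ltW q0) //.
    apply: (le_trans (key2 _)); rewrite -ler_pdivlMl; last by rewrite mulr_gt0 ?exprn_gt0.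
    rewrite mulrC; apply: ltW; apply: inv_small => //.
    by rewrite /k !leq_max leqnn orbT.
  have h2 : nrm (fun t => ap (adj A) (ap A (x (phi k))) t - ap (adj A) y t) <= s * (e * s / 2).
    have lA := l2_ap HA (l2x (phi k)).
    rewrite -(apB HB) //; apply: le_trans (nrm_ap HB (l2B lA l2y)) _.
    by rewrite ler_wpM2l ?(ltW s0) //; apply: nrm_le; exact: HN.
  exists (phi k).
    have lA := l2_ap HA (l2x (phi k)); have lB := l2_ap HB lA; have lY := l2_ap HB l2y.
    have lx2 : l2 (fun t => real_complex R (s ^+ 2) * x (phi k) t) by exact: l2Z.
    have -> : (fun t => x (phi k) t - w t) = (fun t => real_complex R (s ^- 2) *
        ((ap (adj A) (ap A (x (phi k))) t - ap (adj A) y t) +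
         (-1) * (ap (adj A) (ap A (x (phi k))) t - real_complex R (s ^+ 2) * x (phi k) t))).
      apply/funext => t; rewrite /w; set a1 := ap (adj A) (ap A _) t.
      set a2 := ap (adj A) y t.
      have E : real_complex R (s ^- 2) * real_complex R (s ^+ 2) = 1.
        by rewrite -rmorphM /= mulVf // rmorph1.
      rewrite [RHS](_ : _ = real_complex R (s ^- 2) * real_complex R (s ^+ 2) * x (phi k) t -
        real_complex R (s ^- 2) * a2); last by ring.
      by rewrite E mul1r.
    rewrite nrmZ; last by apply: l2D; [exact: l2B|apply: l2Z; exact: l2B].
    rewrite cabs_real ger0_norm ?invr_ge0 ?sqr_ge0 // mulrC ler_pdivrMr ?exprn_gt0 //.
    apply: (le_trans (nrmD (l2B lB lY) (l2Z (-1) (l2B lB lx2)))).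
    rewrite nrmZ; last exact: l2B.
    rewrite cabsN cabs1 mul1r.
    have -> : e * s ^+ 2 = s * (e * s / 2) + e * s ^+ 2 / 2 by field.
    exact: lerD.
  apply: le_lt_trans (Hx (phi k)).2; rewrite lerD2l lerN2.
  rewrite mulrC -ler_pdivlMr //; apply: ltW; apply: inv_small; first exact: divr_gt0.
  by rewrite /k !leq_max leqnn !orbT.
have nw1 : nrm w <= 1.
  apply: (@ler_addgt0_mul _ _ _ 1) => // e e0; have [k h _] := conv e e0.
  have := nrmD (l2B l2w (l2x k)) (l2x k); rewrite nrmBC.
  under [X in nrm X <= _]eq_fun do rewrite subrK.
  have := nx k; lra.
have nAw : s <= nrm (ap A w).
  have k0 : 0 <= 1 + s by rewrite addr_ge0 ?(ltW s0).
  apply: (ler_addgt0_mul k0) => e e0.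
  have [k h1 h2] := conv e e0.
  have lA := l2_ap HA (l2x k); have lw := l2_ap HA l2w.
  have := nrmD (l2B lA lw) lw; under [X in nrm X <= _]eq_fun do rewrite subrK.
  have := nrm_ap HA (l2B (l2x k) l2w); rewrite (apB HA) //.
  have : s * nrm (fun t => x k t - w t) <= s * e by rewrite ler_wpM2l ?(ltW s0).
  lra.
have nAw2 := nrm_ap HA l2w.
exists w; split=> //.
  apply/eqP; rewrite eq_le nw1 /= -(ler_pM2l s0) mulr1; exact: le_trans nAw nAw2.
apply/eqP; rewrite eq_le nAw andbT; apply: (le_trans nAw2).
by rewrite -[leRHS]mulr1 ler_wpM2l ?(ltW s0).
Qed.

Definition deflate A (s : R) (u v : T -> R[i]) : T -> T -> R[i] :=
  fun a b => A a b - real_complex R s * u a * conjc (v b).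

Lemma ap_deflate A c s u v x : opb A c -> l2 u -> l2 v -> l2 x ->
  ap (deflate A s u v) x = fun t => ap A x t - real_complex R s * u t * ip x v.
Proof.
move=> HA lu lv lx; apply/funext => t; apply: csumE.
apply: eq_has_sum (has_sumD (ap_has_sum t HA lx)
  (has_sumN (has_sumZ (real_complex R s * u t) (ip_has_sum lx lv)))) => a.
by rewrite /deflate; ring.
Qed.

Lemma adj_deflate A s u v : adj (deflate A s u v) = deflate (adj A) s v u.
Proof.
have E (x y : R[i]) : conjc (real_complex R s * x * conjc y) = real_complex R s * y * conjc x.
  case: x => x1 x2; case: y => y1 y2; simpc; congr (_ +i* _)%C; ring.
by apply/funext => a; apply/funext => b; rewrite /adj /deflate rmorphB /= E.
Qed.

(** * Singular value decomposition by deflation *)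

(** Let [v] be a maximizing unit vector and [u = A v / s]. Maximality forces the adjoint to send [u]
    back to [s v], so removing the rank one term is the same as composing [A] with the projection
    onto the complement of [v]; this preserves compactness and the bound [s]. For [s = 0] zero
    vectors are returned, so that the step can be iterated indefinitely. *)
Lemma svd_step A : seqcompact A -> exists uv : (T -> R[i]) * (T -> R[i]),
  let s := opn A in let A' := deflate A s uv.1 uv.2 in
  [/\ l2 uv.1 /\ l2 uv.2, seqcompact A' /\ opb A' s,
     (ip uv.1 uv.1 = (s != 0)%:R /\ ip uv.2 uv.2 = (s != 0)%:R) /\
     (s = 0 -> (forall t, uv.1 t = 0) /\ (forall t, uv.2 t = 0)),
     ap A uv.2 = (fun t => real_complex R s * uv.1 t) /\
     ap (adj A) uv.1 = (fun t => real_complex R s * uv.2 t) &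
     ap A' uv.2 = (fun=> 0) /\ ap (adj A') uv.1 = (fun=> 0)].
Proof.
move=> cA; have [[c HA0] Hc] := cA; set s := opn A; have HA : opb A s := opb_opn HA0.
have HB := opb_adj HA.
have z2 : l2 (fun _ : T => 0 : R[i]) by exists 0; exact: l2b0.
have apz (B : T -> T -> R[i]) : ap B (fun=> 0) = (fun=> 0).
  apply/funext => t; by apply: csum_eq0 => t0; rewrite mulr0.
have ipz : ip (fun _ : T => 0 : R[i]) (fun=> 0) = 0.
  by rewrite (@ip_nrm _ _ (fun=> 0)) // (_ : nrm _ = 0) ?expr0n //;
    apply/eqP; rewrite eq_le nrm_ge0 nrm_le //; exact: l2b0.
have [s0|s0] := eqVneq s 0.
  exists (fun=> 0, fun=> 0) => /=; rewrite -/s s0 eqxx /=.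
  have -> : deflate A 0 (fun=> 0) (fun=> 0) = A.
    by apply/funext => a; apply/funext => b; rewrite /deflate mulr0 mul0r subr0.
  rewrite !apz ipz -s0; split=> //; split=> //; apply/funext => t; by rewrite mulr0.
have sp : 0 < s by rewrite lt_neqAle eq_sym s0 opn_ge0.
have [v [lv nv nAv]] := opn_attained cA sp.
pose u t := real_complex R s^-1 * ap A v t.
have lAv := l2_ap HA lv; have lBv := l2_ap HB lAv.
have lu : l2 u by exact: l2Z.
have rs z : real_complex R s * (real_complex R s^-1 * z) = z.
  by rewrite mulrA -rmorphM /= divff // rmorph1 mul1r.
have Av : ap A v = (fun t => real_complex R s * u t).
  by apply/funext => t; rewrite /u rs.
have Bu : ap (adj A) u = (fun t => real_complex R s * v t).
  have E : nrm (fun t => ap (adj A) (ap A v) t - real_complex R (s ^+ 2) * v t) = 0.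
    apply/eqP; rewrite -sqrf_eq0 eq_le sqr_ge0 andbT.
    rewrite nrm_sqrB //; last exact: l2Z.
    rewrite nrmZ // cabs_real ger0_norm ?sqr_ge0 // ipZr // conjc_real.
    have -> : ip (ap (adj A) (ap A v)) v = real_complex R (nrm (ap A v) ^+ 2).
      by rewrite ipC // -(ip_ap_adj HA) // ip_nrm // conjc_real.
    rewrite -rmorphM /= nv nAv -/s.
    have : nrm (ap (adj A) (ap A v)) <= s * s by have := nrm_ap HB lAv; rewrite nAv.
    rewrite -(@ler_pXn2r _ 2) ?nnegrE ?nrm_ge0 ?mulr_ge0 ?(ltW sp) // => h.
    have -> : s ^+ 2 * s ^+ 2 *+ 2 = (s * s) ^+ 2 + (s * s) ^+ 2 by ring.
    have -> : (s ^+ 2 * 1) ^+ 2 = (s * s) ^+ 2 by ring.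
    lra.
  have Z := nrm_eq0 (l2B lBv (l2Z _ lv)) E.
  rewrite /u (apZ _ HB) //; apply/funext => t.
  have /eqP := Z t; rewrite subr_eq0 => /eqP ->.
  by rewrite mulrA -rmorphM /= expr2 mulrA mulVf // mul1r.
have nu : nrm u = 1.
  rewrite nrmZ // nAv cabs_real ger0_norm ?invr_ge0 ?(ltW sp) //.
  by rewrite mulVf.
have ipu : ip u u = 1 by rewrite ip_nrm // nu expr1n.
have ipv : ip v v = 1 by rewrite ip_nrm // nv expr1n.
have dA x : l2 x -> ap (deflate A s u v) x = ap A (fun t => x t - ip x v * v t).
  move=> lx; rewrite (ap_deflate _ HA) // (apB HA) ?(apZ _ HA) //; last exact: l2Z.
  by rewrite Av; apply/funext => t; ring.
have proj x d : l2b x d -> l2b (fun t => x t - ip x v * v t) d.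
  move=> Hx; have d0 : 0 <= d by case: Hx.
  have lx : l2 x by exists d.
  suff h : nrm (fun t => x t - ip x v * v t) <= d.
    have [_ hb] := l2b_nrm (l2B lx (l2Z (ip x v) lv)).
    split=> // J uJ; apply: (le_trans (hb J uJ)).
    by rewrite ler_pXn2r ?nnegrE ?nrm_ge0.
  rewrite -(@ler_pXn2r _ 2) ?nnegrE ?nrm_ge0 // nrm_sqrB //; last exact: l2Z.
  rewrite nrmZ // ipZr // nv mulr1 mulrC mul_conjc /=.
  have h2 : nrm x ^+ 2 <= d ^+ 2 by rewrite ler_pXn2r ?nnegrE ?nrm_ge0 // nrm_le.
  have := sqr_ge0 (cabs (ip x v)); lra.
have bA' : opb (deflate A s u v) s.
  apply: opb_of_l2 => [|x _ Hx]; first exact: ltW.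
  rewrite dA; last by exists 1.
  by rewrite -[s]mulr1; apply: l2b_ap HA _; exact: proj.
exists (u, v) => /=; rewrite -/s s0; split=> //.
- split=> //; split; first by exists s.
  move=> x Hx; have [k|phi [y [h1 h2 h3]]] := Hc (fun k t => x k t - ip (x k) v * v t).
    exact: proj.
  exists phi, y; split=> // e /h3[N HN]; exists N => k /HN.
  by rewrite dA //; exists 1; exact: Hx.
- by split=> // /eqP; rewrite (negbTE s0).
split.
  rewrite dA // ipv (_ : (fun t => v t - 1 * v t) = fun=> 0) ?apz //.
  by apply/funext => t; rewrite mul1r subrr.
rewrite adj_deflate (ap_deflate _ HB) // Bu ipu; apply/funext => t; ring.
Qed.

(** [sv_rem] and [sv_cvg] together give convergence of the expansion in operator norm. Vanishing
    singular values come with zero vectors, as recorded in the two [orthofam] fields. *)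
Record svd A := Svd {
  sv : nat -> R; su : nat -> T -> R[i]; sw : nat -> T -> R[i];
  sv_ge0 : forall k, 0 <= sv k;
  su_ortho : orthofam (fun k => sv k != 0) su;
  sw_ortho : orthofam (fun k => sv k != 0) sw;
  sv_ap : forall k, ap A (sw k) = (fun t => real_complex R (sv k) * su k t);
  sv_rem : forall n, opb (fun a b => A a b -
     \sum_(k < n) real_complex R (sv k) * su k a * conjc (sw k b)) (sv n);
  sv_cvg : forall e : R, 0 < e -> exists N, forall k, (N <= k)%N -> sv k <= e
}.

(** [svd_step] is iterated on the subtype of compact operators. The singular vectors are orthogonal
    because every deflated operator, and its adjoint, annihilates all the vectors removed before. *)
Lemma svd_exists A : seqcompact A -> inhabited (svd A).
Proof.
move=> cA.
have [g Hg] := @choice _ _ (fun (B : {B : T -> T -> R[i] | seqcompact B}) uv =>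
  let s := opn (sval B) in let A' := deflate (sval B) s uv.1 uv.2 in
  [/\ l2 uv.1 /\ l2 uv.2, seqcompact A' /\ opb A' s,
     (ip uv.1 uv.1 = (s != 0)%:R /\ ip uv.2 uv.2 = (s != 0)%:R) /\
     (s = 0 -> (forall t, uv.1 t = 0) /\ (forall t, uv.2 t = 0)),
     ap (sval B) uv.2 = (fun t => real_complex R s * uv.1 t) /\
     ap (adj (sval B)) uv.1 = (fun t => real_complex R s * uv.2 t) &
     ap A' uv.2 = (fun=> 0) /\ ap (adj A') uv.1 = (fun=> 0)])
  (fun B => svd_step (svalP B)).
have cD (B : {B : T -> T -> R[i] | seqcompact B}) :
    seqcompact (deflate (sval B) (opn (sval B)) (g B).1 (g B).2).
  by have [_ [h _] _ _ _] := Hg B.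
have [As [As0 AsS']] : exists As : nat -> {B : T -> T -> R[i] | seqcompact B},
    sval (As 0%N) = A /\ forall n, sval (As n.+1) =
    deflate (sval (As n)) (opn (sval (As n))) (g (As n)).1 (g (As n)).2.
  by exists (fix F n := if n is n'.+1 then exist _ _ (cD (F n')) else exist _ _ cA).
pose s n := opn (sval (As n)); pose u n := (g (As n)).1; pose v n := (g (As n)).2.
have lu n : l2 (u n) by have [[] ] := Hg (As n).
have lv n : l2 (v n) by have [[] ] := Hg (As n).
have AsS n : sval (As n.+1) = deflate (sval (As n)) (s n) (u n) (v n) by exact: AsS'.
have bA n : opb (sval (As n)) (s n).
  by have [[c h] _] := svalP (As n); exact: opb_opn h.
have bB n := opb_adj (bA n).
have s_ge0 n : 0 <= s n by exact: opn_ge0.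
have Av n : ap (sval (As n)) (v n) = (fun t => real_complex R (s n) * u n t).
  by have [_ _ _ []] := Hg (As n).
have Bu n : ap (adj (sval (As n))) (u n) = (fun t => real_complex R (s n) * v n t).
  by have [_ _ _ []] := Hg (As n).
have s0 n : s n = 0 -> u n = (fun=> 0) /\ v n = (fun=> 0).
  have [_ _ [_ h] _ _] := Hg (As n).
  by move=> /h [h1 h2]; split; apply/funext.
have smono m n : (m <= n)%N -> s n <= s m.
  move=> /subnK <-; elim: (n - m)%N => [|k IH]; first by rewrite add0n.
  rewrite addSn; move: (k + m)%N IH => j IH; apply: (le_trans _ IH).
  rewrite [in leLHS]/s AsS; apply: (opn_le (c := s j)); by have [_ [_ h] _ _ _] := Hg (As j).
(* Induction on [n]: once an operator annihilates [v m], the next singular pair is orthogonal to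
   [v m] as soon as its singular value is nonzero, so one more deflation changes nothing on
   [v m]. *)
have kill m n : (m < n)%N -> ap (sval (As n)) (v m) = (fun=> 0) /\
    ap (adj (sval (As n))) (u m) = (fun=> 0).
  move=> /subnK <-; elim: (n - m.+1)%N => [|k [IH1 IH2]].
    by rewrite add0n AsS; have [_ _ _ _ h] := Hg (As m).
  rewrite addSn AsS; move: (k + m.+1)%N IH1 IH2 => j IH1 IH2.
  have e1 : real_complex R (s j) * ip (v m) (v j) = 0.
    have := ip_ap_adj (bA j) (lv m) (lu j); rewrite IH1 Bu ipZr // conjc_real => <-.
    by apply: csum_eq0 => t0; rewrite mul0r.
  have e2 : real_complex R (s j) * ip (u m) (u j) = 0.
    have := ip_ap_adj (bB j) (lu m) (lv j); rewrite IH2.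
    have -> : adj (adj (sval (As j))) = sval (As j).
      by apply/funext => a; apply/funext => b; rewrite /adj conjcK.
    rewrite Av ipZr // conjc_real => <-.
    by apply: csum_eq0 => t0; rewrite mul0r.
  rewrite (ap_deflate _ (bA j)) // adj_deflate (ap_deflate _ (bB j)) // IH1 IH2.
  by split; apply/funext => t; rewrite mulrAC (e1, e2) mul0r subrr.
have ortho n m : (m < n)%N -> ip (v n) (v m) = 0 /\ ip (u n) (u m) = 0.
  move=> mn; have [k1 k2] := kill _ _ mn.
  have z (x : T -> R[i]) : ip x (fun=> 0) = 0.
    by apply: csum_eq0 => t0; rewrite conjc0 mulr0.
  have [/s0[-> ->]|sn] := eqVneq (s n) 0.
    have zl (x : T -> R[i]) : ip (fun=> 0) x = 0.
      by apply: csum_eq0 => t0; rewrite mul0r.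
    by rewrite !zl.
  split.
    have := ip_ap_adj (bB n) (lu n) (lv m).
    have -> : adj (adj (sval (As n))) = sval (As n).
      by apply/funext => a; apply/funext => b; rewrite /adj conjcK.
    rewrite k1 z Bu ipZl // => /eqP; rewrite mulf_eq0 => /orP[/eqP|/eqP//].
    by move=> /(congr1 (@complex.Re R)) /= sn0; rewrite sn0 eqxx in sn.
  have := ip_ap_adj (bA n) (lv n) (lu m).
  rewrite k2 z Av ipZl // => /eqP; rewrite mulf_eq0 => /orP[/eqP|/eqP//].
  by move=> /(congr1 (@complex.Re R)) /= sn0; rewrite sn0 eqxx in sn.
have ofv : orthofam (fun k => s k != 0) v.
  split=> // k l; case: (ltngtP k l) => [kl|lk|<-] /=.
  - by rewrite ipC // (ortho _ _ kl).1 conjc0.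
  - by rewrite (ortho _ _ lk).1.
  - by have [_ _ [[_ ->]]] := Hg (As k).
have ofu : orthofam (fun k => s k != 0) u.
  split=> // k l; case: (ltngtP k l) => [kl|lk|<-] /=.
  - by rewrite ipC // (ortho _ _ kl).2 conjc0.
  - by rewrite (ortho _ _ lk).2.
  - by have [_ _ [[->]]] := Hg (As k).
have AsE n : sval (As n) = (fun a b => A a b -
     \sum_(k < n) real_complex R (s k) * u k a * conjc (v k b)).
  elim: n => [|n IH]; apply/funext => a; apply/funext => b.
    by rewrite big_ord0 subr0 As0.
  by rewrite AsS /deflate {1}IH big_ord_recr opprD addrA.
have [[c HA] Hc] := cA.
have Avn n : ap A (v n) = (fun t => real_complex R (s n) * u n t).
  rewrite -Av AsE; apply/funext => t.
  have hs : has_sum (fun b => (A t b - \sum_(k < n) real_complex R (s k) * u k t *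
      conjc (v k b)) * v n b) (ap A (v n) t - 0).
    have h0 : has_sum (fun b => \sum_(k < n) real_complex R (s k) * u k t *
        (v n b * conjc (v k b))) 0.
      rewrite -[X in has_sum _ X](_ :
          \sum_(k < n) real_complex R (s k) * u k t * ip (v n) (v k) = 0); last first.
        by rewrite big1 // => k _; rewrite (ortho _ _ (ltn_ord k)).1 mulr0.
      apply: (@has_sum_sum _ _ _ _
        (fun (k : 'I_n) b => real_complex R (s k) * u k t * (v n b * conjc (v k b)))) => k.
      apply: has_sumZ; exact: ip_has_sum.
    apply: eq_has_sum (has_sumD (ap_has_sum t HA (lv n)) (has_sumN h0)) => b.
    rewrite mulrBl mulr_suml; congr (_ - _); apply: eq_bigr => k _; ring.
  by rewrite /ap (csumE hs) subr0.
constructor; apply: (@Svd A s u v) => // [n|e e0].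
  by rewrite -AsE.
(* If all singular values exceeded [e], the vectors [A (v n)] would be orthogonal of norm more than
   [e], hence more than [e] apart, against sequential compactness. *)
apply: contrapT => /forallNP H.
have big k : e < s k.
  rewrite ltNge; apply/negP => sk; apply: (H k) => j kj; exact: le_trans (smono _ _ kj) sk.
have nz k : s k != 0 by rewrite gt_eqF // (lt_trans e0).
have [k|phi [y [hphi ly Hy]]] := Hc v.
  have := l2b_nrm (lv k); suff -> : nrm (v k) = 1 by [].
  apply/eqP; rewrite -(@pexpr_eq1 _ _ 2) ?nrm_ge0 //; apply/eqP.
  have := ip_nrm (lv k); rewrite ofv.2 eqxx nz /=.
  by move=> /(congr1 (@complex.Re R)) /= <-.
have [N HN] := Hy _ (divr_gt0 e0 (ltr0Sn _ 1)).
have h := l2bD (HN N.+1 (leqnSn N)) (l2bZ (-1) (HN N (leqnn N))).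
rewrite cabsN cabs1 mul1r in h.
have {}h : nrm (fun t => ap A (v (phi N.+1)) t - ap A (v (phi N)) t) <= e.
  rewrite -splitr in h; apply: nrm_le; apply: l2b_ext h => t; ring.
have NN := hphi N N.+1 (ltnSn N).
move: (phi N.+1) (phi N) NN h => i j ij.
rewrite -(@ler_pXn2r _ 2) ?nnegrE ?nrm_ge0 ?(ltW e0) //.
have nu k : nrm (u k) = 1.
  apply/eqP; rewrite -(@pexpr_eq1 _ _ 2) ?nrm_ge0 //; apply/eqP.
  have := ip_nrm (lu k); rewrite ofu.2 eqxx nz /=.
  by move=> /(congr1 (@complex.Re R)) /= <-.
rewrite !Avn nrm_sqrB; try exact: l2Z.
rewrite ipZl ?ipZr //; last exact: l2Z.
rewrite (ortho _ _ ij).2 !mulr0 /= mul0rn subr0 !nrmZ // !nu !mulr1 !cabs_real.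
rewrite !ger0_norm //.
have h1 : e ^+ 2 < s i ^+ 2 by rewrite ltr_pXn2r ?nnegrE ?(ltW e0).
have h2 : 0 < s j ^+ 2 by rewrite exprn_gt0 // (lt_trans e0).
by move=> h3; move: (le_lt_trans h3 h1); rewrite gtrDl ltNge (ltW h2).
Qed.

End SingularValues.

(** * Diagonal series and Schatten classes *)

Section Diagonal.
Context {R : realType}.

Lemma opb_diag (S T : eqType) (d : S -> R[i]) (A : S -> T -> R[i]) (m c : R) : 0 <= m ->
  (forall s, cabs (d s) <= m) -> opb A c -> opb (fun s t => d s * A s t) (m * c).
Proof.
move=> m0 dm [c0 H]; split=> [|J K x uJ uK]; first exact: mulr_ge0.
apply: (@le_trans _ _ (m ^+ 2 * sqn J (fun s => \sum_(t <- K) A s t * x t))).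
  rewrite /sqn mulr_sumr; apply: ler_sum => s _; rewrite -exprMn.
  rewrite ler_pXn2r ?nnegrE ?mulr_ge0 ?cabs_ge0 //.
  under eq_bigr do rewrite -mulrA.
  by rewrite -mulr_sumr cabsM ler_wpM2r ?cabs_ge0.
by rewrite exprMn -[leRHS]mulrA ler_wpM2l ?sqr_ge0 ?H.
Qed.

Lemma opb_col (S T : eqType) (A : S -> T -> R[i]) c t : opb A c -> forall J, uniq J ->
  sqn J (A ^~ t) <= c ^+ 2.
Proof.
move=> [_ H] J uJ; have := H J [:: t] (fun=> 1) uJ isT.
rewrite /sqn big_seq1 cabs1 expr1n mulr1; congr (_ <= _).
by apply: eq_bigr => s _; rewrite big_seq1 mulr1.
Qed.

Lemma l2b_col (S T : choiceType) (A : S -> T -> R[i]) c t : opb A c -> l2b (A ^~ t) c.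
Proof. by move=> HA; split; [exact: opb_ge0 HA|exact: opb_col]. Qed.

Variables (T : choiceType).
Implicit Types (u v : nat -> T -> R[i]) (d : nat -> R[i]).

Lemma diag_abs u v d (m : R) i j J : opb u 1 -> opb v 1 -> 0 <= m ->
  (forall k, cabs (d k) <= m) -> uniq J ->
  \sum_(k <- J) cabs (d k * u k i * v k j) <= m.
Proof.
move=> Hu Hv m0 dm uJ; apply: (@le_trans _ _ (m * (1 * 1))); last by rewrite !mulr1.
apply: le_trans (ler_wpM2l m0 (sum_mul_le (l2b_col i Hu) (l2b_col j Hv) uJ)).
rewrite mulr_sumr; apply: ler_sum => k _; rewrite !cabsM -mulrA.
by rewrite ler_wpM2r ?mulr_ge0 ?cabs_ge0.
Qed.

Lemma diag_has_sum u v d (m : R) i j : opb u 1 -> opb v 1 -> 0 <= m ->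
  (forall k, cabs (d k) <= m) ->
  has_sum (fun k => d k * u k i * v k j) (csum (fun k => d k * u k i * v k j)).
Proof.
move=> Hu Hv m0 dm.
have [s Hs _] := has_sum_abs (fun J => diag_abs i j Hu Hv m0 dm (J := J)).
by rewrite (csumE Hs).
Qed.

(** A single finite list [N] of indices approximates all the entries of a given section; the partial
    sum over [N] factors through the diagonal matrix of [d] and the contractions [u] and [v]. *)
Lemma diag_opb u v d (m : R) (A : T -> T -> R[i]) : opb u 1 -> opb v 1 -> 0 <= m ->
  (forall k, cabs (d k) <= m) -> (forall i j, has_sum (fun k => d k * u k i * v k j) (A i j)) ->
  opb A m.
Proof.
move=> Hu Hv m0 dm HA; apply: opb_lim => // J K e e0.
have [N HN] : exists N : seq nat, uniq N /\ forall i j, i \in J -> j \in K ->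
    forall M, uniq M -> {subset N <= M} ->
    cabs (\sum_(k <- M) d k * u k i * v k j - A i j) <= e.
  elim: J => [|i J [N1 [uN1 IH]]]; first by exists [::].
  have [N2 [uN2 H2]] : exists N : seq nat, uniq N /\ forall j, j \in K ->
      forall M, uniq M -> {subset N <= M} ->
      cabs (\sum_(k <- M) d k * u k i * v k j - A i j) <= e.
    elim: K {IH} => [|j K [N3 [uN3 IH]]]; first by exists [::].
    have /has_sumP/(_ e e0)[N4 uN4 H4] := HA i j.
    have [uC C3 C4] := uniq_undup_cat N3 N4; exists (undup (N3 ++ N4)); split=> // j'.
    rewrite inE => /orP[/eqP ->|jK] M uM CM.
      by apply/ltW/H4 => // k kN; exact/CM/C4.
    by apply: IH => // k kN; exact/CM/C3.
  have [uC C1 C2] := uniq_undup_cat N1 N2; exists (undup (N1 ++ N2)); split=> // i' j.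
  rewrite inE => /orP[/eqP ->|iJ] jK M uM CM.
    by apply: H2 => // k kN; exact/CM/C2.
  by apply: IH => // k kN; exact/CM/C1.
have [uN hN] := HN; exists (fun i j => \sum_(k <- N) d k * u k i * v k j).
  have := opb_mul uN (opb_tr (opb_diag m0 dm Hu)) Hv; rewrite !mulr1.
  exact: eq_opb.
by move=> i j iJ jK; rewrite cabsBC; exact: hN.
Qed.

End Diagonal.

Section SchattenClass.
Context {R : realType} {T : choiceType}.

Lemma conj_real_conj (s : R) (x : R[i]) :
  conjc (real_complex R s * conjc x) = real_complex R s * x.
Proof. by case: x => a b; simpc; congr (_ +i* _)%C; ring. Qed.

(* A relaxed singular value decomposition: [u] and [v] need not be orthonormal. *)
Definition schmidt_data (p : R) (A : T * T -> R[i]) := exists (s : nat -> R)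
    (u v : nat -> T -> R[i]) (c : R), [/\ forall k, 0 <= s k, opb u 1, opb v 1,
    forall N, \sum_(k < N) s k `^ p <= c &
    forall i j, has_sum (fun k => real_complex R (s k) * u k i * v k j) (A (i, j))].

Lemma powR_le_inv (x c p : R) : 0 < p -> 0 <= x -> x `^ p <= c -> x <= c `^ p^-1.
Proof.
move=> p0 x0 xc; have -> : x = (x `^ p) `^ p^-1.
  by rewrite -powRrM divff ?gt_eqF // powRr1.
by apply: ge0_ler_powR; rewrite ?invr_ge0 ?(ltW p0) ?nnegrE ?powR_ge0 // (le_trans _ xc) ?powR_ge0.
Qed.

Lemma sum_bound_le (s : nat -> R) (p c : R) : 0 < p -> (forall k, 0 <= s k) ->
  (forall N, \sum_(k < N) s k `^ p <= c) -> forall k, s k <= c `^ p^-1.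
Proof.
move=> p0 s0 H k; apply: powR_le_inv => //; apply: le_trans (H k.+1).
by rewrite big_ord_recr /= lerDr; apply: sumr_ge0 => i _; exact: powR_ge0.
Qed.

Lemma orthofam_opb P (v : nat -> T -> R[i]) : orthofam P v -> opb v 1.
Proof. by move=> /orthofam_bessel/opb_tr. Qed.

(** The witness for the power is the series of [s_k^p w_k w_k^*], whose trace is at most the sum of
    the [s_k^p]. That the [s_k^2] and [w_k] give a spectral decomposition is seen by replacing [A]
    with its partial sum [F]: by orthogonality the product of [F] with its adjoint is the partial
    sum of that decomposition, and the error is of order [s N]. *)
Lemma svd_schatten (p c : R) (A : cfun R (T * T)%type) (D : svd (fun i j => A (i, j))) :
  0 < p -> compact_op A -> (forall N, \sum_(k < N) sv D k `^ p <= c) ->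
  schatten_class p A.
Proof.
move=> p0 cA Hc; split=> //.
have [a HA] : exists a, opb (fun i j => A (i, j)) a by apply/bounded_opP; case: cA.
have a0 := opb_ge0 HA.
set s := sv D in Hc *; set u := su D; set w := sw D.
have s0 k : 0 <= s k := sv_ge0 D k.
have sS := sum_bound_le p0 s0 Hc; set S := c `^ p^-1 in sS.
have S0 : 0 <= S by exact: powR_ge0.
have ou : orthofam (fun k => s k != 0) u := su_ortho D.
have ow : orthofam (fun k => s k != 0) w := sw_ortho D.
have bw := orthofam_opb ow.
have bwc : opb (fun k i => conjc (w k i)) 1 by exact: opb_conj.
have powE k : (s k ^+ 2) `^ (p / 2) = s k `^ p.
  by rewrite -powR_mulrn // -powRrM mulrCA divff ?mulr1 // pnatr_eq0.
have c0 : 0 <= c by have := Hc 0%N; rewrite big_ord0.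
have spc k : s k `^ p <= c.
  apply: le_trans (Hc k.+1); rewrite big_ord_recr /= lerDr.
  by apply: sumr_ge0 => i _; exact: powR_ge0.
have dB k : cabs (real_complex R ((s k ^+ 2) `^ (p / 2))) <= c.
  by rewrite powE cabs_real ger0_norm ?powR_ge0.
have HB i j := diag_has_sum i j bw bwc c0 dB.
exists (fun ij => csum (fun k => real_complex R ((s k ^+ 2) `^ (p / 2)) * w k ij.1 * conjc (w k ij.2))).
split; last first.
  rewrite (@le_lt_trans _ _ c%:E) ?ltry //; apply/esum_leP => J uJ; rewrite -Re_sum.
  apply: (le_trans (ler_norm _)); apply: (le_trans (le_Re_cabs _)).
  apply: (has_sum_le (has_sum_sum J (fun i => HB i i))) => K uK.
  apply: (@le_trans _ _ (\sum_(k <- K) s k `^ p)); last first.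
    by apply: sum_nat_le => // k; exact: powR_ge0.
  apply: (le_trans (cabs_sum _ _ _)); apply: ler_sum => k _.
  have -> : \sum_(i <- J) real_complex R ((s k ^+ 2) `^ (p / 2)) * w k i * conjc (w k i) =
      real_complex R (s k `^ p * sqn J (w k)).
    rewrite rmorphM /= /sqn real_complex_sum mulr_sumr; apply: eq_bigr => i _.
    by rewrite powE -mulrA mul_conjc.
  rewrite cabs_real ger0_norm ?mulr_ge0 ?powR_ge0 ?sqn_ge0 //.
  rewrite -[leRHS]mulr1 ler_wpM2l ?powR_ge0 //.
  by have [_ /(_ J uJ)] := opb_row k bw; rewrite expr1n.
exists (fun k => s k ^+ 2), w; split=> //.
- by move=> k; exact: sqr_ge0.
- move=> k l k0 l0; have [lw Hw] := ow.
  have := ip_has_sum (lw k) (lw l); rewrite Hw; move: k0; rewrite sqrf_eq0 => ->.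
  by rewrite andbT.
move=> i j.
have S20 : 0 <= S ^+ 2 by exact: sqr_ge0.
have dS k : cabs (real_complex R (s k ^+ 2)) <= S ^+ 2.
  by rewrite cabs_real ger0_norm ?sqr_ge0 // ler_pXn2r ?nnegrE.
apply: (has_sum_nat (c := S ^+ 2)) => [N|e e0].
  have := diag_abs i j bw bwc S20 dS (iota_uniq 0 N).
  by rewrite big_iota.
pose k0 := 2 * a + 2; have k0p : 0 < k0 by rewrite /k0; lra.
have m0 : 0 < Num.min 1 (e / k0) by rewrite lt_min ltr01 divr_gt0.
have [N0 HN0] := sv_cvg D m0; exists N0 => N NN.
have := HN0 N NN; rewrite -/s le_min => /andP[sN1 sNe].
have HE := sv_rem D N; rewrite -/s -/u -/w in HE.
pose F x y := \sum_(k < N) real_complex R (s k) * u k x * conjc (w k y).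
have HF : opb F (a + s N).
  by apply: (eq_opb _ (opb_sub HA HE)) => x y; rewrite opprB addrC subrK.
have lA y : l2b (fun x => A (x, y)) a := l2b_col y HA.
have lE y : l2b (fun x => A (x, y) - F x y) (s N) := l2b_col y HE.
have lF y : l2b (fun x => F x y) (a + s N) := l2b_col y HF.
have lA' y : l2 (fun x => A (x, y)) by exists a.
have lE' y : l2 (fun x => A (x, y) - F x y) by exists (s N).
have lF' y : l2 (fun x => F x y) by exists (a + s N).
have -> : mmul (madj A) A (i, j) = ip (fun x => A (x, j)) (fun x => A (x, i)).
  by rewrite /mmul /ip; congr csum; apply/funext => x; rewrite mulrC.
have -> : \sum_(k < N) real_complex R (s k ^+ 2) * w k i * conjc (w k j) =
    ip (fun x => F x j) (fun x => F x i).
  have [lu Hu] := ou.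
  have FE y : (fun x => F x y) = (fun x => \sum_(k < N) (real_complex R (s k) * conjc (w k y)) * u k x).
    by apply/funext => x; apply: eq_bigr => k _; rewrite mulrAC.
  rewrite !FE ip_suml => [|k|]; last 2 first.
  - exact: l2Z.
  - by apply: l2_sum => k; exact: l2Z.
  apply: eq_bigr => k _; rewrite ip_sumr => [|l|]; last 2 first.
  - exact: l2Z.
  - exact: l2Z.
  rewrite (bigD1 k) //= big1 ?addr0 => [|l lk]; last first.
    rewrite ipZl ?ipZr //; last exact: l2Z.
    by rewrite Hu eq_sym (negbTE (_ : l != k :> nat)) ?mulr0.
  rewrite ipZl ?ipZr //; last exact: l2Z.
  rewrite conj_real_conj Hu eqxx /=.
  have [->|sk] := eqVneq (s k) 0; first by rewrite expr0n !mul0r.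
  by rewrite mulr1 rmorphXn /= expr2; ring.
have -> : ip (fun x => F x j) (fun x => F x i) - ip (fun x => A (x, j)) (fun x => A (x, i)) =
    - (ip (fun x => A (x, j) - F x j) (fun x => A (x, i)) +
       ip (fun x => F x j) (fun x => A (x, i) - F x i)).
  by rewrite ipBl // ipBr //; ring.
rewrite cabsN; apply: (le_trans (cabsD _ _)).
have h1 := le_trans (ip_le (lE' j) (lA' i))
  (ler_pM (nrm_ge0 _) (nrm_ge0 _) (nrm_le (lE j)) (nrm_le (lA i))).
have h2 := le_trans (ip_le (lF' j) (lE' i))
  (ler_pM (nrm_ge0 _) (nrm_ge0 _) (nrm_le (lF j)) (nrm_le (lE i))).
have h3 : s N * k0 <= e by rewrite -ler_pdivlMr.
have h4 : (a + s N) * s N <= (a + 1) * s N by rewrite ler_wpM2r // lerD2l.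
move: h3; rewrite /k0 => h3.
have h5 : s N * a + (a + 1) * s N <= e by have := s0 N; nra.
lra.
Qed.

(** The polar decomposition in coordinates: from the eigenvectors of the product of [A] with its
    adjoint one takes [s_k = sqrt lam_k] and [u_k = A f_k / s_k]. The exponent [p / 2] of [lam_k]
    becomes [p] on [s_k]. *)
Lemma schatten_schmidt (p : R) (A : cfun R (T * T)%type) : 0 < p ->
  schatten_class p A -> schmidt_data p A.
Proof.
move=> p0 [cA [B [[lam [e [lam0 eo HA2 HB]]] trB]]].
have [a HA] : exists a, opb (fun i j => A (i, j)) a by apply/bounded_opP; case: cA.
have a0 := opb_ge0 HA; set q := p / 2 in HB; have q0 : 0 < q by rewrite divr_gt0.
have [c Hc] : exists c, forall J, uniq J -> \sum_(i <- J) complex.Re (B (i, i)) <= c.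
  case E : (\esum_(i in [set: T]) (complex.Re (B (i, i)))%:E)%E trB => [c||] // _.
    by exists c; apply/esum_leP; rewrite E.
  by exists 0; apply/esum_leP; rewrite E leNye.
(* [positive_power] says nothing about the [e k] with [lam k = 0]; replacing them by 0 gives an
   [orthofam]. *)
pose P k := lam k != 0; pose f k t := if lam k == 0 then 0 else e k t.
have fE k : P k -> f k = e k by rewrite /P => /negbTE h; apply/funext => t; rewrite /f h.
have f0 k : ~~ P k -> f k = (fun=> 0).
  by rewrite /P negbK => h; apply/funext => t; rewrite /f h.
have lf k : l2b (f k) 1.
  case: (boolP (P k)) => Pk; last first.
    rewrite f0 //; split=> // J uJ; have [_ /(_ J uJ)] := @l2b0 R T.
    by rewrite expr0n => /le_trans; apply; rewrite expr1n.
  rewrite fE //; split=> // J uJ; have := eo k k Pk Pk; rewrite eqxx => He.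
  have ge0 t : 0 <= complex.Re (e k t * conjc (e k t)) by rewrite mul_conjc /= sqr_ge0.
  have := has_sum_Re_le ge0 He uJ; rewrite /= expr1n; congr (_ <= _).
  by apply: eq_bigr => t _; rewrite mul_conjc.
have l2f k : l2 (f k) by exists 1.
have of_f : orthofam P f.
  split=> // k l; apply: csumE.
  case: (boolP (P k)) => Pk; last first.
    rewrite andbF f0 //; apply: has_sum_eq0 => t; by rewrite mul0r.
  case: (boolP (P l)) => Pl; last first.
    rewrite [f l]f0 //; have -> : (k == l) = false.
      by apply: contraNF Pl => /eqP <-.
    by apply: has_sum_eq0 => t; rewrite conjc0 mulr0.
  by rewrite !fE // andbT; exact: eo.
have bf := orthofam_opb of_f.
have lq0 k : ~~ P k -> lam k `^ q = 0.
  by rewrite /P negbK => /eqP ->; rewrite powR0 // gt_eqF.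
(* The trace bound gives the sum of the eigenvalues of [B]: on a finite set [J] that carries all but
   [d] of the squared norm of each of the first [N] eigenvectors, the diagonal of [B] already
   dominates nearly the whole sum. *)
have sumlam N : \sum_(k < N) lam k `^ q <= c.
  have ge0 : 0 <= \sum_(k < N) lam k `^ q by apply: sumr_ge0 => k _; exact: powR_ge0.
  apply: (ler_addgt0_mul ge0) => d d0.
  have [J uJ HJ] : exists2 J, uniq J & forall k, (k < N)%N -> P k -> 1 - d <= sqn J (f k).
    elim: N {ge0} => [|N [J uJ IH]]; first by exists [::].
    case: (boolP (P N)) => PN; last first.
      exists J => // k; rewrite ltnS leq_eqVlt => /orP[/eqP ->|/IH//].
      by rewrite (negbTE PN).
    have /has_sumP/(_ d d0)[J1 uJ1 HJ1] := eo N N PN PN.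
    have [uC C C1] := uniq_undup_cat J J1; exists (undup (J ++ J1)) => // k.
    rewrite ltnS leq_eqVlt => /orP[/eqP ->|kN] Pk; last first.
      exact: le_trans (IH k kN Pk) (sqn_subset _ uJ C).
    have := HJ1 _ uC C1; rewrite eqxx.
    rewrite (eq_bigr (fun t => real_complex R (cabs (f N t) ^+ 2))); last first.
      by move=> t _; rewrite mul_conjc fE.
    rewrite -real_complex_sum -(rmorph1 (real_complex R)) -(rmorphB (real_complex R)) cabs_real.
    by rewrite ltr_norml => /andP[]; rewrite -/(sqn _ _); lra.
  apply: (@le_trans _ _ (\sum_(k < N) lam k `^ q * (sqn J (f k) + d))).
    apply: ler_sum => k _; case: (boolP (P k)) => Pk; last by rewrite lq0 // mul0r.
    by rewrite -[leLHS]mulr1 ler_wpM2l ?powR_ge0 //; have := HJ k (ltn_ord k) Pk; lra.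
  under eq_bigr do rewrite mulrDr.
  rewrite big_split /= -mulr_suml lerD2r; apply: le_trans (Hc J uJ).
  have -> : \sum_(k < N) lam k `^ q * sqn J (f k) =
      \sum_(i <- J) \sum_(k <- iota 0 N) complex.Re
        (real_complex R (lam k `^ q) * e k i * conjc (e k i)).
    rewrite exchange_big /= big_iota.
    apply: eq_bigr => k _; rewrite /sqn mulr_sumr; apply: eq_bigr => i _.
    rewrite -mulrA mul_conjc -rmorphM /=.
    case: (boolP (P k)) => Pk; first by rewrite fE.
    by rewrite lq0 // !mul0r.
  apply: ler_sum => i _; apply: has_sum_Re_le (HB i i) (iota_uniq _ _) => k.
  by rewrite -mulrA mul_conjc -rmorphM /= mulr_ge0 ?powR_ge0 ?sqr_ge0.
have lamM := sum_bound_le q0 lam0 sumlam; set M := c `^ q^-1 in lamM.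
have M0 : 0 <= M by exact: powR_ge0.
pose V k t := conjc (f k t); pose DV k t := real_complex R (lam k) * V k t.
have HV : opb V 1 by exact: opb_conj.
have HDV : opb DV M.
  rewrite -[M]mulr1; apply: opb_diag => // k; by rewrite cabs_real ger0_norm.
pose m := Num.max (Num.max a M) 1.
have ma : a <= m by rewrite !le_max lexx.
have mM : M <= m by rewrite !le_max lexx orbT.
have m1 : 1 <= m by rewrite le_max lexx orbT.
(* The operator product is recovered from its matrix entries as a form, which avoids any composition
   of infinite matrices. *)
have form x y : l2 x -> l2 y -> ip (ap (fun i j => A (i, j)) x) (ap (fun i j => A (i, j)) y) =
    ip (ap DV x) (ap V y).
  apply: (ip_ap_ext (opb_le ma HA) (opb_le ma HA) (opb_le mM HDV) (opb_le m1 HV)) => j i.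
  have -> : ip (ap DV (delta j)) (ap V (delta i)) = mmul (madj A) A (i, j).
    apply: csumE; apply: eq_has_sum (HA2 i j) => k; rewrite !ap_delta /DV /V conjcK.
    case: (boolP (P k)) => Pk; first by rewrite fE // mulrAC.
    by have := Pk; rewrite negbK => /eqP ->; rewrite !mul0r.
  by rewrite /ip /mmul; congr csum; apply/funext => k; rewrite !ap_delta mulrC.
have Vf k : P k -> ap V (f k) = delta k.
  move=> Pk; apply/funext => l.
  have -> : ap V (f k) l = ip (f k) (f l).
    by rewrite /ap /ip; congr csum; apply/funext => t; rewrite mulrC.
  by rewrite of_f.2 Pk andbT eq_sym.
have DVap x k : l2 x -> ap DV x k = real_complex R (lam k) * ap V x k.
  move=> lx; apply: csumE; apply: eq_has_sum (has_sumZ _ (ap_has_sum k HV lx)) => t.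
  by rewrite mulrA.
pose s k := Num.sqrt (lam k).
have s2 k : s k ^+ 2 = lam k by rewrite sqr_sqrtr.
have s0 k : P k -> s k != 0 by rewrite /P -s2 sqrf_eq0.
pose u k i := real_complex R (s k)^-1 * ap (fun i j => A (i, j)) (f k) i.
have lAf k : l2 (ap (fun i j => A (i, j)) (f k)) := l2_ap HA (l2f k).
have apz k : ~~ P k -> ap (fun i j => A (i, j)) (f k) = fun=> 0.
  move=> Pk; rewrite f0 //; apply/funext => t; by apply: csum_eq0 => t0; rewrite mulr0.
have su k i : real_complex R (s k) * u k i = ap (fun i j => A (i, j)) (f k) i.
  rewrite /u; case: (boolP (P k)) => Pk; last by rewrite apz // !mulr0.
  by rewrite mulrA -rmorphM /= divff ?s0 // rmorph1 mul1r.
have of_u : orthofam P u.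
  split=> [k|k l]; first exact: l2Z.
  rewrite ipZl ?ipZr //; last exact: l2Z.
  rewrite conjc_real form //.
  have [/eqP Pk|Pk] := boolP (lam k == 0).
    have -> : P k = false by rewrite /P Pk eqxx.
    have -> : ap DV (f k) = fun=> 0.
      apply/funext => t; rewrite DVap // f0 /P ?Pk ?eqxx //.
      by rewrite (_ : ap V _ t = 0) ?mulr0 //; apply: csum_eq0 => t0; rewrite mulr0.
    rewrite andbF (_ : ip _ _ = 0) ?mulr0 //; by apply: csum_eq0 => t0; rewrite mul0r.
  have {}Pk : P k by exact: Pk.
  rewrite Pk andbT.
  have DVf : ap DV (f k) = fun t => real_complex R (lam k) * delta k t.
    apply/funext => t; rewrite DVap // Vf // /delta; case: eqVneq => [->//|_].
    by rewrite !mulr0.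
  rewrite DVf ipZl; [|exact: l2_delta|exact: l2_ap HV (l2f l)].
  case: (boolP (P l)) => Pl; last first.
    have kl : (k == l) = false by apply: contraNF Pl => /eqP <-.
    have -> : ap V (f l) = fun=> 0.
      apply/funext => t; rewrite f0 //; by apply: csum_eq0 => t0; rewrite mulr0.
    rewrite (_ : ip _ _ = 0) ?mulr0 ?kl //; by apply: csum_eq0 => t0; rewrite conjc0 mulr0.
  rewrite Vf // ip_delta /delta; case: eqVneq => [<-|lk].
    rewrite mulr1 -s2 -!rmorphM /= expr2.
    rewrite (_ : (s l)^-1 * ((s l)^-1 * (s l * s l)) = 1) ?rmorph1 //.
    by field; exact: s0.
  by rewrite !mulr0.
have bu := orthofam_opb of_u.
have sM k : s k <= Num.sqrt M by rewrite ler_sqrt.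
exists s, u, V, c; split=> //.
- by move=> k; exact: sqrtr_ge0.
- move=> N; apply: le_trans (sumlam N); apply: ler_sum => k _.
  by rewrite /s -powR12_sqrt // -powRrM /q mulrC.
move=> i j; apply: (has_sum_nat (c := Num.sqrt M)) => [N|d d0].
  have := diag_abs i j bu HV (sqrtr_ge0 M) _ (iota_uniq 0 N).
  move=> /(_ (fun k => real_complex R (s k))).
  rewrite big_iota; apply => k.
  by rewrite cabs_real ger0_norm ?sqrtr_ge0.
have lx : l2 (ap DV (delta j)) := l2_ap HDV (l2_delta j).
have [L uL HL] := l2_tail lx (exprn_gt0 2 d0).
exists (\max_(k <- L) k).+1 => N NL.
have LN : {subset L <= iota 0 N}.
  by move=> k kL; rewrite mem_iota /= add0n (leq_trans _ NL) // ltnS leq_bigmax_seq.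
have {}HL := HL _ (iota_uniq _ _) LN.
(* [w] is what remains of a basis vector after projecting onto the first [N] eigenvectors. Through
   [form], the norm of [A w] is controlled by the coordinates of [ap DV (delta j)] beyond [N], a
   tail of an [l2] vector. So [A] vanishes on the part not reached by the eigenvectors. *)
pose w t := delta j t - \sum_(k < N) conjc (f k j) * f k t.
have lsum : l2 (fun t => \sum_(k < N) conjc (f k j) * f k t).
  by apply: l2_sum => k; exact: l2Z.
have lw : l2 w by apply: l2B => //; exact: l2_delta.
have Vw k : ap V w k = if k \in iota 0 N then 0 else ap V (delta j) k.
  rewrite (apB HV) //; last exact: l2_delta.
  rewrite (ap_sum _ HV); last by move=> l; exact: l2Z.
  under eq_bigr do rewrite (apZ _ HV) //.
  have E (l : 'I_N) : conjc (f l j) * ap V (f l) k = conjc (f l j) * (k == l :> nat)%:R.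
    case: (boolP (P l)) => Pl; first by rewrite Vf.
    have -> : f l j = 0 by rewrite f0.
    by rewrite conjc0 !mul0r.
  under eq_bigr do rewrite E.
  rewrite mem_iota /= add0n ap_delta; case: ltnP => kN.
    rewrite (bigD1 (Ordinal kN)) //= eqxx mulr1 big1 ?addr0 ?subrr // => l lk.
    by rewrite (_ : (k == l :> nat) = false) ?mulr0 //; apply: contraNF lk => /eqP kl;
      apply/eqP/val_inj.
  rewrite big1 ?subr0 // => l _; rewrite (_ : (k == l :> nat) = false) ?mulr0 //.
  by apply/negP => /eqP kl; move: (ltn_ord l); rewrite -kl ltnNge kN.
have nV : nrm (ap V w) <= 1.
  apply: nrm_le; split=> // K uK.
  have /l2b_ap/(_ (l2b_delta j)) := HV; rewrite mulr1 => -[_ /(_ K uK)]; apply: le_trans.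
  apply: ler_sum => k _; rewrite Vw; case: ifP => // _.
  by rewrite cabs0 expr0n sqr_ge0.
have nDV : nrm (ap DV w) <= d ^+ 2.
  apply: le_trans HL; rewrite le_eqVlt; apply/orP; left; apply/eqP; congr nrm.
  apply/funext => k; rewrite !DVap ?Vw //; last exact: l2_delta.
  by rewrite /cutoff; case: ifP => kN; rewrite ?DVap ?mulr0 ?subrr ?subr0 //; exact: l2_delta.
have lAw := l2_ap HA lw.
have nA : nrm (ap (fun i j => A (i, j)) w) <= d.
  rewrite -(@ler_pXn2r _ 2) ?nnegrE ?nrm_ge0 ?(ltW d0) //.
  have <- : cabs (ip (ap (fun i j => A (i, j)) w) (ap (fun i j => A (i, j)) w)) =
      nrm (ap (fun i j => A (i, j)) w) ^+ 2.
    by rewrite ip_nrm // cabs_real ger0_norm ?sqr_ge0.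
  rewrite form //; apply: (le_trans (ip_le (l2_ap HDV lw) (l2_ap HV lw))).
  rewrite -[leRHS]mulr1; apply: ler_pM => //; exact: nrm_ge0.
apply: le_trans nA; rewrite cabsBC; apply: le_trans (nrm_entry i lAw).
rewrite (apB HA) //; last exact: l2_delta.
rewrite ap_delta (ap_sum _ HA); last by move=> k; exact: l2Z.
rewrite le_eqVlt; apply/orP; left; apply/eqP; congr (cabs (_ - _)).
by apply: eq_bigr => k _; rewrite (apZ _ HA) // su mulrC.
Qed.

End SchattenClass.

(** * The three lines lemma *)

Section ThreeLines.
Context {R : realType}.
Implicit Types (g : R[i] -> R[i]) (z : R[i]).

(** All the analyticity that the maximum principle requires: an expansion whose error is [o(rho^2)],
    to be compared with a gain of order [rho^2] in [sum_circle]. *)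
Definition taylor2 g z := exists (a1 a2 : R[i]) (C r : R), [/\ 0 < r, 0 <= C &
  forall h, cabs h < r -> cabs (g (z + h) - (g z + a1 * h + a2 * h ^+ 2)) <= C * cabs h ^+ 3].

Lemma cabs_i : cabs ('i%C : R[i]) = 1.
Proof. by rewrite /cabs /= expr0n expr1n /= add0r sqrtr1. Qed.

Lemma sqr_i_complex : 'i%C ^+ 2 = -1 :> R[i].
Proof. by rewrite expr2; simpc. Qed.

(* Averaging over the four points [z + rho i^j] kills the terms of degree one and two. *)
Lemma taylor2_mean g z : taylor2 g z -> exists (C r : R), [/\ 0 < r, 0 <= C &
  forall rho, 0 < rho < r -> 4 * cabs (g z) ^+ 2 - C * rho ^+ 3 <=
   \sum_(j < 4) cabs (g (z + real_complex R rho * 'i%C ^+ j)) ^+ 2].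
Proof.
move=> [a1 [a2 [C [r [r0 C0 H]]]]].
exists (8 * cabs (g z) * C), r; split=> // [|rho /andP[rho0 rhor]].
  by rewrite !mulr_ge0 ?cabs_ge0.
pose h j := real_complex R rho * 'i%C ^+ j : R[i].
have ch j : cabs (h j) = rho.
  by rewrite cabsM cabsX cabs_i expr1n mulr1 cabs_real ger0_norm // ltW.
have {}H j : cabs (g (z + h j) - (g z + a1 * h j + a2 * h j ^+ 2)) <= C * rho ^+ 3.
  by have := H (h j); rewrite ch; apply.
have S : \sum_(j < 4) (g z + a1 * h j + a2 * h j ^+ 2) = 4 * g z.
  have e3 : 'i%C ^+ 3 = - 'i%C :> R[i] by rewrite exprS sqr_i_complex mulrN1.
  rewrite !big_ord_recr big_ord0 /= /h !exprMn -!exprM /= expr0 expr1 sqr_i_complex e3.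
  ring.
have low : 4 * (cabs (g z) - C * rho ^+ 3) <= \sum_(j < 4) cabs (g (z + h j)).
  apply: (@le_trans _ _ (cabs (\sum_(j < 4) g (z + h j)))); last exact: cabs_sum.
  have -> : 4 * (cabs (g z) - C * rho ^+ 3) = cabs (4 * g z) - 4 * (C * rho ^+ 3).
    have -> : (4 : R[i]) = real_complex R 4 by rewrite rmorph_nat.
    by rewrite cabsM cabs_real ger0_norm // mulrBr.
  rewrite lerBlDr -S; apply: (le_trans (cabs_le_dist _ (\sum_(j < 4) g (z + h j)))).
  rewrite lerD2l -sumrB; apply: (le_trans (cabs_sum _ _ _)).
  apply: (@le_trans _ _ (\sum_(j < 4) C * rho ^+ 3)).
    by apply: ler_sum => j _; rewrite cabsBC.
  by rewrite sumr_const card_ord mulr_natl.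
have CS := sum_CS (index_enum 'I_4) (fun j => cabs (g (z + h j))) (fun=> 1).
have E1 : \sum_(i <- index_enum 'I_4) (1 : R) ^+ 2 = 4.
  by rewrite expr1n sumr_const card_ord.
rewrite E1 in CS.
have E2 : \sum_(i <- index_enum 'I_4) cabs (g (z + h i)) * 1 = \sum_(j < 4) cabs (g (z + h j)).
  by apply: eq_bigr => j _; rewrite mulr1.
rewrite E2 in CS.
set X := \sum_(j < 4) cabs (g (z + h j)) ^+ 2 in CS *.
set Y := \sum_(j < 4) cabs (g (z + h j)) in CS low.
have Y0 : 0 <= Y by apply: sumr_ge0 => j _; exact: cabs_ge0.
have X0 : 0 <= X by apply: sumr_ge0 => j _; exact: sqr_ge0.
set a := cabs (g z) in low *; have a0 : 0 <= a := cabs_ge0 _.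
set b := C * rho ^+ 3 in low; have b0 : 0 <= b by rewrite mulr_ge0 // exprn_ge0 // ltW.
have -> : 8 * a * C * rho ^+ 3 = 8 * a * b by rewrite /b; ring.
have [ab|ab] := lerP a b.
  apply: le_trans X0; rewrite subr_le0.
  have -> : 4 * a ^+ 2 = 4 * a * a by ring.
  have -> : 8 * a * b = 4 * a * (2 * b) by ring.
  by rewrite ler_wpM2l ?mulr_ge0 //; lra.
have : (4 * (a - b)) ^+ 2 <= Y ^+ 2.
  by rewrite ler_pXn2r ?nnegrE // mulr_ge0 // subr_ge0 ltW.
have -> : (4 * (a - b)) ^+ 2 = 16 * a ^+ 2 - 32 * a * b + 16 * b ^+ 2 by ring.
have := sqr_ge0 b; lra.
Qed.

Lemma circle_points z (rho : R) : exists2 p : 'I_4 -> R * R,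
  (forall j : 'I_4, complex.Re (z + real_complex R rho * 'i%C ^+ j) = complex.Re z + (p j).1 /\
             complex.Im (z + real_complex R rho * 'i%C ^+ j) = complex.Im z + (p j).2) &
  forall j : 'I_4, p j = nth (0, 0) [:: (rho, 0); (0, rho); (- rho, 0); (0, - rho)] j.
Proof.
exists (fun j => nth (0, 0) [:: (rho, 0); (0, rho); (- rho, 0); (0, - rho)] j) => // j.
case: z => a b; case: j => -[|[|[|[|//]]]] /= _; rewrite ?expr0 ?expr1 ?sqr_i_complex.
- by simpc => /=; rewrite ?addr0.
- by simpc => /=; rewrite ?addr0.
- by simpc => /=; rewrite ?addr0 ?mulrN1 ?subr0.
- by split; ring.
Qed.

Lemma strip_circle z (rho : R) (j : 'I_4) : 0 < rho -> rho <= complex.Re z ->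
  rho <= 1 - complex.Re z -> strip (z + real_complex R rho * 'i%C ^+ j).
Proof.
move=> r0 r1 r2; have [p Hp pE] := circle_points z rho; rewrite /strip (Hp j).1 pE.
by case: j => -[|[|[|[|//]]]] /= _; apply/andP; split; lra.
Qed.

(** A discrete form of strict subharmonicity: [2 x^2 - y^2] has Laplacian 2, so its mean over the
    four points exceeds the central value by [rho^2 / 2]. *)
Lemma sum_circle z (rho : R) :
  \sum_(j < 4) (2 * complex.Re (z + real_complex R rho * 'i%C ^+ j) ^+ 2 -
    complex.Im (z + real_complex R rho * 'i%C ^+ j) ^+ 2) =
  4 * (2 * complex.Re z ^+ 2 - complex.Im z ^+ 2) + 2 * rho ^+ 2.
Proof.
have [p Hp pE] := circle_points z rho.
under eq_bigr do rewrite (Hp _).1 (Hp _).2 pE.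
rewrite !big_ord_recr big_ord0 /=; ring.
Qed.

Definition cont_strip g := forall z, strip z -> forall e : R, 0 < e ->
  exists2 d : R, 0 < d & forall w, strip w -> cabs (w - z) < d -> cabs (g w - g z) < e.

(* The maximum principle applied to the strictly subharmonic function
   [|g z|^2 + eps (2 x^2 - y^2)], which tends to [-oo] at the ends of the strip. *)
Lemma three_lines g (M B : R) : 0 <= M -> cont_strip g ->
  (forall z, strip z -> cabs (g z) <= B) -> (forall z, open_strip z -> taylor2 g z) ->
  (forall z, complex.Re z = 0 -> cabs (g z) <= M) ->
  (forall z, complex.Re z = 1 -> cabs (g z) <= M) ->
  forall z, strip z -> cabs (g z) <= M.
Proof.
move=> M0 gc gB gT g0 g1 z1 sz1.
pose psi (z : R[i]) : R := 2 * complex.Re z ^+ 2 - complex.Im z ^+ 2.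
suff key (e : R) : 0 < e -> forall z, strip z ->
    cabs (g z) ^+ 2 + e * psi z <= M ^+ 2 + 2 * e.
  rewrite -(@ler_pXn2r _ 2) ?nnegrE ?cabs_ge0 //.
  have k0 : 0 <= 2 + complex.Im z1 ^+ 2 by rewrite addr_ge0 ?sqr_ge0.
  apply: (ler_addgt0_mul k0) => e e0; have := key e e0 z1 sz1; rewrite /psi.
  have := mulr_ge0 (ltW e0) (sqr_ge0 (complex.Re z1)); lra.
move=> e0 z2 sz2; rewrite leNgt; apply/negP => Hz2.
pose phi (z : R[i]) := cabs (g z) ^+ 2 + e * psi z.
have psi2 z : strip z -> psi z <= 2 - complex.Im z ^+ 2.
  by move=> /andP[h0 h1]; rewrite /psi lerD2r; nra.
have B0 : 0 <= B by apply: le_trans (gB _ sz1); exact: cabs_ge0.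
have phiB z : strip z -> phi z <= B ^+ 2 + e * (2 - complex.Im z ^+ 2).
  move=> sz; rewrite /phi; apply: lerD; last by rewrite ler_wpM2l ?psi2 // ltW.
  by rewrite ler_pXn2r ?nnegrE ?cabs_ge0 // gB.
pose E := [set phi z | z in [set z | strip z]].
have hE : has_sup E.
  split; first by exists (phi z2), z2.
  exists (B ^+ 2 + e * 2) => _ [z sz <-]; apply: (le_trans (phiB z sz)).
  by rewrite lerD2l ler_pM2l // lerBlDr lerDl sqr_ge0.
set s := sup E; have phis z : strip z -> phi z <= s.
  by move=> sz; apply: sup_upper_bound => //; exists z.
have sM : M ^+ 2 + 2 * e < s by apply: lt_le_trans Hz2 (phis z2 sz2).
have wit (n : nat) : exists z, strip z /\ s - n.+1%:R^-1 < phi z.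
  have n0 : 0 < n.+1%:R^-1 :> R by rewrite invr_gt0.
  by have [_ [z sz <-] h] := sup_adherent n0 hE; exists z.
have [z Hz] := choice wit.
(* Near-maximizers stay bounded because [- e y^2] outweighs the bounded part of [phi] far up the
   strip. *)
have zB n (_ : unit) : cabs (z n) <= 1 + (1 + (B ^+ 2 + e * 2 + 1 - s) / e).
  have [sz hz] := Hz n; apply: (le_trans (cabs_le_ReIm _)).
  have /andP[h0 h1] := sz; apply: lerD; first by rewrite ger0_norm.
  have h2 : s - 1 < phi (z n).
    apply: le_lt_trans hz; rewrite lerD2l lerN2 invf_le1 //; by rewrite ler1n.
  have h3 := phiB _ sz.
  have h4 : complex.Im (z n) ^+ 2 <= (B ^+ 2 + e * 2 + 1 - s) / e.
    rewrite ler_pdivlMr //; lra.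
  apply: le_trans (_ : 1 + complex.Im (z n) ^+ 2 <= _); last by rewrite lerD2l.
  rewrite -[complex.Im (z n) ^+ 2]real_normK ?num_real //.
  have := sqr_ge0 (`|complex.Im (z n)| - 1); rewrite sqrrB expr1n.
  have := normr_ge0 (complex.Im (z n)); nra.
have [y Hy] := cluster_seq zB; set w := y tt.
have near N (d : R) : 0 < d -> exists2 k, (N <= k)%N & cabs (z k - w) <= d.
  move=> d0; have [k Nk h] := Hy [:: tt] N d d0; exists k => //; exact: h.
have sw : strip w.
  have ReB (a b : R[i]) : complex.Re (a - b) = complex.Re a - complex.Re b.
    by case: a b => ? ? [].
  apply/andP; split; apply: (@ler_addgt0_mul _ _ _ 1) => // d /(near 0%N)[k _ hk];
    have /andP[h0 h1] := (Hz k).1; have := le_trans (le_Re_cabs _) hk;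
    rewrite ReB ler_norml => /andP[]; lra.
have psic (d : R) : 0 < d -> exists2 d', 0 < d' & forall v, cabs (v - w) <= d' ->
    `|psi v - psi w| <= d.
  move=> d0; pose m := 2 * (2 * `|complex.Re w| + 1) + (2 * `|complex.Im w| + 1).
  have m0 : 0 < m by rewrite /m; have := normr_ge0 (complex.Re w); have := normr_ge0 (complex.Im w); lra.
  exists (Num.min 1 (d / m)) => [|v]; first by rewrite lt_min ltr01 divr_gt0.
  rewrite le_min => /andP[v1 vd].
  set x := complex.Re (v - w); set t := complex.Im (v - w).
  have vE : v = w + (v - w) by rewrite addrC subrK.
  have ReD (a b : R[i]) : complex.Re (a + b) = complex.Re a + complex.Re b.
    by case: a b => ? ? [].
  have ImD (a b : R[i]) : complex.Im (a + b) = complex.Im a + complex.Im b.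
    by case: a b => ? ? [].
  have hx := le_trans (le_Re_cabs (v - w)) vd; have ht := le_trans (le_Im_cabs (v - w)) vd.
  have hx1 := le_trans (le_Re_cabs (v - w)) v1; have ht1 := le_trans (le_Im_cabs (v - w)) v1.
  rewrite -/x in hx hx1; rewrite -/t in ht ht1.
  rewrite /psi {1 2}vE ReD ImD -/x -/t.
  set a := complex.Re w; set b := complex.Im w.
  have -> : 2 * (a + x) ^+ 2 - (b + t) ^+ 2 - (2 * a ^+ 2 - b ^+ 2) =
    2 * ((2 * a + x) * x) - (2 * b + t) * t by ring.
  apply: (le_trans (ler_normB _ _)); rewrite !normrM ger0_norm //.
  have h1 : `|2 * a + x| <= 2 * `|a| + 1.
    by apply: (le_trans (ler_normD _ _)); rewrite normrM ger0_norm // lerD2l.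
  have h2 : `|2 * b + t| <= 2 * `|b| + 1.
    by apply: (le_trans (ler_normD _ _)); rewrite normrM ger0_norm // lerD2l.
  have h3 := ler_pM (normr_ge0 _) (normr_ge0 _) h1 hx.
  have h4 := ler_pM (normr_ge0 _) (normr_ge0 _) h2 ht.
  have -> : d = m * (d / m) by field; rewrite gt_eqF.
  rewrite /m; lra.
have phiw : s <= phi w.
  have k0 : 0 <= 1 + e + (2 * B) by rewrite addr_ge0 ?mulr_ge0 // addr_ge0 // ltW.
  apply: (ler_addgt0_mul k0) => d d0.
  have [d1 d10 Hd1] := gc w sw d d0; have [d2 d20 Hd2] := psic d d0.
  have m0 : 0 < Num.min (d1 / 2) d2 by rewrite lt_min d20 andbT divr_gt0.
  have [k Nk] := near (Num.truncn d^-1) _ m0; rewrite le_min => /andP[hk1 hk2].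
  have [sz hz] := Hz k.
  have h1 := Hd1 _ sz (le_lt_trans hk1 (_ : d1 / 2 < d1)).
  have {}h1 : cabs (g (z k) - g w) < d by apply: h1; lra.
  have h2 := Hd2 _ hk2.
  have h3 : k.+1%:R^-1 <= d.
    rewrite invf_ple ?posrE //; apply: ltW; apply: (lt_le_trans (truncnS_gt _)).
    by rewrite ler_nat.
  have h4 : cabs (g (z k)) ^+ 2 - cabs (g w) ^+ 2 <= 2 * B * d.
    have u1 := gB _ sz; have u2 := gB _ sw.
    have u3 := cabs_le_dist (g (z k)) (g w).
    have c1 := cabs_ge0 (g (z k)); have c2 := cabs_ge0 (g w).
    have -> : cabs (g (z k)) ^+ 2 - cabs (g w) ^+ 2 =
      (cabs (g (z k)) + cabs (g w)) * (cabs (g (z k)) - cabs (g w)) by ring.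
    apply: (@le_trans _ _ ((cabs (g (z k)) + cabs (g w)) * d)).
      by rewrite ler_wpM2l ?addr_ge0 //; lra.
    by rewrite ler_wpM2r ?(ltW d0) //; lra.
  have h5 : e * psi (z k) - e * psi w <= e * d.
    by rewrite -[leLHS]mulrBr ler_wpM2l ?(ltW e0) // (le_trans (ler_norm _)).
  move: hz h3 h4 h5; rewrite /phi.
  move: (cabs (g (z k)) ^+ 2) (cabs (g w) ^+ 2) (e * psi (z k)) (e * psi w) => X1 X2 X3 X4.
  by move: (k.+1%:R^-1) => X5; clear; lra.
have /andP[w0 w1] := sw.
have psiw : psi w <= 2.
  by apply: (le_trans (psi2 _ sw)); rewrite lerBlDr lerDl sqr_ge0.
have bdry : cabs (g w) <= M -> False.
  move=> h; have : cabs (g w) ^+ 2 <= M ^+ 2 by rewrite ler_pXn2r ?nnegrE ?cabs_ge0.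
  have : e * psi w <= e * 2 by rewrite ler_wpM2l ?(ltW e0).
  by move: phiw; rewrite /phi; lra.
move: w0; rewrite le_eqVlt => /orP[/eqP w0|w0]; first by apply/bdry/g0.
move: w1; rewrite le_eqVlt => /orP[/eqP w1|w1]; first by apply/bdry/g1.
have ow : open_strip w by rewrite /open_strip w0 w1.
have [C [r [r0 C0 Hm]]] := taylor2_mean (gT w ow).
(* The first three terms keep the four points inside the disc of the expansion and inside the strip;
   the last makes the error [C * rho ^+ 3] smaller than the gain [2 * e * rho ^+ 2]. *)
pose rho := Num.min (r / 2) (Num.min (complex.Re w) (Num.min (1 - complex.Re w) (e / (C + 1)))).
have C1 : 0 < C + 1 by rewrite ltr_wpDl.
have rho0 : 0 < rho by rewrite !lt_min divr_gt0 // w0 subr_gt0 w1 divr_gt0.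
have : rho <= rho by []; rewrite {2}/rho !le_min => /and4P[h1 h2 h3 h4].
have := Hm rho; rewrite rho0 /= (le_lt_trans h1) ?ltr_pdivrMr ?ltr_pMr ?ltr1n //.
move=> /(_ isT) hm.
have sj (j : 'I_4) : strip (w + real_complex R rho * 'i%C ^+ j).
  exact: strip_circle.
have psiS := sum_circle w rho; rewrite -/(psi w) in psiS.
have : \sum_(j < 4) phi (w + real_complex R rho * 'i%C ^+ j) <= \sum_(j < 4) s.
  by apply: ler_sum => j _; apply/phis/sj.
rewrite big_split /= -mulr_sumr psiS sumr_const card_ord -mulr_natl.
have h5 : C * rho ^+ 3 < 2 * e * rho ^+ 2.
  have -> : C * rho ^+ 3 = C * rho * rho ^+ 2 by ring.
  rewrite ltr_pM2r ?exprn_gt0 //.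
  have h6 : (C + 1) * rho <= e by rewrite mulrC -ler_pdivlMr.
  by move: h6; rewrite mulrDl mul1r; lra.
have h6 : 4 * s <= 4 * phi w by rewrite ler_pM2l.
by move: h6 hm; rewrite /phi; nra.
Qed.

End ThreeLines.

(** * Cauchy products and the complex exponential *)

Section CauchyProduct.

(** The square of indices is cut along the antidiagonal: the lower triangle is the truncated Cauchy
    product and the rest is the error of the truncation. *)
Lemma cauchy_triangle (V : nmodType) (N : nat) (F : nat -> nat -> V) :
  \sum_(i < N) \sum_(j < N) F i j =
  \sum_(n < N) \sum_(i < n.+1) F i (n - i)%N +
  \sum_(i < N) \sum_(j < N | (N <= i + j)%N) F i j.
Proof.
have -> : \sum_(n < N) \sum_(i < n.+1) F i (n - i)%N =
    \sum_(i < N) \sum_(j < N | (i + j < N)%N) F i j.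
  elim: N => [|N IH]; first by rewrite !big_ord0.
  rewrite big_ord_recr /= IH [in RHS]big_ord_recr /=.
  have -> : \sum_(j < N.+1 | (N + j < N.+1)%N) F N j = F N 0%N.
    rewrite (big_pred1 ord0) // => j /=.
    by rewrite -val_eqE /=; apply/idP/idP; lia.
  rewrite big_ord_recr /= subnn addrA -big_split /=; congr (_ + _).
  apply: eq_bigr => i _.
  rewrite (bigD1 (Ordinal (leq_ltn_trans (leq_subr i N) (ltnSn N)))) /=; last first.
    by rewrite subnKC // ltnW.
  rewrite addrC; congr (_ + _).
  rewrite [RHS]big_mkcond [LHS]big_mkcond big_ord_recr /=.
  rewrite (_ : ((i + N < N.+1)%N && _) = false) ?addr0; last first.
    by apply/negP => /andP[]; rewrite -val_eqE /=; move: (ltn_ord i); lia.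
  apply: eq_bigr => j _; congr (if _ then _ else _).
  rewrite -val_eqE /=; have iN := ltn_ord i; apply/idP/idP; lia.
rewrite -big_split /=; apply: eq_bigr => i _.
rewrite [LHS](bigID (fun j : 'I_N => (i + j < N)%N)) /=; congr (_ + _).
by apply: eq_bigl => j; rewrite -leqNgt.
Qed.

End CauchyProduct.

Section ComplexExponential.
Context {R : realType}.
Implicit Types (z w : R[i]).

Definition expc_coeff z (k : nat) : R[i] := z ^+ k / k`!%:R.
Definition expc z : R[i] := csum (expc_coeff z).

Lemma cabs_expc_coeff z k : cabs (expc_coeff z k) = exp_coeff (cabs z) k.
Proof.
rewrite /expc_coeff /exp_coeff /= cabsM cabsX; congr (_ * _).
have -> : (k`!%:R^-1 : R[i]) = real_complex R (k`!%:R^-1) by rewrite fmorphV rmorph_nat.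
by rewrite cabs_real ger0_norm // invr_ge0.
Qed.

Lemma exp_sum_le (x : R) N : 0 <= x -> \sum_(k < N) exp_coeff x k <= expR x.
Proof.
move=> x0; rewrite -(big_mkord predT (exp_coeff x)).
apply: (@nondecreasing_cvgn_le _ (series (exp_coeff x)) _ (is_cvg_series_exp_coeff x) N).
by apply: nondecreasing_series => n _ _; exact: exp_coeff_ge0.
Qed.

Lemma exp_sum_cvg (x e : R) : 0 < e -> exists N0, forall N, (N0 <= N)%N ->
  `|\sum_(k < N) exp_coeff x k - expR x| <= e.
Proof.
move=> e0; have /cvgrPdist_le/(_ e e0)[N0 _ H] := is_cvg_series_exp_coeff x.
exists N0 => N NN; rewrite distrC -(big_mkord predT (exp_coeff x)); exact: H.
Qed.

Lemma has_sum_partial (f : nat -> R[i]) s (e : R) : has_sum f s -> 0 < e ->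
  exists N0, forall N, (N0 <= N)%N -> cabs (\sum_(k < N) f k - s) <= e.
Proof.
move=> /has_sumP H /H[A uA HA]; exists (\max_(j <- A) j).+1 => N NA.
rewrite -big_iota; apply/ltW/HA => [|k kA]; first exact: iota_uniq.
by rewrite mem_iota /= add0n (leq_trans _ NA) // ltnS leq_bigmax_seq.
Qed.

Lemma expc_has_sum z : has_sum (expc_coeff z) (expc z).
Proof.
have [s Hs _] : exists2 s, has_sum (expc_coeff z) s & cabs s <= expR (cabs z).
  apply: has_sum_abs => J uJ; under eq_bigr do rewrite cabs_expc_coeff.
  apply: sum_nat_le => // [k|N]; first by apply: exp_coeff_ge0; exact: cabs_ge0.
  by apply: exp_sum_le; exact: cabs_ge0.
by rewrite /expc (csumE Hs).
Qed.

Lemma exp_coeffD (F : numFieldType) (x y : F) n : (x + y) ^+ n / n`!%:R =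
  \sum_(i < n.+1) x ^+ i / i`!%:R * (y ^+ (n - i) / (n - i)`!%:R).
Proof.
rewrite addrC exprDn mulr_suml; apply: eq_bigr => i _.
have fn0 m : m`!%:R != 0 :> F by rewrite pnatr_eq0 -lt0n fact_gt0.
have B : 'C(n, i)%:R * (i`!%:R * (n - i)`!%:R) = n`!%:R :> F.
  by rewrite -!natrM bin_fact // -ltnS.
rewrite -[X in X / _]mulr_natr -B; field.
rewrite !fn0 /= pnatr_eq0 -lt0n bin_gt0 -ltnS ltn_ord //.
Qed.

Lemma exp_triangle (F : numFieldType) (x y : F) N :
  (\sum_(k < N) x ^+ k / k`!%:R) * (\sum_(k < N) y ^+ k / k`!%:R) -
    \sum_(k < N) (x + y) ^+ k / k`!%:R =
  \sum_(i < N) \sum_(j < N | (N <= i + j)%N) x ^+ i / i`!%:R * (y ^+ j / j`!%:R).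
Proof.
rewrite mulr_suml; under eq_bigr do rewrite mulr_sumr.
rewrite (cauchy_triangle N (fun i j => x ^+ i / i`!%:R * (y ^+ j / j`!%:R))).
by under [X in _ - X]eq_bigr do rewrite exp_coeffD; rewrite addrC addKr.
Qed.

(** The upper triangle left by the Cauchy product is dominated termwise by the same triangle for the
    real numbers [cabs z] and [cabs w], which tends to 0 by [expRD]. *)
Lemma expcD z w : expc (z + w) = expc z * expc w.
Proof.
have lin (x y f : R) : 0 <= x * f -> 0 <= f * y ->
    (f + f) + (x * f + f * y) <= 0 + (2 * (x + y) + 2) * f by lra.
apply/eqP; rewrite eq_sym -subr_eq0; apply/eqP/cabs_eq0/eqP; rewrite eq_le cabs_ge0 andbT.
set a := cabs z; set b := cabs w.
have a0 : 0 <= a := cabs_ge0 _; have b0 : 0 <= b := cabs_ge0 _.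
have k0 : 0 <= 2 * (expR a + expR b) + 2 by rewrite !(addr_ge0, mulr_ge0) ?expR_ge0.
apply: (ler_addgt0_mul k0) => e e0.
have [N1 H1] := has_sum_partial (expc_has_sum z) e0.
have [N2 H2] := has_sum_partial (expc_has_sum w) e0.
have [N3 H3] := has_sum_partial (expc_has_sum (z + w)) e0.
have [N4 H4] := exp_sum_cvg (a + b) e0.
pose N := maxn (maxn N1 N2) (maxn N3 N4).
have {}H1 := H1 N (leq_trans (leq_maxl _ _) (leq_maxl _ _)).
have {}H2 := H2 N (leq_trans (leq_maxr _ _) (leq_maxl _ _)).
have {}H3 := H3 N (leq_trans (leq_maxl _ _) (leq_maxr _ _)).
have {}H4 := H4 N (leq_trans (leq_maxr _ _) (leq_maxr _ _)).
set Sz := \sum_(k < N) expc_coeff z k in H1; set Sw := \sum_(k < N) expc_coeff w k in H2.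
set Szw := \sum_(k < N) expc_coeff (z + w) k in H3.
have T : cabs (Sz * Sw - Szw) <= e.
  rewrite exp_triangle; apply: (le_trans (cabs_sum _ _ _)).
  apply: (@le_trans _ _ (\sum_(i < N) \sum_(j < N | (N <= i + j)%N)
      exp_coeff a i * exp_coeff b j)).
    apply: ler_sum => i _; apply: (le_trans (cabs_sum _ _ _)).
    by apply: ler_sum => j _; rewrite cabsM !cabs_expc_coeff.
  rewrite -(exp_triangle a b); apply: le_trans H4.
  rewrite distrC; apply: le_trans (ler_norm _); rewrite lerD2r expRD.
  by apply: ler_pM; rewrite ?exp_sum_le //; apply: sumr_ge0 => k _; exact: exp_coeff_ge0.
have nS : cabs Sz <= expR a.
  apply: (le_trans (cabs_sum _ _ _)); under eq_bigr do rewrite cabs_expc_coeff.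
  exact: exp_sum_le.
have nw : cabs (expc w) <= expR b.
  apply: (has_sum_le (expc_has_sum w)) => J uJ; apply: (le_trans (cabs_sum _ _ _)).
  under eq_bigr do rewrite cabs_expc_coeff.
  apply: sum_nat_le => // [k|M]; first exact: exp_coeff_ge0.
  exact: exp_sum_le.
have -> : expc z * expc w - expc (z + w) = (Szw - expc (z + w)) + (Sz * Sw - Szw) +
    (- (Sz * (Sw - expc w)) - (Sz - expc z) * expc w).
  by move: Sz Sw Szw (expc z) (expc w) (expc (z + w)) {H1 H2 H3 T nS nw} => *; ring.
have h1 := cabsD (Szw - expc (z + w) + (Sz * Sw - Szw))
  (- (Sz * (Sw - expc w)) - (Sz - expc z) * expc w).
have h2 := cabsD (Szw - expc (z + w)) (Sz * Sw - Szw).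
have h3 := cabsD (- (Sz * (Sw - expc w))) (- ((Sz - expc z) * expc w)).
rewrite !cabsN !cabsM in h3.
have h4 := ler_pM (cabs_ge0 _) (cabs_ge0 _) nS H2.
have h5 := ler_pM (cabs_ge0 _) (cabs_ge0 _) H1 nw.
have h6 : 0 <= expR a * e by rewrite mulr_ge0 ?expR_ge0 ?(ltW e0).
have h7 : 0 <= e * expR b by rewrite mulr_ge0 ?expR_ge0 ?(ltW e0).
apply: (le_trans h1); apply: le_trans (lin _ _ _ h6 h7); apply: lerD.
  by apply: (le_trans h2); exact: lerD.
by apply: (le_trans h3); exact: lerD.
Qed.

Lemma expc_real (x : R) : expc (real_complex R x) = real_complex R (expR x).
Proof.
have E N : \sum_(k < N) expc_coeff (real_complex R x) k =
    real_complex R (\sum_(k < N) exp_coeff x k).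
  rewrite real_complex_sum; apply: eq_bigr => k _.
  by rewrite /expc_coeff /exp_coeff /= rmorphM rmorphXn fmorphV rmorph_nat.
apply: csumE; apply: (has_sum_nat (c := expR `|x|)) => [N|e e0].
  under eq_bigr do rewrite cabs_expc_coeff cabs_real.
  exact: exp_sum_le.
have [N0 H] := exp_sum_cvg x e0; exists N0 => N /H.
by rewrite E -(rmorphB (real_complex R)) cabs_real.
Qed.

Lemma expc_conj z : expc (conjc z) = conjc (expc z).
Proof.
apply: csumE; apply: eq_has_sum (has_sum_conj (expc_has_sum z)) => k.
by rewrite /expc_coeff rmorphM rmorphXn fmorphV rmorph_nat.
Qed.

(** The squared modulus is [expc z * expc (conjc z)], the exponential of a real number. *)
Lemma cabs_expc z : cabs (expc z) = expR (complex.Re z).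
Proof.
apply/eqP; rewrite -(@eqrXn2 _ 2) ?cabs_ge0 ?expR_ge0 //; apply/eqP.
apply: (@complexI R); rewrite -mul_conjc -expc_conj -expcD.
have -> : z + conjc z = real_complex R (complex.Re z + complex.Re z).
  by case: z => a b; simpc.
by rewrite expc_real expRD expr2.
Qed.

(** For [k >= N] one has [|z|^k <= q^k x^k <= q^N x^k]. The free scale [x] allows a bound that is
    uniform when [z] is a large multiple of a small number. *)
Lemma expc_tail z (q x : R) N : 0 <= q <= 1 -> 0 <= x -> cabs z <= q * x ->
  cabs (expc z - \sum_(k < N) expc_coeff z k) <= q ^+ N * expR x.
Proof.
move=> /andP[q0 q1] x0 zx.
have H : has_sum (fun k => if (k < N)%N then 0 else expc_coeff z k)
    (expc z - \sum_(k < N) expc_coeff z k).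
  have h : has_sum (fun k => if (k < N)%N then expc_coeff z k else 0)
      (\sum_(k < N) expc_coeff z k).
    have := @has_sum_fin _ nat (iota 0 N) (fun k => if (k < N)%N then expc_coeff z k else 0)
      (iota_uniq _ _).
    rewrite big_iota (eq_bigr (fun k : 'I_N => expc_coeff z k)) => [|k _]; last by rewrite ltn_ord.
    by apply => k; rewrite mem_iota /= add0n => /negbTE ->.
  apply: eq_has_sum (has_sumD (expc_has_sum z) (has_sumN h)) => k.
  by case: ifP => _; rewrite ?subrr ?subr0.
apply: (has_sum_le H) => J uJ; apply: (le_trans (cabs_sum _ _ _)).
apply: (@le_trans _ _ (\sum_(k <- J) q ^+ N * exp_coeff x k)).
  apply: ler_sum => k _; case: ltnP => kN.
    by rewrite cabs0 mulr_ge0 ?exprn_ge0 ?exp_coeff_ge0.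
  rewrite cabs_expc_coeff /exp_coeff /= mulrA ler_wpM2r ?invr_ge0 //.
  apply: (@le_trans _ _ ((q * x) ^+ k)).
    by rewrite lerXn2r ?nnegrE ?cabs_ge0 ?mulr_ge0.
  by rewrite exprMn ler_wpM2r ?exprn_ge0 // ler_wiXn2l.
rewrite -mulr_sumr ler_wpM2l ?exprn_ge0 //; apply: sum_nat_le => // [k|M].
  exact: exp_coeff_ge0.
exact: exp_sum_le.
Qed.

End ComplexExponential.

(** * Trace class operators *)

Section TraceClass.
Context {R : realType} {I : choiceType}.
Local Notation mat := (I * I -> R[i]).
Implicit Types (A b : mat) (J : seq I).

(** [Tr(A b^T)] truncated to the indices in [J]. *)
Definition pair_sec (J : seq I) (A b : mat) : R[i] :=
  \sum_(i <- J) \sum_(j <- J) A (i, j) * b (i, j).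

(* The trace norm of [A] is at most [c], expressed by duality with the compacts. *)
Definition tcb A (c : R) := 0 <= c /\ forall b J, uniq J ->
  opb (fun i j => b (i, j)) 1 -> cabs (pair_sec J A b) <= c.

Lemma pair_secZ J A b (z : R[i]) : pair_sec J A (fun p => z * b p) = z * pair_sec J A b.
Proof.
rewrite /pair_sec mulr_sumr; apply: eq_bigr => i _; rewrite mulr_sumr.
by apply: eq_bigr => j _; rewrite mulrCA.
Qed.

Lemma tcb_scale A c b d J : tcb A c -> uniq J -> opb (fun i j => b (i, j)) d ->
  cabs (pair_sec J A b) <= c * d.
Proof.
move=> [c0 H] uJ Hb; have d0 := opb_ge0 Hb.
apply: (ler_addgt0_mul c0) => e e0; rewrite -mulrDr.
have de : 0 < d + e by rewrite ltr_wpDl.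
have := H (fun p => real_complex R (d + e)^-1 * b p) J uJ.
rewrite pair_secZ cabsM cabs_real ger0_norm ?invr_ge0 ?(ltW de) //.
rewrite mulrC ler_pdivrMr //; apply.
apply: (opb_le _ (opb_scale _ Hb)); rewrite cabs_real ger0_norm ?invr_ge0 ?(ltW de) //.
by rewrite mulrC ler_pdivrMr // mul1r lerDl ltW.
Qed.

Lemma diag_tcb (d : nat -> R[i]) (u v : nat -> I -> R[i]) A c : opb u 1 -> opb v 1 ->
  (forall N, \sum_(k < N) cabs (d k) <= c) ->
  (forall i j, has_sum (fun k => d k * u k i * v k j) (A (i, j))) -> tcb A c.
Proof.
move=> Hu Hv Hc HA; split=> [|b J uJ Hb]; first by have := Hc 0%N; rewrite big_ord0.
have HS : has_sum (fun k => \sum_(i <- J) \sum_(j <- J)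
    b (i, j) * (d k * u k i * v k j)) (pair_sec J A b).
  apply: has_sum_sum => i; apply: has_sum_sum => j; rewrite mulrC.
  exact/has_sumZ/HA.
apply: (has_sum_le HS) => K uK.
apply: (le_trans (cabs_sum _ _ _)); apply: (@le_trans _ _ (\sum_(k <- K) cabs (d k))); last first.
  by apply: sum_nat_le => // k; exact: cabs_ge0.
apply: ler_sum => k _.
have -> : \sum_(i <- J) \sum_(j <- J) b (i, j) * (d k * u k i * v k j) =
    d k * \sum_(i <- J) \sum_(j <- J) b (i, j) * v k j * u k i.
  rewrite mulr_sumr; apply: eq_bigr => i _; rewrite mulr_sumr.
  by apply: eq_bigr => j _; ring.
rewrite cabsM -[leRHS]mulr1 ler_wpM2l ?cabs_ge0 //.
rewrite -(@ler_pXn2r _ 2) ?nnegrE ?cabs_ge0 ?ler01 // expr1n.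
apply: (le_trans (opb_bil (v k) (u k) Hb uJ uJ)).
have [_ /(_ J uJ)] := opb_row k Hv; have [_ /(_ J uJ)] := opb_row k Hu.
rewrite !expr1n mul1r => h1 h2; rewrite -[leRHS]mulr1.
by apply: ler_pM => //; exact: sqn_ge0.
Qed.

Lemma schmidt_tcb A : schmidt_data 1 A -> exists c, tcb A c.
Proof.
move=> [s [u [v [c [s0 Hu Hv Hc HA]]]]]; exists c; apply: (diag_tcb Hu Hv _ HA) => N.
apply: le_trans (Hc N); apply: ler_sum => k _.
by rewrite cabs_real ger0_norm // powRr1.
Qed.

(** The test matrix is the conjugate of the section of [A], normalized in the Hilbert-Schmidt norm,
    which dominates the operator norm. *)
Lemma tcb_HS A c J : tcb A c -> uniq J -> \sum_(i <- J) sqn J (fun j => A (i, j)) <= c ^+ 2.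
Proof.
move=> [c0 H] uJ; set h := leLHS.
have h0 : 0 <= h by apply: sumr_ge0 => i _; exact: sqn_ge0.
have [->|hn] := eqVneq h 0; first exact: sqr_ge0.
have hp : 0 < h by rewrite lt_neqAle eq_sym hn h0.
set r := Num.sqrt h; have r0 : 0 < r by rewrite sqrtr_gt0.
pose b p := if (p.1 \in J) && (p.2 \in J) then real_complex R r^-1 * conjc (A p) else 0.
have Hb : opb (fun i j => b (i, j)) 1.
  apply: opb_HS => // K L uK uL.
  have [uC KC JC] := uniq_undup_cat K J; have [uC' LC JC'] := uniq_undup_cat L J.
  have E : \sum_(i <- J) sqn J (fun j => b (i, j)) = 1.
    have -> : 1 = r^-1 ^+ 2 * h by rewrite exprVn sqr_sqrtr // mulVf // gt_eqF.
    rewrite /h mulr_sumr; apply: eq_big_seq => i iJ; rewrite /sqn mulr_sumr.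
    apply: eq_big_seq => j jJ; rewrite /b /= iJ jJ cabsM cabs_real cabs_conj.
    by rewrite ger0_norm ?invr_ge0 ?(ltW r0) // exprMn.
  rewrite expr1n -E.
  have z1 i : i \notin J -> forall M, sqn M (fun j => b (i, j)) = 0.
    by move=> iJ M; apply: big1 => j _; rewrite /b /= (negbTE iJ) cabs0 expr0n.
  apply: (@le_trans _ _ (\sum_(i <- undup (K ++ J)) sqn L (fun j => b (i, j)))).
    rewrite [leRHS](bigID (mem K)) /= -[leLHS]addr0; apply: lerD.
      rewrite -[X in _ <= X]big_filter le_eqVlt; apply/orP; left; apply/eqP.
      apply: perm_big; apply: uniq_perm; rewrite ?filter_uniq //.
      by move=> y; rewrite mem_filter; apply/idP/andP => [xJ|[]//]; split=> //; exact: KC.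
    by apply: sumr_ge0 => i _; exact: sqn_ge0.
  rewrite (big_subset_supp uJ uC JC) => [|i _ /z1 //].
  apply: ler_sum => i _; apply: (le_trans (sqn_subset _ uL LC)).
  rewrite /sqn (big_subset_supp uJ uC' JC') // => j _ jJ.
  by rewrite /b /= (negbTE jJ) andbF cabs0 expr0n.
have := H b J uJ Hb.
have -> : pair_sec J A b = real_complex R (r^-1 * h).
  rewrite rmorphM /= /h real_complex_sum mulr_sumr; apply: eq_big_seq => i iJ.
  rewrite /sqn real_complex_sum mulr_sumr; apply: eq_big_seq => j jJ.
  by rewrite /b /= iJ jJ mulrCA mul_conjc.
have -> : r^-1 * h = r by rewrite -{1}(sqr_sqrtr h0) expr2 mulKf // gt_eqF.
rewrite cabs_real ger0_norm ?(ltW r0) // => rc.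
by rewrite -(sqr_sqrtr h0) ler_pXn2r ?nnegrE ?(ltW r0).
Qed.

Lemma tcb_capprox A c : tcb A c -> capprox A.
Proof. by move=> H; apply: (@capprox_HS _ _ A (c ^+ 2)) => J uJ; exact: tcb_HS. Qed.

Lemma tcb_opb A c : tcb A c -> opb (fun i j => A (i, j)) c.
Proof.
move=> HA; have c0 : 0 <= c by case: HA.
apply: opb_HS => // J K uJ uK; have [uC JC KC] := uniq_undup_cat J K.
apply: le_trans (tcb_HS HA uC).
apply: (@le_trans _ _ (\sum_(i <- J) sqn (undup (J ++ K)) (fun j => A (i, j)))).
  by apply: ler_sum => i _; exact: sqn_subset.
rewrite [leRHS](bigID (mem J)) /= -[leLHS]addr0; apply: lerD.
  rewrite -[X in _ <= X]big_filter le_eqVlt; apply/orP; left; apply/eqP.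
  apply: perm_big; apply: uniq_perm; rewrite ?filter_uniq //.
  by move=> y; rewrite mem_filter; apply/idP/andP => [xJ|[]//]; split=> //; exact: JC.
by apply: sumr_ge0 => i _; exact: sqn_ge0.
Qed.

(** Built so that pairing it with [A] gives, in the limit of large [J], the sum of the [be k * s_k]
    over [k < N]. Taking [be = 1] recovers the trace norm, and letting [be] depend on [z] is used
    for the other Schatten classes. *)
Definition svd_test (A : mat) (D : svd (fun i j => A (i, j))) (be : nat -> R[i]) (N : nat) : mat :=
  fun p => \sum_(k < N) be k * conjc (su D k p.1) * sw D k p.2.

Lemma svd_test_opb A (D : svd (fun i j => A (i, j))) be N m : 0 <= m ->
  (forall k, cabs (be k) <= m) -> opb (fun i j => svd_test D be N (i, j)) m.
Proof.
move=> m0 bm.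
have bu := opb_conj (orthofam_opb (su_ortho D)); have bw := orthofam_opb (sw_ortho D).
have := opb_mul (iota_uniq 0 N) (opb_tr (opb_diag m0 bm bu)) bw; rewrite !mulr1.
by apply: eq_opb => i j; rewrite big_iota.
Qed.

Lemma svd_test_pair A c (D : svd (fun i j => A (i, j))) be N (e : R) :
  opb (fun i j => A (i, j)) c -> 0 < e -> exists2 J, uniq J &
  cabs (pair_sec J A (svd_test D be N) - \sum_(k < N) be k * real_complex R (sv D k)) <= e.
Proof.
move=> HA e0.
have [lu Hu] := su_ortho D; have [lw Hw] := sw_ortho D.
pose m : R := 1 + \sum_(k < N) cabs (be k).
have m0 : 0 < m by rewrite ltr_pwDl // sumr_ge0 // => k _; exact: cabs_ge0.
have [J uJ HJ] : exists2 J, uniq J & forall M, uniq M -> {subset J <= M} -> forall k, (k < N)%N ->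
    cabs (\sum_(i <- M) \sum_(j <- M) A (i, j) * sw D k j * conjc (su D k i) -
      ip (ap (fun i j => A (i, j)) (sw D k)) (su D k)) <= e / m.
  elim: N {m m0} (e / m) (divr_gt0 e0 m0) => [|N IH] d d0; first by exists [::].
  have [J uJ HJ] := IH d d0.
  have [J1 uJ1 HJ1] := ip_ap_trunc HA (lw N) (lu N) d0.
  have [uC C C1] := uniq_undup_cat J J1; exists (undup (J ++ J1)) => // M uM CM k.
  rewrite ltnS leq_eqVlt => /orP[/eqP ->|kN].
    by apply: HJ1 => // t tJ; exact/CM/C1.
  by apply: HJ => // t tJ; exact/CM/C.
exists J => //.
have -> : pair_sec J A (svd_test D be N) - \sum_(k < N) be k * real_complex R (sv D k) =
    \sum_(k < N) be k * (\sum_(i <- J) \sum_(j <- J) A (i, j) * sw D k j * conjc (su D k i) -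
      ip (ap (fun i j => A (i, j)) (sw D k)) (su D k)).
  under [RHS]eq_bigr do rewrite mulrBr.
  rewrite sumrB; congr (_ - _); last first.
    apply: eq_bigr => k _; rewrite sv_ap ipZl // Hu eqxx /=.
    by case: eqVneq => [->|_]; rewrite ?rmorph0 ?mul0r ?mulr1.
  rewrite /pair_sec /svd_test.
  under eq_bigr do under eq_bigr do rewrite mulr_sumr.
  under eq_bigr do rewrite exchange_big /=.
  rewrite exchange_big /=; apply: eq_bigr => k _; rewrite mulr_sumr; apply: eq_bigr => i _.
  by rewrite mulr_sumr; apply: eq_bigr => j _; ring.
apply: (le_trans (cabs_sum _ _ _)).
apply: (@le_trans _ _ (\sum_(k < N) cabs (be k) * (e / m))).
  by apply: ler_sum => k _; rewrite cabsM ler_wpM2l ?cabs_ge0 // HJ.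
rewrite -mulr_suml mulrCA -[leRHS]mulr1 ler_pM2l // ler_pdivrMr // mul1r /m.
by rewrite lerDr ler01.
Qed.

(** Pairing with the truncated polar part, a contraction, bounds every partial sum of the singular
    values by [c]. *)
Lemma tcb_schatten A c : tcb A c -> schatten_class 1 (A : cfun R (I * I)%type).
Proof.
move=> HA; have cA := tcb_capprox HA.
have HO := tcb_opb HA.
have [D] := svd_exists (approximable_seqcompact cA).
apply: (@svd_schatten _ _ 1 c _ D); rewrite ?ltr01 //; first exact/compact_opE.
move=> N; apply: (@ler_addgt0_mul _ _ _ 1) => // e e0.
have be1 (k : nat) : cabs ((fun=> 1 : R[i]) k) <= 1 by rewrite cabs1.
have [J uJ HJ] := svd_test_pair D (fun=> 1) N HO e0.
have h := tcb_scale HA uJ (svd_test_opb D N ler01 be1).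
have -> : \sum_(k < N) sv D k `^ 1 = cabs (\sum_(k < N) 1 * real_complex R (sv D k)).
  under [in RHS]eq_bigr do rewrite mul1r.
  rewrite -real_complex_sum cabs_real ger0_norm; last by apply: sumr_ge0 => k _; exact: sv_ge0.
  by apply: eq_bigr => k _; rewrite powRr1 ?sv_ge0.
apply: (le_trans (cabs_le_dist _ (pair_sec J A (svd_test D (fun=> 1) N)))).
by rewrite mulr1 in h; apply: lerD => //; rewrite cabsBC mul1r.
Qed.

Lemma schatten1P (A : cfun R (I * I)%type) : schatten_class 1 A <-> exists c, tcb A c.
Proof.
split=> [/schatten_schmidt|[c]]; last exact: tcb_schatten.
by move=> /(_ ltr01); exact: schmidt_tcb.
Qed.

(** [trace_pairing] is an iterated sum, so the row sums have to be absolutely summable. Multiplying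
    the rows of [b] by suitable phases keeps its norm bound and turns the pairing into the sum of
    the moduli. *)
Lemma pair_sec_le_row A c b d : tcb A c -> opb (fun i j => b (i, j)) d ->
  exists2 r : I -> R[i], (forall i, has_sum (fun k => A (i, k) * b (i, k)) (r i)) &
    forall K, uniq K -> \sum_(i <- K) cabs (r i) <= c * d.
Proof.
move=> HA Hb; have HO := tcb_opb HA; have c0 : 0 <= c by case: HA.
have d0 := opb_ge0 Hb.
have [r Hr] := choice (fun i => let: ex_intro2 y Hy _ :=
  has_sum_mul (opb_row i HO) (opb_row i Hb) in ex_intro (fun y => has_sum _ y) y Hy).
exists r => // K uK; have n0 : 0 <= (size K)%:R :> R by [].
apply: (ler_addgt0_mul n0) => e e0.
have [J uJ [KJ HJ]] : exists2 J, uniq J & {subset K <= J} /\ forall i, i \in K ->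
    cabs (\sum_(k <- J) A (i, k) * b (i, k) - r i) <= e.
  suff [J uJ HJ] : exists2 J, uniq J & forall M, uniq M -> {subset J <= M} ->
     forall i, i \in K -> cabs (\sum_(k <- M) A (i, k) * b (i, k) - r i) <= e.
    have [uC C C1] := uniq_undup_cat K J; exists (undup (K ++ J)) => //; split=> //.
    exact: HJ.
  elim: K {uK n0} => [|i K [J uJ IH]]; first by exists [::].
  have /has_sumP/(_ e e0)[J1 uJ1 HJ1] := Hr i.
  have [uC C C1] := uniq_undup_cat J J1; exists (undup (J ++ J1)) => // M uM CM i'.
  rewrite inE => /orP[/eqP ->|iK].
    by apply/ltW/HJ1 => // t tJ; exact/CM/C1.
  by apply: IH => // t tJ; exact/CM/C.
pose z i := \sum_(k <- J) A (i, k) * b (i, k).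
(* The conjugate phase of the truncated row sum, set to 0 outside [K] so that only the rows of [K]
   count. *)
pose th i := if i \in K then if z i == 0 then 0 else conjc (z i) * real_complex R (cabs (z i))^-1 else 0 : R[i].
have th1 i : cabs (th i) <= 1.
  rewrite /th; case: ifP => _; last by rewrite cabs0.
  case: eqVneq => [_|zi]; first by rewrite cabs0.
  rewrite cabsM cabs_conj cabs_real ger0_norm ?invr_ge0 ?cabs_ge0 // divff //.
  by rewrite gt_eqF // cabs_gt0.
have thz i : i \in K -> th i * z i = real_complex R (cabs (z i)).
  move=> iK; rewrite /th iK; case: eqVneq => [->|zi]; first by rewrite mulr0 cabs0.
  have zn : cabs (z i) != 0 by rewrite gt_eqF // cabs_gt0.
  rewrite mulrAC [conjc _ * _]mulrC mul_conjc -rmorphM /= expr2 -mulrA divff // mulr1 //.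
have := tcb_scale HA uJ (b := fun p => th p.1 * b p) (opb_diag ler01 th1 Hb).
rewrite mul1r.
have -> : pair_sec J A (fun p => th p.1 * b p) = real_complex R (\sum_(i <- K) cabs (z i)).
  rewrite /pair_sec.
  transitivity (\sum_(i <- J) th i * z i).
    by apply: eq_bigr => i _; rewrite mulr_sumr; apply: eq_bigr => j _; rewrite mulrCA.
  rewrite (big_subset_supp uK uJ KJ) => [|i _ iK]; last by rewrite /th (negbTE iK) mul0r.
  by rewrite real_complex_sum; apply: eq_big_seq => i iK; rewrite thz.
rewrite cabs_real ger0_norm; last by apply: sumr_ge0 => i _; exact: cabs_ge0.
move=> h; apply: le_trans (_ : \sum_(i <- K) (cabs (z i) + e) <= _).
  rewrite !big_seq; apply: ler_sum => i iK.
  by apply: (le_trans (cabs_le_dist _ (z i))); rewrite lerD2l cabsBC HJ.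
by rewrite big_split /= big_const_seq count_predT iter_addr addr0 -[X in _ + X <= _]mulr_natl lerD2r.
Qed.

Lemma trace_pairingE A c b d : tcb A c -> opb (fun i j => b (i, j)) d ->
  exists2 r : I -> R[i], (forall i, has_sum (fun k => A (i, k) * b (i, k)) (r i)) &
    has_sum r (trace_pairing (A : cfun R (I * I)%type) b).
Proof.
move=> HA Hb; have [r Hr rb] := pair_sec_le_row HA Hb; exists r => //.
have [s Hs _] := has_sum_abs rb.
suff -> : trace_pairing (A : cfun R (I * I)%type) b = s by [].
apply: csumE; apply: eq_has_sum Hs => i; apply/esym/csumE; exact: Hr.
Qed.

Lemma trace_pairing_le A c b d : tcb A c -> opb (fun i j => b (i, j)) d ->
  cabs (trace_pairing (A : cfun R (I * I)%type) b) <= c * d.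
Proof.
move=> HA Hb; have [r Hr rb] := pair_sec_le_row HA Hb.
have [s Hs ns] := has_sum_abs rb.
suff -> : trace_pairing (A : cfun R (I * I)%type) b = s by [].
apply: csumE; apply: eq_has_sum Hs => i; apply/esym/csumE; exact: Hr.
Qed.

Lemma trace_pairingB A c b b' d d' : tcb A c -> opb (fun i j => b (i, j)) d ->
  opb (fun i j => b' (i, j)) d' ->
  trace_pairing (A : cfun R (I * I)%type) (fun p => b p - b' p) =
  trace_pairing (A : cfun R (I * I)%type) b - trace_pairing (A : cfun R (I * I)%type) b'.
Proof.
move=> HA Hb Hb'.
have [r Hr hr] := trace_pairingE HA Hb; have [r' Hr' hr'] := trace_pairingE HA Hb'.
apply: csumE; apply: eq_has_sum (has_sumD hr (has_sumN hr')) => i.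
apply/esym/csumE; apply: eq_has_sum (has_sumD (Hr i) (has_sumN (Hr' i))) => k.
by rewrite /mtr mulrBr.
Qed.

Lemma trace_pairing_sec A b J : uniq J ->
  trace_pairing (A : cfun R (I * I)%type) (fun p => sub_section (fun i j => b (i, j)) J p.1 p.2) =
  pair_sec J A b.
Proof.
move=> uJ; apply: csumE.
rewrite (_ : pair_sec J A b = \sum_(i <- J) csum (fun k => A (i, k) *
   mtr (fun p => sub_section (fun i j => b (i, j)) J p.1 p.2) (k, i))).
  apply: has_sum_fin => // i iJ; apply: csum_eq0 => k.
  by rewrite /mtr /sub_section /= (negbTE iJ) mulr0.
apply: eq_big_seq => i iJ; apply/esym/csumE.
rewrite (_ : \sum_(j <- J) _ = \sum_(j <- J) A (i, j) *
   mtr (fun p => sub_section (fun i j => b (i, j)) J p.1 p.2) (j, i)).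
  by apply: has_sum_fin => // j jJ; rewrite /mtr /sub_section /= (negbTE jJ) andbF mulr0.
by apply: eq_big_seq => j jJ; rewrite /mtr /sub_section /= iJ jJ.
Qed.

(** Finite sections of the compact [b] converge to it in norm, so the infinite trace is a limit of
    finite pairings. *)
Lemma trace_pairing_lim A c b (e : R) : tcb A c -> capprox b -> 0 < e ->
  exists2 J0, uniq J0 & forall J, uniq J -> {subset J0 <= J} ->
  cabs (trace_pairing (A : cfun R (I * I)%type) b - pair_sec J A b) <= e.
Proof.
move=> HA [[d Hb] cb] e0; have c0 : 0 <= c by case: HA.
have k1 : 0 < 2 * (c + 1) by rewrite mulr_gt0 // ltr_wpDl.
have e1 : 0 < e / (2 * (c + 1)) by rewrite divr_gt0.
have [J0 HJ0] := cb _ e1; exists (undup J0) => [|J uJ JJ]; first exact: undup_uniq.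
have HJ := opb_co_section (fun t h => JJ t (etrans (mem_undup _ _) h)) HJ0.
rewrite -trace_pairing_sec // -(trace_pairingB HA Hb (opb_sub_section J Hb)).
apply: (le_trans (trace_pairing_le HA HJ)).
set f := e / _ in e1 *; have -> : e = 2 * (c + 1) * f.
  by rewrite /f; field; rewrite gt_eqF // ltr_wpDl.
lra.
Qed.

End TraceClass.

(** * Matrices over the endpoint spaces *)

Section MatrixBounds.
Context {R : realType} {I : choiceType}.
Local Notation mat := (cfun R (I * I)%type).

(* [sib] and [s1b] bound the norms of a [K]-indexed matrix over [S_infty] and [S_1]. *)
Definition sib (K : eqType) (x : K -> K -> mat) (c : R) :=
  opb (fun p q : K * I => x p.1 q.1 (p.2, q.2)) c.

Definition s1b (K : eqType) (x : K -> K -> mat) (c : R) := 0 <= c /\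
  forall (L : finType) (b : L -> L -> mat) (J : seq I), uniq J -> sib b 1 ->
    opb (fun p q : K * L => pair_sec J (x p.1 q.1) (b p.2 q.2)) c.

Definition linform (phi : mat -> R[i]) :=
  (forall A B, phi (A + B) = phi A + phi B) /\ (forall (z : R[i]) A, phi (z *: A) = z * phi A).

Lemma linform_entry p : linform (fun A => A p).
Proof. by []. Qed.

Lemma linform_pair J b : linform (fun A => pair_sec J A b).
Proof.
split=> [A B|z A]; rewrite /pair_sec.
  rewrite -big_split; apply: eq_bigr => i _; rewrite -big_split; apply: eq_bigr => j _.
  exact: mulrDl.
rewrite mulr_sumr; apply: eq_bigr => i _; rewrite mulr_sumr; apply: eq_bigr => j _.
by rewrite mulrA.
Qed.

Lemma linform0 phi : linform phi -> phi 0 = 0.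
Proof. by move=> [_ h]; rewrite -(scale0r (0 : mat)) h mul0r. Qed.

Lemma linform_sum phi (T : Type) (r : seq T) (F : T -> mat) : linform phi ->
  phi (\sum_(t <- r) F t) = \sum_(t <- r) phi (F t).
Proof.
move=> Hp; elim: r => [|t r IH]; first by rewrite !big_nil linform0.
by rewrite !big_cons Hp.1 IH.
Qed.

Section Family.
Variables (L : eqType) (phi : L -> L -> mat -> R[i]).
Hypothesis lphi : forall l l', linform (phi l l').

(** Stated for a family of linear forms so that matrix entries, which compute the norm of [S_infty],
    and pairings with a test matrix, which compute that of [S_one], share one proof. *)
Lemma family_amx m n (a : 'M[R[i]]_(m, n)) (x : 'M[mat]_n) (b : 'M[R[i]]_(n, m)) al be c :
  opb (fun i j => a i j) al -> opb (fun i j => b i j) be ->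
  opb (fun p q : 'I_n * L => phi p.2 q.2 (x p.1 q.1)) c ->
  opb (fun p q : 'I_m * L => phi p.2 q.2 (amx a x b p.1 q.1)) (al * c * be).
Proof.
move=> Ha Hb Hx; apply: eq_opb (opb_rmul Hb (opb_lmul Ha Hx)) => p q /=.
rewrite /amx mxE linform_sum //.
under [RHS]eq_bigr do rewrite linform_sum //.
rewrite exchange_big /=; apply: eq_bigr => l _; rewrite mulr_suml.
by apply: eq_bigr => k _; rewrite (lphi _ _).2; ring.
Qed.

Lemma family_block m n (x : 'M[mat]_m) (y : 'M[mat]_n) c :
  opb (fun p q : 'I_m * L => phi p.2 q.2 (x p.1 q.1)) c ->
  opb (fun p q : 'I_n * L => phi p.2 q.2 (y p.1 q.1)) c ->
  opb (fun p q : 'I_(m + n) * L => phi p.2 q.2 (block_mx x 0 0 y p.1 q.1)) c.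
Proof.
move=> Hx Hy.
pose col (p : 'I_(m + n) * L) := if fintype.split p.1 is inl _ then true else false.
have z l l' : phi l l' 0 = 0 by exact: linform0.
have cE (p : 'I_(m + n) * L) : (exists i, p.1 = lshift n i /\ col p = true) \/
    (exists i, p.1 = rshift m i /\ col p = false).
  rewrite /col; case: fintype.splitP => i pi; [left|right]; exists i; split=> //; exact: val_inj.
apply: (@opb_dsum _ _ _ _ col col) => [|p q|d]; first exact: opb_ge0 Hx.
  have [[i [-> ->]]|[i [-> ->]]] := cE p; have [[j [-> ->]]|[j [-> ->]]] := cE q => // _.
    by rewrite block_mxEur mxE z.
  by rewrite block_mxEdl mxE z.
case: d.
  pose f (p : 'I_(m + n) * L) := if fintype.split p.1 is inl i then Some (i, p.2) else None.
  have fi s1 s2 : f s1 != None -> f s1 = f s2 -> s1 = s2.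
    move: s1 s2 => [i l] [j l']; rewrite /f /=; case: fintype.splitP => // i' ii _.
    by case: fintype.splitP => // j' jj [ij ->]; congr (_, _); apply: val_inj; rewrite /= ii ij -jj.
  have := opb_pinj fi fi Hx; apply: eq_opb => p q; rewrite /f /col.
  case: p => i l; case: q => j l' /=; case: fintype.splitP => [i' ii|//]; case: fintype.splitP => [j' jj|//] /=.
  have -> : i = lshift n i' by exact: val_inj.
  have -> : j = lshift n j' by exact: val_inj.
  by rewrite block_mxEul.
pose f (p : 'I_(m + n) * L) := if fintype.split p.1 is inr i then Some (i, p.2) else None.
have fi s1 s2 : f s1 != None -> f s1 = f s2 -> s1 = s2.
  move: s1 s2 => [i l] [j l']; rewrite /f /=; case: fintype.splitP => // i' ii _.
  by case: fintype.splitP => // j' jj [ij ->]; congr (_, _); apply: val_inj; rewrite /= ii ij -jj.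
have := opb_pinj fi fi Hy; apply: eq_opb => p q; rewrite /f /col.
case: p => i l; case: q => j l' /=; case: fintype.splitP => [//|i' ii]; case: fintype.splitP => [//|j' jj] /=.
have -> : i = rshift m i' by exact: val_inj.
have -> : j = rshift m j' by exact: val_inj.
by rewrite block_mxEdr.
Qed.

(** A crude bound, used to show that norms are finite and that norm conditions may be checked entry
    by entry. *)
Lemma family_entries (K : finType) (x : K -> K -> mat) (c : K -> K -> R) :
  (forall k k', opb (fun l l' => phi l l' (x k k')) (c k k')) ->
  opb (fun p q : K * L => phi p.2 q.2 (x p.1 q.1)) (\sum_k \sum_k' c k k').
Proof.
move=> H.
pose f k (p : K * L) := if p.1 == k then Some p.2 else None.
have fi k s1 s2 : f k s1 != None -> f k s1 = f k s2 -> s1 = s2.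
  move: s1 s2 => [i l] [j l']; rewrite /f /=; case: (eqVneq i k) => [->|//] _.
  by case: (eqVneq j k) => [->|//] [->].
have h : opb (fun p q : K * L => \sum_(k <- index_enum K) \sum_(k' <- index_enum K)
   (if f k p is Some l then if f k' q is Some l' then phi l l' (x k k') else 0 else 0))
   (\sum_(k <- index_enum K) \sum_(k' <- index_enum K) c k k').
  by apply: opb_sum => k; apply: opb_sum => k'; apply: opb_pinj (H k k'); exact: fi.
apply: (eq_opb _ h) => -[i l] [j l'] /=.
rewrite (bigD1 i) //= [X in _ + X]big1 ?addr0 => [|k ki]; last first.
  by rewrite big1 // => k' _; rewrite /f /= eq_sym (negbTE ki).
rewrite (bigD1 j) //= [X in _ + X]big1 ?addr0 => [|k kj]; last first.
  by rewrite /f /= eqxx eq_sym (negbTE kj).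
by rewrite /f /= !eqxx.
Qed.

End Family.

Lemma sib_reindex (K K' : eqType) (f : K' -> K) (x : K -> K -> mat) c : injective f ->
  sib x c -> sib (fun k k' => x (f k) (f k')) c.
Proof.
move=> fi H; have gi : injective (fun p : K' * I => (f p.1, p.2)).
  by move=> [? ?] [? ?] [/fi -> ->].
exact: (opb_inj gi gi H).
Qed.

Lemma s1b_reindex (K K' : eqType) (f : K' -> K) (x : K -> K -> mat) c : injective f ->
  s1b x c -> s1b (fun k k' => x (f k) (f k')) c.
Proof.
move=> fi [c0 H]; split=> // L b J uJ Hb.
have gi : injective (fun p : K' * L => (f p.1, p.2)).
  by move=> [? ?] [? ?] [/fi -> ->].
exact: (opb_inj gi gi (H L b J uJ Hb)).
Qed.

Lemma sib_entry (K : eqType) (x : K -> K -> mat) c k k' : sib x c ->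
  opb (fun i j => x k k' (i, j)) c.
Proof.
have gi (k0 : K) : injective (fun i : I => (k0, i)) by move=> ? ? [].
by move=> H; exact: (opb_inj (gi k) (gi k') H).
Qed.

Lemma sib_scale (K : eqType) (x : K -> K -> mat) c (z : R[i]) : sib x c ->
  sib (fun k k' => z *: x k k') (cabs z * c).
Proof. exact: opb_scale. Qed.

Lemma s1b_test (K : eqType) (x : K -> K -> mat) c (L : finType) (b : L -> L -> mat) d J :
  uniq J -> s1b x c -> sib b d ->
  opb (fun p q : K * L => pair_sec J (x p.1 q.1) (b p.2 q.2)) (c * d).
Proof.
move=> uJ [c0 H] Hb; have d0 := opb_ge0 Hb.
apply: opb_eps => [|e e0]; first exact: mulr_ge0.
have c1 : 0 < c + 1 by rewrite ltr_wpDl.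
pose f := e / (c + 1); have f0 : 0 < f by rewrite divr_gt0.
have df : 0 < d + f by rewrite ltr_wpDl.
have Hb' : sib (fun l l' => real_complex R (d + f)^-1 *: b l l') 1.
  apply: (opb_le _ (sib_scale _ Hb)); rewrite cabs_real ger0_norm ?invr_ge0 ?(ltW df) //.
  by rewrite mulrC ler_pdivrMr // mul1r lerDl ltW.
apply: (opb_le _ (eq_opb _ (opb_scale (real_complex R (d + f)) (H L _ J uJ Hb')))).
  rewrite cabs_real ger0_norm ?(ltW df) // mulrC mulrDr lerD2l /f mulrCA.
  by rewrite -[leRHS]mulr1 ler_pM2l // ler_pdivrMr // mul1r lerDl ler01.
move=> p q; rewrite (pair_secZ _ _ (b p.2 q.2)) mulrA -rmorphM /= divff ?gt_eqF //.
by rewrite mul1r.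
Qed.

Lemma sqn_allpairs (S T : Type) (J : seq S) (K : seq T) (x : S -> R[i]) (y : T -> R[i]) :
  sqn (allpairs pair J K) (fun p => x p.1 * y p.2) = sqn J x * sqn K y.
Proof.
rewrite /sqn big_allpairs_dep /= mulr_suml; apply: eq_bigr => s _; rewrite mulr_sumr.
by apply: eq_bigr => t _; rewrite cabsM exprMn.
Qed.

(* A bounded functional on the compacts is completely bounded with the same bound. *)
Lemma tcb_cb (A : mat) c (L : finType) (b : L -> L -> mat) J : uniq J -> tcb A c ->
  sib b 1 -> opb (fun l l' => pair_sec J A (b l l')) c.
Proof.
move=> uJ HA Hb; have c0 : 0 <= c by case: HA.
apply: opb_bil_conv => // J1 K1 x y uJ1 uK1.
pose b' p := \sum_(l <- J1) \sum_(l' <- K1) b l l' p * x l' * y l.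
set a := Num.sqrt (sqn K1 x) * Num.sqrt (sqn J1 y).
have a0 : 0 <= a by rewrite mulr_ge0 ?sqrtr_ge0.
have Hb' : opb (fun i j => b' (i, j)) a.
  apply: opb_bil_conv => // M N xi eta uM uN.
  have up (U V : eqType) (s : seq U) (t : seq V) : uniq s -> uniq t -> uniq (allpairs pair s t).
    by move=> us ut; apply: allpairs_uniq => // -[? ?] [].
  have := opb_bil (fun p => x p.1 * xi p.2) (fun p => y p.1 * eta p.2) Hb
    (up _ _ _ _ uJ1 uM) (up _ _ _ _ uK1 uN).
  rewrite !sqn_allpairs expr1n mul1r big_allpairs_dep.
  have -> : a ^+ 2 * sqn N xi * sqn M eta = sqn K1 x * sqn N xi * (sqn J1 y * sqn M eta).
    by rewrite /a exprMn !sqr_sqrtr ?sqn_ge0 //; ring.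
  congr (cabs _ ^+ 2 <= _).
  rewrite exchange_big /=; apply: eq_bigr => i _.
  under eq_bigr do rewrite big_allpairs_dep exchange_big /=.
  rewrite exchange_big /=; apply: eq_bigr => j _.
  rewrite /b' mulr_suml mulr_suml; apply: eq_bigr => l _.
  by rewrite mulr_suml mulr_suml; apply: eq_bigr => l' _; ring.
have -> : \sum_(l <- J1) \sum_(l' <- K1) pair_sec J A (b l l') * x l' * y l = pair_sec J A b'.
  rewrite /pair_sec /b'.
  under [RHS]eq_bigr do under eq_bigr do rewrite mulr_sumr.
  under [RHS]eq_bigr do rewrite exchange_big /=.
  rewrite [RHS]exchange_big /=; apply: eq_bigr => l _.
  under [RHS]eq_bigr do under eq_bigr do rewrite mulr_sumr.
  under [RHS]eq_bigr do rewrite exchange_big /=.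
  rewrite [RHS]exchange_big /=; apply: eq_bigr => l' _.
  rewrite mulr_suml mulr_suml; apply: eq_bigr => i _.
  by rewrite mulr_suml mulr_suml; apply: eq_bigr => j _; ring.
have h := tcb_scale HA uJ Hb'.
have -> : c ^+ 2 * sqn K1 x * sqn J1 y = (c * a) ^+ 2.
  by rewrite /a !exprMn !sqr_sqrtr ?sqn_ge0 //; ring.
by rewrite ler_pXn2r ?nnegrE ?cabs_ge0 ?mulr_ge0.
Qed.

Lemma s1b_entries (K : finType) (x : K -> K -> mat) (c : K -> K -> R) :
  (forall k k', tcb (x k k') (c k k')) -> s1b x (\sum_k \sum_k' c k k').
Proof.
move=> H; split=> [|L b J uJ Hb].
  by apply: sumr_ge0 => k _; apply: sumr_ge0 => k' _; case: (H k k').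
apply: (@family_entries L (fun l l' A => pair_sec J A (b l l'))) => k k'.
exact: tcb_cb.
Qed.

Lemma s1b_tcb (K : eqType) (x : K -> K -> mat) c k k' : s1b x c -> tcb (x k k') c.
Proof.
move=> [c0 H]; split=> // b J uJ Hb.
have Hb' : sib (fun _ _ : unit => b) 1.
  have gi : injective (fun p : unit * I => p.2) by move=> [[] ?] [[] ?] /= ->.
  exact: (opb_inj gi gi Hb).
exact: (opb_entry (k, tt) (k', tt) (H _ _ J uJ Hb')).
Qed.

Lemma sib_schur (K K' : eqType) (x : K -> K -> mat) (y : K' -> K' -> mat) c d :
  sib x c -> sib y d -> sib (fun p q : K * K' => schur (x p.1 q.1) (y p.2 q.2)) (c * d).
Proof.
move=> Hx Hy.
have gi : injective (fun p : (K * K') * I => ((p.1.1, p.2), (p.1.2, p.2))).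
  by move=> [[? ?] ?] [[? ?] ?] [-> -> ->].
exact: (opb_inj gi gi (opb_tens Hx Hy)).
Qed.

Lemma pair_sec_schur (J : seq I) (A B b : mat) : pair_sec J (schur A B) b = pair_sec J B (schur A b).
Proof.
by apply: eq_bigr => i _; apply: eq_bigr => j _; rewrite /schur mulrAC mulrC mulrA mulrC.
Qed.

(** By [pair_sec_schur] the factor [x] moves onto the test matrix, where [sib_schur] applies. *)
Lemma sib_s1b_schur (K : finType) (K' : eqType) (x : K -> K -> mat) (y : K' -> K' -> mat) c d :
  sib x c -> s1b y d -> s1b (fun p q : K * K' => schur (x p.1 q.1) (y p.2 q.2)) (c * d).
Proof.
move=> Hx Hy; have c0 := opb_ge0 Hx; have [d0 _] := Hy.
split=> [|L b J uJ Hb]; first exact: mulr_ge0.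
have Hb' := sib_schur Hx Hb; rewrite mulr1 in Hb'.
have gi : injective (fun p : (K * K') * L => (p.1.2, (p.1.1, p.2))).
  by move=> [[? ?] ?] [[? ?] ?] [-> -> ->].
have := opb_inj gi gi (s1b_test uJ Hy Hb'); rewrite mulrC.
by apply: eq_opb => p q /=; rewrite pair_sec_schur.
Qed.

(** It is enough that the Schur product of [y] and [b] be a test matrix of norm at most [d], for
    then it can be paired with [x]. Its entries are the pairings of [y] with the pieces of [b]
    supported at single positions; these pieces form one larger test matrix [D] of norm at most 1,
    to which the complete bound of [y] applies. *)
Lemma s1b_schur (K : eqType) (K' : finType) (x : K -> K -> mat) (y : K' -> K' -> mat) c d :
  s1b x c -> s1b y d -> s1b (fun p q : K * K' => schur (x p.1 q.1) (y p.2 q.2)) (c * d).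
Proof.
move=> Hx Hy; have [c0 _] := Hx; have [d0 _] := Hy.
split=> [|L b J uJ Hb]; first exact: mulr_ge0.
(* [y] applied to the compression of [b] to the diagonal of [I * J] *)
pose ix (m : 'I_(size J)) := tnth (in_tuple J) m.
have ixJ m : ix m \in J by exact: mem_tnth.
have ix_inj : injective ix by move=> m m' /(tuple_uniqP (in_tuple J)); apply.
pose D (p q : L * 'I_(size J)) : mat := fun ij =>
  if (ix p.2 == ij.1) && (ix q.2 == ij.2) then b p.1 q.1 ij else 0.
have HD : sib D 1.
  pose f (p : (L * 'I_(size J)) * I) := if ix p.1.2 == p.2 then Some (p.1.1, p.2) else None.
  have fi s1 s2 : f s1 != None -> f s1 = f s2 -> s1 = s2.
    move: s1 s2 => [[l m] i] [[l' m'] i']; rewrite /f /=; case: (ix m =P i) => // <- _.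
    by case: (ix m' =P i') => // <- [-> /ix_inj ->].
  apply: eq_opb (opb_pinj fi fi Hb) => -[[l m] i] [[l' m'] j]; rewrite /f /D /=.
  by case: eqP => //= _; case: eqP.
have HDy := s1b_test uJ Hy HD; rewrite mulr1 in HDy.
pose b' (p q : K' * L) : mat := fun ij =>
  if (ij.1 \in J) && (ij.2 \in J) then y p.1 q.1 ij * b p.2 q.2 ij else 0.
have Hb' : sib b' d.
  pose f (p : (K' * L) * I) : option (K' * (L * 'I_(size J))) :=
    omap (fun m => (p.1.1, (p.1.2, m))) (insub (index p.2 J)).
  have fE k l i : f ((k, l), i) = if i \in J then f ((k, l), i) else None.
    by case: ifPn => // iJ; rewrite /f /= insubF // index_mem; apply/negbTE.
  have fS k l i : i \in J -> exists2 m, f ((k, l), i) = Some (k, (l, m)) & ix m = i.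
    move=> iJ; have iJ' : (index i J < size J)%N by rewrite index_mem.
    exists (Ordinal iJ'); first by rewrite /f /= insubT.
    by rewrite /ix (tnth_nth i) /= nth_index.
  have fi s1 s2 : f s1 != None -> f s1 = f s2 -> s1 = s2.
    move: s1 s2 => [[k l] i] [[k' l'] i']; rewrite fE (fE k').
    case: ifPn => // iJ _; case: ifPn => i'J; have [m -> mi] := fS k l i iJ => //.
    by have [m' -> mi'] := fS k' l' i' i'J => -[-> -> mm]; rewrite -mi -mi' mm.
  apply: eq_opb (opb_pinj fi fi HDy) => -[[k l] i] [[k' l'] j]; rewrite /b' /=.
  rewrite fE; case: (boolP (i \in J)) => //= iJ; have [m -> mi] := fS k l i iJ.
  rewrite fE; case: (boolP (j \in J)) => //= jJ; have [m' -> mj] := fS k' l' j jJ.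
  rewrite /= /pair_sec (bigD1_seq i) //= [X in _ + X]big1 ?addr0 => [|i' ii]; last first.
    by rewrite big1 // => j' _; rewrite /D /= mi eq_sym (negbTE ii) mulr0.
  rewrite (bigD1_seq j) //= [X in _ + X]big1 ?addr0 => [|j' jj]; last first.
    by rewrite /D /= mi mj eqxx eq_sym (negbTE jj) mulr0.
  by rewrite /D /= mi mj !eqxx.
have gi : injective (fun p : (K * K') * L => (p.1.1, (p.1.2, p.2))).
  by move=> [[? ?] ?] [[? ?] ?] [-> -> ->].
apply: eq_opb (opb_inj gi gi (s1b_test uJ Hx Hb')) => p q /=.
rewrite /pair_sec; apply: eq_big_seq => i iJ; apply: eq_big_seq => j jJ.
by rewrite /b' /= iJ jJ /= /schur mulrA.
Qed.

End MatrixBounds.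

(** * Abstract operator spaces *)

Section Matrices.
Context {R : realType}.
Local Notation C := R[i].

Definition opm m n (a : 'M[C]_(m, n)) (c : R) := opb (fun i j => a i j) c.

Lemma mxopnormP m n (a : 'M[C]_(m, n)) c : (mxopnorm a <= c%:E)%E <-> opm a c.
Proof. exact: opnormP. Qed.

Lemma opb_unit1 (z : C) : opb (fun _ _ : unit => z) (cabs z).
Proof.
have h : opb (fun _ _ : unit => z * 1) (cabs z * 1) by apply: opb_scale; exact: opb_idm.
by rewrite !mulr1 in h; apply: eq_opb h => ? ?; rewrite ?mulr1.
Qed.

Lemma opb_fin (S T : finType) (a : S -> T -> C) :
  opb a (\sum_(s <- index_enum S) \sum_(t <- index_enum T) cabs (a s t)).
Proof.
pose h s t (s' : S) (t' : T) : C := if (s' == s) && (t' == t) then a s t else 0.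
have H s t : opb (h s t) (cabs (a s t)).
  pose f (U : eqType) (u u' : U) := if u' == u then Some tt else None.
  have fi (U : eqType) (u s1 s2 : U) : f U u s1 != None -> f U u s1 = f U u s2 -> s1 = s2.
    by rewrite /f; case: (eqVneq s1 u) => // -> _; case: (eqVneq s2 u) => // ->.
  have := opb_pinj (fi S s) (fi T t) (opb_unit1 (a s t)).
  by apply: eq_opb => s' t'; rewrite /h /f; case: eqP => //= _; case: eqP.
have := @opb_sum _ _ _ _ (index_enum S) _ _ (fun s => @opb_sum _ _ _ _ (index_enum T) _ _ (H s)).
apply: eq_opb => s t; rewrite (bigD1 s) //= [X in _ + X]big1 ?addr0 => [|s' ss]; last first.
  by rewrite big1 // => t' _; rewrite /h eq_sym (negbTE ss).
rewrite (bigD1 t) //= [X in _ + X]big1 ?addr0 => [|t' tt']; first by rewrite /h !eqxx.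
by rewrite /h [t == t']eq_sym (negbTE tt') andbF.
Qed.

Lemma mxopnorm_fin m n (a : 'M[C]_(m, n)) : exists2 c, mxopnorm a = c%:E & 0 <= c.
Proof.
have := (mxopnormP _ _).2 (opb_fin a).
have : (0 <= mxopnorm a)%E by exact: opnorm_ge0.
by case: (mxopnorm a) => // c; rewrite lee_fin; exists c.
Qed.

Lemma opm_scalar n (z : C) : opm (z%:M : 'M[_]_n) (cabs z).
Proof.
have h : opb (fun s t : 'I_n => z * @idm _ _ s t) (cabs z * 1).
  by apply: opb_scale; exact: opb_idm.
rewrite mulr1 in h; rewrite /opm; apply: eq_opb h => s t; rewrite mxE /idm.
by case: eqP; rewrite ?mulr1 ?mulr0.
Qed.

Lemma opm_row n (s t : R) :
  opm (row_mx (real_complex R s)%:M (real_complex R t)%:M : 'M[_]_(n, n + n))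
    (Num.sqrt (s ^+ 2 + t ^+ 2)).
Proof.
pose w (d : bool) : C := real_complex R (if d then s else t).
have Hw : opb (fun (d : bool) (_ : unit) => w d) (Num.sqrt (s ^+ 2 + t ^+ 2)).
  apply: opb_col1 => [|J uJ]; rewrite ?sqrtr_ge0 // sqr_sqrtr ?addr_ge0 ?sqr_ge0 //.
  have sub : {subset J <= [:: true; false]} by case.
  apply: (le_trans (sqn_subset _ uJ sub)).
  by rewrite /sqn !big_cons big_nil addr0 /w !cabs_real !real_normK ?num_real.
have := opb_tens (opb_tr Hw) (@opb_idm R 'I_n); rewrite mulr1.
pose g (i : 'I_(n + n)) : bool * 'I_n :=
  match fintype.split i with inl j => (true, j) | inr j => (false, j) end.
have gi : injective g.
  move=> i j; rewrite /g; case: fintype.splitP => i' ii; case: fintype.splitP => j' jj //= [ij];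
  by apply: val_inj; rewrite /= ii jj ij.
have fi : injective (fun i : 'I_n => (tt, i)) by move=> ? ? [].
move=> h; apply: eq_opb (opb_inj fi gi h) => i j; rewrite /g mxE.
by case: fintype.splitP => j' jj /=; rewrite mxE /w /idm; case: eqP; rewrite ?mulr1 ?mulr0.
Qed.

Lemma opm_tr m n (a : 'M[C]_(m, n)) c : opm a c -> opm a^T c.
Proof. by move=> /opb_tr; apply: eq_opb => s t; rewrite mxE. Qed.

Lemma opm_row_delta n (i : 'I_n) : opm (delta_mx 0 i : 'M[C]_(1, n)) 1.
Proof.
have fi : injective (fun _ : 'I_1 => i) by move=> x y; rewrite !ord1.
have := opb_inj fi (@inj_id _) (@opb_idm R 'I_n); rewrite /opm; apply: eq_opb => s t.
by rewrite mxE ord1 /idm eqxx eq_sym; case: eqP.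
Qed.

Lemma opm_col_delta n (i : 'I_n) : opm (delta_mx i 0 : 'M[C]_(n, 1)) 1.
Proof. by rewrite -trmx_delta; apply: opm_tr; exact: opm_row_delta. Qed.

Lemma opm_mul m n k (a : 'M[C]_(m, n)) (b : 'M[C]_(n, k)) al be : opm a al -> opm b be ->
  opm (a *m b) (al * be).
Proof.
move=> Ha Hb; apply: eq_opb (opb_mul (index_enum_uniq _) Ha Hb) => i j.
by rewrite mxE.
Qed.

Lemma opm_block m n m' n' (a : 'M[C]_(m, n)) (b : 'M[C]_(m', n')) c : opm a c -> opm b c ->
  opm (block_mx a 0 0 b) c.
Proof.
move=> Ha Hb.
pose cl k k' (i : 'I_(k + k')) := if fintype.split i is inl _ then true else false.
apply: (@opb_dsum _ _ _ _ (cl m m') (cl n n')) => [|p q|d]; first exact: opb_ge0 Ha.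
  rewrite /cl !mxE; case: fintype.splitP => i _; rewrite !mxE;
  by case: fintype.splitP => j _ //; rewrite mxE.
case: d.
  pose f k k' (i : 'I_(k + k')) := if fintype.split i is inl j then Some j else None.
  have fi k k' s1 s2 : f k k' s1 != None -> f k k' s1 = f k k' s2 -> s1 = s2.
    rewrite /f; case: fintype.splitP => // i ii _; case: fintype.splitP => // j jj [ij].
    by apply: val_inj; rewrite /= ii jj ij.
  have := opb_pinj (@fi m m') (@fi n n') Ha; apply: eq_opb => p q; rewrite /f /cl !mxE.
  by case: fintype.splitP => i _; rewrite !mxE //; case: fintype.splitP.
pose f k k' (i : 'I_(k + k')) := if fintype.split i is inr j then Some j else None.
have fi k k' s1 s2 : f k k' s1 != None -> f k k' s1 = f k k' s2 -> s1 = s2.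
  rewrite /f; case: fintype.splitP => // i ii _; case: fintype.splitP => // j jj [ij].
  by apply: val_inj; rewrite /= ii jj ij.
have := opb_pinj (@fi m m') (@fi n n') Hb; apply: eq_opb => p q; rewrite /f /cl !mxE.
by case: fintype.splitP => i _; rewrite !mxE //; case: fintype.splitP.
Qed.

End Matrices.

Section Amx.
Context {R : realType} {X : Type}.
Local Notation C := R[i].
Local Notation V := (cfun R X).

Lemma amxA m n k n' k' m' (a : 'M[C]_(m, n)) (b : 'M[C]_(n, k)) (x : 'M[V]_(k, k'))
    (c : 'M[C]_(k', n')) (d : 'M[C]_(n', m')) :
  amx a (amx b x c) d = amx (a *m b) x (c *m d).
Proof.
apply/matrixP => i j; rewrite !mxE.
transitivity (\sum_p \sum_q \sum_r \sum_s (a i p * b p r * (c s q * d q j)) *: x r s).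
  apply: eq_bigr => p _; apply: eq_bigr => q _; rewrite mxE scaler_sumr; apply: eq_bigr => r _.
  by rewrite scaler_sumr; apply: eq_bigr => s _; rewrite scalerA; congr (_ *: _); ring.
under eq_bigr do rewrite exchange_big /=; rewrite exchange_big /=; apply: eq_bigr => r _.
under eq_bigr do rewrite exchange_big /=; rewrite exchange_big /=; apply: eq_bigr => s _.
rewrite !mxE mulr_suml scaler_suml; apply: eq_bigr => p _.
by rewrite mulr_sumr scaler_suml; apply: eq_bigr => q _.
Qed.

Lemma amxD m n n' m' (a : 'M[C]_(m, n)) (x y : 'M[V]_(n, n')) (b : 'M[C]_(n', m')) :
  amx a (x + y) b = amx a x b + amx a y b.
Proof.
apply/matrixP => i j; rewrite !mxE -big_split; apply: eq_bigr => k _ /=.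
by rewrite -big_split; apply: eq_bigr => l _ /=; rewrite mxE scalerDr.
Qed.

Lemma amxN m n n' m' (a : 'M[C]_(m, n)) (x : 'M[V]_(n, n')) (b : 'M[C]_(n', m')) :
  amx a (- x) b = - amx a x b.
Proof.
apply/matrixP => i j; rewrite !mxE -sumrN; apply: eq_bigr => k _.
by rewrite -sumrN; apply: eq_bigr => l _; rewrite mxE scalerN.
Qed.

Lemma amx_block m m' n k (a : 'M[C]_(m, n)) (a' : 'M[C]_(m, k)) (x : 'M[V]_n) (y : 'M[V]_k)
   (b : 'M[C]_(n, m')) (b' : 'M[C]_(k, m')) :
  amx (row_mx a a') (block_mx x 0 0 y) (col_mx b b') = amx a x b + amx a' y b'.
Proof.
apply/matrixP => i j; rewrite !mxE big_split_ord /=; congr (_ + _); apply: eq_bigr => p _.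
  rewrite big_split_ord /= [X in _ + X]big1 ?addr0 => [|q _]; last first.
    by rewrite block_mxEur [X in _ *: X]mxE scaler0.
  by apply: eq_bigr => q _; rewrite block_mxEul row_mxEl col_mxEu.
rewrite big_split_ord /= [X in X + _]big1 ?add0r => [|q _]; last first.
  by rewrite block_mxEdl [X in _ *: X]mxE scaler0.
by apply: eq_bigr => q _; rewrite block_mxEdr row_mxEr col_mxEd.
Qed.

Lemma amx_scalar n (z w : C) (x : 'M[V]_n) : amx z%:M x w%:M = smx (z * w) x.
Proof.
apply/matrixP => i j; rewrite !mxE (bigD1 i) //= [X in _ + X]big1 ?addr0 => [|p pi]; last first.
  by rewrite big1 // => q _; rewrite mxE eq_sym (negbTE pi) mulr0n mul0r scale0r.
rewrite (bigD1 j) //= [X in _ + X]big1 ?addr0 => [|q qj]; last first.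
  by rewrite [(w%:M) _ _]mxE (negbTE qj) mulr0n mulr0 scale0r.
by rewrite !mxE !eqxx !mulr1n.
Qed.

Lemma amx_delta n n' (x : 'M[V]_(n, n')) i j :
  amx (delta_mx 0 i : 'M[_]_(1, _)) x (delta_mx j 0 : 'M[_]_(_, 1)) = const_mx (x i j).
Proof.
apply/matrixP => s t; rewrite !mxE !ord1 (bigD1 i) //= [X in _ + X]big1 ?addr0 => [|p pi]; last first.
  by rewrite big1 // => q _; rewrite mxE (negbTE pi) andbF mul0r scale0r.
rewrite (bigD1 j) //= [X in _ + X]big1 ?addr0 => [|q qj]; last first.
  by rewrite [(delta_mx j 0) _ _]mxE (negbTE qj) mulr0 scale0r.
by rewrite !mxE !eqxx mulr1 scale1r.
Qed.

Lemma mx_sum_amx_delta n (x : 'M[V]_n) :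
  x = \sum_i \sum_j amx (delta_mx i 0) (const_mx (x i j) : 'M[_]_1) (delta_mx 0 j).
Proof.
apply/matrixP => s t; rewrite !summxE (bigD1 s) //= [X in _ + X]big1 ?addr0 => [|i si]; last first.
  rewrite summxE big1 // => j _; rewrite mxE big1 // => p _; rewrite big1 // => q _.
  by rewrite mxE eq_sym (negbTE si) mul0r scale0r.
rewrite summxE (bigD1 t) //= [X in _ + X]big1 ?addr0 => [|j tj]; last first.
  rewrite mxE big1 // => p _; rewrite big1 // => q _.
  by rewrite [(delta_mx 0 j) _ _]mxE [t == j]eq_sym (negbTE tj) andbF mulr0 scale0r.
by rewrite mxE !big_ord1 !mxE !eqxx mulr1 scale1r.
Qed.

(* One-sided bounds from which all the axioms follow, except separation and completeness:
   the triangle inequality is [nmD] below. *)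
Record preop (E : opspace R X) : Prop := Preop {
  po_0 : os_car E 0;
  po_D : forall a b, os_car E a -> os_car E b -> os_car E (a + b);
  po_Z : forall (c : C) a, os_car E a -> os_car E (c *: a);
  po_ge0 : forall n (x : 'M[V]_n), os_mx E x -> (0 <= os_norm E x)%E;
  po_fin : forall n (x : 'M[V]_n), os_mx E x -> (os_norm E x < +oo)%E;
  po_mul : forall m n (a : 'M[C]_(m, n)) (x : 'M[V]_n) (b : 'M[C]_(n, m)) al be c,
    os_mx E x -> opm a al -> opm b be -> (os_norm E x <= c%:E)%E ->
    (os_norm E (amx a x b) <= (al * c * be)%:E)%E;
  po_sum : forall m n (x : 'M[V]_m) (y : 'M[V]_n) c, os_mx E x -> os_mx E y ->
    (os_norm E x <= c%:E)%E -> (os_norm E y <= c%:E)%E ->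
    (os_norm E (block_mx x 0 0 y) <= c%:E)%E
}.

Definition nm (E : opspace R X) n (x : 'M[V]_n) : R := fine (os_norm E x).

Section Preop.
Variables (E : opspace R X) (HE : preop E).

Lemma nmE n (x : 'M[V]_n) : os_mx E x -> os_norm E x = (nm E x)%:E.
Proof.
move=> Hx; rewrite /nm fineK // ge0_fin_numE ?(po_ge0 HE) //; exact: po_fin HE _ _ Hx.
Qed.

Lemma nm_ge0 n (x : 'M[V]_n) : os_mx E x -> 0 <= nm E x.
Proof. by move=> Hx; rewrite -lee_fin -nmE //; exact: po_ge0 HE _ _ Hx. Qed.

Lemma car_sum (T : Type) (r : seq T) (P : pred T) (F : T -> V) :
  (forall t, os_car E (F t)) -> os_car E (\sum_(t <- r | P t) F t).
Proof. by move=> H; elim/big_ind: _ => //; [exact: po_0 HE|exact: po_D HE]. Qed.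

Lemma carN a : os_car E a -> os_car E (- a).
Proof. by rewrite -scaleN1r; exact: (po_Z HE). Qed.

Lemma mx0 n : os_mx E (0 : 'M[V]_n).
Proof. by move=> i j; rewrite mxE; exact: po_0 HE. Qed.

Lemma mxD n (x y : 'M[V]_n) : os_mx E x -> os_mx E y -> os_mx E (x + y).
Proof. by move=> Hx Hy i j; rewrite mxE; apply: (po_D HE). Qed.

Lemma mxN n (x : 'M[V]_n) : os_mx E x -> os_mx E (- x).
Proof. by move=> Hx i j; rewrite mxE; apply: carN. Qed.

Lemma mxB n (x y : 'M[V]_n) : os_mx E x -> os_mx E y -> os_mx E (x - y).
Proof. by move=> Hx Hy; apply: mxD => //; exact: mxN. Qed.

Lemma mxZ n z (x : 'M[V]_n) : os_mx E x -> os_mx E (smx z x).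
Proof. by move=> Hx i j; rewrite mxE; apply: (po_Z HE). Qed.

Lemma mx_amx m n (a : 'M[C]_(m, n)) (x : 'M[V]_n) (b : 'M[C]_(n, m)) : os_mx E x ->
  os_mx E (amx a x b).
Proof.
move=> Hx i j; rewrite mxE; apply: car_sum => k; apply: car_sum => l; apply: (po_Z HE).
exact: Hx.
Qed.

Lemma mx_block m n (x : 'M[V]_m) (y : 'M[V]_n) : os_mx E x -> os_mx E y ->
  os_mx E (block_mx x 0 0 y).
Proof.
move=> Hx Hy i j; rewrite !mxE; case: fintype.splitP => i' _; rewrite mxE;
by case: fintype.splitP => j' _; rewrite ?mxE //; exact: po_0 HE.
Qed.

Lemma mx_const a : os_car E a -> os_mx E (const_mx a : 'M[V]_1).
Proof. by move=> Ha i j; rewrite mxE. Qed.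

Lemma nm_mul m n (a : 'M[C]_(m, n)) (x : 'M[V]_n) (b : 'M[C]_(n, m)) al be :
  os_mx E x -> opm a al -> opm b be -> nm E (amx a x b) <= al * nm E x * be.
Proof.
move=> Hx Ha Hb; rewrite -lee_fin -nmE; last exact: mx_amx.
by apply: (po_mul HE) => //; rewrite nmE.
Qed.

Lemma nm_block m n (x : 'M[V]_m) (y : 'M[V]_n) c : os_mx E x -> os_mx E y ->
  nm E x <= c -> nm E y <= c -> nm E (block_mx x 0 0 y) <= c.
Proof.
move=> Hx Hy xc yc; rewrite -lee_fin -nmE; last exact: mx_block.
by apply: (po_sum HE) => //; rewrite nmE // lee_fin.
Qed.

Lemma nmZ_le n z (x : 'M[V]_n) : os_mx E x -> nm E (smx z x) <= cabs z * nm E x.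
Proof.
move=> Hx; rewrite -[z]mulr1 -amx_scalar.
apply: (le_trans (nm_mul Hx (opm_scalar _ z) (opm_scalar _ 1))).
by rewrite cabs1 !mulr1.
Qed.

Lemma smx0 n (x : 'M[V]_n) : smx 0 x = 0.
Proof. by apply/matrixP => i j; rewrite !mxE scale0r. Qed.

Lemma nm0 n : nm E (0 : 'M[V]_n) = 0.
Proof.
have := nmZ_le 0 (@mx0 n); rewrite smx0 cabs0 mul0r => h.
by apply/le_anti; rewrite h nm_ge0 //; exact: (@mx0 _).
Qed.

Lemma smxA n z w (x : 'M[V]_n) : smx z (smx w x) = smx (z * w) x.
Proof. by apply/matrixP => i j; rewrite !mxE scalerA. Qed.

Lemma smx1 n (x : 'M[V]_n) : smx 1 x = x.
Proof. by apply/matrixP => i j; rewrite !mxE scale1r. Qed.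

Lemma nmZ n z (x : 'M[V]_n) : os_mx E x -> nm E (smx z x) = cabs z * nm E x.
Proof.
move=> Hx; have [->|z0] := eqVneq z 0; first by rewrite smx0 nm0 cabs0 mul0r.
apply/le_anti; rewrite nmZ_le //=.
have zp : 0 < cabs z by rewrite cabs_gt0.
have := nmZ_le z^-1 (mxZ z Hx); rewrite smxA mulVf // smx1.
by rewrite -(ler_pM2l zp) mulrA -cabsM divff // cabs1 mul1r.
Qed.

Lemma smxN1 n (x : 'M[V]_n) : smx (-1) x = - x.
Proof. by apply/matrixP => i j; rewrite !mxE scaleN1r. Qed.

Lemma nmN n (x : 'M[V]_n) : os_mx E x -> nm E (- x) = nm E x.
Proof. by move=> Hx; rewrite -smxN1 nmZ // cabsN cabs1 mul1r. Qed.

(* [x + y] is a compression of [(x / a) (+) (y / b)] by the row [(sqrt a, sqrt b)]. *)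
Lemma nmD n (x y : 'M[V]_n) : os_mx E x -> os_mx E y -> nm E (x + y) <= nm E x + nm E y.
Proof.
move=> Hx Hy; have x0 := nm_ge0 Hx; have y0 := nm_ge0 Hy.
apply/ler_addgt0Pr => e e0.
(* The slack keeps both weights positive even when a norm is 0. *)
pose a := nm E x + e / 2; pose b := nm E y + e / 2.
have e2 : 0 < e / 2 by rewrite divr_gt0.
have a0 : 0 < a by rewrite ltr_wpDl.
have b0 : 0 < b by rewrite ltr_wpDl.
have -> : nm E x + nm E y + e = a + b by rewrite /a /b; field.
pose s := Num.sqrt a; pose t := Num.sqrt b.
have s2 : s ^+ 2 = a by rewrite sqr_sqrtr ?ltW.
have t2 : t ^+ 2 = b by rewrite sqr_sqrtr ?ltW.
have Hr := @opm_row R n s t; rewrite s2 t2 in Hr.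
have Hc := opm_tr Hr; rewrite tr_row_mx !tr_scalar_mx in Hc.
pose x' := smx (real_complex R a^-1) x; pose y' := smx (real_complex R b^-1) y.
have Hx' : os_mx E x' by exact: mxZ.
have Hy' : os_mx E y' by exact: mxZ.
have nx' : nm E x' <= 1.
  rewrite nmZ // cabs_real ger0_norm ?invr_ge0 ?(ltW a0) // mulrC ler_pdivrMr // mul1r.
  by rewrite lerDl ltW.
have ny' : nm E y' <= 1.
  rewrite nmZ // cabs_real ger0_norm ?invr_ge0 ?(ltW b0) // mulrC ler_pdivrMr // mul1r.
  by rewrite lerDl ltW.
have := nm_mul (mx_block Hx' Hy') Hr Hc; rewrite amx_block !amx_scalar !smxA -!rmorphM /=.
rewrite -!expr2 s2 t2 !divff ?gt_eqF // !smx1 => h; apply: (le_trans h).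
have ab0 : 0 <= a + b by rewrite addr_ge0 // ltW.
rewrite -[leRHS](sqr_sqrtr ab0) expr2 mulrAC ler_piMr ?mulr_ge0 ?sqrtr_ge0 //.
exact: nm_block.
Qed.

Lemma nmBC n (x y : 'M[V]_n) : os_mx E x -> os_mx E y -> nm E (x - y) = nm E (y - x).
Proof. by move=> Hx Hy; rewrite -nmN ?opprB //; exact: mxB. Qed.

Lemma nm_dist n (x y : 'M[V]_n) : os_mx E x -> os_mx E y -> `|nm E x - nm E y| <= nm E (x - y).
Proof.
move=> Hx Hy; have := nmD (mxB Hx Hy) Hy; rewrite subrK.
have := nmD (mxB Hy Hx) Hx; rewrite subrK nmBC // => h1 h2.
by rewrite ler_norml; apply/andP; split; move: h1 h2; lra.
Qed.

Lemma nm_tri n (x y z : 'M[V]_n) : os_mx E x -> os_mx E y -> os_mx E z ->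
  nm E (x - z) <= nm E (x - y) + nm E (y - z).
Proof.
move=> Hx Hy Hz; have := nmD (mxB Hx Hy) (mxB Hy Hz).
by rewrite addrA subrK.
Qed.

Lemma nm_sum (T : Type) (r : seq T) n (F : T -> 'M[V]_n) : (forall t, os_mx E (F t)) ->
  os_mx E (\sum_(t <- r) F t) /\ nm E (\sum_(t <- r) F t) <= \sum_(t <- r) nm E (F t).
Proof.
move=> H; elim: r => [|t r [IH1 IH2]]; first by rewrite !big_nil nm0; split=> //; exact: (@mx0 _).
rewrite !big_cons; split; first exact: mxD.
by apply: (le_trans (nmD (H t) IH1)); rewrite lerD2l.
Qed.

Lemma nm_entry n (x : 'M[V]_n) i j : os_mx E x -> nm E (const_mx (x i j) : 'M[_]_1) <= nm E x.
Proof.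
move=> Hx; rewrite -amx_delta.
by apply: (le_trans (nm_mul Hx (opm_row_delta i) (opm_col_delta j))); rewrite mul1r mulr1.
Qed.

End Preop.
End Amx.

Section CauchySequences.
Context {R : realType}.

Lemma real_cauchy_lim (u : nat -> R) :
  (forall e, 0 < e -> exists N, forall k, (N <= k)%N -> `|u N - u k| <= e) ->
  exists l, forall e, 0 < e -> exists N, forall k, (N <= k)%N -> `|u k - l| <= e.
Proof.
move=> H; have : cvg (u @ \oo).
  apply: R_complete; apply: cauchy_exP => e e0.
  have [N HN] := H (e / 2) ltac:(by rewrite divr_gt0).
  exists (u N); exists N => // k /= Nk; rewrite /ball /=.
  by apply: (le_lt_trans (HN k Nk)); rewrite ltr_pdivrMr // ltr_pMr // ltr1n.
move=> /cvgrPdist_le h; exists (lim (u @ \oo)) => e e0.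
have [N _ HN] := h e e0; exists N => k Nk; rewrite distrC; exact: HN.
Qed.

Lemma complex_cauchy_lim (u : nat -> R[i]) :
  (forall e, 0 < e -> exists N, forall k, (N <= k)%N -> cabs (u N - u k) <= e) ->
  exists l, forall e, 0 < e -> exists N, forall k, (N <= k)%N -> cabs (u k - l) <= e.
Proof.
move=> H.
have [a Ha] : exists l, forall e, 0 < e -> exists N, forall k, (N <= k)%N ->
    `|complex.Re (u k) - l| <= e.
  apply: real_cauchy_lim => e e0; have [N HN] := H e e0; exists N => k Nk.
  by apply: le_trans (HN k Nk); rewrite -raddfB; exact: le_Re_cabs.
have [b Hb] : exists l, forall e, 0 < e -> exists N, forall k, (N <= k)%N ->
    `|complex.Im (u k) - l| <= e.
  apply: real_cauchy_lim => e e0; have [N HN] := H e e0; exists N => k Nk.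
  by apply: le_trans (HN k Nk); rewrite -raddfB; exact: le_Im_cabs.
exists (a +i* b)%C => e e0; have e2 : 0 < e / 2 by rewrite divr_gt0.
have [N HN] := Ha _ e2; have [M HM] := Hb _ e2; exists (maxn N M) => k.
rewrite geq_max => /andP[Nk Mk]; apply: (le_trans (cabs_le_ReIm _)).
rewrite !raddfB /= [leRHS]splitr; apply: lerD; [exact: HN|exact: HM].
Qed.

End CauchySequences.

(** * The endpoint spaces *)

Section SchattenEndpoints.
Context {R : realType} (I : choiceType).
Local Notation C := R[i].
Local Notation mat := (cfun R (I * I)%type).
Local Notation Soo := (@S_infty R I).
Local Notation S1 := (@S_one R I).

Lemma S_inftyP n (x : 'M[mat]_n) c :
  (os_norm Soo x <= c%:E)%E <-> sib (fun i j => x i j) c.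
Proof. exact: opnormP. Qed.

Lemma S_infty_car (A : mat) : os_car Soo A <-> capprox A.
Proof. exact: compact_opE. Qed.

Lemma S_infty_preop : preop Soo.
Proof.
split=> [|a b /S_infty_car Ha /S_infty_car Hb|c a /S_infty_car Ha|n x _|n x Hx||].
- by apply/S_infty_car; exact: capprox0.
- by apply/S_infty_car; exact: capproxD.
- by apply/S_infty_car; exact: capproxZ.
- exact: opnorm_ge0.
- have h i j : exists c, opb (fun s t => x i j (s, t)) c.
    by apply: capprox_bounded; apply/S_infty_car/Hx.
  have [c Hc] := choice (fun ij : 'I_n * 'I_n => h ij.1 ij.2).
  have /S_inftyP : sib (fun i j => x i j) (\sum_i \sum_j c (i, j)).
    apply: (@family_entries _ _ I (fun l l' A => A (l, l'))) => i j; exact: (Hc (i, j)).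
  by move/le_lt_trans; apply; rewrite ltry.
- move=> m n a x b al be c _ Ha Hb /S_inftyP Hx; apply/S_inftyP.
  exact: (@family_amx _ _ I (fun l l' A => A (l, l')) (fun l l' => linform_entry (l, l'))).
- move=> m n x y c _ _ /S_inftyP Hx /S_inftyP Hy; apply/S_inftyP.
  exact: (@family_block _ _ I (fun l l' A => A (l, l')) (fun l l' => linform_entry (l, l'))).
Qed.

Lemma tcbD (A B : mat) c d : tcb A c -> tcb B d -> tcb (A + B) (c + d).
Proof.
move=> [c0 HA] [d0 HB]; split=> [|b J uJ Hb]; first exact: addr_ge0.
rewrite (linform_pair _ _).1; apply: (le_trans (cabsD _ _)).
by apply: lerD; [exact: HA|exact: HB].
Qed.

Lemma tcbZ (A : mat) c z : tcb A c -> tcb (z *: A) (cabs z * c).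
Proof.
move=> [c0 HA]; split=> [|b J uJ Hb]; first by rewrite mulr_ge0 ?cabs_ge0.
by rewrite (linform_pair _ _).2 cabsM ler_wpM2l ?cabs_ge0 //; exact: HA.
Qed.

Lemma tcb0 : tcb (0 : mat) 0.
Proof. by split=> // b J uJ Hb; rewrite (linform0 (linform_pair _ _)) cabs0. Qed.

Lemma S_one_car (A : mat) : os_car S1 A <-> exists c, tcb A c.
Proof. exact: schatten1P. Qed.

(** [S_one] tests against compacts through an infinite trace, [s1b] against bounded families through
    finite sections. Truncating a test family to [J] makes it compact and turns the trace into
    [pair_sec]; conversely, one large [J] approximates the finitely many traces in the amplified
    matrix at once. *)
Lemma S_oneP n (x : 'M[mat]_n) c : os_mx S1 x -> 0 <= c ->
  (os_norm S1 x <= c%:E)%E <-> s1b (fun i j => x i j) c.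
Proof.
move=> Hx c0; split=> [H|[_ H]].
  split=> // L b J uJ Hb.
  pose b' : 'M[mat]_#|L| := \matrix_(i, j)
    (fun p => sub_section (fun s t => b (enum_val i) (enum_val j) (s, t)) J p.1 p.2).
  have Hb' : os_mx Soo b'.
    move=> i j; apply/S_infty_car; rewrite mxE.
    apply: (@capprox_fin _ _ _ J 1) => [|s t /negbTE]; last by rewrite /sub_section /= => ->.
    exact: (opb_sub_section J (sib_entry (enum_val i) (enum_val j) Hb)).
  have gi : injective (fun p : 'I_#|L| * I => (enum_val p.1, p.2)).
    by move=> [? ?] [? ?] [/enum_val_inj -> ->].
  have nb' : (os_norm Soo b' <= 1)%E.
    apply/(S_inftyP b' 1); apply: eq_opb (opb_inj gi gi
      (opb_restrict (fun p : L * I => p.2 \in J) (fun p : L * I => p.2 \in J) Hb)) => s t.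
    by rewrite mxE /sub_section.
  have /mxopnormP h : (mxopnorm (amplify (@trace_pairing R I) x b') <= c%:E)%E.
    by apply: le_trans H; apply: ereal_sup_ubound; exists _, b'.
  have fi : injective (fun p : 'I_n * L => mxtens_index (p.1, enum_rank p.2)).
    by move=> [? ?] [? ?] /(can_inj (@mxtens_indexK _ _)) [-> /enum_rank_inj ->].
  apply: eq_opb (opb_inj fi fi h) => p q; rewrite mxE !mxtens_indexK /=.
  by rewrite mxE !enum_rankK trace_pairing_sec.
apply: ge_ereal_sup => _ [m [b [Hb /(S_inftyP b 1) nb ->]]]; apply/mxopnormP.
have fi : injective (@mxtens_unindex n m) by exact: can_inj (@mxtens_unindexK _ _).
suff h : opb (fun p q : 'I_n * 'I_m => trace_pairing (x p.1 q.1) (b p.2 q.2)) c.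
  by rewrite /opm; apply: eq_opb (opb_inj fi fi h) => p q; rewrite mxE.
apply: opb_lim => // J1 K1 e e0.
have lim (p : ('I_n * 'I_m) * ('I_n * 'I_m)) : exists J0, uniq J0 /\
    forall J, uniq J -> {subset J0 <= J} ->
    cabs (trace_pairing (x p.1.1 p.2.1) (b p.1.2 p.2.2) -
          pair_sec J (x p.1.1 p.2.1) (b p.1.2 p.2.2)) <= e.
  have /S_one_car [d Hd] := Hx p.1.1 p.2.1; have /S_infty_car Hbb := Hb p.1.2 p.2.2.
  by have [J0 ? ?] := trace_pairing_lim Hd Hbb e0; exists J0.
have [J0 HJ0] := choice lim.
pose J := undup (flatten [seq J0 p | p : ('I_n * 'I_m) * ('I_n * 'I_m)]).
exists (fun p q => pair_sec J (x p.1 q.1) (b p.2 q.2)).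
  by apply: (H _ (fun i j => b i j)) => //; exact: undup_uniq.
move=> s t _ _; apply: (HJ0 (s, t)).2 => [|i iJ]; first exact: undup_uniq.
by rewrite mem_undup; apply/flattenP; exists (J0 (s, t)) => //; apply: map_f; rewrite mem_enum.
Qed.

Lemma S_one_bounded n (x : 'M[mat]_n) : os_mx S1 x -> exists c, s1b (fun i j => x i j) c.
Proof.
move=> Hx.
have [c Hc] := choice (fun ij : 'I_n * 'I_n => (S_one_car _).1 (Hx ij.1 ij.2)).
exists (\sum_i \sum_j c (i, j)); apply: s1b_entries => i j; exact: (Hc (i, j)).
Qed.

Lemma S_one_ge0 n (x : 'M[mat]_n) : (0 <= os_norm S1 x)%E.
Proof.
(* The empty test matrix shows that the supremum is taken over a nonempty set. *)
suff h : (mxopnorm (amplify (@trace_pairing R I) x (0 : 'M[mat]_0)) <= os_norm S1 x)%E.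
  by apply: le_trans h; exact: opnorm_ge0.
apply: ereal_sup_ubound; exists 0%N, 0; split=> [[]||] //.
apply/(S_inftyP _ 1); apply: eq_opb (opb_cst0 _ _ ler01) => -[[? ?] ?] //.
Qed.

Lemma S_one_preop : preop S1.
Proof.
have ex n (x : 'M[mat]_n) c : os_mx S1 x -> (os_norm S1 x <= c%:E)%E -> 0 <= c.
  by move=> _ h; rewrite -lee_fin; apply: le_trans h; exact: S_one_ge0.
have D a b : os_car S1 a -> os_car S1 b -> os_car S1 (a + b).
  by move=> /S_one_car[c Hc] /S_one_car[d Hd]; apply/S_one_car; exists (c + d); exact: tcbD.
have Z (z : C) a : os_car S1 a -> os_car S1 (z *: a).
  by move=> /S_one_car[c Hc]; apply/S_one_car; exists (cabs z * c); exact: tcbZ.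
have O : os_car S1 0 by apply/S_one_car; exists 0; exact: tcb0.
split=> // [n x _|n x Hx||].
- exact: S_one_ge0.
- have [c Hc] := S_one_bounded Hx; have [c0 _] := Hc.
  by move: ((S_oneP Hx c0).2 Hc) => /le_lt_trans; apply; rewrite ltry.
- move=> m n a x b al be c Hx Ha Hb nx; have c0 := ex _ _ _ Hx nx.
  have [_ h] := (S_oneP Hx c0).1 nx.
  apply/S_oneP => [i j||].
  + by rewrite mxE; do 2! (elim/big_ind: _ => // ? _); exact: Z.
  + by rewrite !mulr_ge0 ?(opb_ge0 Ha) ?(opb_ge0 Hb).
  + split=> [|L b' J uJ Hb']; first by rewrite !mulr_ge0 ?(opb_ge0 Ha) ?(opb_ge0 Hb).
    apply: (@family_amx _ _ L (fun l l' A => pair_sec J A (b' l l'))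
      (fun l l' => linform_pair _ _)) => //; exact: h.
- move=> m n x y c Hx Hy nx ny; have c0 := ex _ _ _ Hx nx.
  have [_ hx] := (S_oneP Hx c0).1 nx; have [_ hy] := (S_oneP Hy c0).1 ny.
  apply/S_oneP => // [i j|].
    rewrite !mxE; case: fintype.splitP => i' _; rewrite mxE;
    by case: fintype.splitP => j' _; rewrite ?mxE.
  split=> // L b' J uJ Hb'.
  apply: (@family_block _ _ L (fun l l' A => pair_sec J A (b' l l'))
    (fun l l' => linform_pair _ _)); [exact: hx|exact: hy].
Qed.

Lemma nm_S_one n (x : 'M[mat]_n) c : os_mx S1 x -> 0 <= c ->
  nm S1 x <= c <-> s1b (fun i j => x i j) c.
Proof. by move=> Hx c0; rewrite -S_oneP // (nmE S_one_preop) // lee_fin. Qed.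

Lemma nm_S_one_s1b n (x : 'M[mat]_n) : os_mx S1 x -> s1b (fun i j => x i j) (nm S1 x).
Proof. by move=> Hx; apply/nm_S_one => //; exact: nm_ge0 S_one_preop _ _ Hx. Qed.

Lemma nm_S_infty n (x : 'M[mat]_n) c : os_mx Soo x ->
  nm Soo x <= c <-> sib (fun i j => x i j) c.
Proof. by move=> Hx; rewrite -S_inftyP (nmE S_infty_preop) // lee_fin. Qed.

Lemma nm_S_infty_sib n (x : 'M[mat]_n) : os_mx Soo x -> sib (fun i j => x i j) (nm Soo x).
Proof. by move=> Hx; apply/nm_S_infty. Qed.

Lemma s1b_const (A : mat) c : s1b (fun _ _ : 'I_1 => A) c <-> tcb A c.
Proof.
split=> [/(s1b_tcb ord0 ord0) //|H].
have := @s1b_entries _ _ 'I_1 (fun _ _ => A) (fun _ _ => c) (fun _ _ => H).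
by rewrite !big_ord1.
Qed.

Lemma nm_S_one_tcb (A : mat) c : os_car S1 A -> 0 <= c ->
  nm S1 (const_mx A : 'M[_]_1) <= c <-> tcb A c.
Proof.
move=> HA c0; have Hx : os_mx S1 (const_mx A : 'M[_]_1) by move=> i j; rewrite mxE.
have e : (fun i j => (const_mx A : 'M[mat]_1) i j) = (fun _ _ => A).
  by apply/funext => i; apply/funext => j; rewrite mxE.
by rewrite nm_S_one // e s1b_const.
Qed.

Lemma pair_sec_lim (u : nat -> I * I -> C) (x b : I * I -> C) J (e : R) : 0 < e ->
  (forall p e, 0 < e -> exists N, forall k, (N <= k)%N -> cabs (u k p - x p) <= e) ->
  exists N, forall k, (N <= k)%N -> cabs (pair_sec J (fun p => u k p - x p) b) <= e.
Proof.
move=> e0 H; pose B := 1 + \sum_(i <- J) \sum_(j <- J) cabs (b (i, j)).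
have s0 : 0 <= \sum_(i <- J) \sum_(j <- J) cabs (b (i, j)).
  by apply: sumr_ge0 => i _; apply: sumr_ge0 => j _; exact: cabs_ge0.
have B0 : 0 < B by rewrite ltr_wpDr.
have f0 : 0 < e / B by rewrite divr_gt0.
have [N HN] : exists N, forall k, (N <= k)%N -> forall p, p \in allpairs pair J J ->
    cabs (u k p - x p) <= e / B.
  elim: (allpairs _ _ _) => [|p s [N HN]]; first by exists 0%N.
  have [M HM] := H p _ f0; exists (maxn N M) => k; rewrite geq_max => /andP[Nk Mk] q.
  by rewrite inE => /predU1P[->|qs]; [exact: HM|exact: HN].
exists N => k Nk; apply: (@le_trans _ _ (\sum_(i <- J) \sum_(j <- J) e / B * cabs (b (i, j)))).
  rewrite /pair_sec; apply: (le_trans (cabs_sum _ _ _)).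
  rewrite big_seq [leRHS]big_seq; apply: ler_sum => i iJ.
  apply: (le_trans (cabs_sum _ _ _)); rewrite big_seq [leRHS]big_seq; apply: ler_sum => j jJ.
  rewrite cabsM ler_wpM2r ?cabs_ge0 //; apply: (HN k Nk (i, j)).
  by apply/allpairsP; exists (i, j).
under eq_bigr do rewrite -mulr_sumr; rewrite -mulr_sumr mulrAC ler_pdivrMr // ler_pM2l //.
by rewrite /B lerDr.
Qed.

(** Trace norm bounds control the entries, so an entrywise limit exists; each finite pairing passes
    to this limit, and with it the Cauchy estimate. *)
Lemma S_one_complete (u : nat -> mat) : (forall k, os_car S1 (u k)) ->
  (forall e, 0 < e -> exists N, forall j k, (N <= j)%N -> (N <= k)%N ->
     nm S1 (const_mx (u j - u k) : 'M[_]_1) <= e) ->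
  exists2 x, os_car S1 x & forall e, 0 < e -> exists N, forall k, (N <= k)%N ->
     nm S1 (const_mx (u k - x) : 'M[_]_1) <= e.
Proof.
move=> Hu Hc.
have carB a b : os_car S1 a -> os_car S1 b -> os_car S1 (a - b).
  by move=> Ha Hb; apply: (po_D S_one_preop) => //; exact: (carN S_one_preop).
have Hc' e : 0 < e -> exists N, forall j k, (N <= j)%N -> (N <= k)%N -> tcb (u j - u k) e.
  move=> e0; have [N HN] := Hc e e0; exists N => j k Nj Nk.
  by apply/nm_S_one_tcb; [exact: carB|exact: ltW|exact: HN].
have [x Hx] : exists x : mat, forall p e, 0 < e -> exists N, forall k, (N <= k)%N ->
    cabs (u k p - x p) <= e.
  have /choice[x Hx] : forall p, exists l : C, forall e, 0 < e -> exists N, forall k, (N <= k)%N ->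
      cabs (u k p - l) <= e; last by exists x.
  move=> p; apply: complex_cauchy_lim => e e0; have [N HN] := Hc' e e0.
  exists N => k Nk; case: p => s t; exact: opb_entry s t (tcb_opb (HN N k (leqnn N) Nk)).
have lim e : 0 < e -> exists N, forall k, (N <= k)%N -> tcb (u k - x) e.
  move=> e0; have [N HN] := Hc' e e0; exists N => k Nk; split=> [|b J uJ Hb]; first exact: ltW.
  apply/ler_addgt0Pr => d d0; have [M HM] := pair_sec_lim b J d0 Hx.
  pose j := maxn N M.
  have -> : u k - x = (u k - u j) + (u j - x) by rewrite addrA subrK.
  rewrite (linform_pair _ _).1; apply: (le_trans (cabsD _ _)); apply: lerD.
    by apply: (HN k j Nk (leq_maxl _ _)).2.
  by apply: HM; exact: leq_maxr.
have xS : os_car S1 x.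
  have [N HN] := lim 1 ltr01; have -> : x = u N - (u N - x) by rewrite subKr.
  by apply: carB => //; apply/S_one_car; exists 1; exact: HN.
exists x => // e e0; have [N HN] := lim e e0; exists N => k Nk.
by apply/nm_S_one_tcb; [exact: carB|exact: ltW|exact: HN].
Qed.

End SchattenEndpoints.

Section JointContractivity.
Context {R : realType} {X Y Z : Type}.

(** Membership is included because [nm], obtained through [fine], carries no information outside the
    carrier. *)
Definition jointly_cc (E : opspace R X) (F : opspace R Y) (G : opspace R Z)
    (mul : cfun R X -> cfun R Y -> cfun R Z) :=
  forall m n (x : 'M[cfun R X]_m) (y : 'M[cfun R Y]_n), os_mx E x -> os_mx F y ->
    os_mx G (amplify mul x y) /\ nm G (amplify mul x y) <= nm E x * nm F y.

End JointContractivity.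

Section SchurEndpoints.
Context {R : realType} (I : choiceType).
Local Notation mat := (cfun R (I * I)%type).
Local Notation Soo := (@S_infty R I).
Local Notation S1 := (@S_one R I).

Lemma unindex_inj m n : injective (@mxtens_unindex m n).
Proof. exact: can_inj (@mxtens_unindexK m n). Qed.

Lemma tcb_schur (A B : mat) c d : opb (fun i j => A (i, j)) c -> tcb B d ->
  tcb (schur A B) (c * d).
Proof.
move=> HA HB; have d0 : 0 <= d by case: HB.
split=> [|b J uJ Hb]; first by rewrite mulr_ge0 ?(opb_ge0 HA).
rewrite pair_sec_schur mulrC; apply: tcb_scale => //.
by rewrite -[c]mulr1; exact: opb_schur.
Qed.

Lemma schurC (A B : mat) : schur A B = schur B A.
Proof. by apply/funext => p; rewrite /schur mulrC. Qed.

Lemma S_one_schur : jointly_cc S1 S1 S1 schur.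
Proof.
move=> m n x y Hx Hy; have H : os_mx S1 (amplify schur x y).
  move=> i j; rewrite mxE; apply/S_one_car.
  have /S_one_car[c Hc] := Hx (mxtens_unindex i).1 (mxtens_unindex j).1.
  have /S_one_car[d Hd] := Hy (mxtens_unindex i).2 (mxtens_unindex j).2.
  by exists (c * d); apply: tcb_schur => //; exact: tcb_opb.
split=> //; apply/nm_S_one => //; first by rewrite mulr_ge0 ?(nm_ge0 (@S_one_preop R I)).
have := s1b_schur (nm_S_one_s1b Hx) (nm_S_one_s1b Hy) => /(s1b_reindex (@unindex_inj m n)).
congr s1b; apply/funext => i; apply/funext => j; by rewrite mxE.
Qed.

Lemma S_infty_schur : jointly_cc Soo Soo Soo schur.
Proof.
move=> m n x y Hx Hy; have H : os_mx Soo (amplify schur x y).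
  move=> i j; rewrite mxE; apply/S_infty_car.
  have /S_infty_car Hc := Hx (mxtens_unindex i).1 (mxtens_unindex j).1.
  have /S_infty_car/capprox_bounded[d Hd] := Hy (mxtens_unindex i).2 (mxtens_unindex j).2.
  exact: (capprox_schur Hc Hd).
split=> //; apply/nm_S_infty => //.
have := sib_schur (nm_S_infty_sib Hx) (nm_S_infty_sib Hy) => /(sib_reindex (@unindex_inj m n)).
congr sib; apply/funext => i; apply/funext => j; by rewrite mxE.
Qed.

(** The case [p = 1] of the complete contractivity of [psi]; the index swap puts the bounded factor
    first, as in [sib_s1b_schur]. *)
Lemma S_one_S_infty_schur : jointly_cc S1 Soo S1 schur.
Proof.
move=> m n x y Hx Hy; have H : os_mx S1 (amplify schur x y).
  move=> i j; rewrite mxE; apply/S_one_car.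
  have /S_one_car[c Hc] := Hx (mxtens_unindex i).1 (mxtens_unindex j).1.
  have /S_infty_car/capprox_bounded[d Hd] := Hy (mxtens_unindex i).2 (mxtens_unindex j).2.
  by exists (d * c); rewrite schurC; exact: tcb_schur.
split=> //; have y0 := nm_ge0 (@S_infty_preop R I) Hy.
apply/nm_S_one => //; first by rewrite mulr_ge0 ?(nm_ge0 (@S_one_preop R I)).
have sw : injective (fun i : 'I_(m * n) => ((mxtens_unindex i).2, (mxtens_unindex i).1)).
  apply: (can_inj (g := fun p => mxtens_index (p.2, p.1))) => i.
  by have := mxtens_unindexK i; case: (mxtens_unindex i).
have := sib_s1b_schur (nm_S_infty_sib Hy) (nm_S_one_s1b Hx) => /(s1b_reindex sw).
rewrite mulrC; congr s1b; apply/funext => i; apply/funext => j; by rewrite mxE schurC.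
Qed.

End SchurEndpoints.

(** * Projective tensor products *)

Section Selection.
Context {R : realType}.
Local Notation C := R[i].

Definition selmx m n (s : 'I_m -> 'I_n) : 'M[C]_(m, n) := \matrix_(i, j) (s i == j)%:R.

Lemma opm_sel m n (s : 'I_m -> 'I_n) : injective s -> opm (selmx s) 1.
Proof.
move=> si; have := opb_inj si (@inj_id _) (@opb_idm R 'I_n); rewrite /opm; apply: eq_opb => i j.
by rewrite mxE /idm; case: eqP.
Qed.

Lemma amx_sel (X : Type) m n (s : 'I_m -> 'I_n) (x : 'M[cfun R X]_n) :
  amx (selmx s) x (selmx s)^T = \matrix_(i, j) x (s i) (s j).
Proof.
apply/matrixP => i j; rewrite !mxE (bigD1 (s i)) //= [X in _ + X]big1 ?addr0 => [|k ki]; last first.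
  by rewrite big1 // => l _; rewrite mxE eq_sym (negbTE ki) mul0r scale0r.
rewrite (bigD1 (s j)) //= [X in _ + X]big1 ?addr0 => [|l lj]; last first.
  by rewrite [(selmx s)^T _ _]mxE [selmx s j l]mxE eq_sym (negbTE lj) mulr0 scale0r.
by rewrite !mxE !eqxx mulr1 scale1r.
Qed.

Lemma amx_block_diag (X : Type) m m' n n' (a : 'M[C]_(m, n)) (a' : 'M[C]_(m', n'))
    (x : 'M[cfun R X]_n) (y : 'M[cfun R X]_n') (b : 'M[C]_(n, m)) (b' : 'M[C]_(n', m')) :
  amx (block_mx a 0 0 a') (block_mx x 0 0 y) (block_mx b 0 0 b') =
  block_mx (amx a x b) 0 0 (amx a' y b').
Proof.
have l0 p q k (c : 'M[C]_(p, k)) (z : 'M[cfun R X]_k) : amx c z (0 : 'M[C]_(k, q)) = 0.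
  apply/matrixP => i j; rewrite !mxE big1 // => s _; rewrite big1 // => t _.
  by rewrite mxE mulr0 scale0r.
have r0 p q k (c : 'M[C]_(k, q)) (z : 'M[cfun R X]_k) : amx (0 : 'M[C]_(p, k)) z c = 0.
  apply/matrixP => i j; rewrite !mxE big1 // => s _; rewrite big1 // => t _.
  by rewrite mxE mul0r scale0r.
have colrow p p' q q' k (A1 : 'M[C]_(p, k)) (A2 : 'M[C]_(p', k)) (z : 'M[cfun R X]_k)
    (B1 : 'M[C]_(k, q)) (B2 : 'M[C]_(k, q')) :
    amx (col_mx A1 A2) z (row_mx B1 B2) =
    block_mx (amx A1 z B1) (amx A1 z B2) (amx A2 z B1) (amx A2 z B2).
  apply/matrixP => i j; case: (split_ordP i) => i' ->; case: (split_ordP j) => j' ->;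
    rewrite ?(block_mxEul, block_mxEur, block_mxEdl, block_mxEdr) !mxE;
    apply: eq_bigr => s _; apply: eq_bigr => t _;
    by rewrite ?(col_mxEu, col_mxEd, row_mxEl, row_mxEr).
rewrite block_mxEv [block_mx b _ _ _]block_mxEh colrow !amx_block.
by rewrite !(l0, r0) !(addr0, add0r).
Qed.

End Selection.

Section LinearMaps.
Context {R : realType} {X Z : Type}.
Local Notation C := R[i].
Variable phi : cfun R X -> cfun R Z.
Hypothesis phi_lin : forall (z : C) u v, phi (z *: u + v) = z *: phi u + phi v.

Lemma phiD u v : phi (u + v) = phi u + phi v.
Proof. by have := phi_lin 1 u v; rewrite !scale1r. Qed.

Lemma phi_0 : phi 0 = 0.
Proof. by have := phiD 0 0; rewrite addr0 => h; apply: (addrI (phi 0)); rewrite addr0 -h. Qed.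

Lemma phiB u v : phi (u - v) = phi u - phi v.
Proof. by have := phi_lin (-1) v u; rewrite !scaleN1r ![- _ + _]addrC. Qed.

Lemma map_phi0 n : map_mx phi (0 : 'M[cfun R X]_n) = 0.
Proof. by apply/matrixP => i j; rewrite !mxE phi_0. Qed.

Lemma linear_amx m n (a : 'M[C]_(m, n)) x (b : 'M[C]_(n, m)) :
  map_mx phi (amx a x b) = amx a (map_mx phi x) b.
Proof.
have phiS (I : Type) (r : seq I) (f : I -> C) (g : I -> cfun R X) :
    phi (\sum_(i <- r) f i *: g i) = \sum_(i <- r) f i *: phi (g i).
  by elim: r => [|i r IH]; [rewrite !big_nil phi_0|rewrite !big_cons phi_lin IH].
have phiS1 (I : Type) (r : seq I) (g : I -> cfun R X) :
    phi (\sum_(i <- r) g i) = \sum_(i <- r) phi (g i).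
  by elim: r => [|i r IH]; [rewrite !big_nil phi_0|rewrite !big_cons phiD IH].
apply/matrixP => i j; rewrite !mxE phiS1; apply: eq_bigr => k _; rewrite phiS.
by apply: eq_bigr => l _; rewrite mxE.
Qed.

End LinearMaps.

Section ProjectiveTensor.
Context {R : realType} {X Y : Type} (E : opspace R X) (F : opspace R Y).
Hypotheses (HE : preop E) (HF : preop F).
Local Notation C := R[i].
Local Notation T := (proj_tensor E F).
Local Notation tmx v w := (amplify (@tens R X Y) v w).

Lemma proj_tensor_le n k l (al : 'M[C]_(n, k * l)) v w (be : 'M[C]_(k * l, n)) a b c d :
  os_mx E v -> os_mx F w -> opm al a -> opm be b -> nm E v <= c -> nm F w <= d ->
  (os_norm T (amx al (tmx v w) be) <= (a * c * d * b)%:E)%E.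
Proof.
move=> Hv Hw Ha Hb vc wd.
have v0 := nm_ge0 HE Hv; have w0 := nm_ge0 HF Hw.
apply: (@le_trans _ _ (mxopnorm al * os_norm E v * os_norm F w * mxopnorm be)%E).
  by apply: ereal_inf_lbound; exists k, l, al, v, w, be.
have [a' ea a0] := mxopnorm_fin al; have [b' eb b0] := mxopnorm_fin be.
move/mxopnormP: Ha; move/mxopnormP: Hb; rewrite ea eb !lee_fin => bb aa.
rewrite (nmE HE) // (nmE HF) // -!EFinM lee_fin; apply: ler_pM => //.
  by rewrite !mulr_ge0.
by apply: ler_pM => //; [rewrite mulr_ge0|apply: ler_pM].
Qed.

(** Raises one factor of a product to a positive number while staying below [c], so that factors can
    be divided out even if some norm is 0. *)
Lemma mul_lt_gap (x y c : R) : 0 <= x -> 0 <= y -> x * y < c ->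
  exists x', [/\ 0 < x', x <= x' & x' * y < c].
Proof.
move=> x0 y0 h; pose d := (c - x * y) / (2 * (y + 1)).
have y1 : 0 < 2 * (y + 1) by rewrite mulr_gt0 // ltr_wpDl.
have d0 : 0 < d by rewrite divr_gt0 // subr_gt0.
exists (x + d); split; [by rewrite ltr_wpDl|by rewrite lerDl ltW|].
have : d * (2 * (y + 1)) = c - x * y by rewrite divfK // gt_eqF.
move: d0 y0; clear; move: (x * y) (mulrDl x d y) => z ->; nra.
Qed.

Lemma tens0l (b : cfun R Y) : tens (0 : cfun R X) b = 0.
Proof. by apply/funext => t; exact: mul0r. Qed.

Lemma tmx_smx k l z z' (v : 'M[cfun R X]_k) (w : 'M[cfun R Y]_l) :
  tmx (smx z v) (smx z' w) = smx (z * z') (tmx v w).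
Proof.
apply/matrixP => i j; rewrite !mxE; apply/funext => t; rewrite /tens /=.
exact: mulrACA.
Qed.

Lemma opm_scale m n (a : 'M[C]_(m, n)) c z : opm a c -> opm (z *: a) (cabs z * c).
Proof. by move=> /(opb_scale z); apply: eq_opb => i j; rewrite mxE. Qed.

Lemma amx_scale (Z : Type) m n n' m' z z' (a : 'M[C]_(m, n)) (x : 'M[cfun R Z]_(n, n'))
    (b : 'M[C]_(n', m')) :
  amx (z *: a) x (z' *: b) = amx a (\matrix_(i, j) ((z * z') *: x i j)) b.
Proof.
apply/matrixP => i j; rewrite !mxE; apply: eq_bigr => p _; apply: eq_bigr => q _.
by rewrite !mxE scalerA; congr (_ *: _); ring.
Qed.

(** All of the norm is moved into the scalar matrices, in equal shares. In this normal form the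
    direct sum of two representations costs nothing, since its norm is the larger of the two. *)
Lemma proj_tensor_lt n (u : 'M[_]_n) c : (os_norm T u < c%:E)%E ->
  exists k l (al : 'M[C]_(n, k * l)) v w (be : 'M[C]_(k * l, n)),
    [/\ os_mx E v /\ nm E v <= 1, os_mx F w /\ nm F w <= 1, opm al (Num.sqrt c),
        opm be (Num.sqrt c) & u = amx al (tmx v w) be].
Proof.
move/ereal_inf_lt => [_ [k [l [al [v [w [be [Hv Hw -> ->]]]]]]]].
have v0 := nm_ge0 HE Hv; have w0 := nm_ge0 HF Hw.
have [a ea a0] := mxopnorm_fin al; have [b eb b0] := mxopnorm_fin be.
have Ha : opm al a by apply/mxopnormP; rewrite ea.
have Hb : opm be b by apply/mxopnormP; rewrite eb.
rewrite ea eb (nmE HE) // (nmE HF) // -!EFinM lte_fin => h.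
have [a' [a'0 aa' h1]] : exists x', [/\ 0 < x', a <= x' & x' * (nm E v * nm F w * b) < c].
  by apply: mul_lt_gap => //; rewrite ?mulr_ge0 // !mulrA.
have [v' [v'0 vv' h2]] : exists x', [/\ 0 < x', nm E v <= x' & x' * (nm F w * b * a') < c].
  by apply: mul_lt_gap; rewrite ?mulr_ge0 ?(ltW a'0) //; apply: le_lt_trans h1; rewrite le_eqVlt;
     apply/orP; left; apply/eqP; ring.
have [w' [w'0 ww' h3]] : exists x', [/\ 0 < x', nm F w <= x' & x' * (b * a' * v') < c].
  by apply: mul_lt_gap; rewrite ?mulr_ge0 ?(ltW a'0) ?(ltW v'0) //; apply: le_lt_trans h2;
     rewrite le_eqVlt; apply/orP; left; apply/eqP; ring.
have c0 : 0 < c by apply: le_lt_trans h3; rewrite !mulr_ge0 // ltW.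
pose s := Num.sqrt c; have s0 : 0 < s by rewrite sqrtr_gt0.
have s2 : s * s = c by rewrite -expr2 sqr_sqrtr // ltW.
pose r (x : R) := real_complex R x.
have nr x : 0 < x -> cabs (r x) = x by move=> x0; rewrite /r cabs_real gtr0_norm.
exists k, l, (r (s / a') *: al), (smx (r v'^-1) v), (smx (r w'^-1) w), (r (a' * v' * w' / s) *: be).
split.
- split; first exact: mxZ.
  by rewrite nmZ // nr ?invr_gt0 // mulrC ler_pdivrMr // mul1r.
- split; first exact: mxZ.
  by rewrite nmZ // nr ?invr_gt0 // mulrC ler_pdivrMr // mul1r.
- apply: (opb_le _ (opm_scale _ Ha)); rewrite nr ?divr_gt0 //.
  by rewrite mulrAC ler_pdivrMr // ler_pM2l.
- apply: (opb_le _ (opm_scale _ Hb)); rewrite nr ?divr_gt0 ?mulr_gt0 //.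
  rewrite mulrAC ler_pdivrMr // s2; apply: ltW; apply: le_lt_trans h3.
  by rewrite le_eqVlt; apply/orP; left; apply/eqP; ring.
rewrite amx_scale tmx_smx; congr (amx _ _ _); apply/matrixP => i j; rewrite !mxE.
rewrite scalerA -!rmorphM /=.
have -> : s / a' * (a' * v' * w' / s) * (v'^-1 / w') = 1.
  by field; rewrite !gt_eqF.
by rewrite scale1r.
Qed.

Lemma proj_tensor_mul m n (a : 'M[C]_(m, n)) u (b : 'M[C]_(n, m)) al be c :
  opm a al -> opm b be -> (os_norm T u <= c%:E)%E ->
  (os_norm T (amx a u b) <= (al * c * be)%:E)%E.
Proof.
move=> Ha Hb uc; have a0 := opb_ge0 Ha; have b0 := opb_ge0 Hb.
apply/lee_addgt0Pr => e e0; pose d := e / (al * be + 1).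
have ab1 : 0 < al * be + 1 by rewrite ltr_wpDl // mulr_ge0.
have d0 : 0 < d by rewrite divr_gt0.
have /proj_tensor_lt [k [l [al' [v [w [be' [[Hv nv] [Hw nw] Ha' Hb' ->]]]]]]] :
    (os_norm T u < (c + d)%:E)%E by apply: le_lt_trans uc _; rewrite lte_fin ltrDl.
have s0 : 0 <= c + d.
  apply: ltW; rewrite -lte_fin; apply: le_lt_trans (_ : os_norm T u < _)%E.
    apply: le_ereal_inf_tmp => _ [k' [l' [al0 [v0 [w0 [be0 [Hv0 Hw0 _ ->]]]]]]].
    by rewrite !mule_ge0 ?opnorm_ge0 ?(po_ge0 HE) ?(po_ge0 HF).
  by apply: le_lt_trans uc _; rewrite lte_fin ltrDl.
rewrite amxA; apply: (le_trans (proj_tensor_le Hv Hw (opm_mul Ha Ha') (opm_mul Hb' Hb) nv nw)).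
rewrite -EFinD lee_fin !mulr1.
have -> : al * Num.sqrt (c + d) * (Num.sqrt (c + d) * be) = al * be * Num.sqrt (c + d) ^+ 2 by ring.
rewrite sqr_sqrtr // mulrDr [al * c * be]mulrAC lerD2l /d mulrCA ler_piMr ?(ltW e0) //.
by rewrite ler_pdivrMr // mul1r lerDl.
Qed.

Lemma proj_tensor_ge0 n (u : 'M[_]_n) : (0 <= os_norm T u)%E.
Proof.
apply: le_ereal_inf_tmp => _ [k [l [al [v [w [be [Hv Hw _ ->]]]]]]].
by rewrite !mule_ge0 ?opnorm_ge0 ?(po_ge0 HE) ?(po_ge0 HF).
Qed.

(** The tensor product of [v (+) v'] and [w (+) w'] also contains the mixed blocks; the injective
    selection [s] of rows and columns keeps only the two wanted ones and has norm at most 1. *)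
Lemma proj_tensor_block m n (u : 'M[_]_m) (u' : 'M[_]_n) c : (os_norm T u <= c%:E)%E ->
  (os_norm T u' <= c%:E)%E -> (os_norm T (block_mx u 0 0 u') <= c%:E)%E.
Proof.
move=> uc uc'; apply/lee_addgt0Pr => e e0.
have lt x : (x <= c%:E -> x < (c + e)%:E)%E.
  by move=> h; apply: le_lt_trans h _; rewrite lte_fin ltrDl.
have s0 : 0 <= c + e by apply: ltW; rewrite -lte_fin; apply: le_lt_trans (lt _ uc); exact: proj_tensor_ge0.
have [k [l [al [v [w [be [[Hv nv] [Hw nw] Ha Hb ->]]]]]]] := proj_tensor_lt (lt _ uc).
have [k' [l' [al' [v' [w' [be' [[Hv' nv'] [Hw' nw'] Ha' Hb' ->]]]]]]] := proj_tensor_lt (lt _ uc').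
pose s (i : 'I_(k * l + k' * l')) : 'I_((k + k') * (l + l')) :=
  match fintype.split i with
  | inl p => mxtens_index (lshift k' (mxtens_unindex p).1, lshift l' (mxtens_unindex p).2)
  | inr p => mxtens_index (rshift k (mxtens_unindex p).1, rshift l (mxtens_unindex p).2)
  end.
have unl p : s (lshift _ p) = mxtens_index (lshift k' (mxtens_unindex p).1, lshift l' (mxtens_unindex p).2).
  by rewrite /s -[lshift _ p]/(unsplit (inl p)) unsplitK.
have unr p : s (rshift _ p) = mxtens_index (rshift k (mxtens_unindex p).1, rshift l (mxtens_unindex p).2).
  by rewrite /s -[rshift _ p]/(unsplit (inr p)) unsplitK.
have si : injective s.
  have ui n1 n2 (p q : 'I_(n1 * n2)) : (mxtens_unindex p).1 = (mxtens_unindex q).1 ->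
      (mxtens_unindex p).2 = (mxtens_unindex q).2 -> p = q.
    move=> e1 e2; apply: (can_inj (@mxtens_unindexK _ _)).
    by move: e1 e2; case: (mxtens_unindex p) => ? ?; case: (mxtens_unindex q) => ? ? /= -> ->.
  move=> i j; case: (split_ordP i) => p ->; case: (split_ordP j) => q ->; rewrite ?unl ?unr;
    move=> /(can_inj (@mxtens_indexK _ _)) e1.
  - congr lshift; apply: ui; [exact: (lshift_inj (congr1 fst e1))|exact: (lshift_inj (congr1 snd e1))].
  - by have /eqP := congr1 fst e1; rewrite eq_lrshift.
  - by have /eqP := congr1 fst e1; rewrite eq_rlshift.
  - congr rshift; apply: ui; [exact: (rshift_inj (congr1 fst e1))|exact: (rshift_inj (congr1 snd e1))].
have Hsel : amx (selmx s) (tmx (block_mx v 0 0 v') (block_mx w 0 0 w')) (selmx s)^T =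
    block_mx (tmx v w) 0 0 (tmx v' w').
  rewrite amx_sel; apply/matrixP => i j; rewrite mxE.
  case: (split_ordP i) => p ->; case: (split_ordP j) => q ->; rewrite ?unl ?unr [amplify _ _ _ _ _]mxE !mxtens_indexK /=;
    rewrite ?(block_mxEul, block_mxEur, block_mxEdl, block_mxEdr) ?[in RHS]mxE //;
    by rewrite [X in tens X _]mxE tens0l.
rewrite -amx_block_diag -Hsel amxA.
have Hv2 : os_mx E (block_mx v 0 0 v') by exact: mx_block.
have Hw2 : os_mx F (block_mx w 0 0 w') by exact: mx_block.
have := proj_tensor_le Hv2 Hw2 (opm_mul (opm_block Ha Ha') (opm_sel si))
  (opm_mul (opm_tr (opm_sel si)) (opm_block Hb Hb')) (nm_block HE Hv Hv' nv nv') (nm_block HF Hw Hw' nw nw').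
by rewrite !mulr1 mul1r -expr2 sqr_sqrtr // EFinD.
Qed.

(** The sum is a compression of the direct sum by the row [(1, 1)]. Only finiteness is claimed,
    since the sharp triangle inequality [nmD] presupposes the [preop] being established. *)
Lemma proj_tensor_finD n (u u' : 'M[_]_n) : (os_norm T u < +oo)%E -> (os_norm T u' < +oo)%E ->
  (os_norm T (u + u') < +oo)%E.
Proof.
move=> uf uf'; have u0 := proj_tensor_ge0 u; have u0' := proj_tensor_ge0 u'.
have fe (x : \bar R) : (0 <= x)%E -> (x < +oo)%E -> x = (fine x)%:E.
  by move=> x0 xf; rewrite fineK // ge0_fin_numE.
pose c := fine (os_norm T u) + fine (os_norm T u').
have uc : (os_norm T u <= c%:E)%E by rewrite (fe _ u0 uf) lee_fin lerDl fine_ge0.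
have uc' : (os_norm T u' <= c%:E)%E by rewrite (fe _ u0' uf') lee_fin lerDr fine_ge0.
have := proj_tensor_mul (@opm_row R n 1 1) (opm_tr (@opm_row R n 1 1)) (proj_tensor_block uc uc').
rewrite tr_row_mx !tr_scalar_mx amx_block !amx_scalar mulr1 !smx1.
by move/le_lt_trans; apply; rewrite ltry.
Qed.

Lemma proj_tensor_preop : preop T.
Proof.
split=> [|a b [n [a1 [b1 [Ha Hb ->]]]] [n' [a2 [b2 [Ha' Hb' ->]]]]|z a [n [a1 [b1 [Ha Hb ->]]]]|n x _|n u Hu||].
- by exists 0%N, (fun _ => 0), (fun _ => 0); split=> [[]|[]|] //; rewrite big_ord0.
- exists (n + n')%N, (fun i => match fintype.split i with inl i => a1 i | inr i => a2 i end),
    (fun i => match fintype.split i with inl i => b1 i | inr i => b2 i end); split=> [i|i|].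
  + by case: fintype.split.
  + by case: fintype.split.
  rewrite big_split_ord /=; congr (_ + _); apply: eq_bigr => i _.
    by rewrite -[lshift _ i]/(unsplit (inl i)) unsplitK.
  by rewrite -[rshift _ i]/(unsplit (inr i)) unsplitK.
- exists n, (fun i => z *: a1 i), b1; split=> // [i|]; first exact: (po_Z HE).
  rewrite scaler_sumr; apply: eq_bigr => i _; apply/funext => t; exact: mulrA.
- exact: proj_tensor_ge0.
- pose sg i j z : 'M[cfun R (X * Y)]_n := amx (delta_mx i 0) (const_mx z : 'M[_]_1) (delta_mx 0 j).
  have sgD i j z z' : sg i j (z + z') = sg i j z + sg i j z'.
    by rewrite -amxD; congr (amx _ _ _); apply/matrixP => s t; rewrite !mxE.
  have fin_tens i j a b : os_car E a -> os_car F b -> (os_norm T (sg i j (tens a b)) < +oo)%E.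
    move=> Ha Hb; have -> : sg i j (tens a b) = amx (delta_mx i 0 : 'M[C]_(n, 1 * 1))
        (tmx (const_mx a : 'M[_]_(1, 1)) (const_mx b : 'M[_]_(1, 1))) (delta_mx 0 j : 'M[C]_(1 * 1, n)).
      by congr (amx _ _ _); apply/matrixP => s t; rewrite !mxE.
    apply: le_lt_trans (proj_tensor_le (mx_const Ha) (mx_const Hb) (opm_col_delta i)
      (opm_row_delta j) (lexx _) (lexx _)) _; exact: ltry.
  have fin0 : (os_norm T (0 : 'M[cfun R (X * Y)]_n) < +oo)%E.
    have H0 : os_mx E (0 : 'M[_]_0) by case.
    have H0' : os_mx F (0 : 'M[_]_0) by case.
    have -> : (0 : 'M[cfun R (X * Y)]_n) = amx (0 : 'M[C]_(n, 0 * 0)) (tmx 0 0) (0 : 'M[C]_(0 * 0, n)).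
      by apply/matrixP => s t; rewrite !mxE big_ord0.
    apply: le_lt_trans (proj_tensor_le H0 H0' (opb_fin _) (opb_fin _) (lexx _) (lexx _)) _.
    exact: ltry.
  have fin_sg i j : (os_norm T (sg i j (u i j)) < +oo)%E.
    have [k [a [b [Ha Hb ->]]]] := Hu i j.
    have fin_sum (r : seq 'I_k) : (os_norm T (sg i j (\sum_(s <- r) tens (a s) (b s))%R) < +oo)%E.
      elim: r => [|s r IH]; last by rewrite big_cons sgD; apply: proj_tensor_finD => //; exact: fin_tens.
      have z0 : (0 : cfun R (X * Y)) = tens 0 0 by rewrite tens0l.
        by rewrite big_nil z0; apply: fin_tens; [exact: po_0 HE|exact: po_0 HF].
    exact: fin_sum.
  rewrite (mx_sum_amx_delta u).
  by do 2! (elim/big_ind: _ => [//|? ?|? _]; first exact: proj_tensor_finD); exact: fin_sg.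
- by move=> m n a x b al be c _; exact: proj_tensor_mul.
- by move=> m n x y c _ _; exact: proj_tensor_block.
Qed.

Section LinearExtension.
Context {Z : Type} (G : opspace R Z) (HG : preop G).
Variables (phi : cfun R (X * Y) -> cfun R Z) (mul : cfun R X -> cfun R Y -> cfun R Z).
Hypotheses (phi_lin : forall (z : C) u v, phi (z *: u + v) = z *: phi u + phi v)
  (phi_tens : forall a b, phi (tens a b) = mul a b).

Lemma phi_contractive n (u : 'M[_]_n) : jointly_cc E F G mul -> os_mx T u ->
  os_mx G (map_mx phi u) /\ nm G (map_mx phi u) <= nm T u.
Proof.
move=> Hjc Hu; have HT := proj_tensor_preop.
have rep e : 0 < e -> os_mx G (map_mx phi u) /\ nm G (map_mx phi u) <= nm T u + e.
  move=> e0; have u0 := nm_ge0 HT Hu.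
  have /proj_tensor_lt [k [l [al [v [w [be [[Hv nv] [Hw nw] Ha Hb eu]]]]]]] :
      (os_norm T u < (nm T u + e)%:E)%E by rewrite (nmE HT) // lte_fin ltrDl.
  have [Hvw nvw] := Hjc _ _ _ _ Hv Hw.
  have e1 : map_mx phi (tmx v w) = amplify mul v w.
    by apply/matrixP => i j; rewrite !mxE phi_tens.
  have -> : map_mx phi u = amx al (amplify mul v w) be by rewrite eu (linear_amx phi_lin) e1.
  split; first exact: mx_amx.
  apply: (le_trans (nm_mul HG Hvw Ha Hb)).
  have s0 : 0 <= nm T u + e by rewrite addr_ge0 // ltW.
  rewrite mulrAC -expr2 sqr_sqrtr // ler_piMr //; apply: (le_trans nvw).
  by rewrite mulr_ile1 // nm_ge0.
split; first by have [] := rep 1 ltr01.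
by apply/ler_addgt0Pr => e /rep[].
Qed.

End LinearExtension.

End ProjectiveTensor.

Lemma mul_addgt0 (R : realType) (z x y : R) : 0 <= x -> 0 <= y ->
  (forall e, 0 < e -> z <= (x + e) * (y + e)) -> z <= x * y.
Proof.
move=> x0 y0 H; apply: (@ler_addgt0_mul _ _ _ (x + y + 1)); first by rewrite !addr_ge0.
move=> e e0; pose d := Num.min e 1.
have d0 : 0 < d by rewrite lt_min e0 ltr01.
have d1 : d <= 1 by rewrite ge_min lexx orbT.
have de : d <= e by rewrite ge_min lexx.
apply: (le_trans (H d d0)); move: d d0 d1 de {H}; clear z e0 => d; nra.
Qed.

Section PointwiseProduct.
Context {R : realType}.
Local Notation C := R[i].

Definition pmul {X : Type} (a b : cfun R X) : cfun R X := fun x => a x * b x.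

Lemma pmulBl (X : Type) (a a' b : cfun R X) : pmul (a - a') b = pmul a b - pmul a' b.
Proof. by apply/funext => x; exact: mulrBl. Qed.

Lemma pmulBr (X : Type) (a b b' : cfun R X) : pmul a (b - b') = pmul a b - pmul a b'.
Proof. by apply/funext => x; exact: mulrBr. Qed.

Lemma cfun_sumE (X J : Type) (r : seq J) (F : J -> cfun R X) p :
  (\sum_(t <- r) F t) p = \sum_(t <- r) F t p.
Proof. by elim: r => [|t r IH]; [rewrite !big_nil|rewrite !big_cons -IH]. Qed.

Lemma amx_at (X : Type) m n n' m' (a : 'M[C]_(m, n)) (x : 'M[cfun R X]_(n, n')) (b : 'M[C]_(n', m')) i j p :
  amx a x b i j p = \sum_k \sum_l (a i k * b l j) * x k l p.
Proof.
by rewrite mxE cfun_sumE; apply: eq_bigr => k _; rewrite cfun_sumE.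
Qed.

Lemma amplify_amx (X : Type) m n m' n' (a : 'M[C]_(m, n)) (x : 'M[cfun R X]_n) (b : 'M[C]_(n, m))
    (a' : 'M[C]_(m', n')) (x' : 'M[cfun R X]_n') (b' : 'M[C]_(n', m')) :
  amplify pmul (amx a x b) (amx a' x' b') = amx (tensmx a a') (amplify pmul x x') (tensmx b b').
Proof.
apply/matrixP => i j; apply/funext => p; rewrite mxE /pmul !amx_at mulr_sum; apply: eq_bigr => k _.
rewrite mulr_sum; apply: eq_bigr => l _; rewrite [tensmx a a' _ _]mxE [tensmx b b' _ _]mxE.
by rewrite [amplify _ _ _ _ _]mxE /pmul; ring.
Qed.

Lemma opm_tens m n m' n' (a : 'M[C]_(m, n)) (a' : 'M[C]_(m', n')) c c' :
  opm a c -> opm a' c' -> opm (tensmx a a') (c * c').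
Proof.
move=> Ha Ha'; have := opb_inj (@unindex_inj m m') (@unindex_inj n n') (opb_tens Ha Ha').
by rewrite /opm; apply: eq_opb => i j; rewrite mxE.
Qed.

Lemma jointly_cc_car (X Y Z : Type) (E : opspace R X) (F : opspace R Y) (G : opspace R Z) mul a b :
  jointly_cc E F G mul -> os_car E a -> os_car F b -> os_car G (mul a b).
Proof.
move=> H Ha Hb; have [h _] := H 1%N 1%N (const_mx a) (const_mx b) (mx_const Ha) (mx_const Hb).
by have := h ord0 ord0; rewrite !mxE.
Qed.

End PointwiseProduct.

Section ProjectiveTensorProduct.
Context {R : realType} {X Y : Type} (E : opspace R X) (F : opspace R Y).
Hypotheses (HE : preop E) (HF : preop F).
Local Notation T := (proj_tensor E F).
Local Notation tmx v w := (amplify (@tens R X Y) v w).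

(** The two sides order the four index factors differently, as [(k, l, k', l')] and as
    [(k, k', l, l')]; [s] is the reshuffling, and [t] its inverse. *)
Lemma tmx_pmul k l k' l' v w v' w' : exists2 s, injective s &
  amplify pmul (tmx (v : 'M[_]_k) (w : 'M[_]_l)) (tmx (v' : 'M[_]_k') (w' : 'M[_]_l')) =
  amx (selmx s) (tmx (amplify pmul v v') (amplify pmul w w')) (selmx s)^T.
Proof.
pose un := mxtens_unindex.
pose s (i : 'I_((k * l) * (k' * l'))) : 'I_((k * k') * (l * l')) :=
  mxtens_index (mxtens_index ((un _ _ (un _ _ i).1).1, (un _ _ (un _ _ i).2).1),
                mxtens_index ((un _ _ (un _ _ i).1).2, (un _ _ (un _ _ i).2).2)).
pose t (i : 'I_((k * k') * (l * l'))) : 'I_((k * l) * (k' * l')) :=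
  mxtens_index (mxtens_index ((un _ _ (un _ _ i).1).1, (un _ _ (un _ _ i).2).1),
                mxtens_index ((un _ _ (un _ _ i).1).2, (un _ _ (un _ _ i).2).2)).
have sK : cancel s t.
  have p1 a b (x : 'I_a) (y : 'I_b) : (mxtens_unindex (mxtens_index (x, y))).1 = x.
    by rewrite mxtens_indexK.
  have p2 a b (x : 'I_a) (y : 'I_b) : (mxtens_unindex (mxtens_index (x, y))).2 = y.
    by rewrite mxtens_indexK.
  have pe a b (x : 'I_(a * b)) : mxtens_index ((mxtens_unindex x).1, (mxtens_unindex x).2) = x.
    by rewrite -surjective_pairing mxtens_unindexK.
  by move=> i; rewrite /s /t /un !(p1, p2) !pe.
exists s; first exact: can_inj sK.
rewrite amx_sel; apply/matrixP => i j; rewrite !mxE /s !mxtens_indexK.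
by apply/funext => p; rewrite /pmul /tens /=; exact: mulrACA.
Qed.

Lemma proj_tensor_jointly_cc : jointly_cc E E E pmul -> jointly_cc F F F pmul -> jointly_cc T T T pmul.
Proof.
move=> jE jF m n x y Hx Hy; have HT := proj_tensor_preop HE HF.
have carT a b : os_car T a -> os_car T b -> os_car T (pmul a b).
  move=> [k [a1 [b1 [Ha Hb ->]]]] [k' [a2 [b2 [Ha' Hb' ->]]]].
  exists (k * k')%N, (fun i => pmul (a1 (mxtens_unindex i).1) (a2 (mxtens_unindex i).2)),
    (fun i => pmul (b1 (mxtens_unindex i).1) (b2 (mxtens_unindex i).2)); split=> [i|i|].
  - exact: (jointly_cc_car jE).
  - exact: (jointly_cc_car jF).
  apply/funext => p; rewrite /pmul !cfun_sumE mulr_sum; apply: eq_bigr => i _.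
  exact: mulrACA.
have H : os_mx T (amplify pmul x y) by move=> i j; rewrite mxE; exact: carT.
split=> //; have x0 := nm_ge0 HT Hx; have y0 := nm_ge0 HT Hy.
apply: mul_addgt0 => // e e0.
have /(proj_tensor_lt HE HF) [k [l [al [v [w [be [[Hv nv] [Hw nw] Ha Hb ex]]]]]]] :
    (os_norm T x < (nm T x + e)%:E)%E by rewrite (nmE HT) // lte_fin ltrDl.
have /(proj_tensor_lt HE HF) [k' [l' [al' [v' [w' [be' [[Hv' nv'] [Hw' nw'] Ha' Hb' ey]]]]]]] :
    (os_norm T y < (nm T y + e)%:E)%E by rewrite (nmE HT) // lte_fin ltrDl.
have [s si es] := tmx_pmul v w v' w'.
have exy : amplify pmul x y = amx (tensmx al al' *m selmx s)
    (tmx (amplify pmul v v') (amplify pmul w w')) ((selmx s)^T *m tensmx be be').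
  by rewrite ex ey amplify_amx es amxA.
have [Hvv nvv] := jE _ _ _ _ Hv Hv'; have [Hww nww] := jF _ _ _ _ Hw Hw'.
have nvv1 : nm E (amplify pmul v v') <= 1 by apply: (le_trans nvv); rewrite mulr_ile1 ?nm_ge0.
have nww1 : nm F (amplify pmul w w') <= 1 by apply: (le_trans nww); rewrite mulr_ile1 ?nm_ge0.
have := proj_tensor_le HE HF Hvv Hww (opm_mul (opm_tens Ha Ha') (opm_sel si))
  (opm_mul (opm_tr (opm_sel si)) (opm_tens Hb Hb')) nvv1 nww1.
rewrite -exy (nmE HT) // lee_fin !mulr1 mul1r mulrACA -!expr2 !sqr_sqrtr //; by rewrite addr_ge0 // ltW.
Qed.

End ProjectiveTensorProduct.

(** * Images of completions *)

Section OperatorSpaces.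
Context {R : realType} {X : Type} (E : opspace R X).
Hypothesis HE : preop E.
Local Notation C := R[i].

Lemma const_mxB (a b : cfun R X) : const_mx (a - b) = const_mx a - const_mx b :> 'M[_]_1.
Proof. by apply/matrixP => i j; rewrite !mxE. Qed.

Lemma const_mx_entry (x : 'M[cfun R X]_1) : x = const_mx (x 0 0).
Proof. by apply/matrixP => i j; rewrite mxE !ord1. Qed.

Lemma os_cauchyP n (u : nat -> 'M[cfun R X]_n) : (forall k, os_mx E (u k)) ->
  os_cauchy E u <-> forall e, 0 < e -> exists N, forall j k, (N <= j)%N -> (N <= k)%N ->
    nm E (u j - u k) < e.
Proof.
move=> Hu; split=> H e e0; have [N HN] := H e e0; exists N => j k Nj Nk.
  by have := HN j k Nj Nk; rewrite (nmE HE) ?lte_fin //; exact: mxB.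
by rewrite (nmE HE) ?lte_fin; [exact: HN|exact: mxB].
Qed.

Lemma os_cvgP n (u : nat -> 'M[cfun R X]_n) x : (forall k, os_mx E (u k)) ->
  os_cvg E u x <-> os_mx E x /\ forall e, 0 < e -> exists N, forall k, (N <= k)%N ->
    nm E (u k - x) < e.
Proof.
move=> Hu; split=> -[Hx H]; split=> //.
  have /cvge0P h : forall k, (0 <= os_norm E (u k - x))%E.
    by move=> k; apply: (po_ge0 HE); exact: mxB.
  move=> e e0; have [N HN] := h.1 H e e0; exists N => k Nk; rewrite -lte_fin -(nmE HE).
    exact: HN.
  exact: mxB.
apply/cvge0P => [k|e e0]; first by apply: (po_ge0 HE); exact: mxB.
have [N HN] := H e e0; exists N => k Nk; rewrite (nmE HE) ?lte_fin; first exact: HN.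
exact: mxB.
Qed.

(** The reverse inequality for direct sums comes from compressing to either block, and separation
    for matrices comes from compressing to entries. *)
Lemma preop_operator_space :
  (forall a, os_car E a -> nm E (const_mx a : 'M[_]_1) = 0 -> a = 0) ->
  (forall u : nat -> cfun R X, (forall k, os_car E (u k)) ->
    (forall e, 0 < e -> exists N, forall j k, (N <= j)%N -> (N <= k)%N ->
      nm E (const_mx (u j - u k) : 'M[_]_1) < e) ->
    exists2 x, os_car E x & forall e, 0 < e -> exists N, forall k, (N <= k)%N ->
      nm E (const_mx (u k - x) : 'M[_]_1) < e) ->
  is_operator_space E.
Proof.
move=> sep compl; split; try by case: HE.
- move=> n x Hx nx; apply/matrixP => i j; rewrite mxE; apply: sep => //.
  apply/le_anti; rewrite (nm_ge0 HE) ?andbT; last exact: mx_const.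
  by apply: (le_trans (nm_entry HE i j Hx)); rewrite /nm nx.
- by move=> n c x Hx; rewrite !(nmE HE) //; [rewrite -EFinM nmZ|exact: mxZ].
- by move=> n x y Hx Hy; rewrite !(nmE HE) //; [rewrite -EFinD lee_fin nmD|exact: mxD].
- move=> m n x y Hx Hy; have Hb := mx_block HE Hx Hy; rewrite !(nmE HE) // -EFin_max; congr EFin.
  apply/le_anti; rewrite ge_max nm_block ?le_max ?lexx ?orbT //=.
  have one k : opm (1%:M : 'M[C]_k) 1 by rewrite -[X in opm _ X]cabs1; exact: opm_scalar.
  have z m' n' (z : 'M[cfun R X]_n') : amx (0 : 'M[C]_(m', n')) z (0 : 'M[C]_(n', m')) = 0.
    apply/matrixP => i j; rewrite !mxE big1 // => k _; rewrite big1 // => l _.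
    by rewrite !mxE mul0r scale0r.
  have sel k k' (s : 'I_k -> 'I_k') (w : 'M[cfun R X]_k') : injective s -> os_mx E w ->
      nm E (\matrix_(i, j) w (s i) (s j)) <= nm E w.
    move=> si Hw; rewrite -amx_sel.
    by apply: (le_trans (nm_mul HE Hw (opm_sel si) (opm_tr (opm_sel si)))); rewrite mul1r mulr1.
  apply/andP; split.
    apply: le_trans (sel _ _ (@lshift m n) _ (@lshift_inj _ _) Hb); rewrite le_eqVlt; apply/orP; left.
    by apply/eqP; congr nm; apply/matrixP => i j; rewrite mxE block_mxEul.
  apply: le_trans (sel _ _ (@rshift m n) _ (@rshift_inj _ _) Hb); rewrite le_eqVlt; apply/orP; left.
  by apply/eqP; congr nm; apply/matrixP => i j; rewrite mxE block_mxEdr.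
- move=> m n a x b Hx; have [al ea a0] := mxopnorm_fin a; have [be eb b0] := mxopnorm_fin b.
  have Ha : opm a al by apply/mxopnormP; rewrite ea.
  have Hb : opm b be by apply/mxopnormP; rewrite eb.
  by rewrite ea eb !(nmE HE) //; [rewrite -!EFinM lee_fin nm_mul|exact: mx_amx].
- move=> u Hu; have Hu' k : os_mx E (const_mx (u k) : 'M[_]_1) by exact: mx_const.
  move/(os_cauchyP Hu') => Hc; have [|x Hx lim] := compl u Hu.
    by move=> e e0; have [N HN] := Hc e e0; exists N => j k Nj Nk; rewrite const_mxB; exact: HN.
  exists x; apply/os_cvgP => //; split; first exact: mx_const.
  by move=> e e0; have [N HN] := lim e e0; exists N => k Nk; rewrite -const_mxB; exact: HN.
Qed.

End OperatorSpaces.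

Lemma bilin_small (R : realType) (a b e : R) : 0 < e -> 0 <= a -> 0 <= b ->
  exists2 f, 0 < f & forall p q p' q', 0 <= p -> p < f -> 0 <= q -> q < f ->
    0 <= p' -> p' <= a -> 0 <= q' -> q' <= b -> p * q' + p' * q < e.
Proof.
move=> e0 a0 b0; have ab : 0 < a + b + 1 by rewrite ltr_wpDl // addr_ge0.
exists (e / (a + b + 1)); first by rewrite divr_gt0.
move=> p q p' q' p0 pf q0 qf p'0 p'a q'0 q'b.
have f0 : 0 < e / (a + b + 1) by rewrite divr_gt0.
have : e / (a + b + 1) * (a + b + 1) = e by rewrite divfK // gt_eqF.
move: (e / (a + b + 1)) pf qf f0 => f pf qf f0 <-; rewrite mulrDr mulr1 mulrDr.
have h1 : p * q' <= f * b by apply: ler_pM => //; exact: ltW.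
have h2 : p' * q <= f * a by rewrite [f * a]mulrC; apply: ler_pM => //; exact: ltW.
by move: h1 h2 f0; lra.
Qed.

Section CompletedImage.
Context {R : realType} {X Z : Type} (T : opspace R X) (G : opspace R Z).
Variable phi : cfun R X -> cfun R Z.
Local Notation C := R[i].
Hypotheses (HT : preop T) (HG : preop G).
Hypothesis G_sep : forall a, os_car G a -> nm G (const_mx a : 'M[_]_1) = 0 -> a = 0.
Hypothesis G_complete : forall u : nat -> cfun R Z, (forall k, os_car G (u k)) ->
  (forall e, 0 < e -> exists N, forall j k, (N <= j)%N -> (N <= k)%N ->
     nm G (const_mx (u j - u k) : 'M[_]_1) <= e) ->
  exists2 x, os_car G x & forall e, 0 < e -> exists N, forall k, (N <= k)%N ->
     nm G (const_mx (u k - x) : 'M[_]_1) <= e.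
Hypothesis phi_lin : forall (z : C) u v, phi (z *: u + v) = z *: phi u + phi v.
Hypothesis phi_contr : forall n (u : 'M[cfun R X]_n), os_mx T u ->
  os_mx G (map_mx phi u) /\ nm G (map_mx phi u) <= nm T u.
Local Notation Q := (completed_image T G phi).

Definition cmap n (u : nat -> 'M[cfun R X]_n) (x : 'M[cfun R Z]_n) :=
  [/\ forall k, os_mx T (u k),
      forall e, 0 < e -> exists N, forall j k, (N <= j)%N -> (N <= k)%N -> nm T (u j - u k) < e,
      os_mx G x &
      forall e, 0 < e -> exists N, forall k, (N <= k)%N -> nm G (map_mx phi (u k) - x) < e].

Lemma completed_mapP n (u : nat -> 'M[cfun R X]_n) x : completed_map T G phi u x <-> cmap u x.
Proof.
have aux : (forall k, os_mx T (u k)) -> forall k, os_mx G (map_mx phi (u k)).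
  by move=> H k; apply: (phi_contr (H k)).1.
split=> [[Hu Hc Hl]|[Hu Hc Hx Hl]].
  have [Hx lim] := (os_cvgP HG _ (aux Hu)).1 Hl.
  by split=> //; exact: (os_cauchyP HT Hu).1.
split=> //; first exact/(os_cauchyP HT Hu).
by apply/(os_cvgP HG _ (aux Hu)).
Qed.

Lemma cmap_lim n (u : nat -> 'M[cfun R X]_n) x : cmap u x -> exists2 l,
  limn (fun k => os_norm T (u k)) = l%:E &
  forall e, 0 < e -> exists N, forall k, (N <= k)%N -> `|nm T (u k) - l| <= e.
Proof.
move=> [Hu Hc _ _].
have [l Hl] : exists l, forall e, 0 < e -> exists N, forall k, (N <= k)%N -> `|nm T (u k) - l| <= e.
  apply: real_cauchy_lim => e e0; have [N HN] := Hc e e0; exists N => k Nk.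
  by apply: (le_trans (nm_dist HT (Hu N) (Hu k))); apply: ltW; exact: HN.
exists l => //; apply/cvg_lim => //; apply/fine_cvgP; split.
  by near=> k; rewrite (nmE HT).
apply/cvgrPdist_le => e e0; have [N HN] := Hl e e0; exists N => // k /= Nk.
by rewrite distrC; exact: HN.
Unshelve. all: by end_near. Qed.

Lemma Q_le n (u : nat -> 'M[cfun R X]_n) x c N : cmap u x ->
  (forall k, (N <= k)%N -> nm T (u k) <= c) -> (os_norm Q x <= c%:E)%E.
Proof.
move=> Hu uc; have [l el Hl] := cmap_lim Hu.
apply: (@le_trans _ _ l%:E).
  by apply: ereal_inf_lbound; exists u; [exact/completed_mapP|exact: el].
rewrite lee_fin; apply/ler_addgt0Pr => e e0; have [M HM] := Hl e e0.
have := HM (maxn N M) (leq_maxr _ _); have := uc (maxn N M) (leq_maxl _ _).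
by rewrite ler_distl => h /andP[h1 h2]; move: h h1 h2; lra.
Qed.

(** Dropping an initial segment makes the bound hold for every term of the representing sequence,
    not only for its limit. *)
Lemma Q_lt n (x : 'M[cfun R Z]_n) c : (os_norm Q x < c%:E)%E ->
  exists2 u, cmap u x & forall k, nm T (u k) < c.
Proof.
move/ereal_inf_lt => [_ [u /completed_mapP Hu <-]].
have [l -> Hl] := cmap_lim Hu; rewrite lte_fin => lc.
have cl : 0 < (c - l) / 2 by rewrite divr_gt0 // subr_gt0.
have [N HN] := Hl _ cl; have [H1 H2 H3 H4] := Hu.
exists (fun k => u (k + N)%N) => [|k].
  split=> // e e0.
    have [M HM] := H2 e e0; exists M => j k Mj Mk.
    by apply: HM; [exact: leq_trans Mj (leq_addr _ _)|exact: leq_trans Mk (leq_addr _ _)].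
  by have [M HM] := H4 e e0; exists M => k Mk; apply: HM; exact: leq_trans Mk (leq_addr _ _).
by have := HN (k + N)%N (leq_addl _ _); rewrite ler_distl => /andP[_]; move: lc; lra.
Qed.

Lemma cmap_add n (u v : nat -> 'M[cfun R X]_n) x y : cmap u x -> cmap v y ->
  cmap (fun k => u k + v k) (x + y).
Proof.
move=> [Hu Cu Hx Lu] [Hv Cv Hy Lv].
have Gu k : os_mx G (map_mx phi (u k)) by exact: (phi_contr (Hu k)).1.
have Gv k : os_mx G (map_mx phi (v k)) by exact: (phi_contr (Hv k)).1.
split=> [k|e e0||e e0]; first exact: mxD; last 2 first.
- exact: mxD.
- have e2 : 0 < e / 2 by rewrite divr_gt0.
  have [N HN] := Lu _ e2; have [M HM] := Lv _ e2; exists (maxn N M) => k.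
  rewrite geq_max => /andP[Nk Mk].
  have -> : map_mx phi (u k + v k) - (x + y) = (map_mx phi (u k) - x) + (map_mx phi (v k) - y).
    by apply/matrixP => i j; rewrite !mxE (phiD phi_lin) opprD addrACA.
  rewrite [e]splitr; apply: (le_lt_trans (nmD HG (mxB HG (Gu k) Hx) (mxB HG (Gv k) Hy))).
  by apply: ltrD; [exact: HN|exact: HM].
have e2 : 0 < e / 2 by rewrite divr_gt0.
have [N HN] := Cu _ e2; have [M HM] := Cv _ e2; exists (maxn N M) => j k.
rewrite !geq_max => /andP[Nj Mj] /andP[Nk Mk]; rewrite opprD addrACA [e]splitr.
apply: (le_lt_trans (nmD HT (mxB HT (Hu j) (Hu k)) (mxB HT (Hv j) (Hv k)))).
by apply: ltrD; [exact: HN|exact: HM].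
Qed.

Lemma cmap_amx m n (a : 'M[C]_(m, n)) u x (b : 'M[C]_(n, m)) : cmap u x ->
  cmap (fun k => amx a (u k) b) (amx a x b).
Proof.
move=> [Hu Cu Hx Lu].
have [al _ /mxopnormP Ha] : exists2 al, 0 <= al & (mxopnorm a <= al%:E)%E.
  by have [al -> al0] := mxopnorm_fin a; exists al.
have [be _ /mxopnormP Hb] : exists2 be, 0 <= be & (mxopnorm b <= be%:E)%E.
  by have [be -> be0] := mxopnorm_fin b; exists be.
have a0 := opb_ge0 Ha; have b0 := opb_ge0 Hb.
have c1 : 0 < al * be + 1 by rewrite ltr_wpDl // mulr_ge0.
have sm z e : 0 <= z -> z < e / (al * be + 1) -> al * z * be < e.
  move=> z0; rewrite ltr_pdivlMr // => h; apply: le_lt_trans h.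
  by rewrite mulrAC mulrC ler_wpM2l // lerDl.
split=> [k|e e0||e e0]; first exact: mx_amx; last 2 first.
- exact: mx_amx.
- have e1 : 0 < e / (al * be + 1) by rewrite divr_gt0.
  have [N HN] := Lu _ e1; exists N => k Nk; rewrite (linear_amx phi_lin) -amxN -amxD.
  have Hg := mxB HG (phi_contr (Hu k)).1 Hx.
  apply: (le_lt_trans (nm_mul HG Hg Ha Hb)); apply: sm; [exact: nm_ge0 HG _ _ Hg|exact: HN].
have e1 : 0 < e / (al * be + 1) by rewrite divr_gt0.
have [N HN] := Cu _ e1; exists N => j k Nj Nk; rewrite -amxN -amxD.
have Hg := mxB HT (Hu j) (Hu k).
by apply: (le_lt_trans (nm_mul HT Hg Ha Hb)); apply: sm; [exact: nm_ge0 HT _ _ Hg|exact: HN].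
Qed.

Lemma block_mxB (W : zmodType) m n (x x' : 'M[W]_m) (y y' : 'M[W]_n) :
  block_mx x 0 0 y - block_mx x' 0 0 y' = block_mx (x - x') 0 0 (y - y').
Proof. by rewrite opp_block_mx add_block_mx !oppr0 !addr0. Qed.

Lemma cmap_block m n u (v : nat -> 'M[cfun R X]_n) (x : 'M[cfun R Z]_m) y : cmap u x -> cmap v y ->
  cmap (fun k => block_mx (u k) 0 0 (v k)) (block_mx x 0 0 y).
Proof.
move=> [Hu Cu Hx Lu] [Hv Cv Hy Lv].
have nb (V : Type) (E : opspace R V) (HE : preop E) p q (z : 'M[cfun R V]_p) (w : 'M[cfun R V]_q) c :
    os_mx E z -> os_mx E w -> nm E z < c -> nm E w < c -> nm E (block_mx z 0 0 w) < c.
  move=> Hz Hw zc wc; apply: (@le_lt_trans _ _ (Num.max (nm E z) (nm E w))).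
    by apply: (nm_block HE) => //; rewrite le_max lexx ?orbT.
  by rewrite gt_max zc.
split=> [k|e e0||e e0]; first exact: mx_block; last 2 first.
- exact: mx_block.
- have [N HN] := Lu _ e0; have [M HM] := Lv _ e0; exists (maxn N M) => k.
  rewrite geq_max => /andP[Nk Mk].
  have -> : map_mx phi (block_mx (u k) 0 0 (v k)) = block_mx (map_mx phi (u k)) 0 0 (map_mx phi (v k)).
    by rewrite map_block_mx; congr block_mx; apply/matrixP => i j; rewrite !mxE (phi_0 phi_lin).
  rewrite block_mxB; apply: (nb _ _ HG); try by [exact: HN|exact: HM].
    exact: (mxB HG (phi_contr (Hu k)).1 Hx).
  exact: (mxB HG (phi_contr (Hv k)).1 Hy).
have [N HN] := Cu _ e0; have [M HM] := Cv _ e0; exists (maxn N M) => j k.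
rewrite !geq_max => /andP[Nj Mj] /andP[Nk Mk]; rewrite block_mxB.
by apply: (nb _ _ HT); [exact: mxB|exact: mxB|exact: HN|exact: HM].
Qed.

Lemma cmap_entry n (u : nat -> 'M[cfun R X]_n) x i j : cmap u x ->
  cmap (fun k => const_mx (u k i j) : 'M[_]_1) (const_mx (x i j)).
Proof.
move=> /(cmap_amx (delta_mx 0 i : 'M[C]_(1, n)) (delta_mx j 0 : 'M[C]_(n, 1))); rewrite amx_delta.
by congr cmap; apply/funext => k; rewrite amx_delta.
Qed.

Lemma cmap_cst n (u : 'M[cfun R X]_n) : os_mx T u -> cmap (fun=> u) (map_mx phi u).
Proof.
move=> Hu; split=> // [e e0||e e0].
- by exists 0%N => j k _ _; rewrite subrr nm0.
- exact: (phi_contr Hu).1.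
- by exists 0%N => k _; rewrite subrr nm0.
Qed.

(** The carrier of the quotient is defined entry by entry, whereas its matrix norms use Cauchy
    sequences of matrices. Placing the sequences of the entries at their positions and adding them
    up reconciles the two. *)
Lemma Q_mxP n (x : 'M[cfun R Z]_n) : os_mx Q x <-> exists u, cmap u x.
Proof.
split=> [Hx|[u Hu] i j]; last first.
  by exists (fun k => const_mx (u k i j)); apply/completed_mapP; exact: cmap_entry.
have /choice[U HU] : forall ij : 'I_n * 'I_n, exists u, cmap u (const_mx (x ij.1 ij.2) : 'M[_]_1).
  by move=> ij; have [u /completed_mapP Hu] := Hx ij.1 ij.2; exists u.
have sum_cmap (J : Type) (r : seq J) (f : J -> nat -> 'M[cfun R X]_n) g : (forall j, cmap (f j) (g j)) ->
    cmap (fun k => \sum_(j <- r) f j k) (\sum_(j <- r) g j).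
  move=> H; elim: r => [|j r IH].
    rewrite big_nil; have := cmap_cst (@mx0 _ _ _ HT n).
    rewrite (map_phi0 phi_lin).
    by congr cmap; apply/funext => k; rewrite big_nil.
  rewrite big_cons; have := cmap_add (H j) IH.
  by congr cmap; apply/funext => k; rewrite big_cons.
exists (fun k => \sum_i \sum_j amx (delta_mx i 0) (U (i, j) k) (delta_mx 0 j)).
rewrite (mx_sum_amx_delta x); apply: (sum_cmap) => i; apply: (sum_cmap) => j.
by apply: cmap_amx; exact: (HU (i, j)).
Qed.

Lemma Q_ge0 n (x : 'M[cfun R Z]_n) : (0 <= os_norm Q x)%E.
Proof.
apply: le_ereal_inf_tmp => _ [u /completed_mapP Hu <-]; have [l -> Hl] := cmap_lim Hu.
rewrite lee_fin; apply/ler_addgt0Pr => e /Hl[N /(_ N (leqnn N))].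
case: Hu => Hu _ _ _; have := nm_ge0 HT (Hu N).
by rewrite ler_distl => h /andP[_ h2]; move: h h2; lra.
Qed.

Lemma completed_image_preop : preop Q.
Proof.
have mx1 a : os_car Q a <-> exists u, cmap u (const_mx a : 'M[_]_1).
  split=> [[u /completed_mapP Hu]|[u Hu]]; exists u => //; exact/completed_mapP.
split=> [|a b /mx1[u Hu] /mx1[v Hv]|z a /mx1[u Hu]|n x _|n x /Q_mxP[u Hu]||].
- apply/mx1; exists (fun=> 0); have := cmap_cst (@mx0 _ _ _ HT 1); congr cmap.
  by apply/matrixP => i j; rewrite !mxE (phi_0 phi_lin).
- apply/mx1; exists (fun k => u k + v k); have := cmap_add Hu Hv; congr cmap.
  by apply/matrixP => i j; rewrite !mxE.
- apply/mx1; exists (fun k => amx z%:M (u k) 1%:M); have := cmap_amx z%:M 1%:M Hu; congr cmap.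
  by rewrite amx_scalar mulr1; apply/matrixP => i j; rewrite !mxE.
- exact: Q_ge0.
- have [Cu _ _ _] := Hu; have [l _ Hl] := cmap_lim Hu; have [N HN] := Hl 1 ltr01.
  have := @Q_le _ _ _ (l + 1) N Hu; move/(_ _)/le_lt_trans; apply; last exact: ltry.
  by move=> k Nk; have := HN k Nk; rewrite ler_distl => /andP[_]; rewrite addrC.
- move=> m n a x b al be c Hx Ha Hb xc; apply/lee_addgt0Pr => e e0.
  have a0 := opb_ge0 Ha; have b0 := opb_ge0 Hb.
  have c1 : 0 < al * be + 1 by rewrite ltr_wpDl // mulr_ge0.
  have [|u Hu uc] := @Q_lt _ x (c + e / (al * be + 1)).
    by apply: le_lt_trans xc _; rewrite lte_fin ltrDl divr_gt0.
  rewrite -EFinD; apply: (Q_le (N := 0) (cmap_amx a b Hu)) => k _.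
  have [Cu _ _ _] := Hu; apply: (le_trans (nm_mul HT (Cu k) Ha Hb)).
  apply: (@le_trans _ _ (al * (c + e / (al * be + 1)) * be)).
    by rewrite ler_wpM2r // ler_wpM2l // ltW.
  rewrite mulrDr mulrDl lerD2l mulrAC mulrA ler_pdivrMr // mulrC.
  by rewrite ler_pM2l // lerDl.
- move=> m n x y c Hx Hy xc yc; apply/lee_addgt0Pr => e e0.
  have lt z : (z <= c%:E -> z < (c + e)%:E)%E.
    by move=> h; apply: le_lt_trans h _; rewrite lte_fin ltrDl.
  have [u Hu uc] := Q_lt (lt _ xc); have [v Hv vc] := Q_lt (lt _ yc).
  rewrite -EFinD; apply: (Q_le (N := 0) (cmap_block Hu Hv)) => k _.
  by apply: nm_block => //; [case: Hu|case: Hv|exact: ltW|exact: ltW].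
Qed.

Let HQ := completed_image_preop.

Lemma Q_nm_le n (u : nat -> 'M[cfun R X]_n) x c N : cmap u x ->
  (forall k, (N <= k)%N -> nm T (u k) <= c) -> nm Q x <= c.
Proof.
move=> Hu uc; rewrite -lee_fin -(nmE HQ); first exact: Q_le Hu uc.
by apply/Q_mxP; exists u.
Qed.

Lemma Q_nm_lt n (x : 'M[cfun R Z]_n) c : os_mx Q x -> nm Q x < c ->
  exists2 u, cmap u x & forall k, nm T (u k) < c.
Proof. by move=> Hx xc; apply: Q_lt; rewrite (nmE HQ) // lte_fin. Qed.

Lemma completed_image_le n (x : 'M[cfun R Z]_n) : os_mx Q x -> os_mx G x /\ nm G x <= nm Q x.
Proof.
move=> Hx; have [u [_ _ Gx _]] := (Q_mxP x).1 Hx; split=> //; apply/ler_addgt0Pr => e e0.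
have e2 : 0 < e / 2 by rewrite divr_gt0.
have [|v [Hv Cv _ Lv] vc] := @Q_nm_lt _ x (nm Q x + e / 2) Hx; first by rewrite ltrDl.
have [N HN] := Lv _ e2; have [Gv nv] := phi_contr (Hv N).
have := nmD HG (mxB HG Gx Gv) Gv; rewrite subrK (nmBC HG) //.
have := HN N (leqnn N); have := vc N; move: nv; lra.
Qed.

(** A late term of a representing Cauchy sequence lifts [x] up to [e] without enlarging the norm
    bound: what is left over is represented by the differences to that term. *)
Lemma completed_image_approx (x : cfun R Z) c e : 0 < e -> os_car Q x ->
  nm Q (const_mx x : 'M[_]_1) < c ->
  exists d, [/\ os_car T d, nm T (const_mx d : 'M[_]_1) < c &
                nm Q (const_mx (x - phi d) : 'M[_]_1) <= e].
Proof.
move=> e0 Hx xc; have [u Hu uc] := Q_nm_lt (mx_const Hx) xc.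
have [Cu Du _ _] := Hu; have [N HN] := Du e e0.
have eu : u N = const_mx (u N 0 0) by exact: const_mx_entry.
exists (u N 0 0); split; [exact: Cu|by rewrite -eu|].
have H := cmap_add Hu (cmap_amx (-1)%:M 1%:M (cmap_cst (Cu N))).
have -> : const_mx (x - phi (u N 0 0)) =
    const_mx x + amx (-1)%:M (map_mx phi (u N)) 1%:M :> 'M[cfun R Z]_1.
  by rewrite amx_scalar mulr1 smxN1 eu const_mxB; congr (_ - _); apply/matrixP => i j; rewrite !mxE.
apply: (Q_nm_le (N := N) H) => k Nk.
by rewrite amx_scalar mulr1 smxN1 ltW // HN.
Qed.

Lemma phi_car d : os_car T d -> os_car Q (phi d) /\
  nm Q (const_mx (phi d) : 'M[_]_1) <= nm T (const_mx d : 'M[_]_1).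
Proof.
move=> Hd; have h := cmap_cst (mx_const Hd).
have e1 : map_mx phi (const_mx d : 'M[_]_1) = const_mx (phi d).
  by apply/matrixP => i j; rewrite !mxE.
rewrite e1 in h; split; first by exists (fun=> const_mx d); apply/completed_mapP.
exact: (Q_nm_le (N := 0) h).
Qed.

(* Successive approximation: the [D k] form a Cauchy sequence of [T] whose images follow a
   fast subsequence of the given Cauchy sequence of the quotient. *)
Lemma completed_image_complete (x : nat -> cfun R Z) : (forall k, os_car Q (x k)) ->
  (forall e, 0 < e -> exists N, forall j k, (N <= j)%N -> (N <= k)%N ->
    nm Q (const_mx (x j - x k) : 'M[_]_1) < e) ->
  exists2 l, os_car Q l & forall e, 0 < e -> exists N, forall k, (N <= k)%N ->
    nm Q (const_mx (x k - l) : 'M[_]_1) < e.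
Proof.
move=> Hx Hc.
have lin1 (a b c d : R) : a <= 4 * c - 4 * b -> d < 2 * b -> b = 2 * (b / 2) -> d + a <= 4 * c - 4 * (b / 2).
  lra.
have lin2 (a b c d : R) : a <= 4 * c -> b <= 4 * c -> 8 * c < d -> a + b < d by lra.
have lin3 (a b c d f e : R) : a <= 4 * d -> 8 * d < e -> b < d -> 0 < d -> c <= b + a -> f < d -> f + c < e.
  lra.
pose h k : R := 2^-1 ^+ k.
have h0 k : 0 < h k by rewrite exprn_gt0 // invr_gt0.
have hS k : h k = 2 * h k.+1 by rewrite /h exprS mulrA divff ?mul1r // pnatr_eq0.
have /choice[Nf HNf] := fun k => Hc (h k) (h0 k).
(* Summing the [Nf j] gives an index beyond [Nf k] both at stage [k] and at stage [k.+1]. *)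
pose M k := (\sum_(j < k.+1) Nf j)%N.
have NM k : (Nf k <= M k)%N by rewrite /M big_ord_recr leq_addl.
have NMS k : (Nf k <= M k.+1)%N by rewrite /M big_ord_recr /=; exact: leq_trans (NM k) (leq_addr _ _).
pose y k := x (M k).
have Q2 a b : os_car Q a -> os_car Q b -> os_car Q (a - b).
  by move=> Ha Hb; exact: (po_D HQ Ha (carN HQ Hb)).
have tri a b c : os_car Q a -> os_car Q b -> os_car Q c -> nm Q (const_mx (a - c) : 'M[_]_1) <=
    nm Q (const_mx (a - b) : 'M[_]_1) + nm Q (const_mx (b - c) : 'M[_]_1).
  by move=> Ha Hb Hc'; rewrite !const_mxB; apply: (nm_tri HQ); exact: mx_const.
pose P k d := os_car T d /\ nm Q (const_mx (y k - phi d) : 'M[_]_1) < h k.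
(* The invariant [P] is a premise inside the existential, so that [choice] yields a total function;
   off the invariant any witness will do. *)
have step kd : exists d', P kd.1 kd.2 ->
    P kd.1.+1 d' /\ nm T (const_mx (d' - kd.2) : 'M[_]_1) < 2 * h kd.1.
  case: kd => k d /=; have [[Hd nd]|np] := pselect (P k d); last by exists d.
  have Hpd := (phi_car Hd).1.
  have lt : nm Q (const_mx (y k.+1 - phi d) : 'M[_]_1) < 2 * h k.
    apply: (le_lt_trans (tri _ (y k) _ (Hx _) (Hx _) Hpd)).
    by rewrite mulr_natl mulr2n; apply: ltrD nd; exact: HNf.
  have hS2 : 0 < h k.+1 / 2 by rewrite divr_gt0.
  have [d' [Hd' nd' ad']] := completed_image_approx hS2 (Q2 _ _ (Hx _) Hpd) lt.
  exists (d + d') => _; split; last by rewrite addrC addKr.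
  split; first exact: (po_D HT).
  rewrite (phiD phi_lin) opprD addrA; apply: (le_lt_trans ad').
  by rewrite ltr_pdivrMr // ltr_pMr // ltr1n.
have [f Hf] := choice step.
have h02 : 0 < h 0%N / 2 by rewrite divr_gt0.
have [d0 [Hd0 _ ad0]] := completed_image_approx h02 (Hx (M 0%N)) (ltr_pwDr ltr01 (lexx _)).
pose D := fix D k := if k is k'.+1 then f (k', D k') else d0.
have PD k : P k (D k).
  elim: k => [|k IH]; last by have [] := Hf (k, D k) IH.
  split=> //; apply: (le_lt_trans ad0); by rewrite ltr_pdivrMr // ltr_pMr // ltr1n.
have DS k : nm T (const_mx (D k.+1 - D k) : 'M[_]_1) < 2 * h k by have [] := Hf (k, D k) (PD k).
have HD k : os_mx T (const_mx (D k) : 'M[_]_1) by apply: mx_const; exact: (PD k).1.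
(* The increments telescope, because [2 * h k = 4 * h k - 4 * h k.+1]. *)
have Dfar k j : nm T (const_mx (D (k + j)%N - D k) : 'M[_]_1) <= 4 * h k - 4 * h (k + j)%N.
  elim: j => [|j IH]; first by rewrite addn0 const_mxB !subrr nm0.
  rewrite const_mxB; apply: (le_trans (nm_tri HT (HD _) (HD (k + j)%N) (HD _))).
  rewrite -!const_mxB addnS.
  have -> : h (k + j).+1 = h (k + j)%N / 2 by rewrite [h (k + j)%N]hS mulrAC divff ?mul1r // pnatr_eq0.
  by apply: lin1 => //; rewrite mulrCA divff ?mulr1 // pnatr_eq0.
have Dcau k j : (k <= j)%N -> nm T (const_mx (D j - D k) : 'M[_]_1) <= 4 * h k.
  move=> kj; rewrite -(subnKC kj); apply: (le_trans (Dfar k _)).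
  by rewrite gerBl mulr_ge0 // ltW.
have small e : 0 < e -> exists k, 8 * h k < e.
  move=> e0; exists (Num.bound (8 / e)).
  have kb : 8 / e < (Num.bound (8 / e))%:R by apply: archi_boundP; rewrite divr_ge0 ?ltW.
  rewrite /h exprVn ltr_pdivrMr ?exprn_gt0 // mulrC -ltr_pdivrMr //.
  by apply: (lt_trans kb); rewrite -natrX ltr_nat ltn_expl.
have HDc e : 0 < e -> exists N, forall j k, (N <= j)%N -> (N <= k)%N ->
    nm T (const_mx (D j) - const_mx (D k) : 'M[_]_1) < e.
  move=> e0; have [N HN] := small e e0; exists N => j k Nj Nk.
  apply: (le_lt_trans (nm_tri HT (HD j) (HD N) (HD k))).
  rewrite [X in _ + X](nmBC HT) // -!const_mxB.
  exact: (lin2 _ _ _ _ (Dcau N j Nj) (Dcau N k Nk) HN).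
have phiE a : map_mx phi (const_mx a : 'M[_]_1) = const_mx (phi a).
  by apply/matrixP => i j; rewrite !mxE.
have [||l Hl Ll] := G_complete (u := fun k => phi (D k)).
- by move=> k; have := (phi_contr (HD k)).1; rewrite phiE => /(_ 0 0); rewrite mxE.
- move=> e e0; have [N HN] := HDc e e0; exists N => j k Nj Nk.
  rewrite -(phiB phi_lin) -phiE; apply: (le_trans (phi_contr (mx_const _)).2).
    by apply: (po_D HT) ((PD j).1) (carN HT (PD k).1).
  by rewrite const_mxB ltW // HN.
have Hcm : cmap (fun k => const_mx (D k) : 'M[_]_1) (const_mx l).
  split=> //; first exact: mx_const.
  move=> e e0; have e2 : 0 < e / 2 by rewrite divr_gt0.
  have [N HN] := Ll _ e2; exists N => k Nk; rewrite phiE -const_mxB.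
  by apply: (le_lt_trans (HN k Nk)); rewrite ltr_pdivrMr // ltr_pMr // ltr1n.
have Ql : os_car Q l by exists (fun k => const_mx (D k)); apply/completed_mapP.
exists l => // e e0; have [k Hk] := small e e0; exists (Nf k) => j Nj.
have Pk := (phi_car (PD k).1).1.
have lD : nm Q (const_mx (phi (D k) - l) : 'M[_]_1) <= 4 * h k.
  rewrite const_mxB (nmBC HQ); [|exact: mx_const|exact: mx_const].
  have Hd := cmap_add Hcm (cmap_amx (-1)%:M 1%:M (cmap_cst (HD k))).
  have e1 : const_mx l - const_mx (phi (D k)) =
      const_mx l + amx (-1)%:M (map_mx phi (const_mx (D k))) 1%:M :> 'M[cfun R Z]_1.
    by rewrite amx_scalar mulr1 smxN1 phiE.
  rewrite e1; apply: (Q_nm_le (N := k) Hd) => j' kj'.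
  by rewrite amx_scalar mulr1 smxN1 -const_mxB Dcau.
apply: (le_lt_trans (tri _ (y k) _ (Hx j) (Hx _) Ql)).
exact: (lin3 _ _ _ _ _ _ lD Hk (PD k).2 (h0 k) (tri _ (phi (D k)) _ (Hx (M k)) Pk Ql)
  (HNf k j (M k) Nj (NM k))).
Qed.

(** Separation is inherited from [G], whose norm on the image is dominated by the quotient norm. *)
Lemma completed_image_operator_space : is_operator_space Q.
Proof.
apply: (preop_operator_space HQ); last exact: completed_image_complete.
move=> a Ha na; apply: G_sep; first by have := (completed_image_le (mx_const Ha)).1 0 0; rewrite mxE.
have [Ga le] := completed_image_le (mx_const Ha).
by apply/le_anti; rewrite (nm_ge0 HG) // andbT -na.
Qed.

Variables (mulT : cfun R X -> cfun R X -> cfun R X) (mulG : cfun R Z -> cfun R Z -> cfun R Z).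
Hypotheses (jT : jointly_cc T T T mulT) (jG : jointly_cc G G G mulG).
Hypothesis phi_mul : forall a b, phi (mulT a b) = mulG (phi a) (phi b).
Hypothesis mulTBl : forall a a' b, mulT (a - a') b = mulT a b - mulT a' b.
Hypothesis mulTBr : forall a b b', mulT a (b - b') = mulT a b - mulT a b'.
Hypothesis mulGBl : forall a a' b, mulG (a - a') b = mulG a b - mulG a' b.
Hypothesis mulGBr : forall a b b', mulG a (b - b') = mulG a b - mulG a b'.

Lemma jointly_cc_dist (V : Type) (E : opspace R V) mul m n (x x' : 'M[cfun R V]_m) (y y' : 'M[cfun R V]_n) :
  preop E -> jointly_cc E E E mul -> (forall a a' b, mul (a - a') b = mul a b - mul a' b) ->
  (forall a b b', mul a (b - b') = mul a b - mul a b') ->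
  os_mx E x -> os_mx E x' -> os_mx E y -> os_mx E y' ->
  nm E (amplify mul x y - amplify mul x' y') <= nm E (x - x') * nm E y + nm E x' * nm E (y - y').
Proof.
move=> HE jE Bl Br Hx Hx' Hy Hy'.
have -> : amplify mul x y - amplify mul x' y' = amplify mul (x - x') y + amplify mul x' (y - y').
  by apply/matrixP => i j; rewrite !mxE Bl Br addrA subrK.
have [H1 n1] := jE _ _ _ _ (mxB HE Hx Hx') Hy; have [H2 n2] := jE _ _ _ _ Hx' (mxB HE Hy Hy').
by apply: (le_trans (nmD HE H1 H2)); exact: lerD.
Qed.

Lemma cmap_mul m n (u : nat -> 'M[cfun R X]_m) (v : nat -> 'M[cfun R X]_n) x y c d :
  (forall k, nm T (u k) < c) -> (forall k, nm T (v k) < d) -> cmap u x -> cmap v y ->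
  cmap (fun k => amplify mulT (u k) (v k)) (amplify mulG x y).
Proof.
move=> uc vd [Hu Cu Hx Lu] [Hv Cv Hy Lv].
have c0 : 0 < c by apply: le_lt_trans (uc 0%N); exact: nm_ge0 HT _ _ _.
have d0 : 0 < d by apply: le_lt_trans (vd 0%N); exact: nm_ge0 HT _ _ _.
have y0 := nm_ge0 HG Hy.
split=> [k|e e0||e e0]; first exact: (jT (Hu k) (Hv k)).1; last 2 first.
- exact: (jG Hx Hy).1.
- have [f f0 Hf] := bilin_small e0 (ltW c0) (addr_ge0 y0 (ltW d0)).
  have [N HN] := Lu _ f0; have [M HM] := Lv _ f0; exists (maxn N M) => k.
  rewrite geq_max => /andP[Nk Mk].
  have -> : map_mx phi (amplify mulT (u k) (v k)) = amplify mulG (map_mx phi (u k)) (map_mx phi (v k)).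
    by apply/matrixP => i j; rewrite !mxE phi_mul.
  have [Gu nu] := phi_contr (Hu k); have [Gv nv] := phi_contr (Hv k).
  rewrite (nmBC HG) ?(jG Gu Gv).1 ?(jG Hx Hy).1 //; last exact: (jG Hx Hy).1; last exact: (jG Gu Gv).1.
  apply: (le_lt_trans (jointly_cc_dist HG jG mulGBl mulGBr Hx Gu Hy Gv)).
  rewrite (nmBC HG) // [nm G (y - _)](nmBC HG) //.
  apply: Hf => //; try by apply: (nm_ge0 HG) => //; exact: mxB.
  + exact: HN.
  + exact: HM.
  + by apply: (le_trans nu); exact: ltW.
  + by rewrite lerDl ltW.
have [f f0 Hf] := bilin_small e0 (ltW c0) (ltW d0).
have [N HN] := Cu _ f0; have [M HM] := Cv _ f0; exists (maxn N M) => j k.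
rewrite !geq_max => /andP[Nj Mj] /andP[Nk Mk].
apply: (le_lt_trans (jointly_cc_dist HT jT mulTBl mulTBr (Hu j) (Hu k) (Hv j) (Hv k))).
apply: Hf => //; try by apply: (nm_ge0 HT) => //; exact: mxB.
- exact: HN.
- exact: HM.
- exact: ltW.
- exact: ltW.
Qed.

(** Near-optimal representing sequences are multiplied term by term; [cmap_mul] identifies the limit
    because [phi] is multiplicative and both products are continuous. *)
Lemma completed_image_jointly_cc : jointly_cc Q Q Q mulG.
Proof.
move=> m n x y Hx Hy; have x0 := nm_ge0 HQ Hx; have y0 := nm_ge0 HQ Hy.
have rep e : 0 < e -> exists2 u, cmap u (amplify mulG x y) &
    forall k, nm T (u k) <= (nm Q x + e) * (nm Q y + e).
  move=> e0; have [|u Hu uc] := @Q_nm_lt _ x (nm Q x + e) Hx; first by rewrite ltrDl.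
  have [|v Hv vc] := @Q_nm_lt _ y (nm Q y + e) Hy; first by rewrite ltrDl.
  exists (fun k => amplify mulT (u k) (v k)); first exact: cmap_mul uc vc Hu Hv.
  have [Tu _ _ _] := Hu; have [Tv _ _ _] := Hv.
  by move=> k; apply: (le_trans (jT (Tu k) (Tv k)).2); apply: ler_pM;
    [exact: nm_ge0 HT _ _ _|exact: nm_ge0 HT _ _ _|exact: ltW|exact: ltW].
split; first by have [u Hu _] := rep 1 ltr01; apply/Q_mxP; exists u.
apply: mul_addgt0 => // e /rep[u Hu uc]; exact: (Q_nm_le (N := 0) Hu).
Qed.

End CompletedImage.

Lemma half_sum_le (R : realType) N : \sum_(k < N) (2^-1 : R) ^+ k <= 2.
Proof.
suff -> : \sum_(k < N) (2^-1 : R) ^+ k = 2 - 2 * 2^-1 ^+ N by rewrite gerBl mulr_ge0 ?exprn_ge0 ?invr_ge0.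
elim: N => [|N IH]; first by rewrite big_ord0 expr0 mulr1 subrr.
by rewrite big_ord_recr IH exprS mulrA divff ?pnatr_eq0 // mul1r; move: (_ ^+ N) => x /=; lra.
Qed.

Lemma half_pow_small (R : realType) (K e : R) : 0 < e -> exists N, forall m, (N <= m)%N ->
  K * 2^-1 ^+ m <= e.
Proof.
move=> e0; exists (Num.bound (`|K| / e)) => m Nm.
have h : `|K| / e < m%:R.
  apply: (@lt_le_trans _ _ (Num.bound (`|K| / e))%:R); last by rewrite ler_nat.
  by apply: archi_boundP; rewrite divr_ge0 // ltW.
rewrite exprVn ler_pdivrMr ?exprn_gt0 //; apply: (le_trans (ler_norm K)).
move: h; rewrite ltr_pdivrMr // => h; apply: (le_trans (ltW h)); rewrite mulrC ler_pM2l //.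
by rewrite -natrX ler_nat ltnW // ltn_expl.
Qed.

(** * Admissible functions and interpolation *)

Section ScalarAnalysis.
Context {R : realType}.
Local Notation C := R[i].
Implicit Types (g f : C -> C) (z h w : C).

(** Convergence at the radius [s = r / 2] bounds the numbers [s^k |al k|] by some [B]. For
    [|h| < s / 2] the terms from degree three on are then dominated by a geometric series of ratio
    one half, which explains the constant [2 * B / s ^+ 3]. *)
Lemma taylor2_series g z (al : nat -> C) (r : R) : 0 < r ->
  (forall h, cabs h < r -> forall e, 0 < e -> exists N, forall m, (N <= m)%N ->
     cabs (g (z + h) - \sum_(k < m) h ^+ k * al k) <= e) -> taylor2 g z.
Proof.
move=> r0 H.
have g0 : g z = al 0%N.
  apply/eqP; rewrite -subr_eq0; apply/eqP/cabs_eq0/le_anti; rewrite cabs_ge0 andbT.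
  apply/ler_addgt0Pr => e e0; rewrite add0r; have [|N HN] := H 0 _ e e0; first by rewrite cabs0.
  have := HN N.+1 (leqnSn N); rewrite addr0 big_ord_recl expr0 mul1r big1 ?addr0 // => k _.
  by rewrite expr0n mul0r.
pose s := r / 2; have s0 : 0 < s by rewrite divr_gt0.
have sr : s < r by rewrite /s ltr_pdivrMr // ltr_pMr // ltr1n.
have cs : cabs (real_complex R s) = s by rewrite cabs_real gtr0_norm.
have [B B0 HB] : exists2 B, 0 <= B & forall k, s ^+ k * cabs (al k) <= B.
  have [|N HN] := H (real_complex R s) _ 1 ltr01; first by rewrite cs.
  exists (2 + \sum_(k < N) s ^+ k * cabs (al k)).
    by rewrite addr_ge0 // sumr_ge0 // => k _; rewrite mulr_ge0 ?cabs_ge0 ?exprn_ge0 // ltW.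
  move=> k; have [kN|Nk] := ltnP k N.
    rewrite (bigD1 (Ordinal kN)) //= addrCA lerDl addr_ge0 // sumr_ge0 // => j _.
    by rewrite mulr_ge0 ?cabs_ge0 ?exprn_ge0 // ltW.
  have := cabsD (g (z + real_complex R s) - \sum_(j < k) real_complex R s ^+ j * al j)
     (- (g (z + real_complex R s) - \sum_(j < k.+1) real_complex R s ^+ j * al j)).
  have -> : g (z + real_complex R s) - \sum_(j < k) real_complex R s ^+ j * al j -
      (g (z + real_complex R s) - \sum_(j < k.+1) real_complex R s ^+ j * al j) =
      real_complex R s ^+ k * al k.
    by rewrite big_ord_recr /=; move: (\sum_(_ < _) _) (g _) (_ ^+ k * _) => x y t; ring.
  rewrite cabsM cabsX cs cabsN => h1; apply: (le_trans h1).
  have h2 := HN k Nk; have h3 := HN k.+1 (leqW Nk).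
  have s1 : 0 <= \sum_(j < N) s ^+ j * cabs (al j).
    by apply: sumr_ge0 => j _; rewrite mulr_ge0 ?cabs_ge0 ?exprn_ge0 // ltW.
  by apply: (le_trans (lerD h2 h3)); rewrite -(natrD _ 1 1) lerDl.
exists (al 1%N), (al 2%N), (2 * B / s ^+ 3), (s / 2); split; first by rewrite divr_gt0.
  by rewrite divr_ge0 ?mulr_ge0 ?exprn_ge0 // ltW.
move=> h hs; have hs' : cabs h < s by apply: (lt_trans hs); rewrite ltr_pdivrMr // ltr_pMr // ltr1n.
apply/ler_addgt0Pr => e e0; have [N HN] := H h (lt_trans hs' sr) e e0.
have -> : g (z + h) - (g z + al 1%N * h + al 2%N * h ^+ 2) =
    (g (z + h) - \sum_(k < N.+3) h ^+ k * al k) + \sum_(k < N) h ^+ (k + 3) * al (k + 3)%N.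
  rewrite 3!big_ord_recl /= /bump /= !add1n expr0 expr1 mul1r g0.
  have -> : \sum_(i < N) h ^+ i.+3 * al i.+3 = \sum_(k < N) h ^+ (k + 3) * al (k + 3)%N.
    by apply: eq_bigr => k _; rewrite addn3.
  ring.
apply: (le_trans (cabsD _ _)); rewrite addrC; apply: lerD; last by apply: HN; rewrite -addn3 leq_addr.
apply: (le_trans (cabs_sum _ _ _)).
pose q := cabs h / s; have q0 : 0 <= q by rewrite divr_ge0 ?cabs_ge0 // ltW.
have q2 : q <= 2^-1 by rewrite /q ler_pdivrMr // mulrC ltW.
apply: (@le_trans _ _ (\sum_(k < N) B * q ^+ 3 * (2^-1) ^+ k)).
  apply: ler_sum => k _; rewrite cabsM cabsX.
  have -> : cabs h = q * s by rewrite /q divfK // gt_eqF.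
  rewrite exprMn; apply: (@le_trans _ _ (B * q ^+ (k + 3))).
    by rewrite -[leLHS]mulrA mulrC ler_wpM2r ?exprn_ge0.
  rewrite -[leRHS]mulrA ler_wpM2l // addnC exprD ler_wpM2l ?exprn_ge0 //.
  by apply: lerXn2r; rewrite ?nnegrE ?invr_ge0.
rewrite -mulr_sumr.
have e3 (x y t : R) : 2 * t / y * x = t * (x / y) * 2 by ring.
rewrite e3 -expr_div_n -/q.
by apply: ler_wpM2l; [rewrite mulr_ge0 ?exprn_ge0|exact: half_sum_le].
Qed.

Lemma taylor2_cst c z : taylor2 (fun=> c) z.
Proof.
exists 0, 0, 0, 1; split=> // h _.
by rewrite !mul0r !addr0 subrr cabs0.
Qed.

Lemma taylor2D f g z : taylor2 f z -> taylor2 g z -> taylor2 (fun w => f w + g w) z.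
Proof.
move=> [a1 [a2 [A [r [r0 A0 Hf]]]]] [b1 [b2 [B [s [s0 B0 Hg]]]]].
exists (a1 + b1), (a2 + b2), (A + B), (Num.min r s); split.
- by rewrite lt_min r0.
- exact: addr_ge0.
move=> h; rewrite lt_min => /andP[hr hs].
have -> : f (z + h) + g (z + h) - (f z + g z + (a1 + b1) * h + (a2 + b2) * h ^+ 2) =
  (f (z + h) - (f z + a1 * h + a2 * h ^+ 2)) + (g (z + h) - (g z + b1 * h + b2 * h ^+ 2)) by ring.
by rewrite mulrDl; apply: (le_trans (cabsD _ _)); apply: lerD; [exact: Hf|exact: Hg].
Qed.

Lemma taylor2M f g z : taylor2 f z -> taylor2 g z -> taylor2 (fun w => f w * g w) z.
Proof.
move=> [a1 [a2 [A [r [r0 A0 Hf]]]]] [b1 [b2 [B [s [s0 B0 Hg]]]]].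
pose a0 := f z; pose b0 := g z.
pose D := cabs a0 + cabs a1 + cabs a2 + A; pose E := cabs b0 + cabs b1 + cabs b2 + B.
exists (a1 * b0 + a0 * b1), (a2 * b0 + a1 * b1 + a0 * b2),
  (A * E + D * B + (cabs a1 * cabs b2 + cabs a2 * cabs b1 + cabs a2 * cabs b2)),
  (Num.min 1 (Num.min r s)).
have D0 : 0 <= D by rewrite !addr_ge0 ?cabs_ge0.
have E0 : 0 <= E by rewrite !addr_ge0 ?cabs_ge0.
split.
- by rewrite !lt_min ltr01 r0.
- by rewrite !addr_ge0 ?mulr_ge0 ?cabs_ge0.
move=> h; rewrite !lt_min => /and3P[h1 hr hs].
set p := a0 + a1 * h + a2 * h ^+ 2; set q := b0 + b1 * h + b2 * h ^+ 2.
have x0 := cabs_ge0 h; have x1 := ltW h1.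
have x3 : cabs h ^+ 3 <= 1 by rewrite exprn_ile1.
have cp : cabs p <= cabs a0 + cabs a1 + cabs a2.
  apply: (le_trans (cabsD _ _)); apply: lerD; first (apply: (le_trans (cabsD _ _)); apply: lerD => //).
    by rewrite cabsM ler_piMr ?cabs_ge0.
  by rewrite cabsM cabsX ler_piMr ?cabs_ge0 // exprn_ile1.
have cg : cabs (g (z + h)) <= E.
  rewrite -[g (z + h)](subrK q) addrC; apply: (le_trans (cabsD _ _)); apply: lerD.
    apply: (le_trans (cabsD _ _)); apply: lerD; first (apply: (le_trans (cabsD _ _)); apply: lerD => //).
      by rewrite cabsM ler_piMr ?cabs_ge0.
    by rewrite cabsM cabsX ler_piMr ?cabs_ge0 // exprn_ile1.
  by apply: (le_trans (Hg h hs)); rewrite ler_piMr.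
have -> : f (z + h) * g (z + h) - (a0 * b0 + (a1 * b0 + a0 * b1) * h + (a2 * b0 + a1 * b1 + a0 * b2) * h ^+ 2) =
    (f (z + h) - p) * g (z + h) + p * (g (z + h) - q) +
    (a1 * b2 + a2 * b1 + a2 * b2 * h) * h ^+ 3.
  by rewrite /p /q; ring.
rewrite [leRHS]mulrDl [X in _ <= X + _]mulrDl; apply: (le_trans (cabsD _ _)); apply: lerD.
  apply: (le_trans (cabsD _ _)); rewrite !cabsM; apply: lerD.
    by rewrite mulrAC; apply: ler_pM; rewrite ?cabs_ge0 ?Hf.
  rewrite -mulrA; apply: ler_pM; rewrite ?cabs_ge0 ?Hg //.
  by apply: (le_trans cp); rewrite lerDl.
rewrite cabsM cabsX ler_wpM2r ?exprn_ge0 //; apply: (le_trans (cabsD _ _)); apply: lerD.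
  by apply: (le_trans (cabsD _ _)); rewrite !cabsM.
by rewrite !cabsM ler_piMr ?mulr_ge0 ?cabs_ge0.
Qed.

Lemma taylor2_flip g z : taylor2 g (1 - z) -> taylor2 (fun w => g (1 - w)) z.
Proof.
move=> [a1 [a2 [A [r [r0 A0 Hg]]]]]; exists (- a1), a2, A, r; split=> // h hr.
have := Hg (- h); rewrite cabsN => /(_ hr); rewrite sqrrN mulrN mulNr.
by have -> : 1 - (z + h) = 1 - z - h by ring.
Qed.

(** The hypotheses of [three_lines] other than the edge bounds; they are stable under sums, products
    and the reflection of the strip. *)
Definition strip_fun g := [/\ cont_strip g, exists B, forall z, strip z -> cabs (g z) <= B &
  forall z, open_strip z -> taylor2 g z].

Lemma strip_fun_cst c : strip_fun (fun=> c).
Proof.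
split=> [z _ e e0||z _]; last exact: taylor2_cst.
  by exists 1 => // w _ _; rewrite subrr cabs0.
by exists (cabs c).
Qed.

Lemma strip_funD f g : strip_fun f -> strip_fun g -> strip_fun (fun w => f w + g w).
Proof.
move=> [cf [A bf] tf] [cg [B bg] tg]; split=> [z sz e e0||z sz]; last first.
- by apply: taylor2D; [exact: tf|exact: tg].
- by exists (A + B) => z sz; apply: (le_trans (cabsD _ _)); apply: lerD; [exact: bf|exact: bg].
have e2 : 0 < e / 2 by rewrite divr_gt0.
have [d d0 Hd] := cf z sz _ e2; have [d' d'0 Hd'] := cg z sz _ e2.
exists (Num.min d d'); first by rewrite lt_min d0.
move=> w sw; rewrite lt_min => /andP[wd wd']; rewrite opprD addrACA [e]splitr.
by apply: (le_lt_trans (cabsD _ _)); apply: ltrD; [exact: Hd|exact: Hd'].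
Qed.

Lemma strip_funM f g : strip_fun f -> strip_fun g -> strip_fun (fun w => f w * g w).
Proof.
move=> [cf [A bf] tf] [cg [B bg] tg].
split=> [z sz e e0||z sz]; last first.
- by apply: taylor2M; [exact: tf|exact: tg].
- by exists (A * B) => z sz; rewrite cabsM; apply: ler_pM; rewrite ?cabs_ge0 ?bf ?bg.
have A0 : 0 <= A by apply: le_trans (bf z sz); exact: cabs_ge0.
have B0 : 0 <= B by apply: le_trans (bg z sz); exact: cabs_ge0.
have [k k0 Hk] := bilin_small e0 A0 B0.
have [d d0 Hd] := cf z sz _ k0; have [d' d'0 Hd'] := cg z sz _ k0.
exists (Num.min d d'); first by rewrite lt_min d0.
move=> w sw; rewrite lt_min => /andP[wd wd'].
have -> : f w * g w - f z * g z = (f w - f z) * g w + f z * (g w - g z) by ring.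
apply: (le_lt_trans (cabsD _ _)); rewrite !cabsM.
by apply: Hk; rewrite ?cabs_ge0 ?bf ?bg ?Hd ?Hd'.
Qed.

Lemma strip_fun_sum (J : Type) (r : seq J) (f : J -> C -> C) : (forall j, strip_fun (f j)) ->
  strip_fun (fun w => \sum_(j <- r) f j w).
Proof.
move=> H; elim: r => [|j r IH].
  have -> : (fun w => \sum_(j <- [::]) f j w) = (fun=> 0); last exact: strip_fun_cst.
  by apply/funext => w; rewrite big_nil.
have -> : (fun w => \sum_(i <- j :: r) f i w) = (fun w => f j w + \sum_(i <- r) f i w).
  by apply/funext => w; rewrite big_cons.
exact: strip_funD.
Qed.

Lemma Re_flip z : complex.Re (1 - z) = 1 - complex.Re z.
Proof. by case: z. Qed.

Lemma strip_flip z : strip z -> strip (1 - z).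
Proof. by rewrite /strip Re_flip => /andP[h1 h2]; rewrite subr_ge0 h2 gerBl h1. Qed.

Lemma strip_fun_flip g : strip_fun g -> strip_fun (fun w => g (1 - w)).
Proof.
move=> [cg [B bg] tg]; split=> [z sz e e0||z sz].
- have [d d0 Hd] := cg (1 - z) (strip_flip sz) e e0; exists d => // w sw wz.
  apply: Hd; first exact: strip_flip.
  have -> : 1 - w - (1 - z) = - (w - z) by ring.
  by rewrite cabsN.
- by exists B => z sz; apply: bg; exact: strip_flip.
apply: taylor2_flip; apply: tg; move: sz; rewrite /open_strip Re_flip => /andP[h1 h2].
by rewrite subr_gt0 h2 ltrBlDr ltrDl.
Qed.

Lemma expc_continuous (a : C) z (e : R) : 0 < e -> exists2 d, 0 < d &
  forall w, cabs (w - z) < d -> cabs (expc (a * w) - expc (a * z)) <= e.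
Proof.
move=> e0; pose K := cabs (expc (a * z)) * (cabs a + 1) * expR 1 + 1.
have K0 : 0 < K by rewrite ltr_wpDl // !mulr_ge0 ?addr_ge0 ?cabs_ge0 ?expR_ge0.
have a1 : 0 < cabs a + 1 by rewrite ltr_wpDl ?cabs_ge0.
exists (Num.min (e / K) (cabs a + 1)^-1); first by rewrite lt_min divr_gt0 //= invr_gt0.
move=> w; rewrite lt_min => /andP[w1 w2].
have -> : a * w = a * z + a * (w - z) by ring.
rewrite expcD -[X in _ - X]mulr1 -mulrBr cabsM; pose q := cabs (w - z) * (cabs a + 1).
have q0 : 0 <= q by rewrite mulr_ge0 ?cabs_ge0 // ltW.
have q1 : q <= 1 by rewrite /q -ler_pdivlMr // div1r ltW.
have := @expc_tail _ (a * (w - z)) q 1 1%N; rewrite big_ord1 /expc_coeff expr0 divr1 expr1 => h.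
have {}h : cabs (expc (a * (w - z)) - 1) <= q * expR 1.
  apply: h => //; first by rewrite q0.
  by rewrite mulr1 cabsM mulrC /q ler_wpM2l ?cabs_ge0 // lerDl.
apply: (@le_trans _ _ (cabs (expc (a * z)) * (q * expR 1))); first by rewrite ler_wpM2l ?cabs_ge0.
apply: (@le_trans _ _ (cabs (w - z) * K)).
  have -> : cabs (expc (a * z)) * (q * expR 1) =
    cabs (w - z) * (cabs (expc (a * z)) * (cabs a + 1) * expR 1) by rewrite /q; ring.
  by rewrite ler_wpM2l ?cabs_ge0 // /K lerDl.
by rewrite -ler_pdivlMr // ltW.
Qed.

(** After factoring out [expc (a * z)], this is [expc_tail] with [q = cabs h] and three terms. *)
Lemma taylor2_expc (a : C) z : taylor2 (fun w => expc (a * w)) z.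
Proof.
exists (expc (a * z) * a), (expc (a * z) * (a ^+ 2 / 2)), (cabs (expc (a * z)) * expR (cabs a)), 1.
split=> //; first by rewrite mulr_ge0 ?cabs_ge0 ?expR_ge0.
move=> h h1; rewrite mulrDr expcD.
have := @expc_tail _ (a * h) (cabs h) (cabs a) 3%N; rewrite !big_ord_recl big_ord0 /expc_coeff /=.
rewrite /bump /= !add1n expr0 expr1 !divr1 addr0 => H.
have {}H := H _ _ _; rewrite -[leRHS]mulrA.
have -> : expc (a * z) * expc (a * h) - (expc (a * z) + expc (a * z) * a * h +
    expc (a * z) * (a ^+ 2 / 2) * h ^+ 2) =
    expc (a * z) * (expc (a * h) - (1 + (a * h + (a * h) ^+ 2 / 2`!%:R))).
  have -> : (2`!%:R : C) = 2 by [].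
  by move: (expc _) (expc _) => x y; rewrite exprMn; move: (2^-1 : C) => t; ring.
rewrite cabsM ler_wpM2l ?cabs_ge0 //; rewrite [leRHS]mulrC; apply: H.
- by rewrite cabs_ge0 ltW.
- exact: cabs_ge0.
by rewrite cabsM mulrC.
Qed.

Lemma strip_fun_expc (a : R) : strip_fun (fun w => expc (real_complex R a * w)).
Proof.
split=> [z _ e e0||z _]; last exact: taylor2_expc.
  have e2 : 0 < e / 2 by rewrite divr_gt0.
  have [d d0 Hd] := expc_continuous (real_complex R a) z e2; exists d => // w _ /Hd h.
  by apply: (le_lt_trans h); rewrite ltr_pdivrMr // ltr_pMr // ltr1n.
exists (expR `|a|) => z; rewrite /strip cabs_expc => /andP[z0 z1].
rewrite ler_expR; case: z z0 z1 => x y /= x0 x1; rewrite mul0r subr0.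
apply: (le_trans (ler_norm _)); rewrite normrM (ger0_norm x0).
by rewrite ler_piMr.
Qed.

End ScalarAnalysis.

Section Admissible.
Context {R : realType} (I : choiceType).
Local Notation C := R[i].
Local Notation mat := (I * I -> C).
Local Notation bop A c := (opb (fun i j : I => A (i, j)) c).
Implicit Types (F G : C -> mat) (a b : nat -> mat).

Definition opseries F z0 a (r : R) := [/\ 0 < r, forall k, capprox (a k) &
  forall h, cabs h < r -> forall e, 0 < e -> exists N, forall m, (N <= m)%N ->
    bop (fun p => F (z0 + h) p - \sum_(k < m) h ^+ k * a k p) e].

(* Entrywise form of admissibility: in finite matrices over the compacts all the norms in
   question are equivalent to entrywise bounds. *)
Record adm F : Prop := Adm {
  adm_ap : forall z, strip z -> capprox (F z);
  adm_bd : exists c, forall z, strip z -> bop (F z) c;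
  adm_ct : forall z, strip z -> forall e, 0 < e -> exists2 d, 0 < d &
    forall w, strip w -> cabs (w - z) < d -> bop (fun p => F w p - F z p) e;
  adm_an : forall z, open_strip z -> exists a r, opseries F z a r;
  adm_bd1 : exists c, forall z, complex.Re z = 1 -> tcb (F z) c;
  adm_ct1 : forall z, complex.Re z = 1 -> forall e, 0 < e -> exists2 d, 0 < d &
    forall w, complex.Re w = 1 -> cabs (w - z) < d -> tcb (fun p => F w p - F z p) e
}.

Lemma tcb_le (A : mat) c d : c <= d -> tcb A c -> tcb A d.
Proof. by move=> cd [c0 H]; split=> [|b J uJ Hb]; [exact: le_trans cd|apply: le_trans (H b J uJ Hb) cd]. Qed.

Lemma tcb_addP (A B : mat) c d : tcb A c -> tcb B d -> tcb (fun p => A p + B p) (c + d).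
Proof. exact: tcbD. Qed.

Lemma tcb_scaleP (A : mat) c z : tcb A c -> tcb (fun p => z * A p) (cabs z * c).
Proof. exact: tcbZ. Qed.

Lemma tcb_cst0 c : 0 <= c -> tcb (fun _ : I * I => 0 : C) c.
Proof. by move=> c0; exact: tcb_le c0 (tcb0 I). Qed.

Lemma strip_Re1 (z : C) : complex.Re z = 1 -> strip z.
Proof. by rewrite /strip => ->; rewrite lexx ler01. Qed.

Lemma strip_Re0 (z : C) : complex.Re z = 0 -> strip z.
Proof. by rewrite /strip => ->; rewrite lexx ler01. Qed.

Lemma adm_strip_fun F p : adm F -> strip_fun (fun z => F z p).
Proof.
move=> HF; case: p => i j; split=> [z sz e e0||z sz].
- have e2 : 0 < e / 2 by rewrite divr_gt0.
  have [d d0 Hd] := adm_ct HF sz e2; exists d => // w sw /(Hd w sw) /(opb_entry i j) h.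
  by apply: (le_lt_trans h); rewrite ltr_pdivrMr // ltr_pMr // ltr1n.
- by have [c Hc] := adm_bd HF; exists c => z /Hc /(opb_entry i j).
have [a [r [r0 _ Ha]]] := adm_an HF sz.
apply: (taylor2_series (al := fun k => a k (i, j)) r0) => h hr e e0.
by have [N HN] := Ha h hr e e0; exists N => m /HN /(opb_entry i j).
Qed.

Lemma adm_cst0 : adm (fun _ _ => 0).
Proof.
have z0 c : 0 <= c -> bop (fun _ : I * I => (0 : C) - 0) c.
  by move=> c0; rewrite subrr; exact: opb_cst0.
split=> [z _||z _ e e0|z _||z _ e e0].
- exact: capprox0.
- by exists 0 => z _; exact: opb_cst0.
- by exists 1 => // w _ _; apply: z0; exact: ltW.
- exists (fun _ _ => 0), 1; split=> // [k|h _ e e0]; first exact: capprox0.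
  exists 0%N => m _; apply: (eq_opb _ (opb_cst0 I I (ltW e0))) => i j.
  by rewrite big1 ?subrr // => k _; rewrite mulr0.
- by exists 0 => z _; exact: tcb0.
- by exists 1 => // w _ _; rewrite subrr; apply: tcb_cst0; exact: ltW.
Qed.

Lemma admD F G : adm F -> adm G -> adm (fun z p => F z p + G z p).
Proof.
move=> HF HG; split=> [z sz||z sz e e0|z sz||z sz e e0].
- by apply: capproxD; [exact: adm_ap HF z sz|exact: adm_ap HG z sz].
- have [c Hc] := adm_bd HF; have [d Hd] := adm_bd HG; exists (c + d) => z sz.
  by apply: opb_add; [exact: Hc|exact: Hd].
- have e2 : 0 < e / 2 by rewrite divr_gt0.
  have [d d0 Hd] := adm_ct HF sz e2; have [d' d'0 Hd'] := adm_ct HG sz e2.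
  exists (Num.min d d'); first by rewrite lt_min d0.
  move=> w sw; rewrite lt_min => /andP[wd wd']; rewrite [e]splitr.
  by apply: (eq_opb _ (opb_add (Hd w sw wd) (Hd' w sw wd'))) => i j; rewrite opprD addrACA.
- have [a [r [r0 Ca Ha]]] := adm_an HF sz; have [b [s [s0 Cb Hb]]] := adm_an HG sz.
  exists (fun k p => a k p + b k p), (Num.min r s); split=> [|k|h].
  + by rewrite lt_min r0.
  + exact: capproxD.
  rewrite lt_min => /andP[hr hs] e e0; have e2 : 0 < e / 2 by rewrite divr_gt0.
  have [N HN] := Ha h hr _ e2; have [M HM] := Hb h hs _ e2; exists (maxn N M) => m.
  rewrite geq_max => /andP[Nm Mm]; rewrite [e]splitr.
  apply: (eq_opb _ (opb_add (HN m Nm) (HM m Mm))) => i j.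
  under [X in _ = _ - X]eq_bigr do rewrite mulrDr.
  by rewrite big_split /= opprD addrACA.
- have [c Hc] := adm_bd1 HF; have [d Hd] := adm_bd1 HG; exists (c + d) => z sz.
  by apply: tcb_addP; [exact: Hc|exact: Hd].
have e2 : 0 < e / 2 by rewrite divr_gt0.
have [d d0 Hd] := adm_ct1 HF sz e2; have [d' d'0 Hd'] := adm_ct1 HG sz e2.
exists (Num.min d d'); first by rewrite lt_min d0.
move=> w sw; rewrite lt_min => /andP[wd wd']; rewrite [e]splitr.
have := tcb_addP (Hd w sw wd) (Hd' w sw wd'); congr tcb; apply/funext => p.
by rewrite opprD addrACA.
Qed.

Lemma schur_diff (A A' B B' : mat) (x y x' y' : R) : bop (fun p => A p - A' p) x -> bop B y' ->
  bop A' x' -> bop (fun p => B p - B' p) y -> bop (fun p => A p * B p - A' p * B' p) (x * y' + x' * y).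
Proof.
move=> H1 H2 H3 H4; apply: (eq_opb _ (opb_add (opb_schur H1 H2) (opb_schur H3 H4))) => i j.
by ring.
Qed.

Lemma tcb_schurP (A B : mat) c d : bop A c -> tcb B d -> tcb (fun p => A p * B p) (c * d).
Proof. exact: tcb_schur. Qed.

(** Plays the part of Cauchy's estimates: a term of the series at [rho] is the difference of two
    consecutive partial sums, and from some index on both are within 1 of [F]. *)
Lemma opseries_coef F z0 a r rho : opseries F z0 a r -> 0 < rho < r ->
  exists2 B, 0 <= B & forall k, bop (fun p => real_complex R rho ^+ k * a k p) B.
Proof.
move=> [r0 Ca Ha] /andP[p0 pr].
have cp : cabs (real_complex R rho) = rho by rewrite cabs_real gtr0_norm.
have [|N HN] := Ha (real_complex R rho) _ 1 ltr01; first by rewrite cp.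
have /choice[c Hc] : forall k, exists c, bop (fun p => real_complex R rho ^+ k * a k p) c.
  by move=> k; have [c Hc] := capprox_bounded (Ca k); eexists; exact: opb_scale Hc.
have c0 k : 0 <= c k by exact: opb_ge0 (Hc k).
exists (2 + \sum_(k < N) c k); first by rewrite addr_ge0 // sumr_ge0.
move=> k; have [kN|Nk] := ltnP k N.
  apply: (opb_le _ (Hc k)); rewrite (bigD1 (Ordinal kN)) //= addrCA lerDl addr_ge0 //.
  exact: sumr_ge0.
have := opb_sub (HN k Nk) (HN k.+1 (leqW Nk)); rewrite -(natrD _ 1 1) => h.
apply: (opb_le _ (eq_opb _ h)) => [|i j]; first by rewrite lerDl sumr_ge0.
by rewrite big_ord_recr /=; move: (\sum_(_ < _) _) (F _ _) (_ ^+ k * _) => x y t; ring.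
Qed.

Lemma opseries_bound F z0 a r h : opseries F z0 a r -> cabs h < r -> exists c, bop (F (z0 + h)) c.
Proof.
move=> [r0 Ca Ha] hr; have [N HN] := Ha h hr 1 ltr01.
have /choice[c Hc] := fun k => capprox_bounded (Ca k).
exists (1 + \sum_(k < N) cabs (h ^+ k) * c k).
have := @opb_sum _ I I 'I_N (index_enum _) (fun k i j => h ^+ k * a k (i, j)) _ (fun k => opb_scale (h ^+ k) (Hc k)).
move=> /(opb_add (HN N (leqnn N))); apply: eq_opb => i j; by rewrite subrK.
Qed.

(** With [rho = r / 2], the condition [|h| < r / 8] makes terms of degree [k] at most a constant
    times [4^-k]. In the error triangle [i + j >= m], one factor [2^-(i+j)] yields the decay [2^-m]
    and the other one is summable. *)
Lemma opseriesM F G z0 a b r : opseries F z0 a r -> opseries G z0 b r ->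
  opseries (fun z p => F z p * G z p) z0 (fun n p => \sum_(i < n.+1) a i p * b (n - i)%N p) (r / 8).
Proof.
move=> HF HG; have [r0 Ca Ha] := HF; have [_ Cb Hb] := HG.
have r8 : 0 < r / 8 by rewrite divr_gt0.
split=> // [n|h hr e e0].
  by apply: capprox_sum => i; have [c Hc] := capprox_bounded (Cb (n - i)%N); exact: capprox_schur (Ca i) Hc.
have h4 : cabs h < r by apply: (lt_trans hr); rewrite ltr_pdivrMr // ltr_pMr // ltr1n.
pose rho := r / 2; have p0 : 0 < rho by rewrite divr_gt0.
have pr : 0 < rho < r by rewrite p0 ltr_pdivrMr // ltr_pMr // ltr1n.
have [A A0 HA] := opseries_coef HF pr; have [B B0 HB] := opseries_coef HG pr.
have [f Hf] := opseries_bound HF h4; have [g Hg] := opseries_bound HG h4.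
have f0 := opb_ge0 Hf; have g0 := opb_ge0 Hg.
have hk (c : nat -> mat) K k : (forall k, bop (fun p => real_complex R rho ^+ k * c k p) K) ->
    bop (fun p => h ^+ k * c k p) (4^-1 ^+ k * K).
  move=> H; have K0 := opb_ge0 (H 0%N).
  apply: (opb_le _ (eq_opb _ (opb_scale ((h / real_complex R rho) ^+ k) (H k)))) => [|i j].
    rewrite ler_wpM2r // cabsX; apply: lerXn2r; rewrite ?nnegrE ?cabs_ge0 ?invr_ge0 //.
    have -> : cabs (h / real_complex R rho) = cabs h / rho.
      by rewrite -fmorphV cabsM cabs_real ger0_norm ?invr_ge0 ?(ltW p0).
    rewrite ler_pdivrMr // /rho; move: hr; move: (cabs h) => x; lra.
  rewrite mulrA -exprMn divfK //; apply/eqP => /(congr1 (@complex.Re R)) /= rho0.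
  by move: p0; rewrite rho0 ltxx.
have K0 : 0 < g + f + 1 by rewrite ltr_wpDl // addr_ge0.
pose d := Num.min 1 (e / 2 / (g + f + 1)).
have d0 : 0 < d by rewrite lt_min ltr01 !divr_gt0.
have d1 : d <= 1 by rewrite ge_min lexx.
have dK : d * (g + f + 1) <= e / 2 by rewrite -ler_pdivlMr // ge_min lexx orbT.
have [N HN] := Ha h h4 _ d0; have [M HM] := Hb h h4 _ d0.
have e2 : 0 < e / 2 by rewrite divr_gt0.
have [N' HN'] := half_pow_small (4 * (A * B)) e2.
exists (maxn N (maxn M N')) => m; rewrite !geq_max => /and3P[Nm Mm N'm].
pose SA p := \sum_(k < m) h ^+ k * a k p; pose SB p := \sum_(k < m) h ^+ k * b k p.
have HSA : bop SA (f + 1).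
  apply: (opb_le _ (eq_opb _ (opb_sub Hf (HN m Nm)))) => [|i j]; first by rewrite lerD2l.
  by rewrite subKr.
have D1 := @schur_diff (F (z0 + h)) SA (G (z0 + h)) SB _ _ _ _ (HN m Nm) Hg HSA (HM m Mm).
have D2 : bop (fun p => \sum_(i < m) \sum_(j < m)
    (if (m <= i + j)%N then (h ^+ i * a i p) * (h ^+ j * b j p) else 0)) (e / 2).
  pose t (i j : 'I_m) : R := A * B * 2^-1 ^+ m * (2^-1 ^+ i * 2^-1 ^+ j).
  have t0 i j : 0 <= t i j by rewrite !mulr_ge0 ?exprn_ge0 ?invr_ge0.
  apply: (@opb_le _ _ _ _ (\sum_(i < m) \sum_(j < m) t i j)).
    rewrite /t; under eq_bigr do rewrite -mulr_sumr -mulr_sumr.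
    rewrite -mulr_sumr -mulr_suml; apply: le_trans (HN' m N'm).
    have h2 := half_sum_le R m; have h3 : 0 <= \sum_(k < m) (2^-1 : R) ^+ k.
      by apply: sumr_ge0 => k _; rewrite exprn_ge0 ?invr_ge0.
    have h5 : (\sum_(k < m) (2^-1 : R) ^+ k) * (\sum_(k < m) (2^-1 : R) ^+ k) <= 2 * 2.
      exact: ler_pM.
    have h6 : 0 <= A * B * 2^-1 ^+ m by rewrite !mulr_ge0 ?exprn_ge0 ?invr_ge0.
    have := ler_wpM2l h6 h5; move: (A * B) (2^-1 ^+ m) => x y; lra.
  apply: (@opb_sum _ I I 'I_m (index_enum _) (fun (i : 'I_m) s t => \sum_(j < m) (if (m <= i + j)%N then
     (h ^+ i * a i (s, t)) * (h ^+ j * b j (s, t)) else 0))) => i.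
  apply: (@opb_sum _ I I 'I_m (index_enum _) (fun (j : 'I_m) s t => (if (m <= i + j)%N then
     (h ^+ i * a i (s, t)) * (h ^+ j * b j (s, t)) else 0))) => j.
  case: (boolP (m <= i + j)%N) => mij; last exact: opb_cst0.
  apply: (opb_le _ (opb_schur (hk a A i HA) (hk b B j HB))).
  have -> : (4^-1 : R) = 2^-1 * 2^-1 by rewrite -invfM -natrM.
  rewrite !exprMn /t; set x := 2^-1 ^+ i; set y := 2^-1 ^+ j.
  have -> : x * x * A * (y * y * B) = A * B * (x * y) * (x * y) by ring.
  rewrite ler_wpM2r ?mulr_ge0 ?exprn_ge0 ?invr_ge0 // ler_wpM2l ?mulr_ge0 //.
  rewrite /x /y -exprD; apply: ler_wiXn2l => //; rewrite ?invr_ge0 //.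
  by rewrite invf_le1 // ler1n.
apply: (opb_le _ (eq_opb _ (opb_add D1 D2))) => [|i j].
  rewrite [leRHS]splitr lerD2r; apply: le_trans dK.
  by rewrite le_eqVlt; apply/orP; left; apply/eqP; ring.
have := cauchy_triangle m (fun k l => (h ^+ k * a k (i, j)) * (h ^+ l * b l (i, j))).
under eq_bigr do rewrite -mulr_sumr; rewrite -mulr_suml -/(SA (i, j)) -/(SB (i, j)) => ->.
under [X in _ + X = _]eq_bigr do rewrite -big_mkcond.
have -> : \sum_(n < m) \sum_(k < n.+1) h ^+ k * a k (i, j) * (h ^+ (n - k) * b (n - k)%N (i, j)) =
    \sum_(k < m) h ^+ k * \sum_(l < k.+1) a l (i, j) * b (k - l)%N (i, j).
  apply: eq_bigr => n _; rewrite mulr_sumr; apply: eq_bigr => k _.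
  by rewrite mulrACA -exprD subnKC // -ltnS.
by rewrite opprD addrA addrNK.
Qed.

Lemma adm_schur F G : adm F -> adm G -> adm (fun z p => F z p * G z p).
Proof.
move=> HF HG; have [f Hf] := adm_bd HF; have [g Hg] := adm_bd HG.
have [g1 Hg1] := adm_bd1 HG.
have s0 : strip (0 : C) by rewrite /strip /= lexx ler01.
have s1 : complex.Re (1 : C) = 1 by [].
have f0 := opb_ge0 (Hf _ s0); have g0 := opb_ge0 (Hg _ s0).
have g10 : 0 <= g1 by case: (Hg1 _ s1).
split=> [z sz||z sz e e0|z sz||z sz e e0].
- exact: (capprox_schur (adm_ap HF sz) (Hg z sz)).
- by exists (f * g) => z sz; apply: opb_schur; [exact: Hf|exact: Hg].
- have [k k0 Hk] := bilin_small e0 f0 g0; have k2 : 0 < k / 2 by rewrite divr_gt0.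
  have kk : k / 2 < k by rewrite ltr_pdivrMr // ltr_pMr // ltr1n.
  have [d d0 Hd] := adm_ct HF sz k2; have [d' d'0 Hd'] := adm_ct HG sz k2.
  exists (Num.min d d'); first by rewrite lt_min d0.
  move=> w sw; rewrite lt_min => /andP[wd wd'].
  apply: (opb_le _ (@schur_diff (F w) (F z) (G w) (G z) _ _ _ _ (Hd w sw wd) (Hg w sw) (Hf z sz) (Hd' w sw wd'))).
  by apply: ltW; apply: Hk => //; exact: ltW.
- have [a [r Ha]] := adm_an HF sz; have [b [s Hb]] := adm_an HG sz.
  have sub (H : C -> mat) (c : nat -> mat) (r1 r2 : R) : 0 < r2 <= r1 -> opseries H z c r1 -> opseries H z c r2.
    move=> /andP[r20 r21] [r10 Cc Hc]; split=> // h hr e e0; apply: Hc => //; exact: lt_le_trans r21.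
  have [r0 _ _] := Ha; have [s00 _ _] := Hb.
  have m0 : 0 < Num.min r s by rewrite lt_min r0.
  eexists; eexists; apply: (opseriesM (sub F a _ (Num.min r s) _ Ha) (sub G b _ (Num.min r s) _ Hb)).
    by rewrite m0 ge_min lexx.
  by rewrite m0 ge_min lexx orbT.
(* On the line of real part 1 only one factor needs a trace norm bound; the operator norm of the
   other suffices. *)
- exists (f * g1) => z sz; apply: tcb_schurP; last exact: Hg1.
  by apply: Hf; exact: strip_Re1.
have [k k0 Hk] := bilin_small e0 f0 g10; have k2 : 0 < k / 2 by rewrite divr_gt0.
have kk : k / 2 < k by rewrite ltr_pdivrMr // ltr_pMr // ltr1n.
have [d d0 Hd] := adm_ct HF (strip_Re1 sz) k2; have [d' d'0 Hd'] := adm_ct1 HG sz k2.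
exists (Num.min d d'); first by rewrite lt_min d0.
move=> w sw; rewrite lt_min => /andP[wd wd'].
have D1 := @tcb_schurP (fun p => F w p - F z p) _ _ _ (Hd w (strip_Re1 sw) wd) (Hg1 w sw).
have D2 := tcb_schurP (Hf z (strip_Re1 sz)) (Hd' w sw wd').
have -> : (fun p => F w p * G w p - F z p * G z p) =
    (fun p => (F w p - F z p) * G w p + F z p * (G w p - G z p)).
  by apply/funext => p; ring.
apply: (tcb_le _ (tcb_addP D1 D2)).
by apply: ltW; apply: Hk => //; exact: ltW.
Qed.

Lemma admZ (c : C) F : adm F -> adm (fun z p => c * F z p).
Proof.
move=> HF.
have small e : 0 < e -> exists2 k, 0 < k & cabs c * k <= e.
  move=> e0; exists (e / (cabs c + 1)); first by rewrite divr_gt0 // ltr_wpDl ?cabs_ge0.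
  by rewrite mulrCA ler_piMr ?(ltW e0) // ler_pdivrMr ?ltr_wpDl ?cabs_ge0 // mul1r lerDl.
split=> [z sz||z sz e e0|z sz||z sz e e0].
- exact: capproxZ (adm_ap HF sz).
- by have [f Hf] := adm_bd HF; exists (cabs c * f) => z /Hf; exact: opb_scale.
- have [k k0 ck] := small e e0; have [d d0 Hd] := adm_ct HF sz k0; exists d => // w sw wd.
  by apply: (opb_le ck (eq_opb _ (opb_scale c (Hd w sw wd)))) => i j; rewrite mulrBr.
- have [a [r [r0 Ca Ha]]] := adm_an HF sz; exists (fun k p => c * a k p), r; split=> // [k|h hr e e0].
    exact: capproxZ.
  have [k k0 ck] := small e e0; have [N HN] := Ha h hr k k0; exists N => m Nm.
  apply: (opb_le ck (eq_opb _ (opb_scale c (HN m Nm)))) => i j; rewrite mulrBr mulr_sumr.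
  by congr (_ - _); apply: eq_bigr => l _; rewrite mulrCA.
- by have [f Hf] := adm_bd1 HF; exists (cabs c * f) => z /Hf; exact: tcb_scaleP.
have [k k0 ck] := small e e0; have [d d0 Hd] := adm_ct1 HF sz k0; exists d => // w sw wd.
apply: (tcb_le ck); have := tcb_scaleP c (Hd w sw wd); congr tcb.
by apply/funext => p; rewrite mulrBr.
Qed.

Lemma adm_sum (J : Type) (r : seq J) (F : J -> C -> mat) : (forall j, adm (F j)) ->
  adm (fun z p => \sum_(j <- r) F j z p).
Proof.
move=> H; elim: r => [|j r IH].
  have -> : (fun z p => \sum_(j <- [::]) F j z p) = (fun _ _ => 0); last exact: adm_cst0.
  by apply/funext => z; apply/funext => p; rewrite big_nil.
have -> : (fun z p => \sum_(i <- j :: r) F i z p) = (fun z p => F j z p + \sum_(i <- r) F i z p).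
  by apply/funext => z; apply/funext => p; rewrite big_cons.
exact: admD.
Qed.

End Admissible.

Section FiniteChoice.
Context {R : realType} (K : finType).

Lemma fin_pos (P : K -> R -> Prop) :
  (forall k d d', 0 < d' -> d' <= d -> P k d -> P k d') ->
  (forall k, exists2 d, 0 < d & P k d) -> exists2 d, 0 < d & forall k, P k d.
Proof.
move=> mono H; suff [d d0 Hd] : exists2 d, 0 < d & forall k, k \in enum K -> P k d.
  by exists d => // k; apply: Hd; rewrite mem_enum.
elim: (enum K) => [|k s [d d0 IH]]; first by exists 1.
have [d' d'0 Hd'] := H k; exists (Num.min d d') => [|l]; first by rewrite lt_min d0.
have m0 : 0 < Num.min d d' by rewrite lt_min d0.
rewrite inE => /predU1P[->|/IH h].
  by apply: (mono _ d') => //; rewrite ge_min lexx orbT.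
by apply: (mono _ d) => //; rewrite ge_min lexx.
Qed.

Lemma fin_nat (P : K -> nat -> Prop) : (forall k m n, (m <= n)%N -> P k m -> P k n) ->
  (forall k, exists n, P k n) -> exists n, forall k, P k n.
Proof.
move=> mono /choice[f Hf]; exists (\sum_k f k)%N => k; apply: mono (Hf k).
by rewrite (bigD1 k) //= leq_addr.
Qed.

End FiniteChoice.

Section Interpolation.
Context {R : realType} (I : choiceType).
Local Notation C := R[i].
Local Notation mat := (cfun R (I * I)%type).
Local Notation Soo := (@S_infty R I).
Local Notation S1 := (@S_one R I).
Local Notation bop A c := (opb (fun i j : I => A (i, j)) c).
Local Notation HSoo := (@S_infty_preop R I).
Local Notation HS1 := (@S_one_preop R I).

Lemma S_one_sub_infty n (x : 'M[mat]_n) : os_mx S1 x -> os_mx Soo x.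
Proof. by move=> H i j; have /S_one_car[c Hc] := H i j; apply/S_infty_car; exact: tcb_capprox Hc. Qed.

(** [S_one] consists of compact operators, so the sum of the two endpoint spaces is just
    [S_infty]. *)
Lemma sum_carE n (x : 'M[mat]_n) : sum_car Soo S1 x <-> os_mx Soo x.
Proof.
split=> [[x0 [x1 [H0 H1 ->]]]|Hx]; first by apply: (mxD HSoo) => //; exact: S_one_sub_infty.
by exists x, 0; split=> //; [exact: (mx0 HS1)|rewrite addr0].
Qed.

Lemma sum_norm_ge0 n (x : 'M[mat]_n) : (0 <= sum_norm Soo S1 x)%E.
Proof.
apply: le_ereal_inf_tmp => _ [x0 [x1 [_ _ _ ->]]].
by rewrite adde_ge0 ?opnorm_ge0 ?S_one_ge0.
Qed.

Lemma sum_norm_le n (x : 'M[mat]_n) : os_mx Soo x -> (sum_norm Soo S1 x <= os_norm Soo x)%E.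
Proof.
move=> Hx; apply: ereal_inf_lbound; exists x, 0; split=> //; first exact: (mx0 HS1).
  by rewrite addr0.
by have z1 := @mx0 _ _ _ HS1 n; rewrite (nmE HS1 z1) (nm0 HS1) adde0.
Qed.

(** The trace norm dominates the operator norm, so either summand controls the entries. *)
Lemma sum_norm_entry n (x : 'M[mat]_n) c i j : (sum_norm Soo S1 x < c%:E)%E -> bop (x i j) c.
Proof.
move/ereal_inf_lt => [_ [x0 [x1 [H0 H1 -> ->]]]].
rewrite (nmE HSoo) // (nmE HS1) // -EFinD lte_fin => h.
have b0 := sib_entry i j (nm_S_infty_sib H0).
have b1 := tcb_opb (s1b_tcb i j (nm_S_one_s1b H1)).
by apply: (opb_le (ltW h)); apply: (eq_opb _ (opb_add b0 b1)) => s t; rewrite mxE.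
Qed.

Lemma sib_entries n (x : 'M[mat]_n) c : (forall i j, bop (x i j) c) ->
  sib (fun i j => x i j) ((n * n)%:R * c).
Proof.
move=> H; have -> : (n * n)%:R * c = \sum_(i < n) \sum_(j < n) c.
  by rewrite !sumr_const !card_ord -mulrnA mulr_natl.
exact: (@family_entries _ _ I (fun l l' A => A (l, l'))).
Qed.

Lemma s1b_cst_entries n (x : 'M[mat]_n) c : (forall i j, tcb (x i j) c) ->
  s1b (fun i j => x i j) ((n * n)%:R * c).
Proof.
move=> H; have -> : (n * n)%:R * c = \sum_(i < n) \sum_(j < n) c.
  by rewrite !sumr_const !card_ord -mulrnA mulr_natl.
exact: s1b_entries.
Qed.

Lemma nat_small (n : nat) (e : R) : 0 < e -> exists2 k, 0 < k & (n * n)%:R * k < e.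
Proof.
move=> e0; have n0 : 0 < (n * n)%:R + 1 :> R by rewrite ltr_wpDl.
exists (e / ((n * n)%:R + 1)); first by rewrite divr_gt0.
by rewrite mulrCA gtr_pMr // ltr_pdivrMr // mul1r ltrDl.
Qed.

Lemma fin_bound (K : finType) (Z : Type) (D : Z -> Prop) (P : K -> Z -> R -> Prop) :
  (forall k z c c', c <= c' -> P k z c -> P k z c') ->
  (forall k, exists c, forall z, D z -> P k z c) ->
  exists2 c, 0 <= c & forall z, D z -> forall k, P k z c.
Proof.
move=> mono /choice[f Hf]; exists (\sum_k `|f k|); first by apply: sumr_ge0.
move=> z Dz k; apply: mono (Hf k z Dz); apply: (le_trans (ler_norm _)).
by rewrite (bigD1 k) //= lerDl sumr_ge0.
Qed.

(** Admissibility is qualitative: boundedness, continuity and convergence are unaffected by the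
    factor [n * n] that separates matrix norms from entrywise ones. The exact edge norms are kept
    apart, in [interp_bd]. *)
Lemma admissibleP n (F : C -> 'M[mat]_n) :
  admissible Soo S1 F <-> forall i j, adm (fun z => F z i j).
Proof.
split=> [[[Fc [c Hc] Ft] Fa [F0c F0b F0t] [F1c [c1 Hc1] F1t]] i j|H].
  have b1 z e : complex.Re z = 1 -> (os_norm S1 (F z) <= e%:E)%E -> 0 <= e -> tcb (F z i j) e.
    by move=> z1 h e0; apply: s1b_tcb ((S_oneP (F1c z z1) e0).1 h).
  split=> [z sz||z sz e e0|z sz||z sz e e0].
  - by apply/S_infty_car; apply: (sum_carE _).1; exact: Fc.
  - exists (c + 1) => z /Hc h; apply: sum_norm_entry; apply: le_lt_trans h _.
    by rewrite lte_fin ltrDl.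
  - have [d d0 Hd] := Ft z sz e e0; exists d => // w sw wz.
    by apply: (eq_opb _ (sum_norm_entry i j (Hd w sw wz))) => s t; rewrite !mxE.
  - have [a [r [r0 Ca Ha]]] := Fa z sz; exists (fun k => a k i j), r; split=> // [k|h hr e e0].
      by apply/S_infty_car; apply: (sum_carE _).1; exact: Ca.
    have hz : cabs (z + h - z) < r by rewrite addrAC subrr add0r.
    have /cvge0P h0 := fun N => sum_norm_ge0 (F (z + h) - \sum_(k < N) smx ((z + h - z) ^+ k) (a k)).
    have [N HN] := h0.1 (Ha _ hz) e e0; exists N => m Nm.
    apply: (eq_opb _ (sum_norm_entry i j (HN m Nm))) => s t.
    rewrite !mxE summxE; congr (_ - _); rewrite cfun_sumE; apply: eq_bigr => k _.
    by rewrite mxE addrAC subrr add0r.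
  - exists `|c1| => z z1; apply: b1 => //; apply: (le_trans (Hc1 z z1)).
    by rewrite lee_fin ler_norm.
  have [d d0 Hd] := F1t z sz e e0; exists d => // w sw wz.
  have h := Hd w sw wz; have Hm := mxB HS1 (F1c w sw) (F1c z sz).
  have := s1b_tcb i j ((S_oneP Hm (ltW e0)).1 (ltW h)); congr tcb.
  by apply/funext => p; rewrite !mxE.
have Fc z : strip z -> os_mx Soo (F z) by move=> sz i j; apply/S_infty_car; exact: adm_ap (H i j) _ sz.
have F1c z : complex.Re z = 1 -> os_mx S1 (F z).
  by move=> z1 i j; have [c Hc] := adm_bd1 (H i j); apply/S_one_car; exists c; exact: Hc.
have [c c0 Hc] := fin_bound (P := fun (ij : 'I_n * 'I_n) z c => bop (F z ij.1 ij.2) c)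
  (fun _ _ _ _ h => opb_le h) (fun ij => adm_bd (H ij.1 ij.2)).
have [c1 c10 Hc1] := fin_bound (P := fun (ij : 'I_n * 'I_n) z c => tcb (F z ij.1 ij.2) c)
  (fun _ _ _ _ h => tcb_le h) (fun ij => adm_bd1 (H ij.1 ij.2)).
have ooB z : strip z -> (os_norm Soo (F z) <= ((n * n)%:R * c)%:E)%E.
  by move=> sz; apply/S_inftyP; apply: sib_entries => i j; exact: (Hc z sz (i, j)).
have small_oo (x : 'M[mat]_n) k e : (n * n)%:R * k < e -> (forall i j, bop (x i j) k) ->
    (os_norm Soo x < e%:E)%E.
  move=> ke Hx; apply: (@le_lt_trans _ _ ((n * n)%:R * k)%:E); last by rewrite lte_fin.
  by apply/S_inftyP; exact: sib_entries.
have ooT z e : strip z -> 0 < e -> exists2 d, 0 < d & forall w, strip w -> cabs (w - z) < d ->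
    (os_norm Soo (F w - F z)%R < e%:E)%E.
  move=> sz e0; have [k k0 Hk] := nat_small n e0.
  have [||d d0 Hd] := @fin_pos _ _ (fun (ij : 'I_n * 'I_n) (d : R) => forall w, strip w -> cabs (w - z) < d ->
      bop (fun p => F w ij.1 ij.2 p - F z ij.1 ij.2 p) k).
  - by move=> ij d d' _ dd h w sw wd; apply: h => //; exact: lt_le_trans dd.
  - by move=> ij; exact: adm_ct (H ij.1 ij.2) _ sz _ k0.
  exists d => // w sw wd; apply: (small_oo _ _ _ Hk) => i j.
  by apply: (eq_opb _ (Hd (i, j) w sw wd)) => s t; rewrite !mxE.
split.
- split=> [z sz||z sz e e0]; first by apply/sum_carE; exact: Fc.
    exists ((n * n)%:R * c) => z sz; apply: le_trans (ooB z sz).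
    by apply: sum_norm_le; exact: Fc.
  have [d d0 Hd] := ooT z e sz e0; exists d => // w sw wd; apply: le_lt_trans (Hd w sw wd).
  by apply: sum_norm_le; exact: (mxB HSoo (Fc _ sw) (Fc _ sz)).
- move=> z sz.
  have /choice[a Ha] : forall ij : 'I_n * 'I_n, exists (b : nat -> I * I -> C) r,
      opseries (fun w : C => (F w ij.1 ij.2 : I * I -> C)) z b r.
    by move=> ij; exact: adm_an (H ij.1 ij.2) _ sz.
  have [||r r0 Hr] := @fin_pos _ _ (fun (ij : 'I_n * 'I_n) (r : R) => opseries (fun z => F z ij.1 ij.2) z (a ij) r).
  - by move=> ij d d' d'0 dd [_ h1 h2]; split=> // h hd; apply: h2; exact: lt_le_trans dd.
  - by move=> ij; have [r Hr] := Ha ij; exists r => //; case: Hr.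
  have Am k : os_mx Soo (\matrix_(i, j) (a (i, j) k : mat)).
    by move=> i j; rewrite mxE; apply/S_infty_car; have [_ h _] := Hr (i, j); exact: h.
  exists (fun k => \matrix_(i, j) (a (i, j) k : mat)), r; split=> // [k|w wr].
    by apply/sum_carE.
  have zw : z + (w - z) = w by rewrite addrC subrK.
  (* The disc of convergence may leave the strip, so compactness of [F w] is deduced from the series
     and not from [adm_ap]. *)
  have Fw : os_mx Soo (F w).
    move=> i j; apply/S_infty_car; apply: capprox_lim => e e0.
    have [_ h1 h2] := Hr (i, j); have [N HN] := h2 _ wr e e0.
    exists (fun p => \sum_(k < N) (w - z) ^+ k * a (i, j) k p).
      by apply: capprox_sum => k; exact: capproxZ.
    by apply: (eq_opb _ (HN N (leqnn N))) => s t /=; rewrite zw.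
  apply/cvge0P => [N|e e0]; first exact: sum_norm_ge0.
  have [k k0 Hk] := nat_small n e0.
  have [||N HN] := @fin_nat _ (fun (ij : 'I_n * 'I_n) N => forall m, (N <= m)%N ->
    bop (fun p => F w ij.1 ij.2 p - \sum_(l < m) (w - z) ^+ l * a ij l p) k).
  - by move=> ij m n' mn h m' nm; apply: h; exact: leq_trans nm.
  - move=> ij; have [_ _ h2] := Hr ij; have [N HN] := h2 _ wr k k0; exists N => m /HN.
    by apply: eq_opb => s t; rewrite zw.
  exists N => m Nm; have Hx : os_mx Soo (F w - \sum_(l < m) smx ((w - z) ^+ l) (\matrix_(i, j) (a (i, j) l : mat))).
    apply: (mxB HSoo Fw); apply: (nm_sum HSoo _ _).1 => l; exact: (mxZ HSoo).
  apply: le_lt_trans (sum_norm_le Hx) _; apply: (small_oo _ _ _ Hk) => i j.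
  apply: (eq_opb _ (HN (i, j) m Nm)) => s t; rewrite !mxE summxE; congr (_ - _).
  by rewrite cfun_sumE; apply: eq_bigr => l _; rewrite !mxE.
- split=> [z z0||z z0 e e0]; first exact: Fc (strip_Re0 z0).
    by exists ((n * n)%:R * c) => z z0; apply: ooB; exact: strip_Re0.
  have [d d0 Hd] := ooT z e (strip_Re0 z0) e0; exists d => // w w0.
  by apply: Hd; exact: strip_Re0.
have S1B (x : 'M[mat]_n) k : os_mx S1 x -> 0 <= k -> (forall i j, tcb (x i j) k) ->
    (os_norm S1 x <= ((n * n)%:R * k)%:E)%E.
  move=> Hx k0 Hk; apply/S_oneP => //; first by rewrite mulr_ge0.
  exact: s1b_cst_entries.
split=> [z z1||z z1 e e0]; first exact: F1c.
  exists ((n * n)%:R * c1) => z z1; apply: S1B => //; first exact: F1c.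
  by move=> i j; exact: (Hc1 z z1 (i, j)).
have [k k0 Hk] := nat_small n e0.
have [||d d0 Hd] := @fin_pos _ _ (fun (ij : 'I_n * 'I_n) (d : R) => forall w, complex.Re w = 1 ->
    cabs (w - z) < d -> tcb (fun p => F w ij.1 ij.2 p - F z ij.1 ij.2 p) k).
- by move=> ij d d' _ dd h w sw wd; apply: h => //; exact: lt_le_trans dd.
- by move=> ij; exact: adm_ct1 (H ij.1 ij.2) _ z1 _ k0.
exists d => // w w1 wd; apply: (@le_lt_trans _ _ ((n * n)%:R * k)%:E); last by rewrite lte_fin.
apply: S1B; [exact: (mxB HS1 (F1c _ w1) (F1c _ z1))|exact: ltW|] => i j.
have := Hd (i, j) w w1 wd; congr tcb; by apply/funext => p; rewrite !mxE.
Qed.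

Definition interp_bd n (F : C -> 'M[mat]_n) (c : R) :=
  (forall z, complex.Re z = 0 -> sib (fun i j => F z i j) c) /\
  (forall z, complex.Re z = 1 -> s1b (fun i j => F z i j) c).

Lemma interp_norm_le n (th : R) (F : C -> 'M[mat]_n) c : (forall i j, adm (fun z => F z i j)) ->
  interp_bd F c -> (interp_norm Soo S1 th (F (real_complex R th)) <= c%:E)%E.
Proof.
move=> HF [H0 H1]; have c0 : 0 <= c by exact: opb_ge0 (H0 0 erefl).
have F1c z : complex.Re z = 1 -> os_mx S1 (F z).
  by move=> z1 i j; have [d Hd] := adm_bd1 (HF i j); apply/S_one_car; exists d; exact: Hd.
apply: (@le_trans _ _ (maxe (ereal_sup [set os_norm Soo (F z) | z in [set z | complex.Re z = 0]])
             (ereal_sup [set os_norm S1 (F z) | z in [set z | complex.Re z = 1]]))).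
  by apply: ereal_inf_lbound; exists F; split=> //; exact/admissibleP.
rewrite ge_max; apply/andP; split; apply: ge_ereal_sup => _ [z /= zz <-].
  by apply/S_inftyP; exact: H0.
by apply/S_oneP => //; [exact: F1c|exact: H1].
Qed.

Lemma interp_norm_lt n (th : R) (x : 'M[mat]_n) c : (interp_norm Soo S1 th x < c%:E)%E ->
  exists F : C -> 'M[mat]_n, [/\ forall i j, adm (fun z => F z i j), F (real_complex R th) = x & interp_bd F c].
Proof.
move/ereal_inf_lt => [_ [F [/admissibleP HF <- ->]]]; rewrite gt_max => /andP[h0 h1].
have F1c z : complex.Re z = 1 -> os_mx S1 (F z).
  by move=> z1 i j; have [d Hd] := adm_bd1 (HF i j); apply/S_one_car; exists d; exact: Hd.
have b0 z : complex.Re z = 0 -> (os_norm Soo (F z) <= c%:E)%E.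
  move=> z0; apply: ltW; apply: le_lt_trans h0; apply: ereal_sup_ubound; by exists z.
have c0 : 0 <= c by rewrite -lee_fin; apply: le_trans (b0 0 erefl); exact: opnorm_ge0.
exists F; split=> //; split=> z zz; first by apply/S_inftyP; exact: b0.
apply/(S_oneP (F1c z zz) c0); apply: ltW; apply: le_lt_trans h1; apply: ereal_sup_ubound; by exists z.
Qed.

Lemma interp_norm_ge0 n th (x : 'M[mat]_n) : (0 <= interp_norm Soo S1 th x)%E.
Proof.
apply: le_ereal_inf_tmp => _ [F [_ _ ->]]; rewrite le_max; apply/orP; left.
apply: (@le_trans _ _ (os_norm Soo (F 0))); first exact: opnorm_ge0.
by apply: ereal_sup_ubound; exists 0.
Qed.

Section InterpolationSpace.
Variables (th : R) (car : set mat).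
Hypothesis carP : forall A, car A <-> exists2 F, adm F & F (real_complex R th) = A.
Local Notation Sp := (OpSpace car (fun n x => interp_norm Soo S1 th x)).

(** The inequalities hold on both edges for each [z] and are transported by applying the operation
    to [F z]. The carrier is left abstract because that of [S_] is given by singular values;
    [schatten_admP] later supplies [carP]. *)
Lemma interp_preop : preop Sp.
Proof.
split=> [|A B|z A|n x _|n x Hx||] /=.
- by apply/carP; exists (fun _ _ => 0); first exact: adm_cst0.
- move=> /carP[F HF <-] /carP[G HG <-]; apply/carP; exists (fun z p => F z p + G z p) => //.
  exact: admD.
- by move=> /carP[F HF <-]; apply/carP; exists (fun w p => z * F w p) => //; exact: admZ.
- exact: interp_norm_ge0.
- have /choice[F HF] : forall ij : 'I_n * 'I_n, exists F, adm F /\ F (real_complex R th) = x ij.1 ij.2.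
    by move=> ij; have /carP[F HF Fx] := Hx ij.1 ij.2; exists F.
  pose G z : 'M[mat]_n := \matrix_(i, j) (F (i, j) z : mat).
  have HG i j : adm (fun z => G z i j).
    have [h _] := HF (i, j); have -> : (fun z => G z i j) = F (i, j) => //.
    by apply/funext => z; rewrite mxE.
  have <- : G (real_complex R th) = x by apply/matrixP => i j; rewrite mxE; exact: (HF (i, j)).2.
  have := (admissibleP G).2 HG => -[_ _ [_ [c Hc] _] [F1 [d Hd] _]].
  apply: le_lt_trans (ltry (Num.max `|c| `|d|)); apply: interp_norm_le => //; split=> z zz.
    apply/S_inftyP; apply: le_trans (Hc z zz) _; rewrite lee_fin le_max; apply/orP; left.
    exact: ler_norm.
  apply/S_oneP; [exact: F1|by rewrite le_max normr_ge0|].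
  apply: le_trans (Hd z zz) _; rewrite lee_fin le_max; apply/orP; right; exact: ler_norm.
- move=> m n a x b al be c _ Ha Hb xc; apply/lee_addgt0Pr => e e0.
  have a0 := opb_ge0 Ha; have b0 := opb_ge0 Hb.
  have ab1 : 0 < al * be + 1 by rewrite ltr_wpDl // mulr_ge0.
  have [|F [HF <- [B0 B1]]] := @interp_norm_lt _ th x (c + e / (al * be + 1)).
    by apply: le_lt_trans xc _; rewrite lte_fin ltrDl divr_gt0.
  apply: (@le_trans _ _ (al * (c + e / (al * be + 1)) * be)%:E).
    apply: (@interp_norm_le _ th (fun z => amx a (F z) b)) => [i j|].
      have -> : (fun z => amx a (F z) b i j) = (fun z p => \sum_k \sum_l (a i k * b l j) * F z k l p).
        by apply/funext => z; apply/funext => p; rewrite amx_at.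
      by apply: adm_sum => k; apply: adm_sum => l; exact: admZ.
    split=> z zz.
      exact: (@family_amx _ _ I (fun l l' A => A (l, l')) (fun l l' => linform_entry (l, l'))) Ha Hb (B0 z zz).
    have [c0 h] := B1 z zz; split=> [|L b' J uJ Hb']; first by rewrite !mulr_ge0.
    apply: (@family_amx _ _ L (fun l l' A => pair_sec J A (b' l l'))
      (fun l l' => linform_pair _ _)) => //; exact: h.
  rewrite -EFinD lee_fin mulrDr mulrDl lerD2l mulrAC mulrA ler_pdivrMr // mulrC.
  by rewrite ler_pM2l // lerDl.
move=> m n x y c _ _ xc yc; apply/lee_addgt0Pr => e e0.
have lt z : (z <= c%:E -> z < (c + e)%:E)%E.
  by move=> h; apply: le_lt_trans h _; rewrite lte_fin ltrDl.
have [F [HF <- [B0 B1]]] := interp_norm_lt (lt _ xc).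
have [G [HG <- [D0 D1]]] := interp_norm_lt (lt _ yc).
rewrite -EFinD; apply: (@interp_norm_le _ th (fun z => block_mx (F z) 0 0 (G z))) => [i j|].
  case: (split_ordP i) => i' ->; case: (split_ordP j) => j' ->.
  - have -> : (fun z => block_mx (F z) 0 0 (G z) (lshift n i') (lshift n j')) = (fun z => F z i' j') => //.
    by apply/funext => z; rewrite block_mxEul.
  - have -> : (fun z => block_mx (F z) 0 0 (G z) (lshift n i') (rshift m j')) = (fun z _ => 0); last exact: adm_cst0.
    by apply/funext => z; rewrite block_mxEur mxE.
  - have -> : (fun z => block_mx (F z) 0 0 (G z) (rshift m i') (lshift n j')) = (fun z _ => 0); last exact: adm_cst0.
    by apply/funext => z; rewrite block_mxEdl mxE.
  have -> : (fun z => block_mx (F z) 0 0 (G z) (rshift m i') (rshift m j')) = (fun z => G z i' j') => //.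
  by apply/funext => z; rewrite block_mxEdr.
split=> z zz.
  exact: (@family_block _ _ I (fun l l' A => A (l, l')) (fun l l' => linform_entry (l, l'))) (B0 z zz) (D0 z zz).
have [c0 h] := B1 z zz; have [_ h'] := D1 z zz; split=> // L b' J uJ Hb'.
apply: (@family_block _ _ L (fun l l' A => pair_sec J A (b' l l'))
    (fun l l' => linform_pair _ _)); [exact: h|exact: h'].
Qed.

Let HSp := interp_preop.

Lemma interp_schur : jointly_cc Sp Sp Sp schur.
Proof.
move=> m n x y Hx Hy.
have carS A B : car A -> car B -> car (schur A B).
  move=> /carP[F HF <-] /carP[G HG <-]; apply/carP; exists (fun z p => F z p * G z p) => //.
  exact: adm_schur.
have H : os_mx Sp (amplify schur x y) by move=> i j; rewrite mxE; apply: carS; [exact: Hx|exact: Hy].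
split=> //; have x0 := nm_ge0 HSp Hx; have y0 := nm_ge0 HSp Hy.
apply: mul_addgt0 => // e e0.
have [|F [HF Fx [B0 B1]]] := @interp_norm_lt _ th x (nm Sp x + e).
  by rewrite -[interp_norm _ _ _ _]/(os_norm Sp x) (nmE HSp) // lte_fin ltrDl.
have [|G [HG Gy [D0 D1]]] := @interp_norm_lt _ th y (nm Sp y + e).
  by rewrite -[interp_norm _ _ _ _]/(os_norm Sp y) (nmE HSp) // lte_fin ltrDl.
rewrite -lee_fin -(nmE HSp) // -{1}Fx -{1}Gy.
apply: (@interp_norm_le _ th (fun z => amplify schur (F z) (G z))) => [i j|].
  have -> : (fun z => amplify schur (F z) (G z) i j) = (fun z p =>
      F z (mxtens_unindex i).1 (mxtens_unindex j).1 p * G z (mxtens_unindex i).2 (mxtens_unindex j).2 p).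
    by apply/funext => z; rewrite mxE.
  by apply: adm_schur.
split=> z zz.
  have := sib_schur (B0 z zz) (D0 z zz) => /(sib_reindex (@unindex_inj m n)).
  by congr sib; apply/funext => i; apply/funext => j; rewrite mxE.
have := s1b_schur (B1 z zz) (D1 z zz) => /(s1b_reindex (@unindex_inj m n)).
by congr s1b; apply/funext => i; apply/funext => j; rewrite mxE.
Qed.

End InterpolationSpace.

End Interpolation.

Section StripTest.
Context {R : realType} (I : choiceType).
Local Notation C := R[i].
Local Notation mat := (cfun R (I * I)%type).

(** A test matrix and two vectors turn [H z] into a scalar function to which [three_lines] applies.
    The bound is uniform in these data, hence complete. *)
Lemma strip_s1b (K : eqType) (H : C -> K -> K -> mat) c : 0 <= c ->
  (forall k k' p, strip_fun (fun z => H z k k' p)) ->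
  (forall z, complex.Re z = 0 -> s1b (H z) c) -> (forall z, complex.Re z = 1 -> s1b (H z) c) ->
  forall z, strip z -> s1b (H z) c.
Proof.
move=> c0 HS H0 H1 z sz; split=> // L b J uJ Hb; apply: opb_bil_conv => // J1 K1 x y uJ1 uK1.
pose g w := \sum_(s <- J1) \sum_(t <- K1) pair_sec J (H w s.1 t.1) (b s.2 t.2) * x t * y s.
pose M := c * Num.sqrt (sqn K1 x) * Num.sqrt (sqn J1 y).
have M0 : 0 <= M by rewrite !mulr_ge0 ?sqrtr_ge0.
have M2 : M ^+ 2 = c ^+ 2 * sqn K1 x * sqn J1 y.
  by rewrite /M !exprMn !sqr_sqrtr ?sqn_ge0.
have edge w : s1b (H w) c -> cabs (g w) <= M.
  move=> [_ h]; rewrite -(@ler_pXn2r _ 2) ?nnegrE ?cabs_ge0 // M2.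
  exact: opb_bil (h L b J uJ Hb) uJ1 uK1.
have [cg [B bg] tg] : strip_fun g.
  apply: strip_fun_sum => s; apply: strip_fun_sum => t.
  apply: strip_funM (strip_fun_cst _); apply: strip_funM (strip_fun_cst _).
  apply: strip_fun_sum => i; apply: strip_fun_sum => j.
  exact: strip_funM (HS _ _ _) (strip_fun_cst _).
rewrite -[leRHS]M2 ler_pXn2r ?nnegrE ?cabs_ge0 //.
apply: (three_lines M0 cg bg tg _ _ sz) => w ww; apply: edge; [exact: H0|exact: H1].
Qed.

Local Notation Soo := (@S_infty R I).
Local Notation S1 := (@S_one R I).

(** The reflection pairs each edge of one function with the opposite edge of the other: on both
    lines one factor is bounded in [S_infty] and the other in [S_one], so [sib_s1b_schur] applies
    there. *)
Lemma interp_pairing (th th' : R) (car car' : set mat) : 0 <= th <= 1 -> th' = 1 - th ->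
  (forall A, car A <-> exists2 F, adm F & F (real_complex R th) = A) ->
  (forall A, car' A <-> exists2 F, adm F & F (real_complex R th') = A) ->
  jointly_cc (OpSpace car (fun n x => interp_norm Soo S1 th x))
     (OpSpace car' (fun n x => interp_norm Soo S1 th' x)) S1 schur.
Proof.
move=> th01 th'E carP carP' m n x y Hx Hy.
have HSp := interp_preop carP; have HSq := interp_preop carP'.
set Sp := OpSpace car _ in HSp Hx *; set Sq := OpSpace car' _ in HSq Hy *.
have x0 := nm_ge0 HSp Hx; have y0 := nm_ge0 HSq Hy.
have key e : 0 < e -> s1b (fun p q : 'I_m * 'I_n => schur (x p.1 q.1) (y p.2 q.2))
    ((nm Sp x + e) * (nm Sq y + e)).
  move=> e0.
  have [|F [HF Fx [B0 B1]]] := @interp_norm_lt _ _ _ th x (nm Sp x + e).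
    by rewrite -[interp_norm _ _ _ _]/(os_norm Sp x) (nmE HSp) // lte_fin ltrDl.
  have [|G [HG Gy [D0 D1]]] := @interp_norm_lt _ _ _ th' y (nm Sq y + e).
    by rewrite -[interp_norm _ _ _ _]/(os_norm Sq y) (nmE HSq) // lte_fin ltrDl.
  have c0 : 0 <= nm Sp x + e by rewrite addr_ge0 // ltW.
  have d0 : 0 <= nm Sq y + e by rewrite addr_ge0 // ltW.
  have := @strip_s1b _ (fun z (p q : 'I_m * 'I_n) => schur (F z p.1 q.1) (G (1 - z) p.2 q.2)) _
    (mulr_ge0 c0 d0) _ _ _ (real_complex R th) th01.
  have e1 : 1 - real_complex R th = real_complex R th' by rewrite th'E rmorphB rmorph1.
  rewrite Fx e1 Gy; apply.
  - move=> p q ij; apply: strip_funM; first exact: (adm_strip_fun ij (HF p.1 q.1)).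
    exact: (strip_fun_flip (adm_strip_fun ij (HG p.2 q.2))).
  - move=> z z0; apply: sib_s1b_schur; first exact: B0.
    by apply: D1; rewrite Re_flip z0 subr0.
  move=> z z1.
  have sw : injective (fun p : 'I_m * 'I_n => (p.2, p.1)) by move=> [? ?] [? ?] [-> ->].
  have z0 : complex.Re (1 - z) = 0 by rewrite Re_flip z1 subrr.
  have := sib_s1b_schur (D0 _ z0) (B1 z z1) => /(s1b_reindex sw); rewrite mulrC.
  by congr s1b; apply/funext => p; apply/funext => q; rewrite schurC.
have H : os_mx S1 (amplify schur x y).
  move=> i j; rewrite mxE; apply/S_one_car.
  exists ((nm Sp x + 1) * (nm Sq y + 1)).
  exact: (s1b_tcb (mxtens_unindex i) (mxtens_unindex j) (key 1 ltr01)).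
split=> //; apply: mul_addgt0 => // e e0.
have c0 : 0 <= (nm Sp x + e) * (nm Sq y + e) by rewrite mulr_ge0 // addr_ge0 // ltW.
apply/nm_S_one => //; have := s1b_reindex (@unindex_inj m n) (key e e0).
by congr s1b; apply/funext => i; apply/funext => j; rewrite mxE.
Qed.

(* Duality against [sum_k t_k^(p (1 - z)) u_k^* w_k], with [t_k] the normalized singular values. *)
Lemma adm_schatten (p : R) (F : C -> I * I -> C) : 1 < p -> adm F ->
  schatten_class p (F (real_complex R p^-1) : mat).
Proof.
move=> p1 HF; have p0 : 0 < p by exact: lt_trans p1.
have ip0 : 0 <= p^-1 by rewrite invr_ge0 ltW.
have sp : strip (real_complex R p^-1) by rewrite /strip /= ip0 invf_le1 // ltW.
set A : mat := F _; have cA : compact_op A by apply/compact_opE; exact: adm_ap HF _ sp.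
have [D] : inhabited (svd (fun i j => A (i, j))) by apply: svd_exists; exact/compact_opP.
have [c0 Hc0] := adm_bd HF; have [c1 Hc1] := adm_bd1 HF.
have c00 : 0 <= c0 by exact: opb_ge0 (Hc0 _ sp).
have c10 : 0 <= c1 by case: (Hc1 1 erefl).
pose c := Num.max c0 c1; have cc0 : c0 <= c by rewrite le_max lexx.
have cc1 : c1 <= c by rewrite le_max lexx orbT.
have c_ge0 : 0 <= c by exact: le_trans cc0.
apply: (@svd_schatten _ _ p (c `^ p) A D) => // N.
set Q := \sum_(k < N) _.
have Q0 : 0 <= Q by apply: sumr_ge0 => k _; exact: powR_ge0.
have [->|Qn0] := eqVneq Q 0; first exact: powR_ge0.
have Qp : 0 < Q by rewrite lt_def Qn0.
pose q := Q `^ p^-1; have q0 : 0 < q by rewrite powR_gt0.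
have qp : q `^ p = Q by rewrite /q -powRrM mulVf ?gt_eqF // powRr1.
suff qc : q <= c by rewrite -qp; apply: ge0_ler_powR; rewrite ?nnegrE ?(ltW p0) ?(ltW q0).
have s0 k : 0 <= sv D k := sv_ge0 D k.
pose t k := sv D k / q.
have t0 k : 0 <= t k by rewrite divr_ge0 // ltW.
have tp k : t k `^ p = sv D k `^ p / Q.
  by rewrite /t powRM ?invr_ge0 ?(ltW q0) // -[q^-1]powR_inv1 ?(ltW q0) // -powRrM mulN1r powRN qp.
have t1 k : (k < N)%N -> t k <= 1.
  move=> kN; rewrite /t ler_pdivrMr // mul1r; apply: powR_le_inv => //.
  by rewrite /Q (bigD1 (Ordinal kN)) //= lerDl sumr_ge0 // => j _; exact: powR_ge0.
(* Vanishing singular values are excluded because the complex powers are written with [ln]. *)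
pose on k := (k < N)%N && (sv D k != 0).
pose be z k : C := if on k then expc (real_complex R (- (p * ln (t k))) * z + real_complex R (p * ln (t k))) else 0.
have cbe z k : on k -> cabs (be z k) = expR ((1 - complex.Re z) * (p * ln (t k))).
  move=> onk; rewrite /be onk cabs_expc; congr expR; case: z => a b /=.
  by rewrite mul0r subr0; ring.
have onp k : on k -> 0 < t k by move=> /andP[_ sk]; rewrite divr_gt0 // lt_def sk s0.
have bep k : on k -> t k `^ p = expR (p * ln (t k)) by move=> /onp tk; rewrite /powR gt_eqF.
have be1 z k : complex.Re z <= 1 -> cabs (be z k) <= 1.
  move=> z1; case: (boolP (on k)) => onk; last by rewrite /be (negbTE onk) cabs0.
  rewrite cbe // -[leRHS]expR0 ler_expR mulr_ge0_le0 ?subr_ge0 //.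
  rewrite mulr_ge0_le0 ?(ltW p0) // -ln1 ler_ln ?posrE ?onp // t1 //.
  by case/andP: onk.
(* The two edges call for different bounds: here the weights sum to at most 1, whereas on real part
   1 they are only bounded by 1 individually. *)
have be0 z : complex.Re z = 0 -> \sum_(k < N) cabs (be z k) <= 1.
  move=> z0; apply: (@le_trans _ _ (\sum_(k < N) sv D k `^ p / Q)); last first.
    by rewrite -mulr_suml divff ?gt_eqF.
  apply: ler_sum => k _; case: (boolP (on k)) => onk; last first.
    by rewrite /be (negbTE onk) cabs0 divr_ge0 ?powR_ge0.
  by rewrite cbe // z0 subr0 mul1r -bep // tp.
(* At [1 / p] the weight is [t_k^(p - 1)], and [t_k^(p - 1) s_k = q t_k^p]; the normalization makes
   the [t_k^p] sum to 1. *)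
have bth : \sum_(k < N) be (real_complex R p^-1) k * real_complex R (sv D k) = real_complex R q.
  have -> : real_complex R q = \sum_(k < N) real_complex R (q * t k `^ p).
    rewrite -real_complex_sum -mulr_sumr; under eq_bigr do rewrite tp.
    by rewrite -mulr_suml divff ?gt_eqF // mulr1.
  apply: eq_bigr => k _; case: (boolP (on k)) => onk; last first.
    rewrite /be (negbTE onk) mul0r; move: onk; rewrite /on ltn_ord /= negbK => /eqP sk.
    by rewrite /t sk mul0r powR0 ?gt_eqF // mulr0.
  rewrite /be onk -rmorphM -rmorphD expc_real -rmorphM; congr (real_complex R _).
  have -> : sv D k = q * t k by rewrite /t mulrC divfK // gt_eqF.
  rewrite mulrCA; congr (_ * _); rewrite -[X in _ * X]lnK ?posrE ?onp // -expRD bep //.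
  by congr expR; move: (ln (t k)) => l; field; rewrite gt_eqF.
apply/ler_addgt0Pr => e e0.
have [J uJ HJ] := svd_test_pair D (be (real_complex R p^-1)) N (Hc0 _ sp) e0.
pose g z := pair_sec J (F z) (svd_test D (be z) N).
have [cg [B bg] tg] : strip_fun g.
  apply: strip_fun_sum => i; apply: strip_fun_sum => j.
  apply: strip_funM; first exact: adm_strip_fun.
  apply: strip_fun_sum => k; apply: strip_funM (strip_fun_cst _).
  apply: strip_funM (strip_fun_cst _); rewrite /be; case: (on k); last exact: strip_fun_cst.
  have -> : (fun z => expc (real_complex R (- (p * ln (t k))) * z + real_complex R (p * ln (t k)))) =
    (fun z => expc (real_complex R (- (p * ln (t k))) * z) * expc (real_complex R (p * ln (t k)))).
    by apply/funext => z; rewrite expcD.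
  exact: strip_funM (strip_fun_expc _) (strip_fun_cst _).
have g1 z : complex.Re z = 1 -> cabs (g z) <= c.
  move=> z1; apply: le_trans cc1; rewrite -[c1]mulr1; apply: tcb_scale (Hc1 z z1) uJ _.
  by apply: svd_test_opb => // k; apply: be1; rewrite z1.
(* Here [F z] is only bounded, so [g z] is expanded into rank one pairings, each at most [c0], and
   the summability of the weights is used. *)
have g0 z : complex.Re z = 0 -> cabs (g z) <= c.
  move=> z0; apply: le_trans cc0.
  have -> : g z = \sum_(k < N) be z k * \sum_(i <- J) \sum_(j <- J)
      F z (i, j) * sw D k j * conjc (su D k i).
    rewrite /g /pair_sec /svd_test.
    under eq_bigr do under eq_bigr do rewrite mulr_sumr.
    under eq_bigr do rewrite exchange_big /=.
    rewrite exchange_big /=; apply: eq_bigr => k _; rewrite mulr_sumr; apply: eq_bigr => i _.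
    by rewrite mulr_sumr; apply: eq_bigr => j _; ring.
  apply: (le_trans (cabs_sum _ _ _)).
  apply: (@le_trans _ _ (\sum_(k < N) cabs (be z k) * c0)); last first.
    by rewrite -mulr_suml -[leRHS]mul1r ler_wpM2r // be0.
  apply: ler_sum => k _; rewrite cabsM ler_wpM2l ?cabs_ge0 //.
  rewrite -(@ler_pXn2r _ 2) ?nnegrE ?cabs_ge0 //.
  apply: (le_trans (opb_bil (sw D k) (fun i => conjc (su D k i)) (Hc0 z (strip_Re0 z0)) uJ uJ)).
  have bw := orthofam_opb (sw_ortho D); have bu := opb_conj (orthofam_opb (su_ortho D)).
  have [_ /(_ J uJ)] := opb_row (k : nat) bw; have [_ /(_ J uJ)] := opb_row (k : nat) bu.
  rewrite !expr1n => h1 h2; rewrite -mulrA -[leRHS]mulr1 ler_wpM2l ?sqr_ge0 //.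
  by rewrite mulr_ile1 ?sqn_ge0.
have h := three_lines c_ge0 cg bg tg g0 g1 sp.
rewrite bth in HJ; have := cabs_le_dist (real_complex R q) (g (real_complex R p^-1)).
rewrite cabs_real gtr0_norm // => /le_trans; apply; apply: lerD => //.
by rewrite cabsBC.
Qed.

End StripTest.

(** * Schatten classes as interpolation spaces *)

Section Weights.
Context {R : realType}.

Lemma sum_tail (q : nat -> R) c : (forall k, 0 <= q k) -> (forall N, \sum_(k < N) q k <= c) ->
  forall e, 0 < e -> exists N, forall M, \sum_(k < M) q k <= \sum_(k < N) q k + e.
Proof.
move=> q0 Hc e e0; pose S := [set x | exists N, x = \sum_(k < N) q k].
have hS : has_sup S.
  split; first by exists (\sum_(k < 0) q k), 0%N.
  by exists c => _ [N ->].
have [_ [N ->] h] := sup_adherent e0 hS; exists N => M.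
have : \sum_(k < M) q k <= sup S by apply: sup_upper_bound => //; exists M.
by move=> /le_trans; apply; rewrite -lerBlDr ltW.
Qed.

Lemma summable_small (q : nat -> R) c : (forall k, 0 <= q k) -> (forall N, \sum_(k < N) q k <= c) ->
  forall e, 0 < e -> exists N, forall k, (N <= k)%N -> q k <= e.
Proof.
move=> q0 Hc e e0; have [N HN] := sum_tail q0 Hc e0; exists N => k Nk.
have := HN k.+1; rewrite big_ord_recr /= -(subnKC Nk) big_split_ord /= -addrA lerD2l.
by apply: le_trans; rewrite lerDr sumr_ge0.
Qed.

(* du Bois-Reymond: with [r k] the tails of the series, [1 / sqrt (r k)] does. *)
Lemma summable_weights (q : nat -> R) c : (forall k, 0 <= q k) -> (forall N, \sum_(k < N) q k <= c) ->
  exists W : nat -> R, [/\ forall k, 0 < W k,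
    forall M, exists N, forall k, (N <= k)%N -> M <= W k &
    exists c', forall N, \sum_(k < N) q k * W k <= c'].
Proof.
move=> q0 Hc; pose q' k := q k + 2^-1 ^+ k.
have q'0 k : 0 < q' k by rewrite ltr_wpDl // exprn_gt0 // invr_gt0.
have Hc' N : \sum_(k < N) q' k <= c + 2 by rewrite big_split; apply: lerD => //; exact: half_sum_le.
pose S := [set x | exists N, x = \sum_(k < N) q' k].
have hS : has_sup S.
  split; first by exists (\sum_(k < 0) q' k), 0%N.
  by exists (c + 2) => _ [N ->].
pose r k := sup S - \sum_(j < k) q' j.
have lin (x y z : R) : x - y = x - (y + z) + z by ring.
have rS k : r k = r k.+1 + q' k by rewrite /r [in RHS]big_ord_recr; exact: lin.
have r_ge0 k : 0 <= r k by rewrite subr_ge0; apply: sup_upper_bound => //; exists k.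
have r0 k : 0 < r k by rewrite rS ltr_wpDl.
have rle k j : (k <= j)%N -> r j <= r k.
  move=> kj; rewrite -(subnKC kj) /r big_split_ord /= opprD addrA gerBl sumr_ge0 // => i _.
  exact: ltW.
pose w k := Num.sqrt (r k); have w0 k : 0 < w k by rewrite sqrtr_gt0.
have w2 k : w k ^+ 2 = r k by rewrite sqr_sqrtr.
exists (fun k => (w k)^-1); split=> [k|M|].
- by rewrite invr_gt0.
- pose e := ((`|M| + 1)^-1) ^+ 2.
  have M0 : 0 < `|M| + 1 by rewrite ltr_wpDl.
  have e0 : 0 < e by rewrite exprn_gt0 // invr_gt0.
  have [_ [N ->] h] := sup_adherent e0 hS; exists N => k Nk.
  have wk : w k <= (`|M| + 1)^-1.
    rewrite -(@ler_pXn2r _ 2) ?nnegrE ?(ltW (w0 k)) ?invr_ge0 ?(ltW M0) // w2.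
    by apply: (le_trans (rle _ _ Nk)); rewrite /r lerBlDr -lerBlDl ltW.
  apply: (@le_trans _ _ (`|M| + 1)).
    by apply: (le_trans (ler_norm M)); rewrite lerDl.
  by rewrite -[leLHS]invrK lef_pV2 // posrE ?invr_gt0.
exists (2 * w 0%N) => N.
(* [q k] is at most [w k ^+ 2 - w k.+1 ^+ 2], whose factor [w k + w k.+1] is at most [2 * w k]; the
   bound telescopes. *)
have step k : q k * (w k)^-1 <= 2 * w k - 2 * w k.+1.
  rewrite ler_pdivrMr //; apply: (@le_trans _ _ (q' k)); first by rewrite lerDl exprn_ge0 ?invr_ge0.
  have -> : q' k = w k ^+ 2 - w k.+1 ^+ 2 by rewrite !w2 (rS k) [r k.+1 + _]addrC addrK.
  have : w k.+1 <= w k by rewrite ler_sqrt // rle.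
  by move: (w k) (w k.+1) (w0 k) (w0 k.+1) => x y; nra.
suff : \sum_(k < N) q k * (w k)^-1 <= 2 * w 0%N - 2 * w N.
  by move/le_trans; apply; rewrite gerBl mulr_ge0 // ltW.
elim: N => [|N IH]; first by rewrite big_ord0 subrr.
rewrite big_ord_recr /=; apply: (le_trans (lerD IH (step N))).
by rewrite addrA subrK.
Qed.

End Weights.

Section DiagonalFamilies.
Context {R : realType} (I : choiceType).
Local Notation C := R[i].
Local Notation mat := (I * I -> C).
Local Notation bop A c := (opb (fun i j : I => A (i, j)) c).
Variables (u v : nat -> I -> C).
Hypotheses (Hu : opb u 1) (Hv : opb v 1).
Implicit Types (d : nat -> C).

Definition dg d : mat := fun p => csum (fun k => d k * u k p.1 * v k p.2).

Lemma dg_has_sum d m i j : 0 <= m -> (forall k, cabs (d k) <= m) ->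
  has_sum (fun k => d k * u k i * v k j) (dg d (i, j)).
Proof. by move=> m0 dm; exact: (diag_has_sum _ _ Hu Hv m0 dm). Qed.

Lemma dg_opb d m : 0 <= m -> (forall k, cabs (d k) <= m) -> bop (dg d) m.
Proof. by move=> m0 dm; apply: (diag_opb Hu Hv m0 dm) => i j; exact: dg_has_sum m0 dm. Qed.

Lemma dg_tcb d c : (forall N, \sum_(k < N) cabs (d k) <= c) -> tcb (dg d) c.
Proof.
move=> H; have c0 : 0 <= c by have := H 0%N; rewrite big_ord0.
apply: (diag_tcb Hu Hv H) => i j; apply: (dg_has_sum _ _ c0) => k.
by apply: le_trans (H k.+1); rewrite big_ord_recr /= lerDr sumr_ge0 // => l _; exact: cabs_ge0.
Qed.

Lemma dgB d d' m p : 0 <= m -> (forall k, cabs (d k) <= m) -> (forall k, cabs (d' k) <= m) ->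
  dg d p - dg d' p = dg (fun k => d k - d' k) p.
Proof.
move=> m0 dm d'm; case: p => i j; apply/esym/csumE.
have := has_sumD (dg_has_sum i j m0 dm) (has_sumN (dg_has_sum i j m0 d'm)).
by apply: eq_has_sum => k /=; ring.
Qed.

Lemma dg_sum (J : Type) (r : seq J) (z : J -> C) (d : J -> nat -> C) (m : J -> R) p :
  (forall j, 0 <= m j) -> (forall j k, cabs (d j k) <= m j) ->
  \sum_(j <- r) z j * dg (d j) p = dg (fun k => \sum_(j <- r) z j * d j k) p.
Proof.
move=> m0 dm; case: p => i l; apply/esym/csumE.
have := has_sum_sum r (fun j => has_sumZ (z j) (dg_has_sum i l (m0 j) (dm j))).
apply: eq_has_sum => k /=; rewrite !mulr_suml; apply: eq_bigr => j _; ring.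
Qed.

Lemma dg_capprox d (m : nat -> R) : (forall k, cabs (d k) <= m k) ->
  (forall e, 0 < e -> exists N, forall k, (N <= k)%N -> m k <= e) -> capprox (dg d).
Proof.
move=> dm mc.
have [b b0 Hb] : exists2 b, 0 <= b & forall k, cabs (d k) <= b.
  have [N HN] := mc 1 ltr01; exists (1 + \sum_(k < N) cabs (d k)).
    by rewrite addr_ge0 // sumr_ge0 // => k _; exact: cabs_ge0.
  have s0 : 0 <= \sum_(k < N) cabs (d k) by apply: sumr_ge0 => k _; exact: cabs_ge0.
  move=> k; have [kN|Nk] := ltnP k N.
    rewrite (bigD1 (Ordinal kN)) //= addrCA lerDl addr_ge0 // sumr_ge0 // => j _; exact: cabs_ge0.
  by apply: (le_trans (dm k)); apply: (le_trans (HN k Nk)); rewrite lerDl.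
apply: capprox_lim => e e0; have [N HN] := mc e e0.
pose d' k := if (k < N)%N then d k else 0.
have Hb' k : cabs (d' k) <= b by rewrite /d'; case: ifP => _ //; rewrite cabs0.
exists (dg d').
  have -> : dg d' = fun p => \sum_(k <- iota 0 N) d k * (u k p.1 * v k p.2).
    apply/funext => -[i j]; apply: csumE.
    have -> : \sum_(k <- iota 0 N) d k * (u k i * v k j) = \sum_(k <- iota 0 N) d' k * u k i * v k j.
      by apply: eq_big_seq => k; rewrite mem_iota /= add0n /d' => ->; rewrite mulrA.
    apply: has_sum_fin => [|k]; first exact: iota_uniq.
    by rewrite mem_iota /= add0n /d' => /negbTE ->; rewrite !mul0r.
  apply: capprox_sum => k; apply: capproxZ; apply: (@capprox_HS _ _ _ 1) => K uK.
  have [_ /(_ K uK) h1] := opb_row k Hu; have [_ /(_ K uK) h2] := opb_row k Hv.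
  rewrite expr1n in h1 h2.
  have -> : \sum_(s <- K) sqn K (fun t => u k s * v k t) = sqn K (u k) * sqn K (v k).
    rewrite /sqn mulr_suml; apply: eq_bigr => s _; rewrite mulr_sumr; apply: eq_bigr => t _.
    by rewrite cabsM exprMn.
  by rewrite mulr_ile1 ?sqn_ge0.
have h : bop (dg (fun k => d k - d' k)) e.
  apply: dg_opb (ltW e0) _ => k; rewrite /d'; case: ltnP => kN; first by rewrite subrr cabs0 ltW.
  by rewrite subr0; apply: (le_trans (dm k)); exact: HN.
by apply: (eq_opb _ h) => s t; rewrite (dgB (s, t) b0 Hb Hb').
Qed.

Variables (a l : nat -> R).
Hypothesis a0 : forall k, 0 <= a k.
(** A majorant of the coefficients over the whole closed strip: a real exponential on [[0, 1]] is at
    most the sum of its two end values. *)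
Let m k := a k * (1 + expR (l k)).
Hypothesis m_small : forall e, 0 < e -> exists N, forall k, (N <= k)%N -> m k <= e.
Variable c : R.
Hypothesis al_sum : forall N, \sum_(k < N) a k * expR (l k) <= c.

Let d z k : C := real_complex R (a k) * expc (real_complex R (l k) * z).

Let m_ge0 k : 0 <= m k.
Proof. by rewrite mulr_ge0 // addr_ge0 // expR_ge0. Qed.

Let cabs_d z k : cabs (d z k) = a k * expR (l k * complex.Re z).
Proof.
rewrite cabsM cabs_real ger0_norm // cabs_expc; congr (_ * expR _).
by case: z => x y /=; rewrite mul0r subr0.
Qed.

Let exp_line (y : R) x : 0 <= x <= 1 -> expR (y * x) <= 1 + expR y.
Proof.
move=> /andP[x0 x1]; have [y0|y0] := leP 0 y.
  apply: (@le_trans _ _ (expR y)); last by rewrite lerDr.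
  by rewrite ler_expR ler_piMr.
apply: (@le_trans _ _ 1); last by rewrite lerDl expR_ge0.
by rewrite -expR0 ler_expR nmulr_rle0.
Qed.

Let d_le z k : strip z -> cabs (d z k) <= m k.
Proof. by move=> sz; rewrite cabs_d ler_wpM2l // exp_line. Qed.

Let m_bound : exists2 b, 0 <= b & forall k, m k <= b.
Proof.
have [N HN] := m_small ltr01; exists (1 + \sum_(k < N) m k); first by rewrite addr_ge0 // sumr_ge0.
move=> k; have [kN|Nk] := ltnP k N.
  by rewrite (bigD1 (Ordinal kN)) //= addrCA lerDl addr_ge0 // sumr_ge0.
by apply: (le_trans (HN k Nk)); rewrite lerDl sumr_ge0.
Qed.

Let d_cont z N (e : R) : 0 < e -> exists2 r, 0 < r & forall w, cabs (w - z) < r ->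
  forall k, (k < N)%N -> cabs (d w k - d z k) <= e.
Proof.
move=> e0; have [||r r0 Hr] := @fin_pos _ 'I_N (fun k (r : R) => forall w, cabs (w - z) < r -> cabs (d w k - d z k) <= e).
- by move=> k r r' _ rr h w wr; apply: h; exact: lt_le_trans rr.
- move=> k; have k1 : 0 < a k + 1 by rewrite ltr_wpDl.
  have [r r0 Hr] := expc_continuous (real_complex R (l k)) z (divr_gt0 e0 k1); exists r => // w /Hr h.
  rewrite -mulrBr cabsM cabs_real ger0_norm //.
  apply: (le_trans (ler_wpM2l (a0 k) h)); rewrite mulrCA ler_piMr ?(ltW e0) //.
  by rewrite ler_pdivrMr // mul1r lerDl.
by exists r => // w wr k kN; exact: (Hr (Ordinal kN)).
Qed.

(** The exponents [l k] may be unbounded, so the expansions of the individual terms need a common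
    radius. It comes from the distance [t] of [z0] to the boundary: moving the real part by [t]
    either way stays in [[0, 1]], so a factor [expR (t * |l k|)] is still absorbed by [m k]. *)
Let d_series z0 : open_strip z0 -> exists al r, opseries (fun z => dg (d z)) z0 al r.
Proof.
have lin (x y t s : R) : 0 < t -> s < t / 2 -> t <= x -> t <= 1 - x -> - s <= y -> y <= s -> 0 <= x + y <= 1.
  by move=> *; apply/andP; split; lra.
move=> /andP[x0 x1]; set x := complex.Re z0 in x0 x1; have [b b0 Hb] := m_bound.
pose t := Num.min x (1 - x); have t0 : 0 < t by rewrite lt_min x0 subr_gt0.
have tx : t <= x by rewrite ge_min lexx.
have tx1 : t <= 1 - x by rewrite ge_min lexx orbT.
have key k : cabs (d z0 k) * expR (t * `|l k|) <= m k.
  rewrite cabs_d -mulrA -expRD ler_wpM2l //.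
  have [l0|l0] := leP 0 (l k).
    rewrite (ger0_norm l0) -/x [t * _]mulrC -mulrDr; apply: exp_line; rewrite addr_ge0 ?(ltW x0) ?(ltW t0) //=.
    by rewrite -lerBrDl.
  rewrite (ltr0_norm l0) -/x mulrN [t * _]mulrC -mulrBr; apply: exp_line; rewrite subr_ge0 tx /=.
  by rewrite lerBlDr; apply: ler_wpDr (ltW t0) (ltW x1).
pose al n k : C := d z0 k * expc_coeff (real_complex R (l k)) n.
have al_le n k : cabs (al n k) <= t^-1 ^+ n * m k.
  rewrite /al cabsM cabs_expc_coeff cabs_real.
  apply: (@le_trans _ _ (t^-1 ^+ n * (cabs (d z0 k) * expR (t * `|l k|)))); last first.
    by rewrite ler_wpM2l // exprn_ge0 // invr_ge0 ltW.
  rewrite [leRHS]mulrCA ler_wpM2l ?cabs_ge0 //.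
  have -> : exp_coeff `|l k| n = t^-1 ^+ n * exp_coeff (t * `|l k|) n.
    rewrite /exp_coeff /= exprMn mulrA mulrA -exprMn mulVf ?expr1n ?mul1r // gt_eqF //.
  rewrite ler_wpM2l ?exprn_ge0 ?invr_ge0 ?(ltW t0) //.
  have y0 : 0 <= t * `|l k| by rewrite mulr_ge0 // ltW.
  apply: le_trans (exp_sum_le n.+1 y0); rewrite big_ord_recr /= lerDr; apply: sumr_ge0 => i _.
  exact: exp_coeff_ge0.
exists (fun n => dg (al n)), (t / 2); split; first by rewrite divr_gt0.
  move=> n; apply: (dg_capprox (al_le n)) => e e0.
  have tn : 0 < t ^+ n by rewrite exprn_gt0.
  have [N HN] := m_small (mulr_gt0 e0 tn); exists N => k Nk.
  by rewrite exprVn mulrC ler_pdivrMr // HN.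
move=> h ht e e0; have [N HN] := half_pow_small b e0; exists N => n Nn.
have rem k : cabs (d (z0 + h) k - \sum_(j < n) h ^+ j * al j k) <= e.
  have -> : d (z0 + h) k - \sum_(j < n) h ^+ j * al j k =
      d z0 k * (expc (real_complex R (l k) * h) - \sum_(j < n) expc_coeff (real_complex R (l k) * h) j).
    rewrite mulrBr /d mulrDr expcD mulrA; congr (_ - _); rewrite mulr_sumr; apply: eq_bigr => j _.
    by rewrite /al /d /expc_coeff exprMn; ring.
  rewrite cabsM; have := @expc_tail _ (real_complex R (l k) * h) 2^-1 (t * `|l k|) n.
  move/(_ _ _ _)=> H.
  have {}H : cabs (expc (real_complex R (l k) * h) - \sum_(j < n) expc_coeff (real_complex R (l k) * h) j)
      <= 2^-1 ^+ n * expR (t * `|l k|).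
    apply: H; first by rewrite invr_ge0 ler0n invf_le1 ?ler1n.
      by rewrite mulr_ge0 // ltW.
    rewrite cabsM cabs_real mulrC mulrA ler_wpM2r // mulrC; exact: ltW.
  apply: (le_trans (ler_wpM2l (cabs_ge0 _) H)); rewrite mulrCA.
  apply: (@le_trans _ _ (2^-1 ^+ n * b)); last by rewrite mulrC HN.
  by rewrite ler_wpM2l ?exprn_ge0 ?invr_ge0 //; apply: le_trans (key k) (Hb k).
have sh : strip (z0 + h).
  have := le_Re_cabs h; move: ht tx tx1; rewrite /strip raddfD /= -/x ler_norml.
  move: (complex.Re h) (cabs h) => y s h1 h2 h3 /andP[h4 h5].
  exact: (lin _ _ _ _ t0 h1 h2 h3 h4 h5).
apply: (eq_opb _ (dg_opb (ltW e0) rem)) => s r.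
rewrite (@dg_sum 'I_n (index_enum _) (fun j => h ^+ j) al (fun j => t^-1 ^+ j * b)); last 2 first.
- by move=> j; rewrite mulr_ge0 // exprn_ge0 // invr_ge0 ltW.
- move=> j k; apply: (le_trans (al_le j k)); rewrite ler_wpM2l ?exprn_ge0 ?invr_ge0 ?(ltW t0) //.
pose b' := b + \sum_(j < n) cabs (h ^+ j) * (t^-1 ^+ j * b).
have bb : 0 <= \sum_(j < n) cabs (h ^+ j) * (t^-1 ^+ j * b).
  by apply: sumr_ge0 => j _; rewrite !mulr_ge0 ?cabs_ge0 ?exprn_ge0 ?invr_ge0 // ltW.
rewrite -(@dgB _ _ b') // => [|k|k]; first exact: addr_ge0.
  by apply: (le_trans (d_le k sh)); apply: (le_trans (Hb k)); rewrite lerDl.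
apply: (le_trans (cabs_sum _ _ _)); apply: ler_wpDl => //; apply: ler_sum => j _.
rewrite cabsM ler_wpM2l ?cabs_ge0 //; apply: (le_trans (al_le j k)).
by rewrite ler_wpM2l ?exprn_ge0 ?invr_ge0 ?(ltW t0).
Qed.

Lemma diag_adm : adm (fun z => dg (d z)).
Proof.
have [b b0 Hb] := m_bound.
have q0 k : 0 <= a k * expR (l k) by rewrite mulr_ge0 ?expR_ge0.
split=> [z sz||z sz e e0|z sz||z z1 e e0].
- by apply: (dg_capprox _ m_small) => k; exact: d_le.
- exists b => z sz; apply: dg_opb => // k; exact: le_trans (d_le k sz) (Hb k).
- have e2 : 0 < e / 2 by rewrite divr_gt0.
  have [N HN] := m_small e2; have [r r0 Hr] := d_cont z N e0; exists r => // w sw wr.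
  have h : bop (dg (fun k => d w k - d z k)) e.
    apply: (dg_opb (ltW e0)) => k; have [kN|Nk] := ltnP k N; first exact: Hr.
    apply: (le_trans (cabsD _ _)); rewrite cabsN [e]splitr.
    by apply: lerD; [apply: le_trans (d_le k sw) _|apply: le_trans (d_le k sz) _]; exact: HN.
  apply: (eq_opb _ h) => s t; rewrite (@dgB (d w) (d z) b) // => k.
    exact: le_trans (d_le k sw) (Hb k).
  exact: le_trans (d_le k sz) (Hb k).
- exact: d_series.
- exists c => z z1; apply: dg_tcb => N; apply: le_trans (al_sum N); apply: ler_sum => k _.
  by rewrite cabs_d z1 mulr1.
(* On the line of real part 1 the moduli of the coefficients do not depend on [z], so one tail
   estimate serves all points; the remaining finitely many terms are continuous. *)
have e4 : 0 < e / 4 by rewrite divr_gt0.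
have [N HN] := sum_tail q0 al_sum e4.
have eN : 0 < e / 2 / (N%:R + 1) by rewrite !divr_gt0 // ltr_wpDl.
have [r r0 Hr] := d_cont z N eN; exists r => // w w1 wr.
have e1 x k : complex.Re x = 1 -> cabs (d x k) = a k * expR (l k).
  by move=> x1; rewrite cabs_d x1 mulr1.
have h : tcb (dg (fun k => d w k - d z k)) e.
  apply: dg_tcb => M; apply: (@le_trans _ _ (\sum_(k < N + M) cabs (d w k - d z k))).
    rewrite -!(big_mkord predT (fun k => cabs (d w k - d z k))) addnC.
    by rewrite [leRHS](@big_cat_nat _ _ _ M) //= ?leq_addr // lerDl sumr_ge0 // => k _; exact: cabs_ge0.
  rewrite big_split_ord /= [e]splitr; apply: lerD.
    apply: (@le_trans _ _ (\sum_(k < N) e / 2 / (N%:R + 1))).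
      by apply: ler_sum => k _; exact: Hr.
    rewrite sumr_const card_ord -[leLHS]mulr_natl mulrCA ler_piMr ?divr_ge0 ?(ltW e0) //.
    by rewrite ler_pdivrMr ?ltr_wpDl // mul1r lerDl.
  apply: (@le_trans _ _ (\sum_(k < M) (2 * (a (N + k)%N * expR (l (N + k)%N))))).
    apply: ler_sum => k _; apply: (le_trans (cabsD _ _)).
    by rewrite (e1 w _ w1) [X in _ + X]cabsN (e1 z _ z1) [leRHS]mulr_natl mulr2n.
  rewrite -mulr_sumr; have := HN (N + M)%N; rewrite big_split_ord /= lerD2l.
  move: (\sum_(_ < M) _) => y; lra.
move: h; congr tcb; apply/funext => p; rewrite (@dgB (d w) (d z) b) // => k.
  exact: le_trans (d_le k (strip_Re1 w1)) (Hb k).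
exact: le_trans (d_le k (strip_Re1 z1)) (Hb k).
Qed.

End DiagonalFamilies.

Section SchattenCarrier.
Context {R : realType} (I : choiceType).
Local Notation C := R[i].

(* [F z = sum_k a_k b_k^z u_k v_k] with [a_k b_k^(1/p) = s_k], [a_k -> 0] and
   [sum_k a_k b_k] finite. *)
Lemma schatten_adm (p : R) (A : I * I -> C) : 1 < p -> schmidt_data p A ->
  exists2 F, adm F & F (real_complex R p^-1) = A.
Proof.
move=> p1 [s [u [v [c [s0 Hu Hv Hc HA]]]]].
have p0 : 0 < p by exact: lt_trans p1.
have p10 : 0 < p - 1 by rewrite subr_gt0.
have [W [W0 Wlim [c' Hc']]] := @summable_weights _ (fun k => s k `^ p) c (fun k => powR_ge0 _ _) Hc.
(* The two requirements [a e^(l / p) = s] and [a e^l = s^p W] determine [a = W^(-g)] and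
   [l = p (ln s + g ln W)]. The weights [W] tend to infinity, so that [a] tends to 0, which
   compactness on the edge of real part 0 requires. *)
pose g := (p - 1)^-1; have g0 : 0 < g by rewrite invr_gt0.
have gp : g * (p - 1) = 1 by rewrite mulVf // gt_eqF.
pose a k := if s k == 0 then 0 else expR (- (g * ln (W k))).
pose l k := p * (ln (s k) + g * ln (W k)).
have a0 k : 0 <= a k by rewrite /a; case: ifP => // _; exact: expR_ge0.
have sp k : s k != 0 -> s k `^ p = expR (p * ln (s k)) by move=> sk; rewrite /powR (negbTE sk).
have al k : a k * expR (l k) = s k `^ p * W k.
  rewrite /a; case: eqVneq => [->|sk]; first by rewrite powR0 ?gt_eqF // !mul0r.
  rewrite sp // -[X in _ = _ * X]lnK ?posrE ?W0 // -!expRD; congr expR; rewrite /l.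
  have -> : p = (p - 1) + 1 by rewrite subrK.
  move: gp; move: (p - 1) (ln (s k)) (ln (W k)) => t x y gp.
  have -> : - (g * y) + (t + 1) * (x + g * y) = (t + 1) * x + g * t * y by ring.
  by rewrite gp mul1r.
have a_small e : 0 < e -> exists N, forall k, (N <= k)%N -> a k <= e.
  move=> e0; have [N HN] := Wlim (expR (- (p - 1) * ln e)); exists N => k Nk.
  rewrite /a; case: ifP => _; first exact: ltW.
  rewrite -[leRHS]lnK ?posrE // ler_expR lerNl.
  have := HN k Nk; rewrite -ler_ln ?posrE ?expR_gt0 ?W0 // expRK => h.
  have := ler_wpM2l (ltW g0) h; rewrite mulrA mulrN gp mulN1r; exact.
have m_small e : 0 < e -> exists N, forall k, (N <= k)%N -> a k * (1 + expR (l k)) <= e.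
  move=> e0; have e2 : 0 < e / 2 by rewrite divr_gt0.
  have [N HN] := a_small _ e2.
  have [M HM] := summable_small (fun k => mulr_ge0 (powR_ge0 (s k) p) (ltW (W0 k))) Hc' e2.
  exists (maxn N M) => k; rewrite geq_max => /andP[Nk Mk].
  rewrite mulrDr mulr1 al [e]splitr; apply: lerD; [exact: HN|exact: HM].
have al_sum N : \sum_(k < N) a k * expR (l k) <= c'.
  by under eq_bigr do rewrite al; exact: Hc'.
eexists; first exact: (diag_adm Hu Hv a0 m_small al_sum).
apply/funext => -[i j]; apply: csumE; apply: eq_has_sum (HA i j) => k /=.
congr (_ * _ * _); rewrite -rmorphM expc_real -rmorphM; congr (real_complex R _).
rewrite /a; case: eqVneq => [->|sk]; first by rewrite mul0r.
rewrite -expRD -[LHS]lnK ?posrE ?lt_def ?sk ?s0 //; congr expR.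
by rewrite /l mulrAC divff ?gt_eqF // mul1r addrCA addNr addr0.
Qed.

Lemma schatten_admP (p : R) (A : cfun R (I * I)%type) : 1 < p ->
  schatten_class p A <-> exists2 F, adm F & F (real_complex R p^-1) = A.
Proof.
move=> p1; split=> [/schatten_schmidt h|[F HF <-]]; last exact: adm_schatten.
by apply: schatten_adm => //; apply: h; exact: lt_trans p1.
Qed.

End SchattenCarrier.

Section SchattenSpaces.
Context {R : realType} (I : choiceType) (p : R).
Hypothesis p1 : 1 <= p.
Local Notation E := (@S_ R I p%:E).
Local Notation F := (@S_ R I (hoelder_conjugate p%:E)).
Local Notation S1 := (@S_one R I).

Lemma hoelder_conjugate_gt1 : 1 < p -> hoelder_conjugate p%:E = (p / (p - 1))%:E.
Proof.
move=> p_gt1; have p0 : p != 0 by rewrite gt_eqF // (lt_trans ltr01).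
have p10 : p - 1 != 0 by rewrite subr_eq0 gt_eqF.
by rewrite /hoelder_conjugate /= eqe (negbTE p0) -EFinB inver (negbTE p10) -EFinM.
Qed.

Lemma schatten_jointly_cc : [/\ preop E, preop F, jointly_cc E E E schur, jointly_cc F F F schur & jointly_cc E F S1 schur].
Proof.
have := p1; rewrite le_eqVlt => /predU1P[<-|p_gt1].
  (* For [p = 1] both spaces are endpoints, and no interpolation is involved. *)
  rewrite hoelder_conjugate1 /S_ eqxx; split; first exact: S_one_preop.
  - exact: S_infty_preop.
  - exact: S_one_schur.
  - exact: S_infty_schur.
  - exact: S_one_S_infty_schur.
have p0 : 0 < p by apply: lt_trans p_gt1.
have q0 : 0 < p - 1 by rewrite subr_gt0.
have q_gt1 : 1 < p / (p - 1) by rewrite ltr_pdivlMr // mul1r gtrBl.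
have pq : (p / (p - 1))^-1 = 1 - p^-1 by rewrite invf_div mulrBl mul1r mulfV // gt_eqF.
rewrite hoelder_conjugate_gt1 // /S_ (gt_eqF p_gt1) (gt_eqF q_gt1).
have HE A := @schatten_admP R I p A p_gt1; have HF A := @schatten_admP R I _ A q_gt1.
split.
- exact: interp_preop HE.
- exact: interp_preop HF.
- exact: interp_schur HE.
- exact: interp_schur HF.
by apply: interp_pairing => //; rewrite invr_ge0 ltW //= invf_le1 // ltW.
Qed.

End SchattenSpaces.

Section BanachAlgebras.
Context {R : realType} {X : Type} (E : opspace R X) (mul : cfun R X -> cfun R X -> cfun R X).

Lemma jointly_cc_contractive m n (a : 'M[_]_m) (b : 'M[_]_n) : preop E -> jointly_cc E E E mul ->
  os_mx E a -> os_mx E b -> (os_norm E (amplify mul a b) <= os_norm E a * os_norm E b)%E.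
Proof.
by move=> HE H Ha Hb; have [Hab le] := H _ _ _ _ Ha Hb; rewrite !(nmE HE) // -EFinM lee_fin.
Qed.

Lemma jointly_cc_submult a b : preop E -> jointly_cc E E E mul -> os_car E a -> os_car E b ->
  (os_norm E (const_mx (mul a b) : 'M[_]_1) <=
   os_norm E (const_mx a : 'M[_]_1) * os_norm E (const_mx b : 'M[_]_1))%E.
Proof.
move=> HE H Ha Hb; have := jointly_cc_contractive HE H (mx_const Ha) (mx_const Hb).
have -> : amplify mul (const_mx a : 'M[_]_1) (const_mx b : 'M[_]_1) = const_mx (mul a b).
  by apply/matrixP => i j; rewrite !mxE.
by [].
Qed.

End BanachAlgebras.

Theorem theorem4p3 (R : realType) (I : choiceType) (p : R) (hp : 1 <= p) :
  is_commutative_cc_banach_algebra (R_pcb I p) schur.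
Proof.
have [HE HF jE jF jEF] := schatten_jointly_cc I hp; have HG := @S_one_preop R I.
have HT := proj_tensor_preop HE HF; have jT := proj_tensor_jointly_cc HE HF jE jF.
have contr n u := @phi_contractive _ _ _ _ _ HE HF _ _ HG psi schur psi_linear psi_tens n u jEF.
have sep (A : cfun R (I * I)%type) : os_car (S_one I) A -> nm (S_one I) (const_mx A : 'M[_]_1) = 0 -> A = 0.
  move=> HA A0; have /(nm_S_one_tcb HA (lexx 0))/tcb_opb h : nm (S_one I) (const_mx A : 'M[_]_1) <= 0.
    by rewrite A0.
  apply/funext => -[i j]; apply/cabs_eq0/le_anti; rewrite cabs_ge0 andbT; exact: opb_entry h.
have HQ := completed_image_preop HT HG psi_linear contr.
have jQ : jointly_cc (R_pcb I p) (R_pcb I p) (R_pcb I p) schur.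
  (* That [psi] carries the pointwise product to the Schur product holds by conversion, both being
     evaluation on the diagonal; [pmul] on [I * I] is [schur] itself. *)
  exact: (completed_image_jointly_cc (mulG := schur) HT HG psi_linear contr jT (@S_one_schur R I)
    (fun _ _ => erefl) (@pmulBl R _) (@pmulBr R _) (@pmulBl R _) (@pmulBr R _)).
have cl a b := @jointly_cc_car _ _ _ _ _ _ _ schur a b jQ.
split; last by move=> a b _ _; exact: schurC.
split=> [|a b Ha Hb|a b c _ _ _|t a a' b _ _ _|t a b b' _ _ _|a b Ha Hb|m n a b].
- exact: completed_image_operator_space HT HG sep (@S_one_complete R I) psi_linear contr.
- exact: (cl _ _ Ha Hb).
- by apply/funext => x; exact: mulrA.
- apply/funext => x; rewrite /schur /= !fctE mulrDl; congr (_ + _); exact: esym (mulrA _ _ _).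
- apply/funext => x; rewrite /schur /= !fctE mulrDr; congr (_ + _); exact: mulrCA.
- exact: jointly_cc_submult HQ jQ Ha Hb.
- exact: jointly_cc_contractive HQ jQ.
Qed.
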